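(* Let $M\subset\mathbb{C}^n$, $n\ge2$, be a real-analytic hypersurface, nonminimal at the origin and pseudospherical, and let $\sigma\in\mathrm{Aut}(\mathbb{CP}^n)$ be the monodromy operator of $M$. Then the infinitesimal automorphism algebra $\mathfrak{hol}(M,0)$ can be injectively embedded into the subalgebra $c=z(\sigma)\cap\mathfrak{hol}(\mathcal Q)$, where $z(\sigma)\subset\mathfrak{hol}(\mathbb{CP}^n)$ is the centralizer of the element $\sigma\in\mathrm{Aut}(\mathbb{CP}^n)$.
   Context: $M\ni0$ is smooth real-analytic and contains a complex hypersurface $X\ni0$ (nonminimality). For a real-analytic defining function $\phi(Z,\bar Z)$ of $M$ in a neighbourhood $U$ of $0$, the Segre variety of $\zeta\in U$ is $Q_\zeta=\{Z\in U:\phi(Z,\bar\zeta)=0\}$; $M$ is Segre regular in $U$ if the Segre map $\zeta\mapsto Q_\zeta$ is locally injective in $U\setminus X$. A nondegenerate real hyperquadric is $\mathcal Q=\{[\zeta]\in\mathbb{CP}^n:H(\zeta,\bar\zeta)=0\}$, $H$ a nondegenerate (indefinite) Hermitian form on $\mathbb{C}^{n+1}$. $M$ is pseudospherical if $M\setminus X$ is Levi nondegenerate, $M$ is Segre regular in a neighbourhood $U$ of $0$, and at least one of the two components of $M\setminus X$ can be locally biholomorphically mapped into a nondegenerate real hyperquadric $\mathcal Q\subset\mathbb{CP}^n$. Known fact and definition of monodromy: for a suitable $U$ and $p\in(M\setminus X)\cap U$ (in that component), any local biholomorphic map $\mathcal F_p$ of $(M,p)$ into $\mathcal Q$ extends analytically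 along any path in $U\setminus X$ as a locally biholomorphic map into $\mathbb{CP}^n$. If $\gamma\ni p$ is a generator of $\pi_1(U\setminus X)$ and $\mathcal F_{\gamma,p}$ is the continuation of $\mathcal F_p$ along $\gamma$, then $\mathcal F_{\gamma,p}=\sigma\circ\mathcal F_p$ for some $\sigma\in\mathrm{Aut}(\mathbb{CP}^n)=\mathrm{PGL}(n+1,\mathbb{C})$, the monodromy operator (replacing $\mathcal F_p$ by $\tau\circ\mathcal F_p$ replaces $\sigma$ by $\tau\sigma\tau^{-1}$; $\sigma$ and $\mathcal Q$ refer to the same fixed choice of $\mathcal F_p$). $\mathfrak{hol}(M,0)$ is the real Lie algebra of germs at $0$ of holomorphic vector fields $L$ with $\mathrm{Re}\,L$ tangent to $M$. $\mathfrak{hol}(\mathbb{CP}^n)$ is the Lie algebra of holomorphic vector fields on $\mathbb{CP}^n$, $\mathfrak{hol}(\mathcal Q)\subset\mathfrak{hol}(\mathbb{CP}^n)$ the real subalgebra of those whose real part is tangent to $\mathcal Q$. The centralizer $z(\sigma)$ is the Lie algebra of the centralizer subgroup $Z(\sigma)=\{\tau\in\mathrm{Aut}(\mathbb{CP}^n):\tau\sigma=\sigma\tau\}$. Embedding means injective Lie algebra homomorphism. *)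

(* Defs.v *)
From HB Require Import structures.
From mathcomp Require Import all_boot all_order all_algebra.
From mathcomp Require Import all_classical all_reals all_analysis.
From mathcomp Require Import complex.

Set Implicit Arguments.
Unset Strict Implicit.
Unset Printing Implicit Defensive.

Import Order.TTheory GRing.Theory Num.Theory.
Import numFieldNormedType.Exports.

Local Open Scope classical_set_scope.
Local Open Scope ring_scope.

(** The complex numbers are [R[i]] for [R : realType]; C^n is ['rV[R[i]]_n] with
    its sup norm.  Over the scalar field [R[i]], [differentiable] and ['D_v] are
    complex differentiability and the complex directional derivative. *)

(** [numFieldNormedType] provides these instances for abstract number fields
    only, not for the concrete type [R[i]]. *)
Section ComplexNormedModule.
Context {R : rcfType}.
#[export, non_forgetful_inheritance]
HB.instance Definition _ := PseudoPointedMetric.copy R[i] (R[i]^o).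
#[export, non_forgetful_inheritance]
HB.instance Definition _ := NormedModule.copy R[i] (R[i]^o).
End ComplexNormedModule.

Section Holomorphic.
Context {R : realType}.
Local Notation C := R[i].

Definition cconj m n (A : 'M[C]_(m, n)) : 'M[C]_(m, n) :=
  map_mx (fun c => c^*) A.

Definition holomorphic_on (V W : normedModType C) (f : V -> W) (U : set V) :=
  forall x, U x -> differentiable f x.

Definition biholomorphism (V W : normedModType C) (U : set V) (U' : set W)
    (f : V -> W) (g : W -> V) : Prop :=
  [/\ open U, open U', holomorphic_on f U, holomorphic_on g U' &
   (forall x, U x -> U' (f x) /\ g (f x) = x) /\
   (forall y, U' y -> U (g y) /\ f (g y) = y)].

Definition lie_bracket n (L L' : 'rV[C]_n -> 'rV[C]_n) : 'rV[C]_n -> 'rV[C]_n :=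
  fun z => 'D_(L z) L' z - 'D_(L' z) L z.

End Holomorphic.

Section Hypersurfaces.
Context {R : realType} {n : nat}.
Local Notation C := R[i].
Local Notation Cn := 'rV[R[i]]_n.

(** A real-analytic function phi(Z, \bar Z) is given by its complexification
    [Phi : (Z, W) |-> Phi Z W], holomorphic in (Z, W) jointly, with
    phi(Z, \bar Z) = [Phi Z (cconj Z)].  As phi is real, d phi <> 0 iff the
    (1,0)-part of d phi, i.e. the derivative in the first argument, is nonzero. *)
Definition defining_function (M U : set Cn) (Phi : Cn -> Cn -> C) : Prop :=
  [/\ open U /\ connected U,
      holomorphic_on (fun zw : Cn * Cn => Phi zw.1 zw.2)
        [set zw | U zw.1 /\ U (cconj zw.2)],
      forall z, U z -> Phi z (cconj z) \is Num.real,
      forall z, U z -> (M z <-> Phi z (cconj z) = 0) &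
      forall z, U z -> M z -> exists v, 'D_v (Phi ^~ (cconj z)) z != 0].

Definition real_analytic_hypersurface (M : set Cn) : Prop :=
  forall q, M q -> exists U Phi, U q /\ defining_function M U Phi.

Definition complex_hypersurface (X : set Cn) : Prop :=
  forall q, X q -> exists (W : set Cn) (h : Cn -> C),
    [/\ open W /\ W q, holomorphic_on h W,
        forall z, W z -> (X z <-> h z = 0) &
        forall z, W z -> X z -> exists v, 'D_v h z != 0].

Definition nonminimal_along (M X : set Cn) : Prop :=
  [/\ X 0, X `<=` M & complex_hypersurface X].

(** Holomorphic tangent space {v : sum_j phi_{Z_j} v_j = 0} and Levi form
    sum_{j,k} phi_{Z_j \bar Z_k} v_j \bar u_k at [p]. *)
Definition complex_tangent (Phi : Cn -> Cn -> C) (p v : Cn) : Prop :=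
  'D_v (Phi ^~ (cconj p)) p = 0.

Definition levi_form (Phi : Cn -> Cn -> C) (p v u : Cn) : C :=
  'D_(cconj u) (fun w => 'D_v (Phi ^~ w) p) (cconj p).

Definition levi_nondegenerate (Phi : Cn -> Cn -> C) (p : Cn) : Prop :=
  forall v, complex_tangent Phi p v ->
    (forall u, complex_tangent Phi p u -> levi_form Phi p v u = 0) -> v = 0.

Definition segre_variety (Phi : Cn -> Cn -> C) (U : set Cn) (zeta : Cn) :
    set Cn :=
  [set z | U z /\ Phi z (cconj zeta) = 0].

Definition segre_regular (Phi : Cn -> Cn -> C) (U X : set Cn) : Prop :=
  forall zeta, (U `\` X) zeta -> exists2 N, nbhs zeta N &
    forall z1 z2, (N `&` (U `\` X)) z1 -> (N `&` (U `\` X)) z2 ->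
      segre_variety Phi U z1 = segre_variety Phi U z2 -> z1 = z2.

(** Re L = (L + \bar L) / 2 and phi is real, so (Re L) phi = Re (L phi). *)
Definition re_tangent (Phi : Cn -> Cn -> C) (z v : Cn) : Prop :=
  'Re ('D_v (Phi ^~ (cconj z)) z) = 0.

(** [hol_germ M L]: the germ of [L] at 0 belongs to hol(M, 0).  Germs are
    represented by total functions, up to [germ0_eq]. *)
Definition hol_germ (M : set Cn) (L : Cn -> Cn) : Prop :=
  exists U Phi,
    [/\ U 0, defining_function M U Phi, holomorphic_on L U &
        forall z, U z -> M z -> re_tangent Phi z (L z)].

Definition germ0_eq (L L' : Cn -> Cn) : Prop :=
  \forall z \near (0 : Cn), L z = L' z.

End Hypersurfaces.

Section ProjectiveSpace.
Context {R : realType} {n : nat}.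
Local Notation C := R[i].
Local Notation Cn := 'rV[R[i]]_n.
Local Notation Cn1 := 'rV[R[i]]_n.+1.

(** Points of CP^n are nonzero row vectors, and elements of
    Aut(CP^n) = PGL(n+1,C) are invertible matrices acting by v |-> v *m S; both
    are taken modulo [proj_eq]. *)
Definition proj_eq m k (A B : 'M[C]_(m, k)) : Prop :=
  exists2 c : C, c != 0 & A = c *: B.

(** The affine chart {v_i <> 0} of CP^n and its inverse. *)
Definition dehomog (i : 'I_n.+1) (v : Cn1) : Cn :=
  \row_k (v 0 (lift i k) / v 0 i).

Definition homog (i : 'I_n.+1) (z : Cn) : Cn1 :=
  \row_j (if unlift i j is Some k then z 0 k else 1).

Definition hform (H : 'M[C]_n.+1) (v w : Cn1) : C := (v *m H *m w^T) 0 0.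

Definition hyperquadric (H : 'M[C]_n.+1) : set Cn1 :=
  [set v | v != 0 /\ hform H v (cconj v) = 0].

Definition nondegenerate_indefinite (H : 'M[C]_n.+1) : Prop :=
  [/\ H \is hermsymmx, H \in unitmx,
      exists v, 0 < hform H v (cconj v) &
      exists v, hform H v (cconj v) < 0].

(** A germ at [p] of a map into CP^n is given by homogeneous coordinates
    [F : C^n -> C^(n+1)], up to [cp_germ_eq]. *)
Definition cp_germ_eq (p : Cn) (F G : Cn -> Cn1) : Prop :=
  \forall z \near p, proj_eq (F z) (G z).

Definition cp_local_biholo (p : Cn) (F : Cn -> Cn1) : Prop :=
  exists (i : 'I_n.+1) (U U' : set Cn) (g : Cn -> Cn),
    [/\ U p, holomorphic_on F U, forall z, U z -> F z 0 i != 0 &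
        biholomorphism U U' (dehomog i \o F) g].

Definition local_biholo_into_quadric (M : set Cn) (H : 'M[C]_n.+1) (p : Cn)
    (F : Cn -> Cn1) : Prop :=
  cp_local_biholo p F /\ (\forall z \near p, M z -> hyperquadric H (F z)).

(** Vector fields on CP^n, by their expressions in the [n.+1] affine charts. *)
Definition vfield : Type := 'I_n.+1 -> Cn -> Cn.

Definition vf_bracket (V V' : vfield) : vfield :=
  fun i => lie_bracket (V i) (V' i).

Definition hol_CP (V : vfield) : Prop :=
  (forall i, holomorphic_on (V i) setT) /\
  (forall i j z, homog i z 0 j != 0 ->
     V j (dehomog j (homog i z)) = 'D_(V i z) (dehomog j \o homog i) z).

Definition hol_quadric (H : 'M[C]_n.+1) (V : vfield) : Prop :=
  hol_CP V /\
  forall i z, hyperquadric H (homog i z) ->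
    re_tangent (fun x w => hform H (homog i x) (homog i w)) z (V i z).

Definition mexp (B : 'M[C]_n.+1) : 'M[C]_n.+1 :=
  limn (series (fun k => (k`!%:R : C)^-1 *: B ^+ k)).

(** [V] is the velocity field of the one-parameter group exp(tB) of PGL(n+1,C). *)
Definition generates_vfield (B : 'M[C]_n.+1) (V : vfield) : Prop :=
  forall i z, is_derive (0 : C) (1 : C)
    (fun t : C => dehomog i (homog i z *m mexp (t *: B))) (V i z).

Definition centralizer_group (S : 'M[C]_n.+1) : set 'M[C]_n.+1 :=
  [set T | T \in unitmx /\ proj_eq (T *m S) (S *m T)].

Definition centralizer_algebra (S : 'M[C]_n.+1) (V : vfield) : Prop :=
  hol_CP V /\ exists B, generates_vfield B V /\
    forall t : R, centralizer_group S (mexp (real_complex R t *: B)).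

End ProjectiveSpace.

Arguments vfield : clear implicits.

Section PathsAndContinuation.
Context {R : realType} {n : nat}.
Local Notation C := R[i].
Local Notation Cn := 'rV[R[i]]_n.
Local Notation Cn1 := 'rV[R[i]]_n.+1.

Definition path_in (A : set Cn) (p : Cn) (gamma : R -> Cn) : Prop :=
  [/\ {within `[0, 1], continuous gamma}, gamma 0 = p &
      forall t : R, 0 <= t <= 1 -> A (gamma t)].

Definition loop_in (A : set Cn) (p : Cn) (gamma : R -> Cn) : Prop :=
  path_in A p gamma /\ gamma 1 = p.

Definition loop_homotopic (A : set Cn) (p : Cn) (gamma delta : R -> Cn) : Prop :=
  exists h : R * R -> Cn,
    [/\ {within `[0, 1] `*` `[0, 1], continuous h},
        forall s t : R, 0 <= s <= 1 -> 0 <= t <= 1 -> A (h (s, t)),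
        forall t : R, 0 <= t <= 1 -> h (0, t) = gamma t,
        forall t : R, 0 <= t <= 1 -> h (1, t) = delta t &
        forall s : R, 0 <= s <= 1 -> h (s, 0) = p /\ h (s, 1) = p].

Definition loop_mul (gamma delta : R -> Cn) : R -> Cn :=
  fun t => if t <= 2^-1 then gamma (2 * t) else delta (2 * t - 1).

Definition loop_inv (gamma : R -> Cn) : R -> Cn := fun t => gamma (1 - t).

Definition loop_pow (p : Cn) (gamma : R -> Cn) (k : int) : R -> Cn :=
  match k with
  | Posz m => iter m (loop_mul gamma) (fun=> p)
  | Negz m => iter m.+1 (loop_mul (loop_inv gamma)) (fun=> p)
  end.

Definition generates_pi1 (A : set Cn) (p : Cn) (gamma : R -> Cn) : Prop :=
  loop_in A p gamma /\
  forall delta, loop_in A p delta ->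
    exists k : int, loop_homotopic A p delta (loop_pow p gamma k).

(** [Fam t] is the germ at [gamma t] of the continuation of the germ [F] at
    [gamma 0], as a locally biholomorphic map into CP^n. *)
Definition continuation_along (gamma : R -> Cn) (F : Cn -> Cn1)
    (Fam : R -> Cn -> Cn1) : Prop :=
  [/\ cp_germ_eq (gamma 0) (Fam 0) F,
      forall t : R, 0 <= t <= 1 -> cp_local_biholo (gamma t) (Fam t) &
      forall t : R, 0 <= t <= 1 -> \forall s \near t, 0 <= s <= 1 ->
        cp_germ_eq (gamma s) (Fam s) (Fam t)].

Definition polydisc : set Cn := [set z | forall j, `|z 0 j| < 1].

(** A neighbourhood of 0 biholomorphic to a polydisc in which [X] is the trace of
    a coordinate hyperplane, so that pi_1(U \ X) is infinite cyclic. *)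
Definition adapted_nbhd (X U : set Cn) : Prop :=
  exists (psi psi' : Cn -> Cn) (k : 'I_n),
    [/\ biholomorphism polydisc U psi psi', psi 0 = 0 &
        forall z, polydisc z -> (X (psi z) <-> z 0 k = 0)].

(** [p] lies in one of the components of the germ at 0 of [M `\` X]. *)
Definition in_component_at0 (M X U : set Cn) (p : Cn) : Prop :=
  ((M `&` U) `\` X) p /\
  closure (connected_component ((M `&` U) `\` X) p) 0.

Definition pseudospherical (M X : set Cn) : Prop :=
  exists U Phi,
    [/\ U 0 /\ defining_function M U Phi,
        forall q, ((M `&` U) `\` X) q -> levi_nondegenerate Phi q,
        segre_regular Phi U X &
        exists (H : 'M[C]_n.+1) (p : Cn),
          [/\ nondegenerate_indefinite H, in_component_at0 M X U p &
              forall q, connected_component ((M `&` U) `\` X) p q ->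
                exists F, local_biholo_into_quadric M H q F]].

(** [S] represents the monodromy operator of [M], relative to a local
    biholomorphic map [F] of [(M, p)] into the hyperquadric of [H], a
    neighbourhood [U] in which [F] continues along all paths off [X], and a
    generator [gamma] of pi_1(U \ X, p). *)
Definition monodromy_operator (M X : set Cn) (H S : 'M[C]_n.+1) : Prop :=
  exists (U : set Cn) (p : Cn) (F : Cn -> Cn1) (gamma : R -> Cn)
         (Fam : R -> Cn -> Cn1),
    [/\ [/\ adapted_nbhd X U, in_component_at0 M X U p &
            local_biholo_into_quadric M H p F],
        forall delta, path_in (U `\` X) p delta ->
          exists Fam', continuation_along delta F Fam',
        generates_pi1 (U `\` X) p gamma,
        continuation_along gamma F Fam &
        S \in unitmx /\ cp_germ_eq p (Fam 1) (fun z => F z *m S)].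

(** [iota] induces an injective homomorphism of real Lie algebras from hol(M, 0)
    into the subalgebra [c] of hol(CP^n). *)
Definition hol_embedding (M : set Cn) (c : vfield R n -> Prop)
    (iota : (Cn -> Cn) -> vfield R n) : Prop :=
  [/\ forall L, hol_germ M L -> c (iota L),
      forall L L', hol_germ M L -> hol_germ M L' ->
        (iota L = iota L' <-> germ0_eq L L'),
      forall L L', hol_germ M L -> hol_germ M L' ->
        iota (fun z => L z + L' z) = (fun i z => iota L i z + iota L' i z),
      forall (a : R) L, hol_germ M L ->
        iota (fun z => real_complex R a *: L z)
        = (fun i z => real_complex R a *: iota L i z) &
      forall L L', hol_germ M L -> hol_germ M L' ->
        iota (lie_bracket L L') = vf_bracket (iota L) (iota L')].

End PathsAndContinuation.

(* Main.v *)
(** Near a Levi nondegenerate point, complexifying the defining function turns the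
    tangency of [Re L] to [M] into a statement about Segre varieties: the incidence
    relation [H(x, conj w) = 0] is preserved infinitesimally by the pair
    [(F_* L, conj (F_* L))], so [F_* L] moves hyperplanes to hyperplanes.  A
    holomorphic field [v] with this property satisfies [D^2 v (u, u) || u], hence is
    projective: it is induced by a matrix [B], unique modulo scalars, and tangency
    to the quadric reads [B H + H B^* = c H].

    In homogeneous coordinates "[F_* L] is induced by [B]" is the identity [D_L F =
    F B + c F] of holomorphic germs. Rescaling [F] only changes [c], and the
    identity persists under analytic continuation. The germ of [L] lives near 0
    only; a loop in the complement of [X] is contracted towards 0 by the radial
    homotopy of the adapted chart, and the continuation is transported across the
    resulting squares. Going around the generator of the fundamental group replaces
    [F] by [F S], so [B] and [S B S^-1] differ by a scalar, which vanishes on taking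
    traces; thus [B] lies in the Lie algebra of the centralizer of [S]. Finally [L
    |-> B] is linear, injective since [F] is locally biholomorphic, and its
    compatibility with brackets is checked in a chart. *)
Require Import Defs.
From HB Require Import structures.
From mathcomp Require Import all_boot all_order all_algebra.
From mathcomp Require Import all_classical all_reals all_analysis.
From mathcomp Require Import complex ring lra.

Set Implicit Arguments.
Unset Strict Implicit.
Unset Printing Implicit Defensive.

Import Order.TTheory GRing.Theory Num.Theory.
Import numFieldNormedType.Exports.

Local Open Scope classical_set_scope.
Local Open Scope ring_scope.
Local Open Scope complex_scope.

(** * Norms and derivatives *)

(** Complex differentiability is the only analytic datum, so Cauchy's theory comes first; contour
    integrals are normalised by the integral of [1 / z], whose value is only shown to be nonzero.
    Statements about [M] become holomorphic identities by means of a holomorphic retraction of the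
    complexified space onto the complexified hypersurface, together with uniqueness on the totally
    real diagonal. The case [n = 1] has to be excluded for projectivity: there every field satisfies
    [D^2 v (u, u) || u], and it is the symmetry of third derivatives in two independent directions
    that makes the factor of proportionality constant. Two obstacles shape the global part. [F]
    lives at [p] and the germ [L] near 0, so a point of [M] close to 0 is joined to [p] inside the
    component, and the quadric condition is carried to it before the local argument applies.
    Moreover continuation is granted along single paths, not over homotopies: germs over a square
    are built by continuing along segments from one corner, and their coherence is proved along
    these segments. *)

Section RealNorm.
Context {R : realType}.
Local Notation C := R[i].

(** Norms of modules over [R[i]] take values in [R[i]]; the real part loses nothing and lets all
    estimates run in the ordered field [R]. *)
Definition nrm {V : normedModType C} (v : V) : R := complex.Re `|v|.

Lemma nrmE (V : normedModType C) (v : V) : `|v| = (nrm v)%:C.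
Proof. by rewrite /nrm RRe_real // normr_real. Qed.

Lemma nrm_ge0 (V : normedModType C) (v : V) : 0 <= nrm v.
Proof. by rewrite -lecR -nrmE normr_ge0. Qed.

Lemma nrm0 (V : normedModType C) : nrm (0 : V) = 0.
Proof. by rewrite /nrm normr0. Qed.

Lemma nrm_eq0 (V : normedModType C) (v : V) : (nrm v == 0) = (v == 0).
Proof.
by rewrite -(normr_eq0 v) nrmE -(inj_eq (@complexI R)).
Qed.

Lemma nrm_gt0 (V : normedModType C) (v : V) : (0 < nrm v) = (v != 0).
Proof. by rewrite lt_def nrm_ge0 andbT nrm_eq0. Qed.

Lemma nrmD (V : normedModType C) (u v : V) : nrm (u + v) <= nrm u + nrm v.
Proof. by rewrite -lecR rmorphD /= -!nrmE ler_normD. Qed.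

Lemma nrmN (V : normedModType C) (v : V) : nrm (- v) = nrm v.
Proof. by rewrite /nrm normrN. Qed.

Lemma nrmB (V : normedModType C) (u v : V) : nrm (u - v) <= nrm u + nrm v.
Proof. by rewrite -(nrmN v) nrmD. Qed.

Lemma nrm_sub (V : normedModType C) (u v : V) : nrm (u - v) = nrm (v - u).
Proof. by rewrite -nrmN opprB. Qed.

Lemma nrm_tri (V : normedModType C) (w u v : V) :
  nrm (u - v) <= nrm (u - w) + nrm (w - v).
Proof. by rewrite (le_trans _ (nrmD _ _)) // addrA subrK. Qed.

Lemma nrmZ (V : normedModType C) (c : C) (v : V) :
  nrm (c *: v) = nrm c * nrm v.
Proof. by apply: complexI; rewrite rmorphM /= -!nrmE normrZ. Qed.

Lemma nrmM (c d : C) : nrm (c * d) = nrm c * nrm d.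
Proof. exact: nrmZ. Qed.

Lemma nrm1 : nrm (1 : C) = 1.
Proof. by rewrite /nrm normr1. Qed.

Lemma nrmX (c : C) n : nrm (c ^+ n) = nrm c ^+ n.
Proof. by elim: n => [|n IH]; rewrite ?nrm1 // !exprS nrmM IH. Qed.

Lemma nrmV (c : C) : nrm c^-1 = (nrm c)^-1.
Proof.
have [->|c0] := eqVneq c 0; first by rewrite invr0 nrm0 invr0.
have n0 : nrm c != 0 by rewrite nrm_eq0.
by apply: (mulfI n0); rewrite -nrmM !divff // nrm1.
Qed.

Lemma nrm_real (x : R) : nrm (x%:C) = `|x|.
Proof. by rewrite /nrm normc_def /= expr0n /= addr0 sqrtr_sqr. Qed.

Lemma nrm_i : nrm ('i : C) = 1.
Proof. by rewrite /nrm normc_def /= expr0n /= add0r expr1n sqrtr1. Qed.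

Lemma nrm_conj (c : C) : nrm (c^*)%C = nrm c.
Proof. by rewrite /nrm normcJ. Qed.

Lemma nrm_Re (c : C) : `|complex.Re c| <= nrm c.
Proof. by rewrite -lecR -nrmE normc_ge_Re. Qed.

Lemma nrm_Im (c : C) : `|complex.Im c| <= nrm c.
Proof.
have := nrm_Re ('i * c); rewrite nrmM nrm_i mul1r; case: c => a b /=.
by rewrite mul0r mul1r sub0r normrN.
Qed.

Lemma nrm_ReIm (c : C) : nrm c <= `|complex.Re c| + `|complex.Im c|.
Proof.
rewrite {1}(complexE c) (le_trans (nrmD _ _)) // nrmM nrm_i mul1r.
by rewrite !nrm_real.
Qed.

Lemma nearP (V : normedModType C) (a : V) (P : V -> Prop) :
  (\forall x \near a, P x) <->
  exists2 r : R, 0 < r & forall x, nrm (x - a) < r -> P x.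
Proof.
split=> [/nbhs_normP [e /= e0 H]|[r r0 H]].
  have eR : e = (complex.Re e)%:C by rewrite RRe_real // gtr0_real.
  exists (complex.Re e); first by rewrite -ltcR -eR.
  move=> x xa; apply: H => /=; rewrite eR distrC nrmE ltcR; exact: xa.
apply/nbhs_normP; exists r%:C => /=; first by rewrite ltcR.
by move=> x /=; rewrite distrC nrmE ltcR; apply: H.
Qed.

Lemma nrm_cvgP (T : topologicalType) (V : normedModType C) (F : set_system T)
    {FF : Filter F} (f : T -> V) (l : V) :
  f @ F --> l <-> forall e : R, 0 < e -> \forall x \near F, nrm (f x - l) < e.
Proof.
split=> [/cvgrPdist_lt H e e0|H].
  have := H e%:C; rewrite ltcR => /(_ e0); apply: filterS => x.
  by rewrite distrC nrmE ltcR.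
apply/cvgrPdist_lt => e e0.
have eR : e = (complex.Re e)%:C by rewrite RRe_real // gtr0_real.
have e0' : 0 < complex.Re e by rewrite -ltcR -eR.
move: (H _ e0'); apply: filterS => x.
by rewrite distrC nrmE eR ltcR.
Qed.

Definition lin {V W : normedModType C} (l : V -> W) :=
  forall (a : C) u v, l (a *: u + v) = a *: l u + l v.

(** The Fréchet derivative in real epsilon-delta form, with [l] a plain function rather than a
    bundled linear map; [hasd_diff] and [diff_hasd] translate to and from [differentiable]. *)
Definition hasd {V W : normedModType C} (f : V -> W) (x : V) (l : V -> W) :=
  [/\ lin l, exists K, forall h, nrm (l h) <= K * nrm h &
      forall e : R, 0 < e -> exists2 d : R, 0 < d &
        forall h, nrm h < d -> nrm (f (x + h) - f x - l h) <= e * nrm h].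

Lemma lin0 (V W : normedModType C) (l : V -> W) : lin l -> l 0 = 0.
Proof.
move=> ll; have := ll 1 0 0; rewrite !scale1r addr0.
by move=> /(congr1 (fun z => z - l 0)); rewrite subrr addrK => <-.
Qed.

Lemma linZ (V W : normedModType C) (l : V -> W) a u :
  lin l -> l (a *: u) = a *: l u.
Proof. by move=> ll; have := ll a u 0; rewrite !addr0 lin0 // addr0. Qed.

Lemma linD (V W : normedModType C) (l : V -> W) u v :
  lin l -> l (u + v) = l u + l v.
Proof. by move=> ll; have := ll 1 u v; rewrite !scale1r. Qed.

Lemma hasd_diff (V W : normedModType C) (f : V -> W) x (l : V -> W) :
  hasd f x l -> differentiable f x /\ 'd f x = l :> (V -> W).
Proof.
case=> ll [K lK] H.
pose A := GRing.isLinear.Build C V W *:%R l ll.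
pose L : {linear V -> W} := HB.pack l A.
have cL : continuous L.
  move=> u; apply/nrm_cvgP => e e0; apply/nearP.
  have K0 : 0 < `|K| + 1 by rewrite ltr_wpDl.
  exists (e / (`|K| + 1)); first by rewrite divr_gt0.
  move=> v; rewrite ltr_pdivlMr // => vu.
  rewrite -linearB; apply: le_lt_trans (lK _) _.
  apply: le_lt_trans vu; rewrite mulrC ler_wpM2l ?nrm_ge0 //.
  by rewrite (le_trans (ler_norm _)) // lerDl.
have E : f \o shift x = cst (f x) + L +o_ 0 id.
  apply/eqaddoP => e e0.
  have eR : e = (complex.Re e)%:C by rewrite RRe_real // gtr0_real.
  have e0' : 0 < complex.Re e by rewrite -ltcR -eR.
  have [d d0 Hd] := H _ e0'.
  rewrite /prop_near1 /= nbhs_nearE; apply/nearP; exists d => // h; rewrite subr0 => hd.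
  rewrite /= !nrmE eR -rmorphM lecR.
  have := Hd h hd; rewrite (addrC x) opprD addrA; exact.
have dE := diff_unique cL E; split; last exact: dE.
apply/diff_locallyP; rewrite dE; split => //.
Qed.

Lemma diff_hasd (V W : normedModType C) (f : V -> W) x :
  differentiable f x -> hasd f x ('d f x).
Proof.
move=> df; split.
- by move=> a u v; rewrite linearP.
- have [k k0 H] := linear_lipschitz (diff_continuous df).
  exists (complex.Re k) => h.
  by rewrite -lecR rmorphM /= -!nrmE RRe_real ?gtr0_real.
move=> e e0.
have [_ /diff_locallyP [_ E]] := (I, df).
have /eqaddoP := E => /(_ e%:C); rewrite ltcR => /(_ e0).
rewrite /prop_near1 /= nbhs_nearE => /nearP [d d0 H].
exists d => // h hd; have := H h; rewrite subr0 => /(_ hd) /=.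
by rewrite !nrmE -rmorphM lecR (addrC x) opprD addrA.
Qed.

Lemma hasd_derive (V W : normedModType C) (f : V -> W) x (l : V -> W) v :
  hasd f x l -> 'D_v f x = l v.
Proof. by move=> /hasd_diff [df <-]; rewrite deriveE. Qed.

Lemma diff_hasD (V W : normedModType C) (f : V -> W) x :
  differentiable f x -> hasd f x (fun v => 'D_v f x).
Proof.
move=> df; have := diff_hasd df; congr (hasd f x _).
by apply/funext => v; rewrite deriveE.
Qed.

Lemma deriveP_lin (V W : normedModType C) (f : V -> W) x :
  differentiable f x -> lin (fun v => 'D_v f x).
Proof. by move=> /diff_hasD []. Qed.

(** Cauchy estimates produce quadratic remainders, so this is the form in which most derivatives
    below are obtained. *)
Lemma hasd_quad (V W : normedModType C) (f : V -> W) x (l : V -> W) (K K' r : R) :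
  0 < r -> lin l -> (forall h, nrm (l h) <= K * nrm h) ->
  (forall h, nrm h < r -> nrm (f (x + h) - f x - l h) <= K' * nrm h ^+ 2) ->
  hasd f x l.
Proof.
move=> r0 ll lK H; split => //; first by exists K.
move=> e e0; have K0 : 0 < `|K'| + 1 by rewrite ltr_wpDl.
exists (Num.min r (e / (`|K'| + 1))); first by rewrite lt_min r0 divr_gt0.
move=> h; rewrite lt_min => /andP[/H h1 h2]; apply: (le_trans h1).
rewrite expr2 mulrA ler_wpM2r ?nrm_ge0 //.
move: h2; rewrite ltr_pdivlMr // => h2; apply: le_trans (ltW h2).
rewrite mulrC ler_wpM2l ?nrm_ge0 //.
by rewrite (le_trans (ler_norm _)) // lerDl.
Qed.

Lemma hasd_line (V W : normedModType C) (f : V -> W) (a u : V) (t : C) l :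
  hasd f (a + t *: u) l ->
  hasd (fun s : C => f (a + s *: u)) t (fun s => s *: l u).
Proof.
case=> ll [K lK] H; split.
- by move=> b s s' /=; rewrite scalerDl -scalerA.
- by exists (nrm (l u)) => h; rewrite nrmZ mulrC.
move=> e e0; have u0 : 0 < nrm u + 1 by rewrite ltr_wpDl // nrm_ge0.
have [d d0 Hd] := H (e / (nrm u + 1)) (divr_gt0 e0 u0).
exists (d / (nrm u + 1)); first by rewrite divr_gt0.
move=> h; rewrite ltr_pdivlMr // => hd.
have hu : nrm (h *: u) <= nrm h * (nrm u + 1).
  by rewrite nrmZ ler_wpM2l ?nrm_ge0 // lerDl.
have := Hd (h *: u) (le_lt_trans hu hd); rewrite (linZ _ _ ll) -(addrA a) -scalerDl.
move=> /le_trans; apply.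
apply: (le_trans (ler_wpM2l _ hu)); first by rewrite ltW // divr_gt0.
by rewrite mulrCA divfK ?gt_eqF // mulrC.
Qed.

Lemma hasd_cont (V W : normedModType C) (f : V -> W) x l :
  hasd f x l -> {for x, continuous f}.
Proof. by move=> /hasd_diff [/differentiable_continuous]. Qed.

End RealNorm.

#[export] Hint Extern 0 (is_true (@Order.le _ _ _ (@nrm _ _ _))) =>
  solve [apply: nrm_ge0] : core.

(** * Goursat's theorem and Cauchy's formula *)

Section ComplexIntegral.
Context {R : realType}.
Local Notation C := R[i].

(** Two-sided continuity, also at the end points, so that it passes to subintervals without subspace
    topologies. *)
Definition ccont (a b : R) (g : R -> C) :=
  forall x, a <= x <= b -> {for x, continuous g}.

Definition rint (a b : R) (g : R -> R) : R :=
  \int[@lebesgue_measure R]_(x in `[a, b]) g x.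

Definition cint (a b : R) (g : R -> C) : C :=
  rint a b (fun x => complex.Re (g x)) +i* rint a b (fun x => complex.Im (g x)).

Lemma cont_Re (T : topologicalType) (g : T -> C) (x : T) :
  {for x, continuous g} -> {for x, continuous (fun x => complex.Re (g x))}.
Proof.
move=> /nrm_cvgP H; apply/cvgrPdist_lt => e /H.
apply: filterS => y; apply: le_lt_trans.
by rewrite -raddfB nrm_sub nrm_Re.
Qed.

Lemma cont_Im (T : topologicalType) (g : T -> C) (x : T) :
  {for x, continuous g} -> {for x, continuous (fun x => complex.Im (g x))}.
Proof.
move=> /nrm_cvgP H; apply/cvgrPdist_lt => e /H.
apply: filterS => y; apply: le_lt_trans.
by rewrite -raddfB nrm_sub nrm_Im.
Qed.

Lemma cont_within (a b : R) (g : R -> R) :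
  (forall x, a <= x <= b -> {for x, continuous g}) ->
  {within `[a, b], continuous g}.
Proof.
by move=> H; apply: continuous_in_subspaceT => x; rewrite inE /= in_itv /=; exact: H.
Qed.

Lemma cont_int (a b : R) (g : R -> R) :
  (forall x, a <= x <= b -> {for x, continuous g}) ->
  (@lebesgue_measure R).-integrable `[a, b] (EFin \o g).
Proof.
move=> /cont_within H.
by apply: continuous_compact_integrable => //; exact: segment_compact.
Qed.

Lemma rint_split (a m b : R) (g : R -> R) : a <= m -> m <= b ->
  (forall x, a <= x <= b -> {for x, continuous g}) ->
  rint a b g = rint a m g + rint m b g.
Proof.
move=> am mb H; rewrite /rint.
have := @Rintegral_itvB R g (BLeft a) (BRight b) m (cont_int H).
rewrite !bnd_simp => /(_ am mb) E.
rewrite -[X in _ = _ + X]Rintegral_itv_obnd_cbnd; last first.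
  apply: integrableS (cont_int H) => //.
  by apply: subset_itvr; rewrite bnd_simp.
by rewrite -E addrC subrK.
Qed.

Lemma cint_split (a m b : R) (g : R -> C) : a <= m -> m <= b -> ccont a b g ->
  cint a b g = cint a m g + cint m b g.
Proof.
move=> am mb H; rewrite /cint [LHS]/=.
rewrite (rint_split am mb) => [|x /H]; last exact: cont_Re.
rewrite (rint_split am mb (g:= fun x => complex.Im _)) => [|x /H]; last exact: cont_Im.
by [].
Qed.

Lemma rintD (a b : R) (f g : R -> R) :
  (forall x, a <= x <= b -> {for x, continuous f}) ->
  (forall x, a <= x <= b -> {for x, continuous g}) ->
  rint a b (fun x => f x + g x) = rint a b f + rint a b g.
Proof. by move=> Hf Hg; rewrite /rint RintegralD //; apply: cont_int. Qed.

Lemma rintZ (a b : R) k (f : R -> R) :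
  (forall x, a <= x <= b -> {for x, continuous f}) ->
  rint a b (fun x => k * f x) = k * rint a b f.
Proof. by move=> Hf; rewrite /rint RintegralZl //; apply: cont_int. Qed.

Lemma cintD (a b : R) (f g : R -> C) : ccont a b f -> ccont a b g ->
  cint a b (fun x => f x + g x) = cint a b f + cint a b g.
Proof.
move=> Hf Hg; rewrite /cint.
have -> : rint a b (fun x => complex.Re (f x + g x)) =
   rint a b (fun x => complex.Re (f x)) + rint a b (fun x => complex.Re (g x)).
  rewrite -rintD; [|by move=> x /Hf/cont_Re|by move=> x /Hg/cont_Re].
  by congr rint; apply/funext => x; rewrite raddfD.
have -> : rint a b (fun x => complex.Im (f x + g x)) =
   rint a b (fun x => complex.Im (f x)) + rint a b (fun x => complex.Im (g x)).
  rewrite -rintD; [|by move=> x /Hf/cont_Im|by move=> x /Hg/cont_Im].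
  by congr rint; apply/funext => x; rewrite raddfD.
by [].
Qed.

Lemma cintZ (a b : R) (k : C) (f : R -> C) : ccont a b f ->
  cint a b (fun x => k * f x) = k * cint a b f.
Proof.
move=> Hf; rewrite /cint; case: k => p q.
have HR x : a <= x <= b -> {for x, continuous (fun x => complex.Re (f x))}.
  by move=> /Hf/cont_Re.
have HI x : a <= x <= b -> {for x, continuous (fun x => complex.Im (f x))}.
  by move=> /Hf/cont_Im.
have Z (g : R -> R) k : (forall x, a <= x <= b -> {for x, continuous g}) ->
    forall x, a <= x <= b -> {for x, continuous (fun x => k * g x)}.
  by move=> H x /H Hg; apply: cvgM => //; exact: cvg_cst.
have -> : rint a b (fun x => complex.Re ((p +i* q) * f x)) =
   p * rint a b (fun x => complex.Re (f x)) + (- q) * rint a b (fun x => complex.Im (f x)).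
  rewrite -!rintZ // -rintD; [|exact: Z..].
  by congr rint; apply/funext => x; case: (f x) => u v /=; rewrite mulNr.
have -> : rint a b (fun x => complex.Im ((p +i* q) * f x)) =
   p * rint a b (fun x => complex.Im (f x)) + q * rint a b (fun x => complex.Re (f x)).
  rewrite -!rintZ // -rintD; [|exact: Z..].
  by congr rint; apply/funext => x; case: (f x) => u v /=.
by apply/eqP; rewrite eq_complex /= mulNr !eqxx.
Qed.

Lemma rint_cst (a b k : R) : a <= b -> rint a b (fun=> k) = k * (b - a).
Proof.
move=> ab; rewrite /rint Rintegral_cst //= lebesgue_measure_itv /= lte_fin.
move: ab; rewrite le_eqVlt => /orP[/eqP ->|->] //.
by rewrite ltxx subrr.
Qed.

Lemma le_rint (a b : R) (f g : R -> R) :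
  (forall x, a <= x <= b -> {for x, continuous f}) ->
  (forall x, a <= x <= b -> {for x, continuous g}) ->
  (forall x, a <= x <= b -> f x <= g x) -> rint a b f <= rint a b g.
Proof.
move=> Hf Hg H; rewrite /rint; apply: le_Rintegral => //.
- exact: cont_int Hf.
- exact: cont_int Hg.
Qed.

Lemma rint_bound (a b M : R) (f : R -> R) : a <= b ->
  (forall x, a <= x <= b -> {for x, continuous f}) ->
  (forall x, a <= x <= b -> `|f x| <= M) -> `|rint a b f| <= M * (b - a).
Proof.
move=> ab Hf H; have cc k : forall x, a <= x <= b -> {for x, continuous (fun _ : R => k : R)}.
  by move=> x _; exact: cvg_cst.
rewrite ler_norml -mulNr -(rint_cst _ ab) -(rint_cst _ ab).
apply/andP; split.
  by apply: le_rint; [exact: cc|exact: Hf|move=> x /H; rewrite ler_norml => /andP[]].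
by apply: le_rint; [exact: Hf|exact: cc|move=> x /H; rewrite ler_norml => /andP[]].
Qed.

Lemma cint_bound (a b M : R) (f : R -> C) : a <= b -> ccont a b f ->
  (forall x, a <= x <= b -> nrm (f x) <= M) ->
  nrm (cint a b f) <= 2 * M * (b - a).
Proof.
move=> ab Hf H; apply: (le_trans (nrm_ReIm _)); rewrite /=.
rewrite -mulrA mulr_natl mulr2n lerD // rint_bound // => x xab.
- by apply: cont_Re; exact: Hf.
- exact: le_trans (nrm_Re _) (H _ xab).
- by apply: cont_Im; exact: Hf.
- exact: le_trans (nrm_Im _) (H _ xab).
Qed.

Lemma eq_cint (a b : R) (f g : R -> C) : (forall x, a <= x <= b -> f x = g x) ->
  cint a b f = cint a b g.
Proof.
move=> H; rewrite /cint /rint; congr (_ +i* _); apply: eq_Rintegral => x;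
by rewrite inE /= in_itv /= => /H ->.
Qed.

Definition rder (G : R -> C) (x : R) (d : C) :=
  forall e : R, 0 < e -> exists2 r : R, 0 < r & forall h : R, `|h| < r ->
    nrm (G (x + h) - G x - h%:C * d) <= e * `|h|.

Lemma is_derive_real (f : R -> R) x d :
  (forall e : R, 0 < e -> exists2 r : R, 0 < r & forall h : R, `|h| < r ->
    `|f (x + h) - f x - h * d| <= e * `|h|) -> is_derive x 1 f d.
Proof.
move=> H; have E : (fun h => h^-1 *: ((f \o shift x) (h *: 1) - f x)) @ 0^' --> d.
  apply/cvgrPdist_le => e e0; have [r r0 Hr] := H e e0.
  rewrite near_withinE; apply/nbhs_normP; exists r => //= h.
  rewrite /ball_ /= sub0r normrN => hr h0.
  rewrite [h *: 1]mulr1 (addrC h) -[_ *: _]/(_ * _).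
  rewrite -(ler_pM2l (_ : 0 < `|h|)) ?normr_gt0 // -normrM [leRHS]mulrC.
  have := Hr h hr; congr (_ <= _); rewrite distrC; congr Num.norm.
  by rewrite mulrBr mulVKf //; ring.
split; first by apply/cvg_ex; exists d.
exact: cvg_lim E.
Qed.

Lemma rder_Re G x d : rder G x d ->
  is_derive x 1 (fun x => complex.Re (G x)) (complex.Re d).
Proof.
move=> H; apply: is_derive_real => e /H [r r0 Hr]; exists r => // h /Hr.
apply: le_trans; apply: le_trans (nrm_Re _); rewrite le_eqVlt; apply/orP; left.
apply/eqP; congr Num.norm; case: d {H Hr} => u v; case: (G x) => ??; case: (G (x + h)) => ?? /=.
by rewrite mul0r subr0.
Qed.

Lemma rder_Im G x d : rder G x d ->
  is_derive x 1 (fun x => complex.Im (G x)) (complex.Im d).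
Proof.
move=> H; apply: is_derive_real => e /H [r r0 Hr]; exists r => // h /Hr.
apply: le_trans; apply: le_trans (nrm_Im _); rewrite le_eqVlt; apply/orP; left.
apply/eqP; congr Num.norm; case: d {H Hr} => u v; case: (G x) => ??; case: (G (x + h)) => ?? /=.
by rewrite mul0r addr0.
Qed.

Lemma rint_prim (a b : R) (F f : R -> R) : a <= b ->
  (forall x, a <= x <= b -> {for x, continuous f}) ->
  (forall x, a <= x <= b -> is_derive x 1 F (f x)) ->
  rint a b f = F b - F a.
Proof.
rewrite le_eqVlt => /orP[/eqP <- _ _|ab cf dF].
  by rewrite /rint set_itv1 Rintegral_set1 subrr.
have cF x : a <= x <= b -> {for x, continuous F}.
  move=> /dF [dFx _]; apply: differentiable_continuous.
  exact/derivable1_diffP.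
rewrite /rint /Rintegral (continuous_FTC2 ab (cont_within cf) (F := F)) //.
  have wc := cont_within cF.
  split.
  - move=> x; rewrite in_itv /= => /andP[/ltW ax /ltW xb].
    by have [] := dF x; rewrite ?ax.
  - by have /(continuous_within_itvP _ ab) [] := wc.
  - by have /(continuous_within_itvP _ ab) [] := wc.
move=> x; rewrite in_itv /= => /andP[/ltW ax /ltW xb].
have [//|_ E] := dF x; first by rewrite ax.
by rewrite derive1E.
Qed.

Lemma cint_prim (a b : R) (F f : R -> C) : a <= b -> ccont a b f ->
  (forall x, a <= x <= b -> rder F x (f x)) -> cint a b f = F b - F a.
Proof.
move=> ab cf dF; rewrite /cint.
have -> : rint a b (fun x => complex.Re (f x)) = complex.Re (F b) - complex.Re (F a).
  apply: (@rint_prim _ _ (fun x => complex.Re (F x))) => // x.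
    by move/cf/cont_Re.
  by move/dF/rder_Re.
have -> : rint a b (fun x => complex.Im (f x)) = complex.Im (F b) - complex.Im (F a).
  apply: (@rint_prim _ _ (fun x => complex.Im (F x))) => // x.
    by move/cf/cont_Im.
  by move/dF/rder_Im.
by case: (F a) => ??; case: (F b) => ??.
Qed.

End ComplexIntegral.

(** * Contour integrals over rectangles *)

Section Rectangles.
Context {R : realType}.
Local Notation C := R[i].

Lemma cont_hor (T : topologicalType) (f : C -> T) (x y : R) :
  {for (x +i* y), continuous f} -> {for x, continuous (fun x => f (x +i* y))}.
Proof.
move=> fc; apply: continuous_comp fc; apply/nrm_cvgP => e e0.
apply/nbhs_normP; exists e => // x' /=; rewrite distrC => H.
have -> : (x' +i* y) - (x +i* y) = (x' - x)%:C.
  by apply/eqP; rewrite eq_complex /= subrr !eqxx.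
by rewrite nrm_real.
Qed.

Lemma cont_ver (T : topologicalType) (f : C -> T) (x y : R) :
  {for (x +i* y), continuous f} -> {for y, continuous (fun y => f (x +i* y))}.
Proof.
move=> fc; apply: continuous_comp fc; apply/nrm_cvgP => e e0.
apply/nbhs_normP; exists e => // y' /=; rewrite distrC => H.
have -> : (x +i* y') - (x +i* y) = 'i * (y' - y)%:C.
  by apply/eqP; rewrite eq_complex /= !mul0r !mul1r !subrr ?add0r ?subr0 !eqxx.
by rewrite nrmM nrm_i mul1r nrm_real.
Qed.

Lemma diff_cder (f : C -> C) (z : C) :
  differentiable f z -> hasd f z (fun h => h * 'D_1 f z).
Proof.
move=> df; have := diff_hasD df; congr (hasd f z _); apply/funext => h.
by rewrite -[X in 'D_X _ _](mulr1 h) (linZ _ _ (deriveP_lin df)).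
Qed.

Lemma rder_hor (F : C -> C) (x y : R) d : hasd F (x +i* y) (fun h => h * d) ->
  rder (fun x => F (x +i* y)) x d.
Proof.
case=> _ _ H e /H [r r0 Hr]; exists r => // h hr.
have := Hr (h%:C); rewrite nrm_real => /(_ hr).
by have -> : (x +i* y) + h%:C = (x + h) +i* y by apply/eqP; rewrite eq_complex /= addr0 !eqxx.
Qed.

Lemma rder_ver (F : C -> C) (x y : R) d : hasd F (x +i* y) (fun h => h * d) ->
  rder (fun y => F (x +i* y)) y ('i * d).
Proof.
case=> _ _ H e /H [r r0 Hr]; exists r => // h hr.
have := Hr ('i * h%:C); rewrite nrmM nrm_i mul1r nrm_real => /(_ hr).
have -> : (x +i* y) + 'i * h%:C = x +i* (y + h).
  by apply/eqP; rewrite eq_complex /= !mul0r !mul1r !subrr ?add0r ?addr0 !eqxx.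
by rewrite mulrAC mulrC.
Qed.

(** The counterclockwise boundary integral: bottom, right, top and left edge, with [dz = 'i dy] on
    the vertical ones. *)
Definition rect (f : C -> C) (x0 x1 y0 y1 : R) : C :=
  cint x0 x1 (fun x => f (x +i* y0)) + 'i * cint y0 y1 (fun y => f (x1 +i* y))
  - cint x0 x1 (fun x => f (x +i* y1)) - 'i * cint y0 y1 (fun y => f (x0 +i* y)).

Definition inR (x0 x1 y0 y1 : R) (z : C) :=
  (x0 <= complex.Re z <= x1) && (y0 <= complex.Im z <= y1).

Definition onB (x0 x1 y0 y1 : R) (z : C) := inR x0 x1 y0 y1 z &&
  [|| complex.Re z == x0, complex.Re z == x1, complex.Im z == y0 | complex.Im z == y1].

Lemma onB_inR x0 x1 y0 y1 z : onB x0 x1 y0 y1 z -> inR x0 x1 y0 y1 z.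
Proof. by case/andP. Qed.

Section Edges.
Variables (x0 x1 y0 y1 : R) (xx : x0 <= x1) (yy : y0 <= y1) (P : C -> Prop).
Hypothesis H : forall z, onB x0 x1 y0 y1 z -> P z.

Lemma edge_b x : x0 <= x <= x1 -> P (x +i* y0).
Proof. by move=> tb; apply: H; rewrite /onB /inR /= tb lexx yy eqxx ?orbT. Qed.
Lemma edge_t x : x0 <= x <= x1 -> P (x +i* y1).
Proof. by move=> tb; apply: H; rewrite /onB /inR /= tb lexx yy eqxx ?orbT. Qed.
Lemma edge_l y : y0 <= y <= y1 -> P (x0 +i* y).
Proof. by move=> tb; apply: H; rewrite /onB /inR /= tb lexx xx eqxx ?orbT. Qed.
Lemma edge_r y : y0 <= y <= y1 -> P (x1 +i* y).
Proof. by move=> tb; apply: H; rewrite /onB /inR /= tb lexx xx eqxx ?orbT. Qed.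

End Edges.

Definition bcont f x0 x1 y0 y1 :=
  forall z, onB x0 x1 y0 y1 z -> {for z, continuous (f : C -> C)}.

Lemma bcont_b f x0 x1 y0 y1 : x0 <= x1 -> y0 <= y1 -> bcont f x0 x1 y0 y1 ->
  ccont x0 x1 (fun x => f (x +i* y0)).
Proof. by move=> xx yy H x /(edge_b yy H) /cont_hor. Qed.
Lemma bcont_t f x0 x1 y0 y1 : x0 <= x1 -> y0 <= y1 -> bcont f x0 x1 y0 y1 ->
  ccont x0 x1 (fun x => f (x +i* y1)).
Proof. by move=> xx yy H x /(edge_t yy H) /cont_hor. Qed.
Lemma bcont_l f x0 x1 y0 y1 : x0 <= x1 -> y0 <= y1 -> bcont f x0 x1 y0 y1 ->
  ccont y0 y1 (fun y => f (x0 +i* y)).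
Proof. by move=> xx yy H x /(edge_l xx H) /cont_ver. Qed.
Lemma bcont_r f x0 x1 y0 y1 : x0 <= x1 -> y0 <= y1 -> bcont f x0 x1 y0 y1 ->
  ccont y0 y1 (fun y => f (x1 +i* y)).
Proof. by move=> xx yy H x /(edge_r xx H) /cont_ver. Qed.

Lemma rectD f g x0 x1 y0 y1 : x0 <= x1 -> y0 <= y1 ->
  bcont f x0 x1 y0 y1 -> bcont g x0 x1 y0 y1 ->
  rect (fun z => f z + g z) x0 x1 y0 y1 = rect f x0 x1 y0 y1 + rect g x0 x1 y0 y1.
Proof.
move=> xx yy Hf Hg; rewrite /rect.
rewrite (cintD (bcont_b xx yy Hf) (bcont_b xx yy Hg)).
rewrite (cintD (bcont_t xx yy Hf) (bcont_t xx yy Hg)).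
rewrite (cintD (bcont_l xx yy Hf) (bcont_l xx yy Hg)).
rewrite (cintD (bcont_r xx yy Hf) (bcont_r xx yy Hg)).
ring.
Qed.

Lemma rectZ k f x0 x1 y0 y1 : x0 <= x1 -> y0 <= y1 -> bcont f x0 x1 y0 y1 ->
  rect (fun z => k * f z) x0 x1 y0 y1 = k * rect f x0 x1 y0 y1.
Proof.
move=> xx yy Hf; rewrite /rect.
rewrite (cintZ _ (bcont_b xx yy Hf)) (cintZ _ (bcont_t xx yy Hf)).
rewrite (cintZ _ (bcont_l xx yy Hf)) (cintZ _ (bcont_r xx yy Hf)).
ring.
Qed.

Lemma eq_rect f g x0 x1 y0 y1 : x0 <= x1 -> y0 <= y1 ->
  (forall z, onB x0 x1 y0 y1 z -> f z = g z) -> rect f x0 x1 y0 y1 = rect g x0 x1 y0 y1.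
Proof.
move=> xx yy H; rewrite /rect.
rewrite (eq_cint (edge_b yy H)) (eq_cint (edge_t yy H)).
by rewrite (eq_cint (edge_l xx H)) (eq_cint (edge_r xx H)).
Qed.

Lemma rect_bound f x0 x1 y0 y1 M : x0 <= x1 -> y0 <= y1 -> bcont f x0 x1 y0 y1 ->
  (forall z, onB x0 x1 y0 y1 z -> nrm (f z) <= M) ->
  nrm (rect f x0 x1 y0 y1) <= 4 * M * ((x1 - x0) + (y1 - y0)).
Proof.
move=> xx yy Hf HM; rewrite /rect.
have := cint_bound xx (bcont_b xx yy Hf) (edge_b yy HM).
have := cint_bound xx (bcont_t xx yy Hf) (edge_t yy HM).
have := cint_bound yy (bcont_l xx yy Hf) (edge_l xx HM).
have := cint_bound yy (bcont_r xx yy Hf) (edge_r xx HM).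
set a := cint _ _ _; set b := cint _ _ _; set c := cint _ _ _; set d := cint _ _ _ => Ha Hb Hc Hd.
have := nrmB (d + 'i * a - c) ('i * b); have := nrmB (d + 'i * a) c.
have := nrmD d ('i * a); rewrite !nrmM nrm_i !mul1r.
lra.
Qed.

Lemma rect_splitx f x0 m x1 y0 y1 : x0 <= m -> m <= x1 -> y0 <= y1 ->
  bcont f x0 x1 y0 y1 ->
  rect f x0 x1 y0 y1 = rect f x0 m y0 y1 + rect f m x1 y0 y1.
Proof.
move=> xm mx yy Hf; have xx := le_trans xm mx.
rewrite /rect (cint_split xm mx (bcont_b xx yy Hf)) (cint_split xm mx (bcont_t xx yy Hf)).
ring.
Qed.

Lemma rect_splity f x0 x1 y0 m y1 : y0 <= m -> m <= y1 -> x0 <= x1 ->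
  bcont f x0 x1 y0 y1 ->
  rect f x0 x1 y0 y1 = rect f x0 x1 y0 m + rect f x0 x1 m y1.
Proof.
move=> ym my xx Hf; have yy := le_trans ym my.
rewrite /rect (cint_split ym my (bcont_l xx yy Hf)) (cint_split ym my (bcont_r xx yy Hf)).
ring.
Qed.

Lemma rect_prim F f x0 x1 y0 y1 : x0 <= x1 -> y0 <= y1 -> bcont f x0 x1 y0 y1 ->
  (forall z, onB x0 x1 y0 y1 z -> hasd F z (fun h => h * f z)) ->
  rect f x0 x1 y0 y1 = 0.
Proof.
move=> xx yy Hf HF; rewrite /rect.
rewrite (cint_prim xx (bcont_b xx yy Hf) (F := fun x => F (x +i* y0))); last first.
  by move=> x /(edge_b yy HF) /rder_hor.
rewrite (cint_prim xx (bcont_t xx yy Hf) (F := fun x => F (x +i* y1))); last first.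
  by move=> x /(edge_t yy HF) /rder_hor.
have ic a b g : ccont a b g -> ccont a b (fun x : R => 'i * g x).
  by move=> H x /H gx; apply: cvgM gx; exact: cvg_cst.
rewrite -(cintZ _ (bcont_l xx yy Hf)) -(cintZ _ (bcont_r xx yy Hf)).
rewrite (cint_prim yy (ic _ _ _ (bcont_r xx yy Hf)) (F := fun y => F (x1 +i* y))); last first.
  by move=> x /(edge_r xx HF) /rder_ver.
rewrite (cint_prim yy (ic _ _ _ (bcont_l xx yy Hf)) (F := fun y => F (x0 +i* y))); last first.
  by move=> x /(edge_l xx HF) /rder_ver.
ring.
Qed.

End Rectangles.

(** * Goursat's theorem by bisection *)

Section Goursat.
Context {R : realType}.
Local Notation C := R[i].

Lemma inRW (a0 a1 b0 b1 x0 x1 y0 y1 : R) z :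
  x0 <= a0 -> a1 <= x1 -> y0 <= b0 -> b1 <= y1 ->
  inR a0 a1 b0 b1 z -> inR x0 x1 y0 y1 z.
Proof.
move=> h1 h2 h3 h4 /andP[/andP[h5 h6] /andP[h7 h8]].
by rewrite /inR (le_trans h1) ?(le_trans h6) ?(le_trans h3) ?(le_trans h8).
Qed.

Lemma hasd_affine (p q c z : C) :
  hasd (fun w => p * w + q * (w - c) ^+ 2 / 2) z (fun h => h * (p + q * (z - c))).
Proof.
apply: (@hasd_quad _ _ _ _ _ _ (nrm (p + q * (z - c))) (nrm (q / 2)) 1 ltr01).
- by move=> a u v; rewrite mulrDl -mulrA.
- by move=> h; rewrite nrmM mulrC.
move=> h _; rewrite -nrmX -nrmM le_eqVlt; apply/orP; left; apply/eqP; congr nrm.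
by field.
Qed.

Lemma cont_affine (p q c z : C) : {for z, continuous (fun w : C => p + q * (w - c))}.
Proof.
have H : hasd (fun w : C => p + q * (w - c)) z (fun h => h * q).
  apply: (@hasd_quad _ _ _ _ _ _ (nrm q) 0 1 ltr01).
  - by move=> a u v; rewrite mulrDl -mulrA.
  - by move=> h; rewrite nrmM mulrC.
  by move=> h _; rewrite mul0r (_ : _ - _ = 0) ?nrm0 //; ring.
have := hasd_cont H; exact.
Qed.

Lemma rect_affine (p q c : C) x0 x1 y0 y1 : x0 <= x1 -> y0 <= y1 ->
  rect (fun z => p + q * (z - c)) x0 x1 y0 y1 = 0.
Proof.
move=> xx yy; apply: (rect_prim (F := fun w => p * w + q * (w - c) ^+ 2 / 2)) => //.
  by move=> z _; exact: cont_affine.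
by move=> z _; exact: hasd_affine.
Qed.

Lemma nrm_inR (x0 x1 y0 y1 : R) (z w : C) :
  inR x0 x1 y0 y1 z -> inR x0 x1 y0 y1 w -> nrm (z - w) <= (x1 - x0) + (y1 - y0).
Proof.
move=> /andP[/andP[h1 h2] /andP[h3 h4]] /andP[/andP[h5 h6] /andP[h7 h8]].
apply: (le_trans (nrm_ReIm _)); apply: lerD.
  by rewrite raddfB ler_norml; apply/andP; split; lra.
by rewrite raddfB ler_norml; apply/andP; split; lra.
Qed.

(** The first-order Taylor polynomial at [c] has a primitive and integrates to 0. What is left is at
    most [e] times the half-perimeter on a contour of that same size, hence the square. *)
Lemma rect_small (f : C -> C) (c : C) e : differentiable f c -> 0 < e ->
  exists2 d : R, 0 < d & forall x0 x1 y0 y1, x0 <= x1 -> y0 <= y1 ->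
    inR x0 x1 y0 y1 c -> bcont f x0 x1 y0 y1 ->
    (x1 - x0) + (y1 - y0) < d ->
    nrm (rect f x0 x1 y0 y1) <= 4 * e * ((x1 - x0) + (y1 - y0)) ^+ 2.
Proof.
move=> df e0; have [_ _ /(_ e e0) [d d0 Hd]] := diff_cder df.
exists d => // x0 x1 y0 y1 xx yy cR fc sd.
pose q := 'D_1 f c; pose a z := f c + q * (z - c); pose r z := f z - a z.
have ac : bcont a x0 x1 y0 y1.
  by move=> z _; exact: cont_affine.
have rc : bcont r x0 x1 y0 y1 by move=> z zB; exact: (cvgB (fc z zB) (ac z zB)).
have -> : rect f x0 x1 y0 y1 = rect (fun z => a z + r z) x0 x1 y0 y1.
  by apply: eq_rect => // z _; rewrite /r addrC subrK.
rewrite rectD // rect_affine // add0r.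
rewrite expr2 mulrA -(mulrA 4).
apply: rect_bound => // z /onB_inR zR.
have zc := nrm_inR zR cR.
have := Hd (z - c) (le_lt_trans zc sd).
rewrite (addrC c) subrK => H.
rewrite /r /a opprD addrA mulrC; apply: (le_trans H); rewrite ler_wpM2l //.
exact: ltW.
Qed.

Lemma quarter (f : C -> C) (x0 xm x1 y0 ym y1 : R) :
  x0 <= xm -> xm <= x1 -> y0 <= ym -> ym <= y1 ->
  (forall z, inR x0 x1 y0 y1 z -> {for z, continuous f}) ->
  rect f x0 x1 y0 y1 = (rect f x0 xm y0 ym + rect f xm x1 y0 ym) +
    (rect f x0 xm ym y1 + rect f xm x1 ym y1).
Proof.
move=> h1 h2 h3 h4 fc.
have sub a0 a1 b0 b1 : x0 <= a0 -> a1 <= x1 -> y0 <= b0 -> b1 <= y1 ->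
    bcont f a0 a1 b0 b1.
  by move=> ? ? ? ? z /onB_inR zR; apply: fc; apply: inRW zR.
rewrite (rect_splity h3 h4) ?(le_trans h1) //; last exact: sub.
by rewrite !(@rect_splitx _ _ x0 xm x1) //; apply: sub.
Qed.

Lemma four_lt (x a b c d : R) :
  x <= a + b + (c + d) -> 4 * a < x -> 4 * b < x -> 4 * c < x -> 4 * d < x -> False.
Proof. by lra. Qed.

Lemma end_mem (a p w : R) : 0 <= w -> p = a \/ p = a + w -> a <= p /\ p <= a + w.
Proof. by move=> w0 [->|->]; split; lra. Qed.

(** Some quarter always carries at least a quarter of the integral. The nested quarters shrink to a
    point [c], where [rect_small] bounds the integral by a quantity of order [4 ^- k] with an
    arbitrarily small factor. *)
Lemma goursat (f : C -> C) (x0 x1 y0 y1 : R) : x0 <= x1 -> y0 <= y1 ->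
  (forall z, inR x0 x1 y0 y1 z -> differentiable f z) ->
  rect f x0 x1 y0 y1 = 0.
Proof.
move=> xx yy df; apply/eqP; rewrite -nrm_eq0; apply/eqP.
apply/le_anti; rewrite nrm_ge0 andbT; apply/ler_addgt0Pr => e1 e10; rewrite add0r.
set m := nrm _.
pose w k : R := (x1 - x0) / 2 ^+ k; pose h k : R := (y1 - y0) / 2 ^+ k.
have p2 k : 0 < (2 : R) ^+ k by rewrite exprn_gt0.
have wS k : w k = w k.+1 + w k.+1 by rewrite /w exprS; field; rewrite expf_neq0.
have hS k : h k = h k.+1 + h k.+1 by rewrite /h exprS; field; rewrite expf_neq0.
have w0 k : 0 <= w k by rewrite /w divr_ge0 ?subr_ge0 // ltW.
have h0 k : 0 <= h k by rewrite /h divr_ge0 ?subr_ge0 // ltW.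
have fc z : inR x0 x1 y0 y1 z -> {for z, continuous f}.
  by move=> /df /differentiable_continuous.
(* [p] is the lower left corner of the rectangle of generation [k]. *)
pose P k (p : R * R) := [/\ x0 <= p.1, p.1 + w k <= x1, y0 <= p.2, p.2 + h k <= y1 &
  m <= 4 ^+ k * nrm (rect f p.1 (p.1 + w k) p.2 (p.2 + h k))].
(* The implication sits under the existential so that [choice] yields a total function; off the
   invariant any value does. *)
have step (kp : nat * (R * R)) : exists p', P kp.1 kp.2 ->
    [/\ P kp.1.+1 p', kp.2.1 <= p'.1, p'.1 + w kp.1.+1 <= kp.2.1 + w kp.1,
     kp.2.2 <= p'.2 & p'.2 + h kp.1.+1 <= kp.2.2 + h kp.1].
  case: kp => k [a b] /=.
  have [[/= h1 h2 h3 h4 h5]|nP] := pselect (P k (a, b)); last by exists (0, 0) => /nP.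
  have wk := wS k; have hk := hS k; have wk0 := w0 k.+1; have hk0 := h0 k.+1.
  have E := @quarter f a (a + w k.+1) (a + w k) b (b + h k.+1) (b + h k).
  have {}E : rect f a (a + w k) b (b + h k) =
    rect f a (a + w k.+1) b (b + h k.+1) + rect f (a + w k.+1) (a + w k) b (b + h k.+1) +
    (rect f a (a + w k.+1) (b + h k.+1) (b + h k) + rect f (a + w k.+1) (a + w k) (b + h k.+1) (b + h k)).
    clear -E wk hk wk0 hk0 fc h1 h2 h3 h4; apply: E; try by clear fc; lra.
    by move=> z zR; apply: fc; apply: inRW zR.
  have aw : a + w k = a + w k.+1 + w k.+1 by lra.
  have bh : b + h k = b + h k.+1 + h k.+1 by lra.
  rewrite aw bh in E.
  pose n p q := nrm (rect f p (p + w k.+1) q (q + h k.+1)).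
  (* Otherwise each of the four integrals would be below a quarter of the whole, against the
     triangle inequality. *)
  have H4 : exists p : R * R, [/\ p.1 = a \/ p.1 = a + w k.+1, p.2 = b \/ p.2 = b + h k.+1 &
     nrm (rect f a (a + w k) b (b + h k)) <= 4 * n p.1 p.2].
    apply: contrapT => nE.
    have N p q : p = a \/ p = a + w k.+1 -> q = b \/ q = b + h k.+1 ->
       4 * n p q < nrm (rect f a (a + w k) b (b + h k)).
      move=> hp hq; rewrite ltNge; apply/negP => Hle; apply: nE; exists (p, q); split => //.
    have N1 := N a b (or_introl erefl) (or_introl erefl).
    have N2 := N (a + w k.+1) b (or_intror erefl) (or_introl erefl).
    have N3 := N a (b + h k.+1) (or_introl erefl) (or_intror erefl).
    have N4 := N (a + w k.+1) (b + h k.+1) (or_intror erefl) (or_intror erefl).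
    have D : nrm (rect f a (a + w k) b (b + h k)) <=
        n a b + n (a + w k.+1) b + (n a (b + h k.+1) + n (a + w k.+1) (b + h k.+1)).
      by rewrite aw bh E; apply: (le_trans (nrmD _ _)); apply: lerD; exact: nrmD.
    exact: (four_lt D N1 N2 N3 N4).
  have [p [hp hq hn]] := H4; exists p => _.
  have [pa pa'] : a <= p.1 /\ p.1 <= a + w k.+1 by exact: end_mem hp.
  have [pb pb'] : b <= p.2 /\ p.2 <= b + h k.+1 by exact: end_mem hq.
  split; [split|..]; try by clear -h1 h2 h3 h4 pa pa' pb pb' aw bh; lra.
  by apply: (le_trans h5); rewrite exprSr -mulrA ler_wpM2l // exprn_ge0.
have [st Hst] := choice step.
pose s := fix s k := if k is k'.+1 then st (k', s k') else (x0, y0).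
have Ps k : P k (s k).
  elim: k => [|k IH].
    have -> : s 0%N = (x0, y0) by [].
    by split; rewrite /= /w /h ?expr0 ?divr1 ?mul1r 1?[x0 + _]addrC 1?[y0 + _]addrC ?subrK.
  by have [] := Hst (k, s k) IH.
have mono k j : (s k).1 <= (s (k + j)%N).1 /\ (s (k + j)%N).1 + w (k + j)%N <= (s k).1 + w k /\
   ((s k).2 <= (s (k + j)%N).2 /\ (s (k + j)%N).2 + h (k + j)%N <= (s k).2 + h k).
  elim: j => [|j [IH1 [IH2 [IH3 IH4]]]]; first by rewrite addn0 !lexx.
  rewrite addnS; have [_ /= g1 g2 g3 g4] := Hst (k + j, s (k + j))%N (Ps (k + j)%N).
  by split; [|split; [|split]]; lra.
have bnd k j : (s j).1 <= (s k).1 + w k /\ (s j).2 <= (s k).2 + h k.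
  have [kj|/ltnW jk] := leqP k j.
    have [_ [H1 [_ H2]]] := mono k (j - k)%N; rewrite subnKC // in H1 H2.
    by have := w0 j; have := h0 j; split; lra.
  have [H1 [_ [H2 _]]] := mono j (k - j)%N; rewrite subnKC // in H1 H2.
  by have := w0 k; have := h0 k; split; lra.
(* The common point of the nested rectangles, as supremum of their lower left corners. *)
pose ca := sup (range (fun k => (s k).1)); pose cb := sup (range (fun k => (s k).2)).
have cR k : inR (s k).1 ((s k).1 + w k) (s k).2 ((s k).2 + h k) (ca +i* cb).
  rewrite /inR /=; apply/andP; split; apply/andP; split.
  - apply: ub_le_sup; last by exists k.
    by exists ((s 0%N).1 + w 0%N) => _ [j _ <-]; have [] := bnd 0%N j.
  - apply: ge_sup; first by exists (s 0%N).1; exists 0%N.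
    by move=> _ [j _ <-]; have [] := bnd k j.
  - apply: ub_le_sup; last by exists k.
    by exists ((s 0%N).2 + h 0%N) => _ [j _ <-]; have [] := bnd 0%N j.
  - apply: ge_sup; first by exists (s 0%N).2; exists 0%N.
    by move=> _ [j _ <-]; have [] := bnd k j.
pose D := (x1 - x0) + (y1 - y0).
have D0 : 0 <= D by rewrite /D; lra.
(* Tuned so that [4 * e * D ^+ 2] stays below [e1]; the [+ 1] covers a degenerate rectangle with
   [D = 0]. *)
have e20 : 0 < e1 / (4 * (D ^+ 2 + 1)).
  by rewrite divr_gt0 // mulr_gt0 // ltr_wpDl // exprn_ge0.
have c0R : inR x0 x1 y0 y1 (ca +i* cb).
  have [g1 g2 g3 g4 _] := Ps 0%N; exact: inRW (cR 0%N).
have [d d0 Hd] := rect_small (df _ c0R) e20.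
have [k Hk] : exists k, D / d < 2 ^+ k.
  exists (Num.bound (D / d)); apply: lt_le_trans (archi_boundP _) _.
    by rewrite divr_ge0 // ltW.
  by rewrite -natrX ler_nat ltnW // ltn_expl.
have [g1 g2 g3 g4 g5] := Ps k.
have wh : w k + h k = D / 2 ^+ k by rewrite /w /h -mulrDl.
have whd : w k + h k < d.
  by rewrite wh ltr_pdivrMr // mulrC -ltr_pdivrMr.
apply: (le_trans g5).
have addK' (a b : R) : a + b - a = b by rewrite addrAC subrr add0r.
have := Hd (s k).1 ((s k).1 + w k) (s k).2 ((s k).2 + h k).
rewrite !addK' => /(_ _ _ (cR k) _ whd) H.
have {}H : nrm (rect f (s k).1 ((s k).1 + w k) (s k).2 ((s k).2 + h k)) <=
   4 * (e1 / (4 * (D ^+ 2 + 1))) * (w k + h k) ^+ 2.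
  apply: H; rewrite ?lerDl //.
  by move=> z /onB_inR zR; apply: fc; apply: inRW zR.
apply: le_trans (ler_wpM2l _ H) _; first by rewrite exprn_ge0.
have E4 : (2 ^+ k) ^+ 2 = 4 ^+ k :> R by rewrite -exprM mulnC exprM; congr (_ ^+ _); ring.
rewrite wh expr_div_n E4 mulrCA (mulrC (D ^+ 2)) mulVKf ?expf_neq0 //.
have D1 : 0 < D ^+ 2 + 1 by rewrite ltr_wpDl // exprn_ge0.
have -> : 4 * (e1 / (4 * (D ^+ 2 + 1))) = e1 / (D ^+ 2 + 1) by field; rewrite gt_eqF.
by rewrite mulrAC ler_pdivrMr // ler_wpM2l ?ltW // ltrDl.
Qed.

End Goursat.

(** * Cauchy's formula on a rectangle *)

Section Cauchy.
Context {R : realType}.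
Local Notation C := R[i].

Lemma cont_nrmP (V W : normedModType C) (f : V -> W) x :
  {for x, continuous f} <-> forall e : R, 0 < e -> exists2 d : R, 0 < d &
    forall y, nrm (y - x) < d -> nrm (f y - f x) < e.
Proof.
split=> [/nrm_cvgP H e /H /nearP //|H].
by apply/nrm_cvgP => e /H He; apply/nearP.
Qed.

Lemma cont_cstn (V W : normedModType C) (c : W) (x : V) :
  {for x, continuous (fun _ : V => c)}.
Proof. by apply/cont_nrmP => e e0; exists 1 => // y _; rewrite subrr nrm0. Qed.

Lemma hasd_ext (V W : normedModType C) (f g : V -> W) x l (r : R) : 0 < r ->
  (forall h, nrm h < r -> f (x + h) = g (x + h)) -> hasd f x l -> hasd g x l.
Proof.
move=> r0 fg [ll lK H]; split => // e /H [d d0 Hd].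
exists (Num.min d r); first by rewrite lt_min d0.
move=> h; rewrite lt_min => /andP[/Hd h1 /fg h2].
by have := fg 0; rewrite addr0 nrm0 -h2 => <-.
Qed.

Lemma diff_ext (V W : normedModType C) (f g : V -> W) x (r : R) : 0 < r ->
  (forall y, nrm (y - x) < r -> f y = g y) -> differentiable f x -> differentiable g x.
Proof.
move=> r0 fg /diff_hasd df; have [] // := @hasd_diff _ _ _ g x _ (hasd_ext r0 _ df).
by move=> h hr; apply: fg; rewrite addrC addrA addNr add0r.
Qed.

Lemma ler_dist_nrm (V : normedModType C) (u v : V) : `|nrm u - nrm v| <= nrm (u - v).
Proof.
have := nrm_tri u v 0; have := nrm_tri v u 0.
rewrite !subr0 (nrm_sub v u) => h1 h2; rewrite ler_norml; apply/andP; split; lra.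
Qed.

Lemma cont_nrm (T : topologicalType) (V : normedModType C) (g : T -> V) (x : T) :
  {for x, continuous g} -> {for x, continuous (fun x => nrm (g x))}.
Proof.
move=> /nrm_cvgP H; apply/cvgrPdist_lt => e /H; apply: filterS => y.
by apply: le_lt_trans; rewrite nrm_sub ler_dist_nrm.
Qed.

Lemma ccont_bounded (a b : R) (g : R -> C) : a <= b -> ccont a b g ->
  exists M, forall x, a <= x <= b -> nrm (g x) <= M.
Proof.
move=> ab H.
have [c _ Hc] := EVT_max ab (cont_within (fun x xab => cont_nrm (H x xab))).
by exists (nrm (g c)) => x xab; apply: Hc; rewrite in_itv.
Qed.

Lemma bcont_bounded (f : C -> C) x0 x1 y0 y1 : x0 <= x1 -> y0 <= y1 ->
  bcont f x0 x1 y0 y1 -> exists M, forall z, onB x0 x1 y0 y1 z -> nrm (f z) <= M.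
Proof.
move=> xx yy H.
have [M1 H1] := ccont_bounded xx (bcont_b xx yy H).
have [M2 H2] := ccont_bounded xx (bcont_t xx yy H).
have [M3 H3] := ccont_bounded yy (bcont_l xx yy H).
have [M4 H4] := ccont_bounded yy (bcont_r xx yy H).
exists (Num.max (Num.max M1 M2) (Num.max M3 M4)) => -[x y] /andP[/andP[/= hx hy]].
by case/or4P => /eqP E; subst; rewrite !le_max ?H1 ?H2 ?H3 ?H4 ?orbT.
Qed.

(** The integrand may fail to be differentiable at one point [w]. *)
Lemma goursat_exc (f : C -> C) (w : C) (x0 x1 y0 y1 : R) :
  x0 < complex.Re w < x1 -> y0 < complex.Im w < y1 ->
  (forall z, inR x0 x1 y0 y1 z -> {for z, continuous f}) ->
  (forall z, inR x0 x1 y0 y1 z -> z != w -> differentiable f z) ->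
  rect f x0 x1 y0 y1 = 0.
Proof.
case: w => a b /= /andP[xa ax] /andP[yb by_] fc df.
apply/eqP; rewrite -nrm_eq0; apply/eqP.
apply/le_anti; rewrite nrm_ge0 andbT; apply/ler_addgt0Pr => e e0; rewrite add0r.
have [d d0 Hd] : exists2 d : R, 0 < d & forall z, nrm (z - (a +i* b)) < d ->
    nrm (f z) <= nrm (f (a +i* b)) + 1.
  have wR : inR x0 x1 y0 y1 (a +i* b) by rewrite /inR /= !ltW.
  have /nrm_cvgP/(_ 1 ltr01)/nearP [d d0 Hd] := fc _ wR.
  exists d => // z /Hd; have := ler_dist_nrm (f z) (f (a +i* b)).
  by move=> /ler_normlP [_ h1] h2; lra.
set M := _ + 1 in Hd.
have M0 : 0 < M by rewrite /M ltr_wpDl ?nrm_ge0.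
(* Half the side of a square about [w]: inside the rectangle, small enough for the bound [M], and
   with [rect_bound] giving at most [e] on it. *)
have [n n0 [n1 n2 n3 n4 [n5 n6]]] : exists2 n : R, 0 < n &
    [/\ x0 <= a - n, a + n <= x1, y0 <= b - n, b + n <= y1 & (n + n + (n + n) < d) /\
        4 * M * (n + n + (n + n)) <= e].
  exists (Num.min (Num.min (a - x0) (x1 - a))
     (Num.min (Num.min (b - y0) (y1 - b)) (Num.min (d / 8) (e / (16 * M))))).
    by rewrite !lt_min !subr_gt0 xa ax yb by_ !divr_gt0 // mulr_gt0.
  set n := Num.min _ _.
  have : n <= n by rewrite lexx.
  rewrite {2}/n !le_min => /andP[/andP[h1 h2] /andP[/andP[h3 h4] /andP[h5 h6]]].
  rewrite ler_pdivlMr ?mulr_gt0 // in h6.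
  split; [lra|lra|lra|lra|split; [lra|]].
  by have -> : 4 * M * (n + n + (n + n)) = n * (16 * M) by ring.
have sub a0 a1 b0 b1 : x0 <= a0 -> a1 <= x1 -> y0 <= b0 -> b1 <= y1 ->
    bcont f a0 a1 b0 b1.
  by move=> ? ? ? ? z /onB_inR zR; apply: fc; apply: inRW zR.
have gz a0 a1 b0 b1 : a0 <= a1 -> b0 <= b1 -> x0 <= a0 -> a1 <= x1 -> y0 <= b0 -> b1 <= y1 ->
    ~~ inR a0 a1 b0 b1 (a +i* b) -> rect f a0 a1 b0 b1 = 0.
  move=> g1 g2 g3 g4 g5 g6 g7; apply: goursat => // z zR; apply: df.
    by apply: inRW zR.
  by apply: contraNneq g7 => <-.
have [am bm] : a - n <= a + n /\ b - n <= b + n by clear -n0; split; lra.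
have [x01 y01] : x0 <= x1 /\ y0 <= y1 by clear -n1 n2 n3 n4 am bm; split; lra.
have [xm mx] : x0 <= a + n /\ a - n <= x1 by clear -n1 n2 am; split; lra.
have [ym my] : y0 <= b + n /\ b - n <= y1 by clear -n3 n4 bm; split; lra.
(* Four rectangles avoiding [w] are cut off in turn, each with integral 0 by [goursat]; the small
   square remains. *)
rewrite (@rect_splitx _ _ x0 (a - n)) //; last exact: sub.
rewrite gz ?add0r //; last by apply/negP => /andP[/= /andP[_ g2] _]; clear -g2 n0; lra.
rewrite (@rect_splitx _ _ (a - n) (a + n)) //; last exact: sub.
rewrite [X in _ + X]gz ?addr0 //; last by apply/negP => /andP[/= /andP[g1 _] _]; clear -g1 n0; lra.
rewrite (@rect_splity _ _ _ _ y0 (b - n)) //; last exact: sub.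
rewrite gz ?add0r //; last by apply/negP => /andP[_ /= /andP[_ g2]]; clear -g2 n0; lra.
rewrite (@rect_splity _ _ _ _ (b - n) (b + n)) //; last exact: sub.
rewrite [X in _ + X]gz ?addr0 //; last by apply/negP => /andP[_ /= /andP[g1 _]]; clear -g1 n0; lra.
apply: le_trans n6; have E (c : R) : c + n - (c - n) = n + n by ring.
have := @rect_bound _ f (a - n) (a + n) (b - n) (b + n) M; rewrite !E; apply => //; first exact: sub.
move=> z /onB_inR zR; apply: Hd; apply: le_lt_trans n5.
rewrite -{1}(E a) -(E b); apply: nrm_inR zR _.
by rewrite /inR /=; apply/andP; split; apply/andP; split; lra.
Qed.

Lemma cont_div (f g : C -> C) (z : C) : {for z, continuous f} -> differentiable g z ->
  g z != 0 -> {for z, continuous (fun z => f z / g z)}.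
Proof.
move=> cf dg gz.
have cg : {for z, continuous g} := differentiable_continuous dg.
exact: (cvgM cf (cvgV gz cg)).
Qed.

(** Cauchy's formula, up to the constant [rect (fun z => (z - w)^-1)]. *)
Lemma cauchy_rect (f : C -> C) (w : C) (x0 x1 y0 y1 : R) :
  x0 < complex.Re w < x1 -> y0 < complex.Im w < y1 ->
  (forall z, inR x0 x1 y0 y1 z -> differentiable f z) ->
  rect (fun z => f z / (z - w)) x0 x1 y0 y1 =
    f w * rect (fun z => 1 / (z - w)) x0 x1 y0 y1.
Proof.
move=> xw yw df.
have xx : x0 <= x1 by case/andP: xw => h1 h2; lra.
have yy : y0 <= y1 by case/andP: yw => h1 h2; lra.
have wR : inR x0 x1 y0 y1 w by case/andP: xw yw => h1 h2 /andP[h3 h4]; rewrite /inR !ltW.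
have wB z : onB x0 x1 y0 y1 z -> z - w != 0.
  move=> /andP[_ H]; rewrite subr_eq0; apply: contraTneq H => ->.
  case/andP: xw yw => h1 h2 /andP[h3 h4].
  by rewrite !negb_or (gt_eqF h1) (lt_eqF h2) (gt_eqF h3) (lt_eqF h4).
have dw z : differentiable (fun z : C => z - w) z.
  by apply: differentiableB => //; exact: differentiable_cst.
(* The difference quotient, filled in continuously at [w]; differentiability at [w] itself is
   unknown, whence [goursat_exc]. *)
pose g z := if z == w then 'D_1 f w else (f z - f w) / (z - w).
have g0 : rect g x0 x1 y0 y1 = 0.
  have dg z : inR x0 x1 y0 y1 z -> z != w -> differentiable g z.
    move=> zR zw; apply: (@diff_ext _ _ (fun z => (f z - f w) / (z - w)) _ _ (nrm (z - w))).
    - by rewrite nrm_gt0 subr_eq0.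
    - move=> y; rewrite /g; case: eqVneq => // ->.
      by rewrite nrm_sub ltxx.
    - apply: differentiableM.
        by apply: differentiableB; [exact: df|exact: differentiable_cst].
      by apply: differentiableV; rewrite ?subr_eq0 //; exact: dw.
  apply: (goursat_exc xw yw) => // z zR; case: (eqVneq z w) => [->|zw]; last first.
    exact: differentiable_continuous (dg z zR zw).
  apply/cont_nrmP => e e0.
  have [_ _ /(_ (e/2))] := diff_cder (df _ wR); rewrite divr_gt0 // => /(_ isT) [d d0 Hd].
  exists d => // y yd; rewrite /g eqxx; case: eqVneq => [_|yw'].
    by rewrite subrr nrm0.
  have := Hd _ yd; rewrite (addrC w) subrK => H.
  have y0' : 0 < nrm (y - w) by rewrite nrm_gt0 subr_eq0.
  rewrite -(ltr_pM2l y0') -nrmM mulrBr mulrCA divff ?subr_eq0 // mulr1.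
  apply: (le_lt_trans H); rewrite mulrC ltr_pM2l //; lra.
have cf : bcont (fun z => f z / (z - w)) x0 x1 y0 y1.
  move=> z zB; apply: cont_div; last exact: wB.
    exact: differentiable_continuous (df _ (onB_inR zB)).
  exact: dw.
have c1 : bcont (fun z => 1 / (z - w)) x0 x1 y0 y1.
  by move=> z zB; exact: (cont_div (@cont_cstn C C 1 z) (dw z) (wB z zB)).
have c2 : bcont (fun z => - f w * (1 / (z - w))) x0 x1 y0 y1.
  by move=> z zB; exact: (cvgM (@cont_cstn C C (- f w) z) (c1 z zB)).
apply/eqP; rewrite -subr_eq0 -mulNr -rectZ // -rectD // -g0; apply/eqP.
apply: eq_rect => // z zB; rewrite /g ifN; last by have := wB z zB; rewrite subr_eq0.
by rewrite mulrBl mul1r mulNr.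
Qed.

End Cauchy.

(** * Taylor coefficients and remainders as contour integrals *)

Section CauchyFunctional.
Context {R : realType}.
Local Notation C := R[i].
Variables (r : R) (r0 : 0 < r).

(** Its inverse is the kernel of the Taylor remainder of order [k] at 0; for [w = 0] it becomes
    [1 / z ^+ k.+1], the kernel of the coefficient. *)
Definition ckern (w : C) (k : nat) (z : C) : C := z ^+ k * (z - w).

(** [csq f 0 k] is a multiple of the k-th Taylor coefficient of [f]. *)
Definition csq (f : C -> C) (w : C) (k : nat) : C :=
  rect (fun z => f z / ckern w k z) (- r) r (- r) r.

Definition bdc (f : C -> C) := bcont f (- r) r (- r) r.

Let rr : - r <= r. Proof. by rewrite (le_trans (y := 0)) ?oppr_le0 ?ltW. Qed.

Lemma bd_norm z : onB (- r) r (- r) r z -> r <= nrm z <= 2 * r.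
Proof.
move: r0 => r0'; case: z => x y /andP[/andP[/= /andP[h1 h2] /andP[h3 h4]] H].
have hx := nrm_Re (x +i* y); have hy := nrm_Im (x +i* y).
have h := nrm_ReIm (x +i* y); rewrite /= in hx hy h.
have nx : `|x| <= r by rewrite ler_norml h1.
have ny : `|y| <= r by rewrite ler_norml h3.
apply/andP; split; last by lra.
have : (`|x| == r) || (`|y| == r).
  by case/or4P: H => /eqP ->; rewrite ?normrN (gtr0_norm r0) eqxx ?orbT.
by case/orP => /eqP E; lra.
Qed.

Lemma inR_norm z : inR (- r) r (- r) r z -> nrm z <= 2 * r.
Proof.
case: z => x y /andP[/= /andP[h1 h2] /andP[h3 h4]].
have h := nrm_ReIm (x +i* y); rewrite /= in h.
have nx : `|x| <= r by rewrite ler_norml h1.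
have ny : `|y| <= r by rewrite ler_norml h3.
by lra.
Qed.

Lemma ball_inner w : nrm w <= r / 2 ->
  (- r < complex.Re w < r) /\ (- r < complex.Im w < r).
Proof.
move=> h; have := nrm_Re w; have := nrm_Im w.
by move=> /ler_normlP[h1 h2] /ler_normlP[h3 h4]; move: r0 => r0'; split; apply/andP; split; lra.
Qed.

Lemma ckern_norm w k z : nrm w <= r / 2 -> onB (- r) r (- r) r z ->
  r ^+ k * (r / 2) <= nrm (ckern w k z).
Proof.
move=> wr /bd_norm /andP[h1 h2]; rewrite /ckern nrmM nrmX.
apply: ler_pM; rewrite ?exprn_ge0 ?divr_ge0 ?(ltW r0) //.
  by apply: lerXn2r; rewrite ?nnegrE ?(ltW r0) ?nrm_ge0.
have := nrm_tri w z 0; rewrite !subr0; lra.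
Qed.

Lemma ckern_neq0 w k z : nrm w <= r / 2 -> onB (- r) r (- r) r z -> ckern w k z != 0.
Proof.
move=> wr zB; rewrite -nrm_gt0; apply: lt_le_trans (ckern_norm k wr zB).
by rewrite mulr_gt0 ?exprn_gt0 ?divr_gt0.
Qed.

Lemma ckern_diff w k z : differentiable (ckern w k) z.
Proof.
apply: differentiableM.
  elim: k => [|k IH]; first exact: differentiable_cst.
  have -> : (fun z : C => z ^+ k.+1) = (fun z => z * z ^+ k).
    by apply/funext => y; rewrite exprS.
  by apply: differentiableM.
by apply: differentiableB => //; exact: differentiable_cst.
Qed.

Lemma bdc_ckern f w k : nrm w <= r / 2 -> bdc f ->
  bcont (fun z => f z / ckern w k z) (- r) r (- r) r.
Proof.
by move=> wr fc z zB; exact: (cont_div (fc z zB) (ckern_diff w k z) (ckern_neq0 k wr zB)).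
Qed.

Lemma nrm0_le : nrm (0 : C) <= r / 2. Proof. by rewrite nrm0 divr_ge0 ?ltW. Qed.
Hint Resolve nrm0_le : core.

(** One step of the geometric expansion: [1 / (z^k (z - w)) = 1 / z^(k+1) + w / (z^(k+1) (z -
    w))]. *)
Lemma csq_rec f w k : nrm w <= r / 2 -> bdc f ->
  csq f w k = csq f 0 k + w * csq f w k.+1.
Proof.
move=> wr fc; rewrite /csq.
have c1 := @bdc_ckern _ _ k nrm0_le fc; have c2 := @bdc_ckern _ _ k.+1 wr fc.
have c3 : bdc (fun z => w * (f z / ckern w k.+1 z)).
  by move=> z zB; exact: (cvgM (@cont_cstn R C C w z) (c2 z zB)).
rewrite -(rectZ _ rr rr c2) -(rectD rr rr c1 c3).
apply: (eq_rect rr rr) => z zB.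
have n1 := ckern_neq0 k wr zB; have n2 := ckern_neq0 1 nrm0_le zB.
move: n1 n2; rewrite /ckern subr0 !mulf_eq0 !negb_or subr_eq0 expr1 => /andP[h1 h2] /andP[h3 _].
by rewrite exprS; field; rewrite h1 h3 subr_eq0 h2.
Qed.

(** The kernel is at least [r ^+ k * (r / 2)] on the boundary and the half-perimeter is [4 r]; with
    the 4 of [rect_bound] this makes 32. *)
Lemma csq_bound f w k M : nrm w <= r / 2 -> bdc f ->
  (forall z, onB (- r) r (- r) r z -> nrm (f z) <= M) ->
  nrm (csq f w k) <= (32 / r ^+ k) * M.
Proof.
move=> wr fc HM; have c1 := @bdc_ckern _ _ k wr fc.
have rk : 0 < r ^+ k by rewrite exprn_gt0.
have := @rect_bound _ _ _ _ _ _ (M / (r ^+ k * (r / 2))) rr rr c1.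
have -> : 4 * (M / (r ^+ k * (r / 2))) * (r - - r + (r - - r)) = 32 / r ^+ k * M.
  by field; rewrite !gt_eqF.
apply=> z zB; rewrite nrmM nrmV.
apply: ler_pM; rewrite ?invr_ge0 ?nrm_ge0 ?HM //.
have h := ckern_norm k wr zB.
by rewrite lef_pV2 ?posrE //; [apply: lt_le_trans h|]; rewrite mulr_gt0 ?divr_gt0.
Qed.

Definition holb (f : C -> C) := forall z, nrm z <= 2 * r -> differentiable f z.

Lemma holb_bdc f : holb f -> bdc f.
Proof.
by move=> fh z /onB_inR /inR_norm /fh /differentiable_continuous.
Qed.

Lemma csq_cauchy f w : nrm w <= r / 2 -> holb f -> csq f w 0 = f w * csq (fun=> 1) w 0.
Proof.
move=> wr fh; have [w1 w2] := ball_inner wr.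
have := cauchy_rect w1 w2 (fun z zR => fh z (inR_norm zR)).
have E g : csq g w 0 = rect (fun z => g z / (z - w)) (- r) r (- r) r.
  by apply: (eq_rect rr rr) => z _; rewrite /ckern expr0 mul1r.
by rewrite !E.
Qed.

Lemma bdc1 : bdc (fun=> 1).
Proof. move=> z _; exact: (@cont_cstn R C C 1 z). Qed.

(** [1 / z^2] has the primitive [- 1 / z] along the contour. Hence the expansion of the constant
    function has no linear term. *)
Lemma csq11 : csq (fun=> 1) 0 1 = 0.
Proof.
apply: (rect_prim (F := fun z => - z^-1)) => //.
  exact: (@bdc_ckern _ _ 1 nrm0_le bdc1).
move=> z zB; have := ckern_neq0 1 nrm0_le zB.
rewrite /ckern subr0 expr1 mulf_eq0 orbb => z0.
have nz : 0 < nrm z by rewrite nrm_gt0.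
apply: (@hasd_quad _ _ _ _ _ _ (nrm (1 / (z * z))) (2 / nrm z ^+ 3) (nrm z / 2)).
- by rewrite divr_gt0.
- by move=> a u v; rewrite mulrDl -mulrA.
- by move=> h; rewrite nrmM mulrC.
move=> h hz.
have zh : nrm z / 2 <= nrm (z + h).
  have := nrm_tri (z + h) z 0; rewrite !subr0 opprD addrA subrr add0r nrmN; lra.
have zh0 : z + h != 0 by rewrite -nrm_gt0; lra.
have -> : - (z + h)^-1 - - z^-1 - h * (1 / (z * z)) = - (h ^+ 2 * (z ^+ 2)^-1 * (z + h)^-1).
  by field; rewrite z0 zh0.
rewrite nrmN !nrmM !nrmV !nrmX mulrC.
have -> : 2 / nrm z ^+ 3 * nrm h ^+ 2 = (nrm z / 2)^-1 * (nrm h ^+ 2 * (nrm z ^+ 2)^-1).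
  by field; rewrite gt_eqF.
apply: ler_wpM2r; first by rewrite !mulr_ge0 ?invr_ge0 ?exprn_ge0 ?nrm_ge0.
by rewrite lef_pV2 ?posrE // ?divr_gt0 //; lra.
Qed.

(** The value is [2 pi i], but only its being nonzero matters: all four sides contribute the same
    integral of [r / (t^2 + r^2)] to the imaginary part, and it is at least 1. *)
Lemma csq10 : csq (fun=> 1) 0 0 != 0.
Proof.
pose g (t : R) := r / (t ^+ 2 + r ^+ 2).
have den t : 0 < t ^+ 2 + r ^+ 2 by rewrite ltr_wpDl ?sqr_ge0 ?exprn_gt0.
have bc := @bdc_ckern _ _ 0 nrm0_le bdc1.
set F := (fun z : C => 1 / ckern 0 0 z).
have FE x y : F (x +i* y) = (x / (x ^+ 2 + y ^+ 2)) -i* (y / (x ^+ 2 + y ^+ 2)).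
  by rewrite /F /ckern expr0 subr0 !mul1r.
have gc : forall x, - r <= x <= r -> {for x, continuous g}.
  move=> x xr; have := cont_Im (bcont_b rr rr bc xr).
  suff -> : (fun x => complex.Im (F (x +i* - r))) = g by [].
  by apply/funext => t; rewrite FE /= sqrrN -mulNr opprK.
have gi : 1 <= rint (- r) r g.
  have cc x : - r <= x <= r -> {for x, continuous (fun _ : R => 1 / (2 * r) : R)}.
    by move=> _; exact: cvg_cst.
  have -> : 1 = rint (- r) r (fun=> 1 / (2 * r)).
    by rewrite rint_cst //; field; rewrite gt_eqF.
  apply: le_rint => // x /andP[h1 h2]; rewrite /g.
  rewrite ler_pdivlMr // mulrAC mul1r ler_pdivrMr ?mulr_gt0 //.
  have := sqr_ge0 x; have : x ^+ 2 <= r ^+ 2.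
    by rewrite -subr_ge0 subr_sqr mulr_ge0 //; lra.
  by rewrite mulrCA -expr2; lra.
suff E : complex.Im (csq (fun=> 1) 0 0) = 4 * rint (- r) r g.
  apply/eqP => H; move: E; rewrite H /= => E; lra.
have Ei (c : C) : complex.Im ('i * c) = complex.Re c.
  by case: c => a b /=; rewrite mul0r mul1r add0r.
have -> : csq (fun=> 1) 0 0 = rect F (- r) r (- r) r by [].
have Im4 (a b c d : C) : complex.Im (a + b - c - d) =
    complex.Im a + complex.Im b - complex.Im c - complex.Im d.
  by case: a => ? ?; case: b => ? ?; case: c => ? ?; case: d.
have Imc a b h : complex.Im (cint a b h) = rint a b (fun x => complex.Im (h x)) by [].
have Rec a b h : complex.Re (cint a b h) = rint a b (fun x => complex.Re (h x)) by [].
rewrite /rect Im4 !Ei !Imc !Rec.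
have Eneg : - rint (- r) r g = rint (- r) r (fun t => -1 * g t).
  by rewrite (rintZ _ gc) mulN1r.
have -> : rint (- r) r (fun x => complex.Im (F (x +i* - r))) = rint (- r) r g.
  by congr rint; apply/funext => t; rewrite FE /= sqrrN -mulNr opprK.
have -> : rint (- r) r (fun y => complex.Re (F (r +i* y))) = rint (- r) r g.
  by congr rint; apply/funext => t; rewrite FE /= addrC.
have -> : rint (- r) r (fun x => complex.Im (F (x +i* r))) = - rint (- r) r g.
  rewrite Eneg; congr rint; apply/funext => t.
  by rewrite FE /= mulN1r /g.
have -> : rint (- r) r (fun y => complex.Re (F (- r +i* y))) = - rint (- r) r g.
  rewrite Eneg; congr rint; apply/funext => t.
  by rewrite FE /= mulN1r /g sqrrN addrC mulNr.
ring.
Qed.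

(** Cauchy's integral for [f'(0)]. On a fixed contour it is linear and bounded by the supremum on
    the boundary, and it makes sense for integrands that are merely continuous there. *)
Definition cder0 (f : C -> C) : C := csq f 0 1 / csq (fun=> 1) 0 0.

Lemma cder0D f g : bdc f -> bdc g -> cder0 (fun z => f z + g z) = cder0 f + cder0 g.
Proof.
move=> fc gc; rewrite /cder0 /csq -mulrDl.
rewrite -(rectD rr rr (@bdc_ckern _ _ 1 nrm0_le fc) (@bdc_ckern _ _ 1 nrm0_le gc)).
by congr (_ / _); apply: (eq_rect rr rr) => z _; rewrite mulrDl.
Qed.

Lemma cder0Z k f : bdc f -> cder0 (fun z => k * f z) = k * cder0 f.
Proof.
move=> fc; rewrite /cder0 /csq mulrA -(rectZ _ rr rr (@bdc_ckern _ _ 1 nrm0_le fc)).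
by congr (_ / _); apply: (eq_rect rr rr) => z _; rewrite mulrA.
Qed.

Definition cconst : R := 32 / r / nrm (csq (fun=> 1) 0 0).

Lemma cconst_ge0 : 0 <= cconst.
Proof. by rewrite /cconst !divr_ge0 ?nrm_ge0 ?(ltW r0). Qed.

Lemma cder0_bound f M : bdc f -> (forall z, onB (- r) r (- r) r z -> nrm (f z) <= M) ->
  nrm (cder0 f) <= cconst * M.
Proof.
move=> fc HM; rewrite /cder0 /cconst nrmM nrmV.
rewrite [leRHS]mulrAC; apply: ler_wpM2r; first by rewrite invr_ge0 nrm_ge0.
by have := csq_bound 1 nrm0_le fc HM; rewrite expr1.
Qed.

Definition cconst2 : R := 64 / r ^+ 2 / nrm (csq (fun=> 1) 0 0).

Lemma cconst2_ge0 : 0 <= cconst2.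
Proof. by rewrite /cconst2 !divr_ge0 ?exprn_ge0 ?nrm_ge0 ?(ltW r0). Qed.

(** [csq 1 w 0] is not known to be independent of [w], so both [f] and 1 are expanded to second
    order. Since [csq 1 0 1 = 0], only [w ^+ 2] times two remainders survives; each contributes 32
    to the constant 64. *)
Lemma cder0_quad_aux f M w : holb f -> nrm w <= r / 2 ->
  (forall z, onB (- r) r (- r) r z -> nrm (f z) <= M) -> nrm (f w) <= M ->
  nrm (f w - f 0 - w * cder0 f) <= cconst2 * M * nrm w ^+ 2.
Proof.
move=> fh wr HB fwM; have fc := holb_bdc fh.
set c0 := csq (fun=> 1) 0 0.
have c00 : 0 < nrm c0 by rewrite nrm_gt0 csq10.
have E : c0 * (f w - f 0 - w * cder0 f) = w ^+ 2 * (csq f w 2 - f w * csq (fun=> 1) w 2).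
  have e1 := csq_cauchy wr fh; have e2 := csq_cauchy nrm0_le fh.
  have e3 := csq_rec 0 wr fc; have e4 := csq_rec 1 wr fc.
  have e5 := csq_rec 0 wr bdc1; have e6 := csq_rec 1 wr bdc1.
  rewrite csq11 add0r in e6; rewrite e6 in e5; rewrite e4 in e3; rewrite -/c0 in e2 e5.
  have -> : c0 * (f w - f 0 - w * cder0 f) = f w * c0 - f 0 * c0 - w * csq f 0 1.
    by rewrite /cder0 -/c0; field; rewrite csq10.
  rewrite e5 e3 e2 in e1.
  have {}e1 : f w * c0 = f 0 * c0 + w * (csq f 0 1 + w * csq f w 2) - f w * (w * (w * csq (fun=> 1) w 2)).
    by rewrite e1; ring.
  by rewrite e1; ring.
have H1 z : onB (- r) r (- r) r z -> nrm (1 : C) <= 1 by rewrite nrm1.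
have b1 := csq_bound 2 wr fc HB; have b2 := csq_bound 2 wr bdc1 H1.
rewrite /cconst2 -/c0 -(ler_pM2l c00) -nrmM E nrmM nrmX.
have -> : nrm c0 * (64 / r ^+ 2 / nrm c0 * M * nrm w ^+ 2) =
    nrm w ^+ 2 * (32 / r ^+ 2 * M + M * (32 / r ^+ 2 * 1)).
  by field; rewrite !gt_eqF.
apply: ler_wpM2l; first by rewrite exprn_ge0 ?nrm_ge0.
apply: (le_trans (nrmB _ _)); apply: lerD => //.
by rewrite nrmM; apply: ler_pM; rewrite ?nrm_ge0.
Qed.

Lemma cder0_quad f M : holb f -> (forall z, nrm z <= 2 * r -> nrm (f z) <= M) ->
  forall w, nrm w <= r / 2 ->
    nrm (f w - f 0 - w * cder0 f) <= cconst2 * M * nrm w ^+ 2.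
Proof.
move=> fh HM w wr; apply: cder0_quad_aux => //; last by apply: HM; move: r0; lra.
by move=> z /bd_norm /andP[_]; exact: HM.
Qed.

Lemma cder0_hasd f : holb f -> hasd f 0 (fun h => h * cder0 f).
Proof.
move=> fh; have fc := holb_bdc fh.
have [M HM] := bcont_bounded rr rr fc.
have f0c : differentiable f 0 by apply: fh; rewrite nrm0 mulr_ge0 ?ltW.
have /cont_nrmP /(_ 1 ltr01) [d d0 Hd] := differentiable_continuous f0c.
(* [M] bounds [f] on the boundary only; the second entry bounds it near 0. *)
pose N := Num.max M (nrm (f 0) + 1).
apply: (@hasd_quad _ _ _ _ _ _ (nrm (cder0 f)) (cconst2 * N) (Num.min d (r / 2))).
- by rewrite lt_min d0 divr_gt0.
- by move=> a u v; rewrite mulrDl -mulrA.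
- by move=> h; rewrite nrmM mulrC.
move=> w; rewrite lt_min add0r => /andP[wd /ltW wr].
apply: cder0_quad_aux => // [z zB|]; rewrite /N le_max.
  by rewrite HM.
have := Hd w; rewrite subr0 => /(_ wd); have := ler_dist_nrm (f w) (f 0).
by move=> /ler_normlP [_ h1] h2; apply/orP; right; lra.
Qed.

(** Accumulating zeros kill every Taylor coefficient; then [f w * csq 1 w 0] equals the remainder of
    any order [N], which is of size [2 ^- N]. *)
Lemma zero_of_limit_zeros f : holb f ->
  (forall e : R, 0 < e -> exists2 w, w != 0 & nrm w < e /\ f w = 0) ->
  exists2 e : R, 0 < e & forall w, nrm w < e -> f w = 0.
Proof.
move=> fh acc; have fc := holb_bdc fh.
have [M HM] := bcont_bounded rr rr fc.
have M0 : 0 <= M.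
  apply: (le_trans (nrm_ge0 (f r%:C))); apply: HM.
  by rewrite /onB /inR /= lexx rr oppr_le0 (ltW r0) eqxx orbT.
set c0 := csq (fun=> 1) 0 0; have c00 : 0 < nrm c0 by rewrite nrm_gt0 csq10.
have expand N : (forall k, (k < N)%N -> csq f 0 k = 0) -> forall w, nrm w <= r / 2 ->
    f w * csq (fun=> 1) w 0 = w ^+ N * csq f w N.
  elim: N => [|N IH] HN w wr; first by rewrite expr0 mul1r (csq_cauchy wr fh).
  rewrite IH //; last by move=> k kN; apply: HN; exact: ltn_trans kN _.
  by rewrite csq_rec // HN // add0r exprSr mulrA.
(* Once the lower coefficients vanish, a zero [w] of [f] gives [csq f 0 k = - w * csq f w k.+1],
   which is small with [w]. *)
have P0 k : csq f 0 k = 0.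
  elim/ltn_ind: k => k IH; apply/eqP; rewrite -nrm_eq0; apply/eqP.
  apply/le_anti; rewrite nrm_ge0 andbT; apply/ler_addgt0Pr => e e0; rewrite add0r.
  pose B := 32 / r ^+ k.+1 * M + 1.
  have B0 : 0 < B by rewrite /B ltr_wpDl // mulr_ge0 // divr_ge0 // exprn_ge0 // ltW.
  have [|w w0 [we fw]] := acc (Num.min (r / 2) (e / B)).
    by rewrite lt_min !divr_gt0.
  move: we; rewrite lt_min => /andP[/ltW wr we].
  have := expand k IH w wr; rewrite fw mul0r csq_rec // => /esym/eqP.
  rewrite mulf_eq0 expf_eq0 (negbTE w0) andbF /= addr_eq0 => /eqP ->.
  rewrite nrmN nrmM; rewrite ltr_pdivlMr // in we; apply: le_trans (ltW we).
  apply: ler_wpM2l; first exact: nrm_ge0.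
  by apply: (le_trans (csq_bound k.+1 wr fc HM)); rewrite /B lerDl ler01.
(* [csq 1 w 0] stays away from 0 for small w. *)
pose B1 := 32 / r ^+ 2 * 1 : R.
have B10 : 0 < B1 by rewrite /B1 mulr1 divr_gt0 // exprn_gt0.
exists (Num.min (Num.min (r / 2) 1) (nrm c0 / B1)).
  by rewrite !lt_min !divr_gt0 ?ltr01.
move=> w; rewrite !lt_min => /andP[/andP[/ltW wr w1] wc].
have H1 z : onB (- r) r (- r) r z -> nrm (1 : C) <= 1 by rewrite nrm1.
have cw : csq (fun=> 1) w 0 != 0.
  have := csq_rec 0 wr bdc1; rewrite (csq_rec 1 wr bdc1) csq11 add0r -/c0 => E.
  apply/eqP => H; move: E; rewrite H => /esym/eqP; rewrite addr_eq0 => /eqP c0E.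
  have := csq_bound 2 wr bdc1 H1; rewrite -/B1 => b2.
  rewrite ltr_pdivlMr // in wc.
  suff : nrm c0 <= nrm w * B1 by rewrite leNgt wc.
  rewrite c0E nrmN !nrmM; apply: ler_wpM2l; first exact: nrm_ge0.
  by apply: le_trans b2; apply: ler_piMl; rewrite ?nrm_ge0 ?ltW.
apply/eqP; rewrite -(inj_eq (mulIf cw)) mul0r -nrm_eq0; apply/eqP.
apply/le_anti; rewrite nrm_ge0 andbT; apply/ler_addgt0Pr => e e0; rewrite add0r.
have [N HN] : exists N : nat, 32 * M / e < 2 ^+ N.
  exists (Num.bound (32 * M / e)); apply: lt_le_trans (archi_boundP _) _.
    by rewrite divr_ge0 ?mulr_ge0 // ltW.
  by rewrite -natrX ler_nat ltnW // ltn_expl.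
rewrite (expand N (fun k _ => P0 k) w wr) nrmM nrmX.
rewrite ltr_pdivrMr // in HN.
have p2 : 0 < (2 : R) ^+ N by rewrite exprn_gt0.
have rN : 0 < r ^+ N by rewrite exprn_gt0.
apply: (le_trans (ler_wpM2l _ (csq_bound N wr fc HM))); first by rewrite exprn_ge0 ?nrm_ge0.
have : nrm w ^+ N <= (r / 2) ^+ N.
  by apply: lerXn2r; rewrite ?nnegrE ?nrm_ge0 // divr_ge0 // ltW.
rewrite expr_div_n => h; apply: (le_trans (ler_wpM2r _ h)).
  by rewrite mulr_ge0 // divr_ge0 // ltW.
have -> : r ^+ N / 2 ^+ N * (32 / r ^+ N * M) = 32 * M / 2 ^+ N.
  by field; rewrite !gt_eqF.
by rewrite ler_pdivrMr // (mulrC e) ltW.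
Qed.


End CauchyFunctional.

(** * Holomorphic functions of several variables *)

Section SeveralVariables.
Context {R : realType}.
Local Notation C := R[i].

(** Connectedness of [[0, 1]] in induction form; it drives the identity theorem and every transport
    along a path. *)
Lemma clopen01 (P : R -> Prop) :
  (forall t, 0 <= t <= 1 -> P t -> exists2 d : R, 0 < d &
    forall s, 0 <= s <= 1 -> `|s - t| < d -> P s) ->
  (forall t, 0 <= t <= 1 -> (forall d : R, 0 < d -> exists2 s, 0 <= s <= 1 & `|s - t| < d /\ P s) -> P t) ->
  P 0 -> forall t, 0 <= t <= 1 -> P t.
Proof.
move=> op cl P0.
pose S := [set t : R | 0 <= t <= 1 /\ forall s, 0 <= s <= t -> P s].
have S0 : S 0.
  split; first by rewrite lexx ler01.
  by move=> s /andP[s0 s0']; have -> : s = 0 by apply/le_anti/andP.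
have ubS : ubound S 1 by move=> t [/andP[]].
have hS : has_sup S by split; [exists 0|exists 1].
set c := sup S.
have c0 : 0 <= c by apply: ub_le_sup => //; exists 1.
have c1 : c <= 1 by apply: ge_sup => //; exists 0.
have Pc' s : 0 <= s -> s < c -> P s.
  move=> s0 sc; have cs0 : 0 < c - s by rewrite subr_gt0.
  have [t [_ Ht] st] := sup_adherent cs0 hS.
  by apply: Ht; rewrite s0 /=; rewrite -/c in st; lra.
have Pc : P c.
  move: c0; rewrite le_eqVlt => /orP[/eqP <- //|c0].
  apply: cl => [|d d0]; first by rewrite ltW.
  have m0 : 0 < Num.min c d by rewrite lt_min c0.
  have [m1 m2] : Num.min c d <= c /\ Num.min c d <= d by rewrite !ge_min !lexx orbT.
  exists (c - Num.min c d / 2); first by apply/andP; split; lra.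
  split; last by apply: Pc'; lra.
  by rewrite addrAC subrr add0r normrN ger0_norm; lra.
have c1E : c = 1.
  apply/eqP; rewrite eq_le c1 /= leNgt; apply/negP => c1'.
  have [|d d0 Hd] := op c _ Pc; first by rewrite c0 ltW.
  have m0 : 0 < Num.min (1 - c) d by rewrite lt_min subr_gt0 c1'.
  have [m1 m2] : Num.min (1 - c) d <= 1 - c /\ Num.min (1 - c) d <= d by rewrite !ge_min !lexx orbT.
  suff : c + Num.min (1 - c) d / 2 <= c by lra.
  apply: ub_le_sup; first by exists 1.
  split; first by apply/andP; split; lra.
  move=> s /andP[s0 sc]; case: (ltP s c) => [/Pc'|cs]; first exact.
  apply: Hd; first by apply/andP; split; lra.
  by rewrite ger0_norm; lra.
move=> t /andP[t0]; rewrite le_eqVlt => /orP[/eqP ->|t1]; first by rewrite -c1E.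
by apply: Pc' => //; rewrite c1E.
Qed.

Lemma ltr_pMaux (r x : R) : 0 < r -> 0 <= x -> 2 * r * x < 2 * r * (2 * (x + 1)).
Proof. by move=> r0 x0; have : 0 <= r * x; [rewrite mulr_ge0 // ltW|nra]. Qed.

Context {V : normedModType C}.
Implicit Types (f : V -> C) (a z h u w : V).

Definition bl a (p : R) z := nrm (z - a) < p.

Definition hol f a (p : R) := forall z, bl a p z -> differentiable f z.

Lemma bl_center a p : 0 < p -> bl a p a.
Proof. by rewrite /bl subrr nrm0. Qed.

Lemma diff_line f a u (t : C) : differentiable f (a + t *: u) ->
  differentiable (fun s : C => f (a + s *: u)) t.
Proof. by move=> /diff_hasD /hasd_line /hasd_diff []. Qed.

Lemma holb_line f a u p r : hol f a p -> 0 <= r -> 2 * r * nrm u < p ->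
  holb r (fun s : C => f (a + s *: u)).
Proof.
move=> fh r0 rp t tr; apply: diff_line; apply: fh; rewrite /bl addrAC subrr add0r nrmZ.
by apply: le_lt_trans rp; rewrite ler_wpM2r.
Qed.

(** Restriction to the complex line [a + s *: u] makes a directional derivative a one-variable
    contour integral. *)
Lemma derive_cder0 f a u p r : hol f a p -> 0 < r -> 2 * r * nrm u < p ->
  'D_u f a = cder0 r (fun s : C => f (a + s *: u)).
Proof.
move=> fh r0 rp; have fl := holb_line fh (ltW r0) rp.
have /hasd_derive := cder0_hasd r0 fl => /(_ 1); rewrite mul1r => <-.
have p0 : 0 < p by apply: le_lt_trans rp; rewrite !mulr_ge0 // ltW.
have da : differentiable f (a + 0 *: u) by rewrite scale0r addr0; apply: fh; exact: bl_center.
by have /hasd_derive := hasd_line (diff_hasD da) => /(_ 1) ->; rewrite scale1r scale0r addr0.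
Qed.

Lemma hol_shift f a p b q : hol f a p -> nrm (b - a) + q <= p -> hol f b q.
Proof.
move=> fh h z zq; apply: fh; rewrite /bl in zq *.
by apply: lt_le_trans h; apply: (le_lt_trans (nrm_tri b _ _)); rewrite addrC ltrD2l.
Qed.

Lemma hol_bounded f a p : 0 < p -> hol f a p -> exists2 q : R, 0 < q <= p & exists2 M : R, 0 <= M &
  forall z, bl a q z -> nrm (f z) <= M.
Proof.
move=> p0 fh; have fa : differentiable f a by apply: fh; exact: bl_center.
have /cont_nrmP /(_ 1 ltr01) [d d0 Hd] := differentiable_continuous fa.
exists (Num.min d p); first by rewrite lt_min d0 p0 ge_min lexx orbT.
exists (nrm (f a) + 1); first by rewrite addr_ge0.
move=> z; rewrite /bl lt_min => /andP[/Hd h _].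
by have /ler_normlP [_ h1] := ler_dist_nrm (f z) (f a); lra.
Qed.

(** Cauchy's estimates along all complex lines at once: the constants depend neither on the point of
    the half ball nor on the direction, because [h] is first normalised. *)
Lemma derive_bound f a p M : 0 < p -> hol f a p -> 0 <= M -> (forall z, bl a p z -> nrm (f z) <= M) ->
  exists2 K : R, 0 <= K & exists2 q : R, 0 < q & forall z h, bl a (p / 2) z ->
    nrm ('D_h f z) <= K * nrm h /\
    (nrm h <= q -> nrm (f (z + h) - f z - 'D_h f z) <= K * nrm h ^+ 2).
Proof.
(* Contours in unit directions then stay within [2 * r = p / 4] of a point of the half ball, hence
   inside the ball of radius [p]. *)
move=> p0 fh M0 HM; pose r := p / 8; have r0 : 0 < r by rewrite divr_gt0.
exists (cconst r * M + cconst2 r * M).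
  by rewrite addr_ge0 // mulr_ge0 ?cconst_ge0 ?cconst2_ge0.
have k1 : 0 <= cconst r * M by rewrite mulr_ge0 ?cconst_ge0.
have k2 : 0 <= cconst2 r * M by rewrite mulr_ge0 ?cconst2_ge0.
exists (r / 2); first by rewrite divr_gt0.
move=> z h zp; have fz : hol f z (p / 2).
  apply: (hol_shift fh); rewrite /bl in zp; lra.
have [->|h0] := eqVneq h 0.
  by rewrite derive0 addr0 subrr subr0 !nrm0 expr2 !mulr0; split.
have nh : 0 < nrm h by rewrite nrm_gt0.
pose u := (nrm h)^-1%:C *: h.
have nu : nrm u = 1 by rewrite nrmZ nrm_real ger0_norm ?invr_ge0 // mulVf // gt_eqF.
have hu : h = (nrm h)%:C *: u.
  by rewrite scalerA -rmorphM /= divff ?gt_eqF // scale1r.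
have ru : 2 * r * nrm u < p / 2 by rewrite nu /r; lra.
have Du := derive_cder0 fz r0 ru.
have dz : differentiable f z by apply: fz; rewrite bl_center // divr_gt0.
have Dh : 'D_h f z = (nrm h)%:C * 'D_u f z.
  by rewrite {1}hu (linZ _ _ (deriveP_lin dz)).
have HM' (s : C) : nrm s <= 2 * r -> nrm (f (z + s *: u)) <= M.
  move=> sr; apply: HM; rewrite /bl; apply: (le_lt_trans (nrm_tri z _ _)).
  rewrite addrAC subrr add0r nrmZ nu mulr1; rewrite /bl in zp; rewrite /r in sr; lra.
have fl := holb_line fz (ltW r0) ru.
split.
  have := cder0_bound r0 (holb_bdc fl) (fun s sB => HM' s (proj2 (andP (bd_norm r0 sB)))).
  rewrite -Du => b; rewrite Dh nrmM nrm_real (ger0_norm (nrm_ge0 h)) mulrC ler_wpM2r //.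
  by rewrite (le_trans b) // lerDl.
move=> hr; have := @cder0_quad _ _ r0 _ _ fl HM' (nrm h)%:C.
rewrite nrm_real (ger0_norm (nrm_ge0 h)) -Du scale0r addr0 -hu -Dh => /(_ hr) b.
by apply: (le_trans b); rewrite ler_wpM2r ?exprn_ge0 // lerDr.
Qed.

(** Both values are integrals over the same contour, and [f (z + s *: u) - f (a + s *: u)] is of
    order [z - a] uniformly in [s] by [derive_bound]. *)
Lemma derive_cont f a p u : 0 < p -> hol f a p -> {for a, continuous (fun z => 'D_u f z)}.
Proof.
move=> p0 fh; have [q /andP[q0 qp] [M M0 HM]] := hol_bounded p0 fh.
have fq : hol f a q by move=> z zq; apply: fh; exact: lt_le_trans zq qp.
have [K K0 [d d0 H]] := derive_bound q0 fq M0 HM.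
have u1 : 0 < nrm u + 1 by rewrite ltr_wpDl.
pose r := q / (16 * (nrm u + 1)); have r0 : 0 < r by rewrite divr_gt0 // mulr_gt0.
have ru : 2 * r * nrm u < q / 4.
  have -> : q / 4 = 2 * r * (2 * (nrm u + 1)) by rewrite /r; field; rewrite gt_eqF.
  by apply: ltr_pMaux.
apply/cont_nrmP => e e0.
pose B := cconst r * (K + K) + 1.
have B0 : 0 < B by rewrite ltr_wpDl // mulr_ge0 ?addr_ge0 // cconst_ge0.
exists (Num.min (Num.min (q / 4) 1) (Num.min d (e / B))).
  by rewrite !lt_min !divr_gt0 // d0 ltr01.
move=> z; rewrite !lt_min => /andP[/andP[zq /ltW z1] /andP[/ltW zd ze]].
have fa : hol f a (q / 4) by apply: (hol_shift fq); rewrite subrr nrm0; lra.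
have fz : hol f z (q / 4) by apply: (hol_shift fq); lra.
rewrite (derive_cder0 fz r0 ru) (derive_cder0 fa r0 ru).
have bz := holb_bdc (holb_line fz (ltW r0) ru).
have ba := holb_bdc (holb_line fa (ltW r0) ru).
have bma : bdc r (fun s : C => -1 * f (a + s *: u)).
  by move=> s sB; exact: (cvgM (@cont_cstn R C C (-1) s) (ba s sB)).
rewrite -[X in _ - X]mul1r -mulNr -(cder0Z r0 _ ba) -(cder0D r0 bz bma).
have bD : bdc r (fun s : C => f (z + s *: u) + -1 * f (a + s *: u)).
  by move=> s sB; exact: (cvgD (bz s sB) (bma s sB)).
apply: (@le_lt_trans _ _ (cconst r * ((K + K) * nrm (z - a)))).
  apply: (cder0_bound r0 bD) => s /(bd_norm r0) /andP[_ sr].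
  have su : nrm (s *: u) < q / 4 by rewrite nrmZ; apply: le_lt_trans ru; rewrite ler_wpM2r.
  have := H (a + s *: u) (z - a); rewrite /bl (_ : a + s *: u - a = s *: u); last by rewrite addrAC subrr add0r.
  move=> /(_ _) []; first lra.
  move=> b1 /(_ zd) b2; have -> : f (z + s *: u) + -1 * f (a + s *: u) =
     (f (a + s *: u + (z - a)) - f (a + s *: u) - 'D_(z - a) f (a + s *: u)) + 'D_(z - a) f (a + s *: u).
    by rewrite subrK mulN1r (_ : a + s *: u + (z - a) = z + s *: u) // addrC addrA subrK.
  apply: (le_trans (nrmD _ _)); rewrite mulrDl lerD // (le_trans b2) //.
  by rewrite expr2 mulrA ler_piMr // mulr_ge0.
rewrite ltr_pdivlMr // in ze; apply: le_lt_trans ze; rewrite mulrA mulrC ler_wpM2l //.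
by rewrite /B lerDl.
Qed.

End SeveralVariables.

(** * Higher derivatives and the one-variable identity theorem *)

Section HigherDerivatives.
Context {R : realType}.
Local Notation C := R[i].
Lemma bdcB (r : R) (g g' : C -> C) : bdc r g -> bdc r g' -> bdc r (fun s => g s - g' s).
Proof. by move=> gc gc' s sB; exact: (cvgB (gc s sB) (gc' s sB)). Qed.

Lemma cder0B (r : R) (r0 : 0 < r) (g g' : C -> C) : bdc r g -> bdc r g' ->
  cder0 r (fun s => g s - g' s) = cder0 r g - cder0 r g'.
Proof.
move=> gc gc'; have nc : bdc r (fun s => -1 * g' s).
  by move=> s sB; exact: (cvgM (@cont_cstn R C C (-1) s) (gc' s sB)).
rewrite -[X in _ - X]mul1r -mulNr -(cder0Z r0 _ gc') -(cder0D r0 gc nc).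
by congr (cder0 r _); apply/funext => s; rewrite mulN1r.
Qed.

Context {V : normedModType C}.
Implicit Types (f : V -> C) (a z h u w : V).

(** Cauchy's formula allows one to differentiate ['D_u f] under the integral. *)
Lemma derive_hasd f a p u : 0 < p -> hol f a p ->
  exists2 r : R, 0 < r & 2 * r * nrm u < p /\
    hasd (fun z => 'D_u f z) a (fun h => cder0 r (fun s : C => 'D_h f (a + s *: u))).
Proof.
move=> p0 fh; have [q /andP[q0 qp] [M M0 HM]] := hol_bounded p0 fh.
have fq : hol f a q by move=> z zq; apply: fh; exact: lt_le_trans zq qp.
have [K K0 [d d0 H]] := derive_bound q0 fq M0 HM.
have u1 : 0 < nrm u + 1 by rewrite ltr_wpDl.
pose r := q / (16 * (nrm u + 1)); have r0 : 0 < r by rewrite divr_gt0 // mulr_gt0.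
have ru : 2 * r * nrm u < q / 4.
  have -> : q / 4 = 2 * r * (2 * (nrm u + 1)) by rewrite /r; field; rewrite gt_eqF.
  by apply: ltr_pMaux.
exists r => //; split; first lra.
have fa : hol f a (q / 4) by apply: (hol_shift fq); rewrite subrr nrm0; lra.
have ins (s : C) : nrm s <= 2 * r -> nrm (s *: u) < q / 4.
  by move=> sr; rewrite nrmZ; apply: le_lt_trans ru; rewrite ler_wpM2r.
have lc (h : V) : bdc r (fun s : C => 'D_h f (a + s *: u)).
  move=> s /(bd_norm r0) /andP[_ /ins sr].
  have fs : hol f (a + s *: u) (q / 4).
    by apply: (hol_shift fq); rewrite addrAC subrr add0r; lra.
  have q4 : 0 < q / 4 by rewrite divr_gt0.
  have /cont_nrmP dc := @derive_cont R V _ _ _ h q4 fs.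
  apply/cont_nrmP => e /dc [e1 e10 He1].
  exists (e1 / (nrm u + 1)); first by rewrite divr_gt0.
  move=> y; rewrite ltr_pdivlMr // => ye; apply: He1.
  rewrite opprD addrACA subrr add0r -scalerBl nrmZ; apply: le_lt_trans ye.
  by rewrite ler_wpM2l // lerDl.
have bK (h : V) s : onB (- r) r (- r) r s -> nrm ('D_h f (a + s *: u)) <= K * nrm h.
  move=> /(bd_norm r0) /andP[_ /ins sr].
  have [] // := H (a + s *: u) h.
  by rewrite /bl addrAC subrr add0r; lra.
have ds (h : V) s : onB (- r) r (- r) r s -> differentiable f (a + s *: u).
  move=> /(bd_norm r0) /andP[_ /ins sr]; apply: fq.
  by rewrite /bl addrAC subrr add0r; lra.
apply: (@hasd_quad _ _ _ _ _ _ (cconst r * K) (cconst r * K) (Num.min d (q / 4))).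
- by rewrite lt_min d0 divr_gt0.
- move=> c h h'.
  have c1 : bdc r (fun s : C => c * 'D_h f (a + s *: u)).
    by move=> s sB; exact: (cvgM (@cont_cstn R C C c s) (lc h s sB)).
  rewrite -[RHS]/(c * _ + _) -(cder0Z r0 c (lc h)) -(cder0D r0 c1 (lc h')).
  congr (_ / _); apply: eq_rect; [have := r0; lra..|] => s sB.
  by congr (_ / _); rewrite (deriveP_lin (ds h s sB)).
- by move=> h; rewrite -mulrA; apply: (cder0_bound r0 (lc h)); exact: bK.
move=> h; rewrite lt_min => /andP[/ltW hd hq].
have fah : hol f (a + h) (q / 4) by apply: (hol_shift fq); rewrite addrAC subrr add0r; lra.
rewrite (derive_cder0 fah r0 ru) (derive_cder0 fa r0 ru).
have b1 := holb_bdc (holb_line fah (ltW r0) ru).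
have b2 := holb_bdc (holb_line fa (ltW r0) ru).
rewrite -(cder0B r0 b1 b2) -(cder0B r0 (bdcB b1 b2) (lc h)) -mulrA.
apply: (cder0_bound r0 (bdcB (bdcB b1 b2) (lc h))) => s sB.
have [_ sr] := andP (bd_norm r0 sB); have /ins {}sr := sr.
have [|_ /(_ hd)] := H (a + s *: u) h; first by rewrite /bl addrAC subrr add0r; lra.
by rewrite (addrAC a).
Qed.

Lemma hol_derive f a p u : hol f a p -> hol (fun z => 'D_u f z) a p.
Proof.
move=> fh z zp; have q0 : 0 < p - nrm (z - a) by rewrite subr_gt0.
have fz : hol f z (p - nrm (z - a)) by apply: (hol_shift fh); rewrite addrC subrK.
by have [r _ [_ /hasd_diff []]] := derive_hasd u q0 fz.
Qed.

(** Both sides are the contour integral of ['D_w f] along the line of direction [u]: one by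
    differentiating under the integral, the other by Cauchy's formula for ['D_w f]. *)
Lemma derive_comm f a p u w : 0 < p -> hol f a p ->
  'D_w (fun z => 'D_u f z) a = 'D_u (fun z => 'D_w f z) a.
Proof.
move=> p0 fh; have [r r0 [rp Hd]] := derive_hasd u p0 fh.
have E1 := hasd_derive w Hd; have E2 := derive_cder0 (hol_derive w fh) r0 rp.
exact: (etrans E1 (esym E2)).
Qed.

(** Discs of fixed radius along the segment: vanishing near a point of it is an open condition, and
    closed because a limit of such points is a limit of zeros. *)
Lemma identity_disc (g : C -> C) (t0 t1 : C) (p : R) :
  (forall t : R, 0 <= t <= 1 -> hol g (t0 + t%:C * (t1 - t0)) p) -> 0 < p ->
  (forall e : R, 0 < e -> exists2 y : C, y != t0 & nrm (y - t0) < e /\ g y = 0) -> g t1 = 0.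
Proof.
move=> gh p0 acc.
pose c (t : R) : C := t0 + t%:C * (t1 - t0).
pose P t := exists2 e : R, 0 < e & forall y : C, nrm (y - c t) < e -> g y = 0.
have L (t : R) : 0 <= t <= 1 ->
   (forall e : R, 0 < e -> exists2 y : C, y != c t & nrm (y - c t) < e /\ g y = 0) -> P t.
  move=> t01 H; pose r := p / 4; have r0 : 0 < r by rewrite divr_gt0.
  have hb : holb r (fun s => g (c t + s)).
    move=> s sr; have gs : differentiable g (c t + s *: 1).
      apply: (gh t t01); rewrite /bl -/(c t) [X in nrm X](_ : _ = s).
        by rewrite /r in sr; lra.
      by rewrite [s *: 1]mulr1; apply: etrans (addrAC _ _ _) _; rewrite subrr add0r.
    by have := diff_line gs; congr (differentiable _ _); apply/funext => y; rewrite [y *: 1]mulr1.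
  have acc' (e : R) : 0 < e -> exists2 y : C, y != 0 & nrm y < e /\ g (c t + y) = 0.
    move=> /H [y y1 [y2 y3]]; exists (y - c t); first by rewrite subr_eq0.
    by split => //; rewrite addrC subrK.
  have [e e0 He] := zero_of_limit_zeros r0 hb acc'.
  by exists e => // y /He; rewrite addrC subrK.
have D t s : c t - c s = (t - s)%:C * (t1 - t0).
  by rewrite /c rmorphB /=; ring.
have nD t s : nrm (c t - c s) = `|t - s| * nrm (t1 - t0) by rewrite D nrmM nrm_real.
have n1 : 0 < nrm (t1 - t0) + 1 by rewrite ltr_wpDl.
have c1 : c 1 = t1 by rewrite /c rmorph1 mul1r addrC subrK.
suff : P 1 by case=> e e0; rewrite c1; apply; rewrite subrr nrm0.
apply: clopen01; last by rewrite lexx ler01.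
- move=> t t01 [e e0 He]; exists (e / 2 / (nrm (t1 - t0) + 1)); first by rewrite !divr_gt0.
  move=> s s01; rewrite ltr_pdivlMr // => hs; exists (e / 2); first by rewrite divr_gt0.
  move=> y ys; apply: He; have := nrm_tri (c s) y (c t); rewrite nD.
  have : `|s - t| * nrm (t1 - t0) <= `|s - t| * (nrm (t1 - t0) + 1) by rewrite ler_wpM2l // lerDl.
  by lra.
- move=> t t01 H; apply: L => // e e0.
  have [|s s01 [hs [d d0 Hd]]] := H (e / 2 / (nrm (t1 - t0) + 1)); first by rewrite !divr_gt0.
  rewrite ltr_pdivlMr // in hs.
  have ce : nrm (c s - c t) < e / 2.
    by rewrite nD; apply: le_lt_trans hs; rewrite ler_wpM2l // lerDl.
  pose m := Num.min (d / 2) (e / 2); have m0 : 0 < m by rewrite lt_min !divr_gt0.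
  have [md me] : m <= d / 2 /\ m <= e / 2 by rewrite /m !ge_min !lexx orbT.
  have dist (x : R) : 0 < x -> x <= m -> nrm (c s + x%:C - c t) < e /\ g (c s + x%:C) = 0.
    move=> x0 xm; split.
      apply: (le_lt_trans (nrm_tri (c s) _ _)); rewrite addrAC subrr add0r nrm_real gtr0_norm //; lra.
    by apply: Hd; rewrite addrAC subrr add0r nrm_real gtr0_norm //; lra.
  (* The zero exhibited has to differ from [c t]; if the first candidate happens to be [c t], half
     the displacement avoids it. *)
  have [E|E] := eqVneq (c s + m%:C) (c t); last first.
    by exists (c s + m%:C) => //; apply: dist.
  exists (c s + (m / 2)%:C); last by apply: dist; lra.
  by apply/eqP; rewrite -E => /addrI /complexI; lra.
- by apply: L => [|e e0]; rewrite ?lexx ?ler01 //; rewrite /c rmorph0 mul0r addr0; exact: acc.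
Qed.

End HigherDerivatives.

(* [lra] with the norms abstracted, so that it does not compare derivatives. *)
Ltac nlra := repeat match goal with
  | H : context [@nrm ?R ?V ?x] |- _ => let v := fresh "v" in set v := (@nrm R V x) in *; clearbody v
  | |- context [@nrm ?R ?V ?x] => let v := fresh "v" in set v := (@nrm R V x) in *; clearbody v
  end; lra.

Section Identity.
Context {R : realType}.
Local Notation C := R[i].

Lemma nrm_pair (V W : normedModType C) (p : V * W) :
  nrm p = Num.max (nrm p.1) (nrm p.2).
Proof.
apply: complexI; rewrite -nrmE prod_normE !nrmE /Num.max ltcR.
by case: (ltP (nrm p.1) (nrm p.2)).
Qed.

Lemma nrm_pair_lt (V W : normedModType C) (p : V * W) e :
  (nrm p < e) = (nrm p.1 < e) && (nrm p.2 < e).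
Proof. by rewrite nrm_pair gt_max. Qed.

Lemma nrm_mx_lt m n (A : 'M[C]_(m, n)) (e : R) : 0 < e ->
  nrm A < e <-> forall i j, nrm (A i j) < e.
Proof.
move=> e0; have E : @ball _ 'M[C]_(m, n) 0 e%:C A = (nrm A < e) :> Prop.
  by rewrite mx_norm_ball /ball_ /= sub0r normrN nrmE ltcR.
rewrite -E; split=> [[_ H] i j|H].
  by have := H i j; rewrite mxE -ball_normE /ball_ /= sub0r normrN nrmE ltcR.
split; first by rewrite ltcR.
by move=> i j; rewrite mxE -ball_normE /ball_ /= sub0r normrN nrmE ltcR.
Qed.

Lemma nrm_mx_le m n (A : 'M[C]_(m, n)) (e : R) : 0 <= e ->
  (forall i j, nrm (A i j) <= e) -> nrm A <= e.
Proof.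
move=> e0 H; apply/ler_addgt0Pr => d d0; apply/ltW/nrm_mx_lt; first lra.
by move=> i j; have := H i j; lra.
Qed.

Lemma nrm_mx_entry m n (A : 'M[C]_(m, n)) i j : nrm (A i j) <= nrm A.
Proof.
apply/ler_addgt0Pr => d d0; apply/ltW.
have A0 := nrm_ge0 A; have e0 : 0 < nrm A + d by lra.
by have /(nrm_mx_lt _ e0) : nrm A < nrm A + d by lra.
Qed.

Lemma nrm_cconj m n (A : 'M[C]_(m, n)) : nrm (cconj A) = nrm A.
Proof.
have H (B : 'M[C]_(m, n)) : nrm (cconj B) <= nrm B.
  apply: nrm_mx_le => // i j; rewrite mxE nrm_conj; exact: nrm_mx_entry.
apply/le_anti; rewrite H /= -{1}[A](_ : cconj (cconj A) = A); first exact: H.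
by apply/matrixP => i j; rewrite !mxE conjCK.
Qed.

Lemma cconjK m n : involutive (@cconj R m n).
Proof. by move=> A; apply/matrixP => i j; rewrite !mxE conjCK. Qed.

Lemma cconjD m n (A B : 'M[C]_(m, n)) : cconj (A + B) = cconj A + cconj B.
Proof. by apply/matrixP => i j; rewrite !mxE rmorphD. Qed.

Lemma cconjB m n (A B : 'M[C]_(m, n)) : cconj (A - B) = cconj A - cconj B.
Proof. by apply/matrixP => i j; rewrite !mxE rmorphB. Qed.

Lemma cconjZ m n (c : C) (A : 'M[C]_(m, n)) : cconj (c *: A) = conjc c *: cconj A.
Proof. by apply/matrixP => i j; rewrite !mxE; exact: (rmorphM (@conjc R)). Qed.

Lemma cconj0 m n : cconj (0 : 'M[C]_(m, n)) = 0.
Proof. by apply/matrixP => i j; rewrite !mxE rmorph0. Qed.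

Lemma hasd_entry (V : normedModType C) m n (G : V -> 'M[C]_(m, n)) x l i j :
  hasd G x l -> hasd (fun z => G z i j) x (fun h => l h i j).
Proof.
case=> ll [K lK] H; split.
- by move=> a u v; rewrite ll !mxE.
- by exists K => h; apply: le_trans (lK h); exact: nrm_mx_entry.
move=> e /H [d d0 Hd]; exists d => // h /Hd; apply: le_trans.
by apply: le_trans (nrm_mx_entry _ i j); rewrite !mxE.
Qed.

Lemma diff_entry (V : normedModType C) m n (G : V -> 'M[C]_(m, n)) x i j :
  differentiable G x -> differentiable (fun z => G z i j) x.
Proof. by move=> /diff_hasd /(hasd_entry i j) /hasd_diff []. Qed.

Lemma derive_entry (V : normedModType C) m n (G : V -> 'M[C]_(m, n)) x v i j :
  differentiable G x -> 'D_v G x i j = 'D_v (fun z => G z i j) x.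
Proof. by move=> /diff_hasD /(hasd_entry i j) /hasd_derive ->. Qed.

Lemma hasd_mx (V : normedModType C) m n (G : V -> 'M[C]_(m, n)) x
    (l : 'I_m -> 'I_n -> V -> C) :
  (forall i j, hasd (fun z => G z i j) x (l i j)) ->
  hasd G x (fun h => \matrix_(i, j) l i j h).
Proof.
move=> H; split.
- by move=> a u v; apply/matrixP => i j; rewrite !mxE; have [ll _ _] := H i j; rewrite ll.
- have HK (ij : 'I_m * 'I_n) : exists K, forall h, nrm (l ij.1 ij.2 h) <= K * nrm h.
    by have [_ [K ?] _] := H ij.1 ij.2; exists K.
  have [K hK] := choice HK; exists (\sum_ij `|K ij|) => h; apply: nrm_mx_le.
    by rewrite mulr_ge0 // sumr_ge0.
  move=> i j; rewrite mxE; apply: (le_trans (hK (i, j) h)); rewrite ler_wpM2r //.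
  rewrite (bigD1 (i, j)) //=; apply: (le_trans (ler_norm _)).
  by rewrite lerDl sumr_ge0.
move=> e e0.
have Hd (ij : 'I_m * 'I_n) : exists d : R, 0 < d /\ forall h, nrm h < d ->
    nrm (G (x + h) ij.1 ij.2 - G x ij.1 ij.2 - l ij.1 ij.2 h) <= e * nrm h.
  by have [_ _ /(_ e e0) [d d0 Hd]] := H ij.1 ij.2; exists d.
have [d hd] := choice Hd.
exists (\big[Num.min/1]_ij d ij).
  elim/big_ind: _ => [|a b a0 b0|ij _]; [exact: ltr01|by rewrite lt_min a0|by have [] := hd ij].
move=> h hm; apply: nrm_mx_le; first by rewrite mulr_ge0 // ltW.
move=> i j; rewrite !mxE; have [_ ] := hd (i, j); apply.
apply: lt_le_trans hm _; rewrite (bigD1 (i, j)) //= ge_min lexx //.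
Qed.

Lemma diff_mx (V : normedModType C) m n (G : V -> 'M[C]_(m, n)) x :
  (forall i j, differentiable (fun z => G z i j) x) -> differentiable G x.
Proof.
move=> H; have [] // := @hasd_diff _ _ _ G x _ (hasd_mx (fun i j => diff_hasD (H i j))).
Qed.

(** On the complex line from [b] to [z] the segment stays at distance at most [m < p] from [a] by
    convexity, which leaves room for discs of a fixed radius. *)
Lemma identity_ball (V : normedModType C) (f : V -> C) a p b q : hol f a p -> bl a p b -> 0 < q ->
  (forall z, bl b q z -> f z = 0) -> forall z, bl a p z -> f z = 0.
Proof.
move=> fh ab q0 f0 z az; rewrite /bl in ab az.
pose g (t : C) := f (b + t *: (z - b)).
have -> : f z = g 1 by rewrite /g scale1r addrC subrK.
have n1 : 0 < nrm (z - b) + 1 by rewrite ltr_wpDl.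
pose m := Num.max (nrm (b - a)) (nrm (z - a)).
have mp : m < p by rewrite gt_max ab.
have [bm zm] : nrm (b - a) <= m /\ nrm (z - a) <= m by rewrite !le_max !lexx orbT.
apply: (@identity_disc _ g 0 1 ((p - m) / (nrm (z - b) + 1))).
- move=> t /andP[t0 t1] s; rewrite add0r subr0 mulr1 /bl ltr_pdivlMr // => st.
  apply: diff_line; apply: fh; rewrite /bl.
  have -> : b + s *: (z - b) - a = (1 - t)%:C *: (b - a) + t%:C *: (z - a) + (s - t%:C) *: (z - b).
    rewrite rmorphB /= rmorph1; apply/eqP; rewrite -subr_eq0.
    have -> : z - b = (z - a) - (b - a) by rewrite opprB addrA subrK.
    have -> : b + s *: (z - a - (b - a)) - a = (b - a) + s *: (z - a - (b - a)) by rewrite addrAC.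
    move: (b - a) (z - a) => u v; rewrite !scalerBl !scalerBr scale1r.
    rewrite subr_eq0 -(addrA u) (addrC (- _) (_ *: v)); apply/eqP.
    by rewrite -(addrA u); congr (u + _); rewrite [RHS]addrC subrK.
  apply: (le_lt_trans (nrmD _ _)); rewrite nrmZ.
  have := nrmD ((1 - t)%:C *: (b - a)) (t%:C *: (z - a)).
  rewrite !nrmZ !nrm_real !ger0_norm ?subr_ge0 //.
  have : nrm (s - t%:C) * nrm (z - b) <= nrm (s - t%:C) * (nrm (z - b) + 1).
    by rewrite ler_wpM2l // lerDl.
  have : (1 - t) * nrm (b - a) <= (1 - t) * m by rewrite ler_wpM2l // subr_ge0.
  have : t * nrm (z - a) <= t * m by rewrite ler_wpM2l.
  rewrite mulrBl mul1r; lra.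
- by rewrite divr_gt0 // subr_gt0.
move=> e e0; pose x := Num.min (e / 2) (q / 2 / (nrm (z - b) + 1)).
have x0 : 0 < x by rewrite lt_min !divr_gt0.
have [x1 x2] : x <= e / 2 /\ x <= q / 2 / (nrm (z - b) + 1) by rewrite !ge_min !lexx orbT.
rewrite ler_pdivlMr // in x2.
exists x%:C; first by rewrite -nrm_gt0 nrm_real gtr0_norm.
rewrite subr0 nrm_real gtr0_norm //; split; first lra.
apply: f0; rewrite /bl addrAC subrr add0r nrmZ nrm_real gtr0_norm //.
have : x * nrm (z - b) <= x * (nrm (z - b) + 1) by rewrite ler_wpM2l ?(ltW x0) ?lerDl ?ler01.
by lra.
Qed.

End Identity.

(** * Uniqueness on the diagonal, and geometric convergence *)

Section TotallyReal.
Context {R : realType}.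
Local Notation C := R[i].

Lemma sub3 (W : zmodType) (x a b : W) : x + a + b - x = a + b.
Proof. by rewrite addrAC (addrC x) addrK. Qed.

Lemma lin_aux (a b c d q : R) : 0 < d -> a < d -> b < d -> c <= 1 * b -> 4 * d <= q ->
  a + c < q.
Proof. lra. Qed.

(** [{(z, conj z)}] is maximal totally real: a point of the ambient space lies on
    a complex line [t |-> c + t d] through it whose real points are in it. *)
Lemma totally_real n (K : 'rV[C]_n * 'rV[C]_n -> C) (z0 : 'rV[C]_n) p q :
  hol K (z0, cconj z0) p -> 0 < p -> 0 < q ->
  (forall z, nrm (z - z0) < q -> K (z, cconj z) = 0) ->
  forall P, bl (z0, cconj z0) p P -> K P = 0.
Proof.
move=> Kh p0 q0 K0.
pose m := Num.min p q / 4; have m0 : 0 < m by rewrite divr_gt0 // lt_min p0.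
have [mp mq] : 4 * m <= p /\ 4 * m <= q.
  have E : 4 * m = Num.min p q by rewrite /m; field.
  by rewrite E !ge_min !lexx orbT.
apply: (identity_ball Kh (bl_center _ p0) m0) => -[z w].
rewrite /bl nrm_pair_lt /= => /andP[zm wm].
set a := z - z0 in zm; set b := w - cconj z0 in wm.
(* Solves [u + 'i *: v = a] and [cconj u + 'i *: cconj v = b], so the line meets [(z, w)] at
   [t = 'i]. *)
pose u := 2^-1 *: (a + cconj b); pose v := (2^-1 * - 'i) *: (a - cconj b).
have n2 : nrm (2^-1 : C) = 2^-1.
  by rewrite nrmV (_ : 2 = 2%:R%:C) ?nrm_real ?ger0_norm // rmorph_nat.
have bm : nrm (cconj b) < m by rewrite nrm_cconj.
have um : nrm u < m by rewrite nrmZ n2; have := nrmD a (cconj b); lra.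
have vm : nrm v < m.
  by rewrite nrmZ nrmM n2 nrmN nrm_i mulr1; have := nrmB a (cconj b); lra.
have ii : 'i * 'i = -1 :> C by rewrite -expr2 sqr_i.
have mix (x y : C) : 2^-1 * (x + y) + 'i * (2^-1 * - 'i * (x - y)) = x.
  have -> : 2^-1 * (x + y) + 'i * (2^-1 * - 'i * (x - y)) =
    2^-1 * (x + y) - ('i * 'i) * (2^-1 * (x - y)) by ring.
  by rewrite ii; field.
have mix' (x y : C) : 2^-1 * (x + y) + 'i * (2^-1 * 'i * (x - y)) = y.
  have -> : 2^-1 * (x + y) + 'i * (2^-1 * 'i * (x - y)) =
    2^-1 * (x + y) + ('i * 'i) * (2^-1 * (x - y)) by ring.
  by rewrite ii; field.
have uv : u + 'i *: v = a.
  by apply/matrixP => i j; rewrite /u /v !mxE; exact: mix.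
have half : (2^-1 : C) = (2^-1 : R)%:C by rewrite fmorphV /= rmorph_nat.
have conj2 : (2^-1 : C)^*%C = 2^-1 by rewrite half conjc_real.
have conji : (('i : C)^*)%C = - 'i by apply/eqP; rewrite eq_complex /= oppr0 !eqxx.
have cu : cconj u = 2^-1 *: (cconj a + b) by rewrite /u cconjZ cconjD cconjK conj2.
have cv : cconj v = (2^-1 * 'i) *: (cconj a - b).
  rewrite /v cconjZ cconjB cconjK; congr (_ *: _).
  have -> : conjc (2^-1 * - 'i : C) = conjc 2^-1 * - conjc 'i.
    by apply: etrans (rmorphM (@conjc R) _ _) _; congr (_ * _); exact: (rmorphN (@conjc R)).
  by rewrite conj2 conji opprK.
have uvc : cconj u + 'i *: cconj v = b.
  by rewrite cu cv; apply/matrixP => i j; rewrite !mxE; exact: mix'.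
pose d := (v, cconj v); pose c := (z0 + u, cconj z0 + cconj u).
pose g (t : C) := K (c + t *: d).
have cE : c + 'i *: d = (z, w).
  rewrite /c /d; congr (_, _) => /=; rewrite -addrA ?uv ?uvc /a /b addrC subrK //.
have gd s : nrm s < 2 -> differentiable g s.
  move=> s2; apply: diff_line; apply: Kh; rewrite /bl nrm_pair_lt /=.
  have sv : nrm s * nrm v <= 2 * nrm v by rewrite ler_wpM2r // ltW.
  have B (x y y' : 'rV[C]_n) : nrm y < m -> nrm y' < m -> nrm s * nrm y' <= 2 * nrm y' ->
      nrm (x + y + s *: y' - x) < p.
    move=> h1 h2 h3; rewrite sub3; apply: (le_lt_trans (nrmD _ _)); rewrite nrmZ.
    by clear - h1 h2 h3 mp m0; nlra.
  by apply/andP; split; apply: B; rewrite ?nrm_cconj.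
rewrite -cE; apply: (@identity_disc _ g 0 'i 1) => // [t /andP[t0 t1] s|e e0].
  rewrite add0r subr0 /bl => st; apply: gd.
  have := ler_dist_nrm s (t%:C * 'i); rewrite nrmM nrm_i mulr1 nrm_real (ger0_norm t0).
  by move=> /ler_normlP [_ h]; clear - h st t1; nlra.
pose x := Num.min (e / 2) 1; have x0 : 0 < x by rewrite lt_min divr_gt0 ?ltr01.
have [x1 x2] : x <= e / 2 /\ x <= 1 by rewrite !ge_min !lexx orbT.
exists x%:C; first by rewrite -nrm_gt0 nrm_real gtr0_norm.
rewrite subr0 nrm_real gtr0_norm //; split; first by clear - x1 e0; lra.
rewrite /g /c /d.
have -> : (z0 + u, cconj z0 + cconj u) + x%:C *: (v, cconj v) =
   (z0 + u + x%:C *: v, cconj (z0 + u + x%:C *: v)).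
  have cxv : cconj (x%:C *: v) = x%:C *: cconj v.
    by rewrite cconjZ; congr (_ *: _); rewrite /conjc /= oppr0.
  by congr (_, _) => //; rewrite [RHS]cconjD cxv cconjD.
apply: K0; rewrite sub3; apply: (le_lt_trans (nrmD _ _)).
rewrite [nrm (_ *: v)]nrmZ nrm_real gtr0_norm //.
have h : x * nrm v <= 1 * nrm v by rewrite ler_wpM2r.
exact: (lin_aux m0 um vm h mq).
Qed.

(** Nested intervals of half-length [2 * c / 2 ^+ k] about [x k]; the explicit rate replaces limit
    calculus in the fixed-point and exponential arguments. *)
Lemma geom_cvg_real (x : nat -> R) (c : R) :
  (forall k, `|x k.+1 - x k| <= c / 2 ^+ k) -> exists l, forall k, `|x k - l| <= 2 * c / 2 ^+ k.
Proof.
move=> H; pose a k := x k - 2 * c / 2 ^+ k; pose b k := x k + 2 * c / 2 ^+ k.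
have c0 : 0 <= c by have := H 0%N; rewrite expr0 divr1; apply: le_trans.
have p2 k : 0 < (2 : R) ^+ k by rewrite exprn_gt0.
have S k : c / 2 ^+ k.+1 = c / 2 ^+ k / 2 by rewrite exprS; field; rewrite gt_eqF.
have Hk k : x k.+1 - x k <= c / 2 ^+ k /\ x k - x k.+1 <= c / 2 ^+ k.
  by have /ler_normlP [h1 h2] := H k; rewrite opprB in h1.
have am k : a k <= a k.+1 by rewrite /a -!mulrA S; have [_] := Hk k; lra.
have bm k : b k.+1 <= b k by rewrite /b -!mulrA S; have [h _] := Hk k; lra.
have ab k : a k <= b k.
  have : 0 <= c / 2 ^+ k by rewrite divr_ge0 // ltW.
  by rewrite /a /b -!mulrA; lra.
have aj k j : a k <= a (k + j)%N by elim: j => [|j IH]; rewrite ?addn0 // addnS (le_trans IH).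
have bj k j : b (k + j)%N <= b k by elim: j => [|j IH]; rewrite ?addn0 // addnS (le_trans (bm _)).
have abj k j : a j <= b k.
  have [kj|/ltnW jk] := leqP k j.
    by apply: (le_trans (ab j)); have := bj k (j - k)%N; rewrite subnKC.
  by apply: le_trans (ab k); have := aj j (k - j)%N; rewrite subnKC.
exists (sup (range a)) => k.
have h1 : a k <= sup (range a).
  apply: ub_le_sup; last by exists k.
  by exists (b 0%N) => _ [j _ <-]; exact: abj.
have h2 : sup (range a) <= b k.
  by apply: ge_sup; [exists (a 0%N); exists 0%N|move=> _ [j _ <-]; exact: abj].
by move: h1 h2; rewrite /a /b ler_norml => h1 h2; apply/andP; split; lra.
Qed.

Lemma geom_cvg (u : nat -> C) (c : R) :
  (forall k, nrm (u k.+1 - u k) <= c / 2 ^+ k) -> exists l, forall k, nrm (u k - l) <= 4 * c / 2 ^+ k.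
Proof.
move=> H.
have [a Ha] : exists l, forall k, `|complex.Re (u k) - l| <= 2 * c / 2 ^+ k.
  apply: geom_cvg_real => k; apply: le_trans (H k); apply: le_trans (nrm_Re _).
  by rewrite raddfB.
have [b Hb] : exists l, forall k, `|complex.Im (u k) - l| <= 2 * c / 2 ^+ k.
  apply: geom_cvg_real => k; apply: le_trans (H k); apply: le_trans (nrm_Im _).
  by rewrite raddfB.
exists (a +i* b) => k; apply: (le_trans (nrm_ReIm _)); rewrite !raddfB /=.
have -> : 4 * c / 2 ^+ k = 2 * c / 2 ^+ k + 2 * c / 2 ^+ k by field; rewrite expf_neq0.
exact: lerD.
Qed.

Lemma geom_small (c e : R) : 0 < e -> exists k : nat, c / 2 ^+ k < e.
Proof.
move=> e0; exists (Num.bound (`|c| / e)).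
rewrite ltr_pdivrMr ?exprn_gt0 // mulrC -ltr_pdivrMr //.
apply: (@le_lt_trans _ _ (`|c| / e)); first by rewrite ler_wpM2r ?invr_ge0 ?(ltW e0) ?ler_norm.
apply: (@lt_le_trans _ _ (Num.bound (`|c| / e))%:R); first by rewrite archi_boundP // divr_ge0 // ltW.
by rewrite -natrX ler_nat ltnW // ltn_expl.
Qed.

End TotallyReal.

(** * The holomorphic implicit function theorem for a scalar equation *)

Section ImplicitFunction.
Context {R : realType}.
Local Notation C := R[i].
Context {V : normedModType C}.

(** Newton's iteration in the single unknown [s], with slope frozen at ['D_e F P0]. Uniqueness
    within radius [r] is part of the conclusion: it later gives reality of the solution and
    comparison of zero sets. *)
Lemma implicit_function (F : V -> C) (P0 e : V) (p : R) : 0 < p -> hol F P0 p ->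
  F P0 = 0 -> 'D_e F P0 != 0 ->
  exists (r q : R) (g : V -> C), [/\ 0 < r, 0 < q, g P0 = 0 &
    forall P, bl P0 q P ->
    [/\ nrm (g P) < r, F (P + g P *: e) = 0,
      forall s : C, nrm s < r -> bl P0 p (P + s *: e) /\ (F (P + s *: e) = 0 -> s = g P) &
      'D_e F (P + g P *: e) != 0 /\
      hasd g P (fun h => - 'D_h F (P + g P *: e) / 'D_e F (P + g P *: e))]].
Proof.
move=> p0 Fh F0; have [k kE] : exists k, k = 'D_e F P0 by exists ('D_e F P0).
rewrite -kE => ke.
have k0 : 0 < nrm k by rewrite nrm_gt0.
have [m /andP[m0 mp] [M M0 HM]] := hol_bounded p0 Fh.
have Fm : hol F P0 m by move=> z zq; apply: Fh; exact: lt_le_trans zq mp.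
have [K K0 [d d0 HK]] := derive_bound m0 Fm M0 HM.
have /cont_nrmP /(_ (nrm k / 4)) := @derive_cont R V F _ _ e m0 Fm.
rewrite divr_gt0 // -kE => /(_ isT) [d1 d10 Hd1].
pose E := nrm e + 1; have E0 : 0 < E by rewrite ltr_wpDl.
have eE : nrm e <= E by rewrite /E lerDl.
(* In order: points stay within [m / 2] of [P0]; the slope stays within [nrm k / 4] of [k]; the
   quadratic estimate applies; and its contribution is at most another [nrm k / 4]. *)
pose r := Num.min (Num.min (m / 4) (d1 / 2)) (Num.min (d / 2) (nrm k / (8 * (K * E + 1)))) / E.
have KE0 : 0 < K * E + 1 by rewrite ltr_wpDl // mulr_ge0 // ltW.
have r0 : 0 < r by rewrite divr_gt0 // !lt_min !divr_gt0 // mulr_gt0.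
have rE : r * E = Num.min (Num.min (m / 4) (d1 / 2)) (Num.min (d / 2) (nrm k / (8 * (K * E + 1)))).
  by rewrite /r divfK // gt_eqF.
have [r1 r2 r3 r4] : [/\ r * E <= m / 4, r * E <= d1 / 2, r * E <= d / 2 & r * E * (8 * (K * E + 1)) <= nrm k].
  have h : r * E <= r * E by [].
  move: h; rewrite {2}rE !le_min => /andP[/andP[-> ->] /andP[->]].
  by rewrite ler_pdivlMr // mulr_gt0.
have near P (s : C) : nrm (P - P0) < r * E -> nrm s < r -> nrm (P + s *: e - P0) < 2 * (r * E).
  move=> hP hs; rewrite addrAC; apply: (le_lt_trans (nrmD _ _)); rewrite nrmZ.
  have h : nrm s * nrm e <= r * E by apply: ler_pM => //; exact: ltW.
  by clear - h hP; nlra.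
have De P (s : C) : nrm (P - P0) < r * E -> nrm s < r -> nrm ('D_e F (P + s *: e) - k) < nrm k / 4.
  by move=> hP hs; apply: Hd1; have h := near P s hP hs; clear - h r2; nlra.
have De0 P (s : C) : nrm (P - P0) < r * E -> nrm s < r -> 3 / 4 * nrm k < nrm ('D_e F (P + s *: e)).
  move=> hP hs; have := De P s hP hs; have := ler_dist_nrm ('D_e F (P + s *: e)) k.
  by move=> /ler_normlP [h _] h2; clear - h h2; nlra.
(* [F (P + s *: e) - s * k] is [nrm k / 2]-Lipschitz in [s]: this makes the iteration contract and
   bounds [F] below and above along the line. *)
have strict P (s s' : C) : nrm (P - P0) < r * E -> nrm s < r -> nrm s' < r ->
    nrm (F (P + s *: e) - F (P + s' *: e) - (s - s') * k) <= nrm k / 2 * nrm (s - s').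
  move=> hP hs hs'; set z := P + s' *: e; set h := (s - s') *: e.
  have zh : P + s *: e = z + h by rewrite /z /h -addrA -scalerDl (addrC s') subrK.
  have zm : bl P0 (m / 2) z by rewrite /bl; have h1 := near P s' hP hs'; rewrite -/z in h1; clear - h1 r1; nlra.
  have dz : differentiable F z by apply: Fm; rewrite /bl in zm *; clear - zm m0; nlra.
  have ss : nrm (s - s') <= 2 * r by have h1 := nrmB s s'; clear - h1 hs hs'; nlra.
  have nh : nrm h <= nrm (s - s') * E by rewrite nrmZ ler_wpM2l.
  have ssE : nrm (s - s') * E <= 2 * r * E by rewrite ler_wpM2r // ltW.
  have [_ H2] := HK z h zm; have {}H2 : nrm (F (z + h) - F z - 'D_h F z) <= K * nrm h ^+ 2.
    by apply: H2; clear - nh ssE r3; nlra.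
  have Dh : 'D_h F z = (s - s') * 'D_e F z by rewrite (linZ _ _ (deriveP_lin dz)).
  have H3 := De P s' hP hs'; rewrite -/z in H3.
  have -> : F (P + s *: e) - F z - (s - s') * k =
    (F (z + h) - F z - 'D_h F z) + (s - s') * ('D_e F z - k) by rewrite zh Dh; ring.
  apply: (le_trans (nrmD _ _)); rewrite nrmM.
  have H4 : nrm (s - s') * nrm ('D_e F z - k) <= nrm (s - s') * (nrm k / 4) by rewrite ler_wpM2l // ltW.
  suff H5 : K * nrm h ^+ 2 <= nrm k / 4 * nrm (s - s') by clear - H2 H4 H5; nlra.
  have h2 : nrm h ^+ 2 <= (nrm (s - s') * E) * (2 * r * E).
    by rewrite expr2; apply: ler_pM => //; apply: (le_trans nh).
  apply: (le_trans (ler_wpM2l K0 h2)).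
  have -> : K * (nrm (s - s') * E * (2 * r * E)) = (K * E * 2 * (r * E)) * nrm (s - s') by ring.
  rewrite ler_wpM2r //; have h1 : 0 < r * E by rewrite mulr_gt0.
  have h3 : r * E * (8 * (K * E + 1)) = 8 * (K * E * (r * E)) + 8 * (r * E) by ring.
  have h4 : 0 <= K * E * (r * E) by rewrite mulr_ge0 ?(ltW h1) // mulr_ge0 // ltW.
  have h5 : K * E * 2 * (r * E) = 2 * (K * E * (r * E)) by ring.
  by rewrite h5; rewrite h3 in r4; clear - h1 h4 r4; nlra.
have strict2 P (s s' : C) : nrm (P - P0) < r * E -> nrm s < r -> nrm s' < r ->
    nrm k / 2 * nrm (s - s') <= nrm (F (P + s *: e) - F (P + s' *: e)).
  move=> hP hs hs'; have h1 := strict P s s' hP hs hs'.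
  have := nrm_tri (F (P + s *: e) - F (P + s' *: e)) ((s - s') * k) 0.
  rewrite !subr0 (nrm_sub _ (_ - F _)) nrmM => h2; clear - h1 h2; nlra.
have strict3 P (s s' : C) : nrm (P - P0) < r * E -> nrm s < r -> nrm s' < r ->
    nrm (F (P + s *: e) - F (P + s' *: e)) <= 3 / 2 * nrm k * nrm (s - s').
  move=> hP hs hs'; have h1 := strict P s s' hP hs hs'.
  have := nrm_tri ((s - s') * k) (F (P + s *: e) - F (P + s' *: e)) 0.
  rewrite !subr0 nrmM => h2; clear - h1 h2; nlra.
have kr8 : 0 < nrm k * r / 8 by apply: divr_gt0 => //; apply: mulr_gt0.
have /cont_nrmP /(_ _ kr8) [d2 d20 Hd2] := differentiable_continuous (Fh _ (bl_center _ p0)).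
rewrite F0 in Hd2.
pose q := Num.min d2 (r * E); have q0 : 0 < q by rewrite lt_min d20 mulr_gt0.
have solve P : exists s : C, nrm (P - P0) < q -> nrm s < r /\ F (P + s *: e) = 0.
  have [hP|nhP] := ltP (nrm (P - P0)) q; last by exists 0.
  move: hP; rewrite lt_min => /andP[/Hd2]; rewrite subr0 => FP hP.
  (* The increments start below [r / 8] and halve at each step, so the iterates stay within
     [r / 4]. *)
  pose u := fix u j : C := if j is j'.+1 then u j' - F (P + u j' *: e) / k else 0.
  have uS j : u j.+1 = u j - F (P + u j *: e) / k by [].
  have Hu j : nrm (u j) <= r / 4 * (1 - (2 ^+ j)^-1) /\ nrm (u j.+1 - u j) <= r / 8 / 2 ^+ j.
    elim: j => [|j [IH1 IH2]].
      split; first by rewrite nrm0 expr0 invr1 subrr mulr0.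
      rewrite uS addrAC subrr add0r nrmN nrmM nrmV scale0r addr0 expr0 divr1.
      rewrite ler_pdivrMr //; clear - FP; nlra.
    have p2 : 0 < (2 : R) ^+ j by rewrite exprn_gt0.
    have i2 : (2 ^+ j.+1)^-1 = (2 ^+ j)^-1 / 2 :> R by rewrite exprS; field; rewrite gt_eqF.
    have ip : 0 < ((2 : R) ^+ j)^-1 by rewrite invr_gt0.
    have h1 : nrm (u j.+1) <= r / 4 * (1 - (2 ^+ j.+1)^-1).
      rewrite i2; have := nrmD (u j) (u j.+1 - u j); rewrite addrC subrK => h.
      by clear - h IH1 IH2; nlra.
    split => //.
    have ir : 0 < r * ((2 : R) ^+ j)^-1 by rewrite mulr_gt0.
    have a1 : nrm (u j) < r by clear - IH1 ir r0; nlra.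
    have a2 : nrm (u j.+1) < r by rewrite i2 in h1; clear - h1 ir r0; nlra.
    have := strict P _ _ hP a2 a1.
    have -> : u j.+2 - u j.+1 = - (F (P + u j.+1 *: e) - F (P + u j *: e) - (u j.+1 - u j) * k) / k.
      have e1 : (u j.+1 - u j) * k = - F (P + u j *: e) by rewrite uS; field.
      have e2 : u j.+2 - u j.+1 = - F (P + u j.+1 *: e) / k.
        by rewrite (uS j.+1) addrAC subrr add0r mulNr.
      by rewrite e1 e2; congr (_ / _); rewrite opprK subrK.
    rewrite nrmM nrmN nrmV => h; rewrite ler_pdivrMr //; apply: (le_trans h).
    have -> : r / 8 / 2 ^+ j.+1 * nrm k = nrm k / 2 * (r / 8 / 2 ^+ j).
      by rewrite exprS; field; rewrite gt_eqF.
    by rewrite ler_wpM2l // divr_ge0.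
  have [s Hs] := geom_cvg (fun j => proj2 (Hu j)).
  have s_r : nrm s < r.
    have := Hs 0%N; rewrite sub0r nrmN expr0 divr1 => h; clear - h r0; nlra.
  exists s => _; split => //.
  apply/eqP; rewrite -nrm_eq0; apply/eqP/le_anti; rewrite nrm_ge0 andbT.
  apply/ler_addgt0Pr => x x0; rewrite add0r.
  have [j Hj] := @geom_small R (nrm k * r) x x0.
  have ip : 0 < ((2 : R) ^+ j)^-1 by rewrite invr_gt0 exprn_gt0.
  have ir : 0 < r * ((2 : R) ^+ j)^-1 by rewrite mulr_gt0.
  have [b1 b2] := Hu j; have uj : nrm (u j) < r by clear - b1 ir r0; nlra.
  have b3 := strict3 P _ _ hP s_r uj.
  have FE : F (P + u j *: e) = - k * (u j.+1 - u j) by rewrite uS; field.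
  have := nrm_tri (F (P + u j *: e)) (F (P + s *: e)) 0; rewrite !subr0.
  rewrite {2}FE nrmM nrmN => b5.
  have b6 : nrm k * nrm (u j.+1 - u j) <= nrm k * (r / 8 / 2 ^+ j) by rewrite ler_wpM2l.
  have b4 : nrm (s - u j) <= 4 * (r / 8) / 2 ^+ j by rewrite nrm_sub.
  have b7 : 3 / 2 * nrm k * nrm (s - u j) <= 3 / 2 * nrm k * (4 * (r / 8) / 2 ^+ j).
    by rewrite ler_wpM2l // mulr_ge0.
  have e1 : 3 / 2 * nrm k * (4 * (r / 8) / 2 ^+ j) = 3 / 4 * (nrm k * r / 2 ^+ j).
    by field; rewrite expf_neq0.
  have e2 : nrm k * (r / 8 / 2 ^+ j) = 1 / 8 * (nrm k * r / 2 ^+ j).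
    by field; rewrite expf_neq0.
  have b8 : 0 < nrm k * r / 2 ^+ j by apply: divr_gt0; [exact: mulr_gt0|exact: exprn_gt0].
  by rewrite e1 in b7; rewrite e2 in b6; clear - b3 b5 b6 b7 b8 Hj; nlra.
have [g Hg] := choice solve.
have uniq P (s s' : C) : nrm (P - P0) < r * E -> nrm s < r -> nrm s' < r ->
   F (P + s *: e) = 0 -> F (P + s' *: e) = 0 -> s = s'.
  move=> hP hs hs' e1 e2; have := strict2 P _ _ hP hs hs'; rewrite e1 e2 subrr nrm0.
  move=> h; apply/eqP; rewrite -subr_eq0 -nrm_eq0 eq_le nrm_ge0 andbT.
  by rewrite -(ler_pM2l (_ : 0 < nrm k / 2)) ?mulr0 ?divr_gt0.
have qr P : nrm (P - P0) < q -> nrm (P - P0) < r * E by rewrite lt_min => /andP[].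
exists r, q, g; split => //.
  have [|h1 h2] := Hg P0; first by rewrite subrr nrm0.
  apply: (uniq P0) => //; rewrite ?nrm0 ?scale0r ?addr0 // subrr nrm0 mulr_gt0 //.
move=> P hP; have [g1 g2] := Hg P hP; have hP' := qr _ hP; split => //.
  move=> s sr; split; first by rewrite /bl; have h := near P s hP' sr; clear - h r1 mp m0; nlra.
  by move=> s0; apply: (uniq P).
set Q := P + g P *: e; set kk := 'D_e F Q.
have kk0 : 3 / 4 * nrm k < nrm kk by apply: De0.
have kkn : kk != 0 by rewrite -nrm_gt0; clear - kk0 k0; nlra.
split => //.
have zm : bl P0 (m / 2) Q by rewrite /bl; have h := near P (g P) hP' g1; rewrite -/Q in h; clear - h r1; nlra.
have dQ : differentiable F Q by apply: Fm; rewrite /bl in zm *; clear - zm m0; nlra.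
have ll := deriveP_lin dQ.
(* Bounds the increment of the lifted point [P + g P *: e] by [B] times that of [P]; the quadratic
   remainder then picks up [B ^+ 2]. *)
pose B := 1 + 4 * (K + K) / nrm k * E; have B1 : 0 <= B.
  by rewrite addr_ge0 // mulr_ge0 ?(ltW E0) // divr_ge0 // mulr_ge0 // addr_ge0.
have B10 : 0 < B + 1 by clear - B1; nlra.
apply: (@hasd_quad _ _ _ _ _ _ (K / nrm kk) (K * B ^+ 2 / nrm kk)
   (Num.min (q - nrm (P - P0)) (Num.min (Num.min d 1) (d / (B + 1))))).
- by rewrite !lt_min subr_gt0 d0 ltr01 divr_gt0 // !andbT; exact: hP.
- move=> a x y; rewrite ll.
  have hl (d3 d4 : C) : - (a * d3 + d4) / kk = a * (- d3 / kk) + - d4 / kk.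
    by rewrite opprD mulrDl -mulrN -mulrA.
  exact: hl.
- by move=> h; rewrite nrmM nrmN nrmV mulrAC ler_wpM2r ?invr_ge0 //; have [] := HK Q h zm.
move=> h; rewrite !lt_min => /andP[hq /andP[/andP[/ltW hd /ltW h1] hB]].
have hPh : nrm (P + h - P0) < q by rewrite addrAC; have h2 := nrmD (P - P0) h; clear - h2 hq; nlra.
have [s1 s2] := Hg _ hPh; set s := g (P + h) in s1 s2 *.
have hPh' := qr _ hPh.
have c1 := strict2 (P + h) s (g P) hPh' s1 g1.
have E2 : P + h + g P *: e = Q + h by rewrite addrAC.
rewrite s2 E2 sub0r nrmN in c1.
have [c2 c3] := HK Q h zm; have {}c3 := c3 hd.
rewrite g2 -/Q in c3.
have c4 : nrm (F (Q + h)) <= (K + K) * nrm h.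
  have := nrmD (F (Q + h) - 0 - 'D_h F Q) ('D_h F Q); rewrite subrK subr0 => a1.
  have a2 : K * nrm h ^+ 2 <= K * nrm h by rewrite expr2 mulrA ler_piMr // mulr_ge0.
  by rewrite subr0 in c3 a1; clear - a1 a2 c3 c2; nlra.
have c5 : nrm (s - g P) * nrm k <= 2 * (K + K) * nrm h by clear - c1 c4; nlra.
pose w := h + (s - g P) *: e.
have c6 : nrm w <= B * nrm h.
  apply: (le_trans (nrmD _ _)); rewrite nrmZ /B mulrDl mul1r lerD2l.
  have : nrm (s - g P) * nrm e <= nrm (s - g P) * E by rewrite ler_wpM2l.
  move/le_trans; apply.
  have -> : 4 * (K + K) / nrm k * E * nrm h = (2 * (2 * (K + K) * nrm h) / nrm k) * E by ring.
  rewrite ler_wpM2r ?(ltW E0) // ler_pdivlMr //.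
  have a1 : 0 <= (K + K) * nrm h by rewrite mulr_ge0 // addr_ge0.
  by clear - a1 c5; nlra.
have c7 : nrm w <= d.
  apply: (le_trans c6); move: hB; rewrite ltr_pdivlMr // mulrDr mulr1 mulrC => hB.
  by have a1 := nrm_ge0 h; clear - a1 hB; nlra.
have [_ /(_ c7) c8] := HK Q w zm.
have E3 : Q + w = P + h + s *: e.
  by rewrite /Q /w scalerBl addrACA; congr (_ + _); rewrite addrC subrK.
have E4 : F Q = 0 by [].
have E5 : 'D_w F Q = 'D_h F Q + (s - g P) * kk by rewrite (linD _ _ ll) (linZ _ _ ll).
have E6 : s - g P - - 'D_h F Q / kk = 'D_w F Q / kk by rewrite E5; field.
rewrite E6 nrmM nrmV mulrAC ler_wpM2r ?invr_ge0 //.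
rewrite E3 s2 E4 subrr sub0r nrmN in c8; apply: (le_trans c8).
have : nrm w ^+ 2 <= (B * nrm h) ^+ 2 by apply: lerXn2r; rewrite ?nnegrE // mulr_ge0.
by move=> c9; rewrite -mulrA; apply: ler_wpM2l => //; rewrite -exprMn.
Qed.

End ImplicitFunction.

(** * Differentiation rules *)

Section Calculus.
Context {R : realType}.
Local Notation C := R[i].

Section Generic.
Context {V W : normedModType C}.

Lemma derD (f g : V -> W) x v : differentiable f x -> differentiable g x ->
  'D_v (fun z => f z + g z) x = 'D_v f x + 'D_v g x.
Proof. by move=> df dg; rewrite deriveD //; exact: diff_derivable. Qed.

Lemma derB (f g : V -> W) x v : differentiable f x -> differentiable g x ->
  'D_v (fun z => f z - g z) x = 'D_v f x - 'D_v g x.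
Proof. by move=> df dg; rewrite deriveB //; exact: diff_derivable. Qed.

Lemma derM (f g : V -> C) x v : differentiable f x -> differentiable g x ->
  'D_v (fun z => f z * g z) x = f x * 'D_v g x + g x * 'D_v f x.
Proof. by move=> df dg; rewrite deriveM //; exact: diff_derivable. Qed.

Lemma difM (f g : V -> C) x : differentiable f x -> differentiable g x ->
  differentiable (fun z => f z * g z) x.
Proof. exact: differentiableM. Qed.

Lemma difD (f g : V -> W) x : differentiable f x -> differentiable g x ->
  differentiable (fun z => f z + g z) x.
Proof. exact: differentiableD. Qed.

Lemma difB (f g : V -> W) x : differentiable f x -> differentiable g x ->
  differentiable (fun z => f z - g z) x.
Proof. exact: differentiableB. Qed.

Lemma difC (c : W) x : differentiable (fun _ : V => c) x.
Proof. exact: differentiable_cst. Qed.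

Lemma difV (f : V -> C) x : differentiable f x -> f x != 0 -> differentiable (fun z => (f z)^-1) x.
Proof. exact: differentiableV. Qed.

Lemma difdiv (f g : V -> C) x : differentiable f x -> differentiable g x -> g x != 0 ->
  differentiable (fun z => f z / g z) x.
Proof. by move=> df dg g0; apply: difM => //; apply: difV. Qed.

Lemma derdiv (f g : V -> C) x v : differentiable f x -> differentiable g x -> g x != 0 ->
  'D_v (fun z => f z / g z) x = ('D_v f x * g x - f x * 'D_v g x) / g x ^+ 2.
Proof.
move=> df dg g0; rewrite derM //; last exact: difV.
have dv : derivable g x v by exact: diff_derivable.
rewrite (deriveV g0 dv) -[_ *: _]/(_ * _).
by move: g0; move: (f x) (g x) ('D_v f x) ('D_v g x) => a b c d b0; field.
Qed.

Lemma difsum n (f : 'I_n -> V -> W) x : (forall i, differentiable (f i) x) ->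
  differentiable (fun z => \sum_(i < n) f i z) x.
Proof.
move=> df; have := differentiable_sum df; congr (differentiable _ _).
by apply/funext => z; rewrite fct_sumE.
Qed.

Lemma dersum n (f : 'I_n -> V -> W) x v : (forall i, differentiable (f i) x) ->
  'D_v (fun z => \sum_(i < n) f i z) x = \sum_(i < n) 'D_v (f i) x.
Proof.
move=> df; rewrite -derive_sum; last by move=> i; exact: diff_derivable.
by congr ('D_v _ x); apply/funext => z; rewrite fct_sumE.
Qed.

Lemma derC (c : W) x v : 'D_v (fun _ : V => c) x = 0.
Proof. exact: derive_cst. Qed.

Lemma der_ext (f g : V -> W) x v (r : R) : 0 < r ->
  (forall y, nrm (y - x) < r -> f y = g y) -> differentiable f x -> 'D_v f x = 'D_v g x.
Proof.
move=> r0 fg df; apply/esym/(hasd_derive v (l := fun v => 'D_v f x)).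
apply: hasd_ext r0 _ (diff_hasD df) => h hr; apply: fg.
by rewrite addrC addKr.
Qed.

End Generic.

Lemma der_comp (U V W : normedModType C) (f : U -> V) (g : V -> W) x v :
  differentiable f x -> differentiable g (f x) ->
  'D_v (fun z => g (f z)) x = 'D_('D_v f x) g (f x).
Proof.
move=> df dg; rewrite !deriveE //; last exact: differentiable_comp.
by rewrite (diff_comp df dg).
Qed.

Lemma dif_comp (U V W : normedModType C) (f : U -> V) (g : V -> W) x :
  differentiable f x -> differentiable g (f x) -> differentiable (fun z => g (f z)) x.
Proof. exact: differentiable_comp. Qed.

Lemma nrm_mulmx m n p (A : 'M[C]_(m, n)) (B : 'M[C]_(n, p)) :
  nrm (A *m B) <= n%:R * nrm A * nrm B.
Proof.
apply: nrm_mx_le => [|i j]; first by rewrite !mulr_ge0.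
rewrite mxE; apply: (@le_trans _ _ (\sum_(k < n) nrm A * nrm B)).
  elim/big_ind2: _ => [|a b c d ha hc|k _]; first by rewrite nrm0.
    exact: le_trans (nrmD _ _) (lerD ha hc).
  by rewrite nrmM ler_pM // nrm_mx_entry.
by rewrite sumr_const card_ord -mulrA mulr_natl.
Qed.

Lemma hasd_mulmxr (V : normedModType C) m n p (G : V -> 'M[C]_(m, n)) x l (B : 'M[C]_(n, p)) :
  hasd G x l -> hasd (fun z => G z *m B) x (fun h => l h *m B).
Proof.
case=> ll [K lK] H; split.
- by move=> a u v; rewrite ll mulmxDl scalemxAl.
- exists (n%:R * K * nrm B) => h; apply: (le_trans (nrm_mulmx _ _)).
  by rewrite [leRHS]mulrAC ler_wpM2r // -mulrA ler_wpM2l.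
move=> e e0; have N0 : 0 < n%:R * nrm B + 1 by rewrite ltr_wpDl // mulr_ge0.
have [d d0 Hd] := H (e / (n%:R * nrm B + 1)) (divr_gt0 e0 N0).
exists d => // h /Hd Hh; rewrite -!mulmxBl; apply: (le_trans (nrm_mulmx _ _)).
rewrite mulrAC; apply: (le_trans (ler_wpM2l _ Hh)); first by rewrite mulr_ge0.
rewrite mulrA ler_wpM2r // mulrCA ler_piMr ?(ltW e0) // ler_pdivrMr // mul1r lerDl.
exact: ler01.
Qed.

Lemma dif_mulmxr (V : normedModType C) m n p (G : V -> 'M[C]_(m, n)) x (B : 'M[C]_(n, p)) :
  differentiable G x -> differentiable (fun z => G z *m B) x.
Proof. by move=> /diff_hasd /(hasd_mulmxr B) /hasd_diff []. Qed.

Lemma der_mulmxr (V : normedModType C) m n p (G : V -> 'M[C]_(m, n)) x v (B : 'M[C]_(n, p)) :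
  differentiable G x -> 'D_v (fun z => G z *m B) x = 'D_v G x *m B.
Proof. by move=> /diff_hasD /(hasd_mulmxr B) /hasd_derive ->. Qed.

Lemma der_mxP (V : normedModType C) m n (G : V -> 'M[C]_(m, n)) x v i j :
  differentiable G x -> ('D_v G x) i j = 'D_v (fun z => G z i j) x.
Proof. exact: derive_entry. Qed.

Lemma dif_scale (V : normedModType C) m n (c : V -> C) (G : V -> 'M[C]_(m, n)) x :
  differentiable c x -> differentiable G x -> differentiable (fun z => c z *: G z) x.
Proof.
move=> dc dG; apply: diff_mx => i j.
have -> : (fun z => (c z *: G z) i j) = (fun z => c z * G z i j) by apply/funext => z; rewrite mxE.
by apply: difM => //; exact: diff_entry.
Qed.

Lemma der_scale (V : normedModType C) m n (c : V -> C) (G : V -> 'M[C]_(m, n)) x v :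
  differentiable c x -> differentiable G x ->
  'D_v (fun z => c z *: G z) x = c x *: 'D_v G x + 'D_v c x *: G x.
Proof.
move=> dc dG; apply/matrixP => i j; rewrite der_mxP; last exact: dif_scale.
have -> : (fun z => (c z *: G z) i j) = (fun z => c z * G z i j) by apply/funext => z; rewrite mxE.
by rewrite derM ?mxE ?(der_mxP _ _ _ dG) 1?mulrC // 1?(mulrC (G x i j)) //; exact: diff_entry.
Qed.

Lemma conjcMc (a y : C) : conjc (conjc a * y) = a * conjc y.
Proof. by case: a => a b; case: y => c d /=; congr (_ +i* _); ring. Qed.

(** Two conjugations cancel: conjugating both the value and, through an antilinear isometry, the
    argument gives a complex linear derivative again. *)
Lemma hasd_conj (V V' : normedModType C) (F : V -> C) (s : V' -> V) x l :
  (forall a u v, s (a *: u + v) = conjc a *: s u + s v) -> (forall u, nrm (s u) = nrm u) ->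
  hasd F (s x) l -> hasd (fun z => conjc (F (s z))) x (fun h => conjc (l (s h))).
Proof.
move=> sl sn [ll [K lK] H].
have sD u v : s (u + v) = s u + s v by have := sl 1 u v; rewrite conjc1 !scale1r.
split.
- move=> a u v; rewrite sl ll; apply: etrans (rmorphD (@conjc R) _ _) _; congr (_ + _).
  exact: conjcMc.
- by exists K => h; rewrite nrm_conj -(sn h).
move=> e /H [d d0 Hd]; exists d => // h; rewrite -sn => /Hd.
rewrite -[X in X <= _]nrm_conj sD; congr (nrm _ <= _).
by rewrite !(raddfB (@conjc R)).
Qed.

Lemma dif_conj (V V' : normedModType C) (F : V -> C) (s : V' -> V) x :
  (forall a u v, s (a *: u + v) = conjc a *: s u + s v) -> (forall u, nrm (s u) = nrm u) ->
  differentiable F (s x) -> differentiable (fun z => conjc (F (s z))) x.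
Proof. by move=> sl sn /diff_hasd /(hasd_conj sl sn) /hasd_diff []. Qed.

Lemma der_conj (V V' : normedModType C) (F : V -> C) (s : V' -> V) x v :
  (forall a u v, s (a *: u + v) = conjc a *: s u + s v) -> (forall u, nrm (s u) = nrm u) ->
  differentiable F (s x) -> 'D_v (fun z => conjc (F (s z))) x = conjc ('D_(s v) F (s x)).
Proof. by move=> sl sn /diff_hasD /(hasd_conj sl sn) /hasd_derive ->. Qed.

Lemma cconj_antilin m n (a : C) (u v : 'M[C]_(m, n)) :
  cconj (a *: u + v) = conjc a *: cconj u + cconj v.
Proof. by rewrite cconjD cconjZ. Qed.

End Calculus.

(** * Charts of the projective space and projective vector fields *)

Section Charts.
Context {R : realType} {n : nat}.
Local Notation C := R[i].
Local Notation Cn := 'rV[C]_n.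
Local Notation Cn1 := 'rV[C]_n.+1.
Implicit Types (i j : 'I_n.+1) (x w : Cn) (v : Cn1) (B : 'M[C]_n.+1).

Definition hlin i w : Cn1 := \row_j (if unlift i j is Some k then w 0 k else 0).

Lemma homog_i i x : homog i x 0 i = 1.
Proof. by rewrite mxE unlift_none. Qed.

Lemma homog_lift i x k : homog i x 0 (lift i k) = x 0 k.
Proof. by rewrite mxE liftK. Qed.

Lemma hlin_i i x : hlin i x 0 i = 0.
Proof. by rewrite mxE unlift_none. Qed.

Lemma hlin_lift i x k : hlin i x 0 (lift i k) = x 0 k.
Proof. by rewrite mxE liftK. Qed.

Lemma row_split i v v' : v 0 i = v' 0 i -> (forall k, v 0 (lift i k) = v' 0 (lift i k)) -> v = v'.
Proof.
move=> h1 h2; apply/rowP => j; case: (unliftP i j) => [k ->|->] //.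
Qed.

Lemma homogD i x w : homog i (x + w) = homog i x + hlin i w.
Proof.
by apply/rowP => j; rewrite !mxE; case: unlift => [k|]; rewrite ?mxE ?addr0.
Qed.

Lemma hlin_lin i a w w' : hlin i (a *: w + w') = a *: hlin i w + hlin i w'.
Proof.
by apply/rowP => j; rewrite !mxE; case: unlift => [k|]; rewrite ?mxE ?mulr0 ?addr0.
Qed.

Lemma hlin0 i : hlin i 0 = 0.
Proof. by apply/rowP => j; rewrite !mxE; case: unlift => // k; rewrite mxE. Qed.

Lemma hlinZ i a w : hlin i (a *: w) = a *: hlin i w.
Proof. by rewrite -[a *: w]addr0 hlin_lin hlin0 addr0. Qed.

Lemma nrm_hlin i w : nrm (hlin i w) <= nrm w.
Proof.
apply: nrm_mx_le => // a j; rewrite mxE; case: unlift => [k|]; last by rewrite nrm0.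
exact: nrm_mx_entry.
Qed.

Lemma homogK i : cancel (@homog R n i) (dehomog i).
Proof. by move=> x; apply/rowP => k; rewrite mxE homog_i homog_lift divr1. Qed.

Lemma dehomogK i v : v 0 i != 0 -> v = v 0 i *: homog i (dehomog i v).
Proof.
move=> v0; apply: (@row_split i) => [|k]; rewrite [RHS]mxE ?homog_i ?mulr1 //.
by rewrite homog_lift mxE mulrCA divff // mulr1.
Qed.

Lemma homog_neq0 i x : homog i x != 0.
Proof.
by apply/eqP => /rowP /(_ i); rewrite homog_i mxE => /eqP; rewrite oner_eq0.
Qed.

Lemma hasd_homog i x : hasd (homog i) x (hlin i).
Proof.
apply: (@hasd_quad _ _ _ _ _ _ 1 0 1 ltr01).
- by move=> a u w; rewrite hlin_lin.
- by move=> h; rewrite mul1r nrm_hlin.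
by move=> h _; rewrite homogD (addrC (homog i x)) addrK subrr nrm0 mul0r.
Qed.

Lemma dif_homog i x : differentiable (homog i) x.
Proof. by have [] := hasd_diff (hasd_homog i x). Qed.

Lemma der_homog i x w : 'D_w (homog i) x = hlin i w.
Proof. exact: (hasd_derive w (hasd_homog i x)). Qed.

Lemma dif_dehomog (V : normedModType C) (G : V -> Cn1) i (z : V) : differentiable G z -> G z 0 i != 0 ->
  differentiable (fun z => dehomog i (G z)) z.
Proof.
move=> dG g0; apply: diff_mx => a k.
have -> : (fun z => dehomog i (G z) a k) = (fun z => G z 0 (lift i k) / G z 0 i).
  by apply/funext => y; rewrite mxE.
by apply: difdiv => //; exact: diff_entry.
Qed.

(** In homogeneous coordinates the derivative of a chart expression is the
    derivative modulo the radial direction. *)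
Lemma der_dehomog (V : normedModType C) (G : V -> Cn1) i (z v : V) : differentiable G z -> G z 0 i != 0 ->
  G z 0 i *: hlin i ('D_v (fun z => dehomog i (G z)) z) =
  'D_v G z - ('D_v G z 0 i / G z 0 i) *: G z.
Proof.
move=> dG g0; apply: (@row_split i) => [|k].
  by rewrite !mxE unlift_none mulr0 divfK // subrr.
rewrite mxE hlin_lift (der_mxP _ 0 k (dif_dehomog dG g0)).
have -> : (fun z => dehomog i (G z) 0 k) = (fun z => G z 0 (lift i k) / G z 0 i).
  by apply/funext => y; rewrite mxE.
rewrite derdiv //; try exact: diff_entry.
rewrite -!(der_mxP _ _ _ dG) !mxE; field; exact: g0.
Qed.

(** Being an eigenvector is polynomial in [x], so it spreads from the ball to the whole chart.
    Comparing the eigenvalues at 0, [e k] and [- e k] shows that they agree. *)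
Lemma scalar_of_eigen (A : 'M[C]_n.+1) i x0 (r : R) : 0 < r ->
  (forall x, nrm (x - x0) < r -> exists c, homog i x *m A = c *: homog i x) ->
  exists c, A = c%:M.
Proof.
move=> r0 H.
have dh x j : differentiable (fun x => homog i x 0 j) x by apply: diff_entry; exact: dif_homog.
have dA x j : differentiable (fun x => (homog i x *m A) 0 j) x.
  by apply: diff_entry; apply: dif_mulmxr; exact: dif_homog.
have E x : homog i x *m A = (homog i x *m A) 0 i *: homog i x.
  apply/rowP => j; rewrite [RHS]mxE.
  pose q (x : Cn) := (homog i x *m A) 0 j - (homog i x *m A) 0 i * homog i x 0 j.
  have qh p : hol q x0 p by move=> y _; apply: difB => //; apply: difM.
  apply/eqP; rewrite -subr_eq0; apply/eqP.
  apply: (@identity_ball _ _ q x0 (nrm (x - x0) + 1) x0 r (qh _)) => //.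
  - by apply: bl_center; rewrite ltr_wpDl.
  - move=> y /H [c Ec]; rewrite /q Ec !mxE unlift_none; ring.
  - by rewrite /bl ltrDl ltr01.
pose e k : Cn := delta_mx 0 k.
pose l x := (homog i x *m A) 0 i.
have h0 : homog i (0 : Cn) *m A = l 0 *: homog i 0 := E 0.
have hk k : hlin i (e k) *m A = l 0 *: hlin i (e k).
  have he : homog i (e k) = homog i 0 + hlin i (e k) by rewrite -homogD add0r.
  have hne : homog i (- e k) = homog i 0 - hlin i (e k).
    by rewrite -[- e k]add0r homogD -scaleN1r hlinZ scaleN1r.
  have e1 := E (e k); have e2 := E (- e k).
  rewrite -/(l _) he mulmxDl h0 in e1; rewrite -/(l _) hne mulmxBl h0 in e2.
  have [a aE] : exists a, a = hlin i (e k) *m A by exists (hlin i (e k) *m A).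
  rewrite -aE in e1 e2 *.
  have ai := congr1 (fun v : Cn1 => v 0 i) e1; have bi := congr1 (fun v : Cn1 => v 0 i) e2.
  have al := congr1 (fun v : Cn1 => v 0 (lift i k)) e1.
  have bl := congr1 (fun v : Cn1 => v 0 (lift i k)) e2.
  move: ai bi al bl; rewrite !mxE !unlift_none !liftK !mxE !eqxx /=.
  rewrite !mulr0 !mulr1 !addr0 !add0r !subr0 !mulr1 mulrN1 => ai bi al /oppr_inj bl.
  have m2 : l (e k) = l 0.
    apply/eqP; rewrite -subr_eq0; have : 2 * (l (e k) - l 0) = 0.
      have -> : 2 * (l (e k) - l 0) = (l (e k) - l 0) + l (e k) - l 0 by ring.
      by rewrite -{1}ai -al bl -bi; ring.
    by move/eqP; rewrite mulf_eq0 pnatr_eq0.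
  by move: e1; rewrite m2 scalerDr => /addrI.
exists (l 0); apply/row_matrixP => j; rewrite !rowE.
case: (unliftP i j) => [k ->|->].
  have -> : delta_mx 0 (lift i k) = hlin i (e k).
    apply: (@row_split i) => [|k']; first by rewrite hlin_i mxE (negbTE (neq_lift i k)) andbF.
    by rewrite hlin_lift !mxE (inj_eq (@lift_inj _ i)).
  by rewrite hk mul_mx_scalar.
have -> : delta_mx 0 i = homog i (0 : Cn).
  apply: (@row_split i) => [|k']; first by rewrite homog_i mxE !eqxx.
  by rewrite homog_lift !mxE eq_sym (negbTE (neq_lift i k')) andbF.
by rewrite h0 mul_mx_scalar.
Qed.

(** The right action [v |-> v B] on rows, read in the affine charts. *)
Definition mxvf B : vfield R n := fun i z =>
  \row_k ((homog i z *m B) 0 (lift i k) - z 0 k * (homog i z *m B) 0 i).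

Lemma mxvfE B i z k : mxvf B i z 0 k =
  (homog i z *m B) 0 (lift i k) - z 0 k * (homog i z *m B) 0 i.
Proof. by rewrite mxE. Qed.

Lemma hlin_mxvf B i z : hlin i (mxvf B i z) =
  homog i z *m B - (homog i z *m B) 0 i *: homog i z.
Proof.
apply: (@row_split i) => [|k]; rewrite [RHS]mxE [X in _ + X]mxE [X in _ - X]mxE.
  by rewrite hlin_i homog_i mulr1 subrr.
by rewrite hlin_lift homog_lift mxE mulrC.
Qed.

Lemma hlin_inj i : injective (hlin i).
Proof.
by move=> w w' E; apply/rowP => k; rewrite -!(hlin_lift i) E.
Qed.

(** Scalars act by the radial field, which is invisible in charts; conversely equal fields make
    every [homog 0 x] an eigenvector of the difference. *)
Lemma mxvfP B B' : mxvf B = mxvf B' <-> exists c, B - B' = c%:M.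
Proof.
split=> [E|[c E]]; last first.
  apply/funext => i; apply/funext => z; apply: (@hlin_inj i); rewrite !hlin_mxvf.
  have -> : B = B' + c%:M by rewrite -E addrC subrK.
  rewrite mulmxDr mul_mx_scalar; move: (homog i z *m B') => P.
  have -> : (P + c *: homog i z) 0 i = P 0 i + c.
    by rewrite [LHS]mxE [X in _ + X]mxE homog_i mulr1.
  by rewrite scalerDl opprD addrACA subrr addr0.
apply: (@scalar_of_eigen _ 0 0 1 ltr01) => x _.
exists ((homog 0 x *m B) 0 0 - (homog 0 x *m B') 0 0).
have := hlin_mxvf B 0 x; rewrite E hlin_mxvf mulmxBr scalerBl => e; apply/eqP.
by rewrite subr_eq -addrA (addrC (- _)) e addrC subrK.
Qed.

Lemma mxvfD B B' : mxvf (B + B') = (fun i z => mxvf B i z + mxvf B' i z).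
Proof.
apply/funext => i; apply/funext => z; apply/rowP => k.
have D j : (homog i z *m (B + B')) 0 j = (homog i z *m B) 0 j + (homog i z *m B') 0 j.
  by rewrite mulmxDr mxE.
by rewrite [RHS]mxE !mxvfE !D; ring.
Qed.

Lemma mxvfZ (a : C) B : mxvf (a *: B) = (fun i z => a *: mxvf B i z).
Proof.
apply/funext => i; apply/funext => z; apply/rowP => k.
have D j : (homog i z *m (a *: B)) 0 j = a * (homog i z *m B) 0 j by rewrite -scalemxAr mxE.
by rewrite [RHS]mxE !mxvfE !D; ring.
Qed.

Lemma dif_mxvf B i z : differentiable (mxvf B i) z.
Proof.
apply: diff_mx => a k.
have -> : (fun z => mxvf B i z a k) = (fun z => (homog i z *m B) 0 (lift i k) - z 0 k * (homog i z *m B) 0 i).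
  by apply/funext => y; rewrite mxE.
have dB j : differentiable (fun z => (homog i z *m B) 0 j) z.
  by apply: diff_entry; apply: dif_mulmxr; exact: dif_homog.
by apply: difB => //; apply: difM => //; apply: diff_entry.
Qed.

Lemma der_coord (w z : Cn) k : 'D_w (fun z : Cn => z 0 k) z = w 0 k.
Proof.
apply: (hasd_derive w (l := fun h : Cn => h 0 k)).
apply: (@hasd_quad _ _ _ _ _ _ 1 0 1 ltr01).
- by move=> a u v; rewrite !mxE.
- by move=> h; rewrite mul1r nrm_mx_entry.
by move=> h _; rewrite mxE (addrC (z 0 k)) addrK subrr nrm0 mul0r.
Qed.

(** The chart change is verified after applying the injective [hlin j], where both sides are the
    homogeneous field minus a radial term. *)
Lemma hol_CP_mxvf B : hol_CP (mxvf B).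
Proof.
split=> [i x _|i j z hj]; first exact: dif_mxvf.
have dh := dif_homog i z.
apply: (@hlin_inj j); apply: (scalerI hj).
have -> : dehomog j \o homog i = (fun z => dehomog j (homog i z)) by [].
rewrite (der_dehomog _ dh hj) der_homog hlin_mxvf hlin_mxvf.
have E := dehomogK hj; rewrite scalerBr scalemxAl -E scalerA.
set h := homog i z in E hj *; set c := h 0 j in E hj *.
have Ej : (homog j (dehomog j h) *m B) 0 j = (h *m B) 0 j / c.
  have -> : (h *m B) 0 j = c * (homog j (dehomog j h) *m B) 0 j.
    by rewrite {1}E -scalemxAl [LHS]mxE.
  by rewrite mulrC mulKf.
have Eh : homog j (dehomog j h) = c^-1 *: h by rewrite {2}E scalerA mulVf // scale1r.
rewrite Ej Eh [in LHS]scalerA (_ : c * ((h *m B) 0 j / c) / c = (h *m B) 0 j / c); last by field.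
have -> : (h *m B - (h *m B) 0 i *: h) 0 j = (h *m B) 0 j - (h *m B) 0 i * c.
  by rewrite [LHS]mxE [X in _ + X]mxE [X in - X]mxE.
rewrite mulrBl mulfK // scalerBl opprB addrCA [RHS]addrC -!addrA; congr (_ + _).
by rewrite addrCA addNr addr0.
Qed.

(** Matrices act on rows from the right, so the linear fields [v B] and [v B'] have bracket
    [v (B B' - B' B)], with no change of sign. *)
Lemma mxvf_bracket B B' : vf_bracket (mxvf B) (mxvf B') = mxvf (B *m B' - B' *m B).
Proof.
apply/funext => i; apply/funext => z; rewrite /vf_bracket /lie_bracket.
have D A w : 'D_w (mxvf A i) z = \row_k ((hlin i w *m A) 0 (lift i k)
   - w 0 k * (homog i z *m A) 0 i - z 0 k * (hlin i w *m A) 0 i).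
  apply/rowP => k; rewrite der_mxP; last exact: dif_mxvf.
  have -> : (fun z => mxvf A i z 0 k) = (fun z => (homog i z *m A) 0 (lift i k) - z 0 k * (homog i z *m A) 0 i).
    by apply/funext => y; rewrite mxE.
  have dA : differentiable (fun z => homog i z *m A) z by apply: dif_mulmxr; exact: dif_homog.
  have dAj j : differentiable (fun z => (homog i z *m A) 0 j) z by apply: diff_entry.
  have dz : differentiable (fun z : Cn => z 0 k) z by apply: diff_entry.
  rewrite derB //; last exact: difM.
  rewrite derM // -!(der_mxP _ _ _ dA) (der_mulmxr _ _ (dif_homog i z)) der_homog.
  rewrite der_coord.
  rewrite [RHS]mxE.
  move: ((hlin i w *m A) 0 (lift i k)) ((hlin i w *m A) 0 i) ((homog i z *m A) 0 i) => a b c.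
  by rewrite opprD addrA addrAC (mulrC c).
have Hk A A' k : (hlin i (mxvf A i z) *m A') 0 k =
   (homog i z *m (A *m A')) 0 k - (homog i z *m A) 0 i * (homog i z *m A') 0 k.
  by rewrite hlin_mxvf mulmxBl -mulmxA -scalemxAl !mxE.
have HB j : (homog i z *m (B *m B' - B' *m B)) 0 j =
  (homog i z *m (B *m B')) 0 j - (homog i z *m (B' *m B)) 0 j.
  by rewrite mulmxBr !mxE.
rewrite !D; apply/rowP => k; rewrite mxvfE !HB.
rewrite [LHS]mxE [X in X + _]mxE [X in _ + X]mxE [X in _ - X]mxE !Hk !mxvfE.
move: ((homog i z *m (B *m B')) 0 (lift i k)) ((homog i z *m (B *m B')) 0 i)
  ((homog i z *m (B' *m B)) 0 (lift i k)) ((homog i z *m (B' *m B)) 0 i)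
  ((homog i z *m B) 0 (lift i k)) ((homog i z *m B) 0 i)
  ((homog i z *m B') 0 (lift i k)) ((homog i z *m B') 0 i) (z 0 k) => a1 a2 a3 a4 a5 a6 a7 a8 a9.
by ring.
Qed.

End Charts.

(** * Functions with vanishing derivative *)

Section LocallyConstant.
Context {R : realType} {V : normedModType R[i]}.
Local Notation C := R[i].

(** With zero derivative an increment is quadratic in the step, so cutting a segment into [2 ^ m]
    pieces bounds the total by [K / 2 ^ m]. The identity theorem passes from a small ball to the
    given one. *)
Lemma hol_const (f : V -> C) a (p : R) : hol f a p ->
  (forall z, bl a p z -> forall u, 'D_u f z = 0) -> forall z, bl a p z -> f z = f a.
Proof.
move=> fh D0 z zp; have p0 : 0 < p by apply: le_lt_trans zp; exact: nrm_ge0.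
have [q /andP[q0 qp] [M M0 HM]] := hol_bounded p0 fh.
have fq : hol f a q by move=> y yq; apply: fh; exact: lt_le_trans yq qp.
have [K K0 [d d0 Hd]] := derive_bound q0 fq M0 HM.
have bisect m h (s t : R) : nrm h < q / 2 -> nrm h <= d -> 0 <= s -> 0 <= t -> s + t <= 1 ->
    nrm (f (a + (s + t)%:C *: h) - f (a + s%:C *: h)) <= K / 2 ^+ m * (t * nrm h) ^+ 2.
  move=> hq hd; elim: m s t => [|m IH] s t s0 t0 st.
    have nr (c : R) : 0 <= c -> nrm (c%:C *: h) = c * nrm h.
      by move=> c0; rewrite nrmZ nrm_real ger0_norm.
    have s1 : bl a (q / 2) (a + s%:C *: h).
      rewrite /bl addrAC subrr add0r nr //; apply: le_lt_trans hq.
      by rewrite ler_piMl //; lra.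
    have [_] := Hd _ (t%:C *: h) s1; rewrite nr //.
    have td : t * nrm h <= d by apply: le_trans hd; rewrite ler_piMl //; lra.
    move=> /(_ td); rewrite D0; last by apply: lt_le_trans s1 _; lra.
    by rewrite subr0 expr0 divr1 rmorphD scalerDl addrA.
  have t2 : 0 <= t / 2 by lra.
  have h1 := IH s (t / 2) s0 t2; have h2 := IH (s + t / 2) (t / 2).
  have e1 : s + t / 2 <= 1 by lra.
  have e2 : 0 <= s + t / 2 by lra.
  have e3 : s + t / 2 + t / 2 = s + t by lra.
  move: (h1 e1) (h2 e2 t2); rewrite e3 => {}h1 /(_ st) {}h2.
  apply: le_trans (nrm_tri (f (a + (s + t / 2)%:C *: h)) _ _) _.
  have -> : K / 2 ^+ m.+1 * (t * nrm h) ^+ 2 = K / 2 ^+ m * (t / 2 * nrm h) ^+ 2 + K / 2 ^+ m * (t / 2 * nrm h) ^+ 2.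
    by rewrite exprS; field; rewrite expf_neq0 // pnatr_eq0.
  exact: lerD.
pose e := Num.min (q / 2) d.
have e0 : 0 < e by rewrite lt_min divr_gt0.
have near h : nrm h < e -> f (a + h) - f a = 0.
  rewrite lt_min => /andP[hq hd]; apply/eqP; rewrite -nrm_eq0 eq_le nrm_ge0 andbT.
  rewrite leNgt; apply/negP => pos.
  have [m] := geom_small (K * nrm h ^+ 2) pos.
  have := bisect m h 0 1 hq (ltW hd) (lexx 0) ler01; rewrite add0r => /(_ (lexx 1)).
  by rewrite scale1r scale0r addr0 mul1r mulrAC => /le_lt_trans hh /hh; rewrite ltxx.
have fB : hol (fun z => f z - f a) a p by move=> y yp; apply: difB; [exact: fh|exact: difC].
apply/eqP; rewrite -subr_eq0; apply/eqP.
apply: (identity_ball fB (bl_center a p0) e0) zp => y ye.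
by have := near _ ye; rewrite [a + _]addrC subrK.
Qed.

End LocallyConstant.

(** * Fields with parallel second derivative *)

Section Projective.
Context {R : realType} {n : nat}.
Local Notation C := R[i].
Local Notation Cn := 'rV[R[i]]_n.
Local Notation e_ k := (delta_mx 0 k : 'rV[R[i]]_n).

(** Row and column [i] are singled out: they hold the constant and the quadratic part of the field,
    the latter negated because [mxvf] subtracts the radial term. *)
Definition quadmx (i : 'I_n.+1) (a : Cn) (A : 'M[C]_n) (m : 'cV[C]_n) : 'M[C]_n.+1 :=
  \matrix_(r, s) match unlift i r, unlift i s with
    | None, None => 0 | None, Some k => a 0 k
    | Some l, Some k => A l k | Some l, None => - m l 0 end.

Lemma mxvf_quadmx i a A m x :
  mxvf (quadmx i a A m) i x = a + x *m A + (x *m m) 0 0 *: x.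
Proof.
have E s : (homog i x *m quadmx i a A m) 0 s =
    quadmx i a A m i s + \sum_k x 0 k * quadmx i a A m (lift i k) s.
  rewrite mxE (bigD1_ord i) //= homog_i mul1r; congr (_ + _).
  by apply: eq_bigr => k _; rewrite homog_lift.
apply/rowP => k; rewrite mxvfE !E [RHS]mxE [X in _ = X + _]mxE [X in _ = _ + X + _]mxE.
have -> : quadmx i a A m i (lift i k) = a 0 k by rewrite /quadmx mxE unlift_none liftK.
have -> : quadmx i a A m i i = 0 by rewrite /quadmx mxE unlift_none.
have -> : \sum_k0 x 0 k0 * quadmx i a A m (lift i k0) (lift i k) = \sum_k0 x 0 k0 * A k0 k.
  by apply: eq_bigr => l _; rewrite /quadmx mxE !liftK.
have -> : \sum_k0 x 0 k0 * quadmx i a A m (lift i k0) i = - \sum_k0 x 0 k0 * m k0 0.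
  by rewrite -sumrN; apply: eq_bigr => l _; rewrite /quadmx mxE !liftK unlift_none mulrN.
rewrite [X in _ = _ + X]mxE [X in _ = _ + X * _]mxE.
by rewrite add0r mulrN opprK [x 0 k * _]mulrC.
Qed.

Lemma lin_row (W : normedModType C) (l : Cn -> W) u : lin l -> l u = \sum_k u 0 k *: l (e_ k).
Proof.
move=> ll; rewrite {1}[u]row_sum_delta.
have -> : forall s : seq 'I_n, l (\sum_(k <- s) u 0 k *: e_ k) = \sum_(k <- s) u 0 k *: l (e_ k).
  by elim=> [|k s IH]; rewrite ?big_nil ?(lin0 ll) // !big_cons ll IH.
by [].
Qed.

Lemma mx0E p q (k : 'I_p) (l : 'I_q) : (0 : 'M[C]_(p, q)) k l = 0.
Proof. by rewrite mxE. Qed.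

Lemma hasd_affine_row (l : Cn -> C) x0 z (K : R) : lin l -> (forall h, nrm (l h) <= K * nrm h) ->
  hasd (fun z => l (z - x0)) z l.
Proof.
move=> ll lK; apply: (@hasd_quad _ _ _ _ _ _ K 0 1 ltr01) => // h _.
have -> : z + h - x0 = (z - x0) + h by rewrite addrAC.
by rewrite (linD (z - x0) h ll) (addrC (l (z - x0))) addrK subrr nrm0 mul0r.
Qed.

Lemma lin_mulmxr (m : 'cV[C]_n) : lin (fun h : Cn => (h *m m) 0 0).
Proof. by move=> a u w; rewrite mulmxDl -scalemxAl mxE [X in X + _]mxE. Qed.

Lemma hasd_mulc (m : 'cV[C]_n) x0 z :
  hasd (fun z : Cn => ((z - x0) *m m) 0 0) z (fun h => (h *m m) 0 0).
Proof.
apply: (@hasd_affine_row (fun h : Cn => (h *m m) 0 0) x0 z (n%:R * nrm m)) => [|h].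
  exact: lin_mulmxr.
by apply: le_trans (nrm_mx_entry _ _ _) _; rewrite mulrAC; exact: nrm_mulmx.
Qed.

Lemma hasd_coordB x0 z k : hasd (fun z : Cn => (z - x0) 0 k) z (fun h => h 0 k).
Proof.
apply: (@hasd_affine_row (fun h : Cn => h 0 k) x0 z 1) => [a u w|h]; first by rewrite !mxE.
by rewrite mul1r nrm_mx_entry.
Qed.

(** The second derivative is constant in [x], so two integrations by [hol_const] give a quadratic
    polynomial in [x - x0]; expanding it about 0 gives the entries of [quadmx]. *)
Lemma quad_field (v : Cn -> Cn) i x0 (r : R) (lam : 'cV[C]_n) :
  (forall k, hol (fun z => v z 0 k) x0 r) ->
  (forall x k u w, bl x0 r x -> 'D_w (fun z => 'D_u (fun z => v z 0 k) z) x =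
     2^-1 * ((u *m lam) 0 0 * w 0 k + (w *m lam) 0 0 * u 0 k)) ->
  exists B, forall x, bl x0 r x -> v x = mxvf B i x.
Proof.
move=> vh D2.
pose A : 'M[C]_n := \matrix_(l, k) 'D_(e_ l) (fun z => v z 0 k) x0.
pose ml : 'cV[C]_n := (2^-1 : C) *: lam.
have mlE u : (u *m ml) 0 0 = 2^-1 * (u *m lam) 0 0 by rewrite /ml -scalemxAr mxE.
have key x : bl x0 r x -> v x = v x0 + (x - x0) *m A + ((x - x0) *m ml) 0 0 *: (x - x0).
  move=> xr; apply/rowP => k.
  have r0 : 0 < r by apply: le_lt_trans xr; exact: nrm_ge0.
  have x00 := bl_center x0 r0.
  have [dm dmE] : (forall z, differentiable (fun z : Cn => ((z - x0) *m ml) 0 0) z) /\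
      forall z w, 'D_w (fun z : Cn => ((z - x0) *m ml) 0 0) z = (w *m ml) 0 0.
    by split=> [z|z w]; [have [] := hasd_diff (hasd_mulc ml x0 z)|exact: (hasd_derive w (hasd_mulc ml x0 z))].
  have [dA dAE] : (forall z, differentiable (fun z : Cn => ((z - x0) *m col k A) 0 0) z) /\
      forall z w, 'D_w (fun z : Cn => ((z - x0) *m col k A) 0 0) z = (w *m col k A) 0 0.
    by split=> [z|z w]; [have [] := hasd_diff (hasd_mulc (col k A) x0 z)|exact: (hasd_derive w (hasd_mulc (col k A) x0 z))].
  have [dk dkE] : (forall z, differentiable (fun z : Cn => (z - x0) 0 k) z) /\
      forall z w, 'D_w (fun z : Cn => (z - x0) 0 k) z = w 0 k.
    by split=> [z|z w]; [have [] := hasd_diff (hasd_coordB x0 z k)|exact: (hasd_derive w (hasd_coordB x0 z k))].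
  have Z1 (m : 'cV[C]_n) : ((x0 - x0) *m m) 0 0 = 0 by rewrite subrr mul0mx mx0E.
  have Z2 : (x0 - x0) 0 k = 0 by rewrite subrr mx0E.
  have E1 u z : bl x0 r z -> 'D_u (fun z => v z 0 k) z =
      (u *m col k A) 0 0 + ((z - x0) *m ml) 0 0 * u 0 k + (u *m ml) 0 0 * (z - x0) 0 k.
    move=> zr; have hu := hol_derive u (vh k).
    pose F z := 'D_u (fun z => v z 0 k) z - (((z - x0) *m ml) 0 0 * u 0 k + (u *m ml) 0 0 * (z - x0) 0 k).
    have d1 z' : differentiable (fun z : Cn => ((z - x0) *m ml) 0 0 * u 0 k) z' by apply: difM => //; exact: difC.
    have d2 z' : differentiable (fun z : Cn => (u *m ml) 0 0 * (z - x0) 0 k) z' by apply: difM => //; exact: difC.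
    have FE : F z = F x0.
      apply: (@hol_const _ _ F x0 r) zr => [y yr|y yr w].
        by apply: difB; [exact: hu|apply: difD].
      rewrite /F derB; [|exact: hu|exact: difD].
      rewrite (D2 _ _ _ _ yr) derD //.
      have -> : 'D_w (fun z : Cn => ((z - x0) *m ml) 0 0 * u 0 k) y = (w *m ml) 0 0 * u 0 k.
        by rewrite derM ?derC ?dmE ?mulr0 ?add0r 1?mulrC //; exact: difC.
      have -> : 'D_w (fun z : Cn => (u *m ml) 0 0 * (z - x0) 0 k) y = (u *m ml) 0 0 * w 0 k.
        by rewrite derM ?derC ?dkE ?mulr0 ?addr0 //; exact: difC.
      by rewrite !mlE; ring.
    move: FE; rewrite /F Z1 Z2; move: ('D_u _ z) ('D_u _ x0) (lin_row u (deriveP_lin (vh k _ x00))) => D1 D0 D0E.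
    have -> : (u *m col k A) 0 0 = D0.
      by rewrite D0E mxE; apply: eq_bigr => l _; rewrite !mxE.
    move: ((z - x0) *m ml) ((u *m ml) 0 0) ((z - x0) 0 k) => p q t.
    rewrite mul0r mulr0 addr0 subr0 => <-; ring.
  pose F z := v z 0 k - (((z - x0) *m col k A) 0 0 + ((z - x0) *m ml) 0 0 * (z - x0) 0 k).
  have FE : F x = F x0.
    apply: (@hol_const _ _ F x0 r) xr => [y yr|y yr w].
      by apply: difB; [exact: vh|apply: difD => //; exact: difM].
    rewrite /F derB; [|exact: vh|by apply: difD => //; exact: difM].
    rewrite derD //; last exact: difM.
    by rewrite derM // E1 // dmE dkE dAE; ring.
  move: FE; rewrite /F !Z1 Z2 mulr0 addr0 subr0.
  move=> /(congr1 (fun t => t + (((x - x0) *m col k A) 0 0 + ((x - x0) *m ml) 0 0 * (x - x0) 0 k))).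
  rewrite subrK addrA => ->; rewrite [RHS]mxE [X in _ = X + _]mxE [X in _ = _ + X]mxE.
  by congr (_ + _ + _); rewrite !mxE; apply: eq_bigr => l _; rewrite !mxE.
exists (quadmx i (v x0 - x0 *m A + (x0 *m ml) 0 0 *: x0) (A - ((x0 *m ml) 0 0)%:M - ml *m x0) ml).
move=> x xr; rewrite mxvf_quadmx (key x xr) !mulmxBl !mulmxBr mulmxA.
have -> : (x *m ml *m x0 : Cn) = (x *m ml) 0 0 *: x0.
  by rewrite -mul_scalar_mx -mx11_scalar.
have -> : (x *m ml - x0 *m ml) 0 0 = (x *m ml) 0 0 - (x0 *m ml) 0 0 by rewrite !mxE.
rewrite mul_mx_scalar.
move: (v x0) (x *m A) (x0 *m A) ((x *m ml) 0 0) ((x0 *m ml) 0 0) => v0 p q s t.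
by apply/rowP => k; rewrite !mxE; ring.
Qed.

End Projective.

Section Projective2.
Context {R : realType} {n : nat}.
Local Notation C := R[i].
Local Notation Cn := 'rV[R[i]]_n.
Local Notation e_ k := (delta_mx 0 k : 'rV[R[i]]_n).

Lemma mxDE p q (A B : 'M[C]_(p, q)) i j : (A + B) i j = A i j + B i j. Proof. by rewrite mxE. Qed.
Lemma mxNE p q (A : 'M[C]_(p, q)) i j : (- A) i j = - A i j. Proof. by rewrite mxE. Qed.
Lemma mxZE p q (c : C) (A : 'M[C]_(p, q)) i j : (c *: A) i j = c * A i j. Proof. by rewrite mxE. Qed.

Lemma dif_coord (z : Cn) k : differentiable (fun z : Cn => z 0 k) z.
Proof. exact: diff_entry. Qed.

Lemma dif_lin_scal (l : Cn -> C) z : lin l -> differentiable l z.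
Proof.
move=> ll; have -> : l = (fun u => \sum_k u 0 k * l (e_ k)).
  by apply/funext => u; rewrite {1}(lin_row u ll).
by apply: difsum => k; apply: difM; [exact: dif_coord|exact: difC].
Qed.

Lemma dif_mulc (m : 'cV[C]_n) (z : Cn) : differentiable (fun z : Cn => (z *m m) 0 0) z.
Proof.
have [+ _] := hasd_diff (hasd_mulc m 0 z).
by congr (differentiable _ _); apply/funext => y; rewrite subr0.
Qed.

Lemma mulmx_deltac (u : Cn) k : (u *m (delta_mx k 0 : 'cV[C]_n)) 0 0 = u 0 k.
Proof. by rewrite -colE mxE. Qed.

Lemma delta_diag (k : 'I_n) : (e_ k) 0 k = 1.
Proof. by rewrite mxE !eqxx. Qed.

Section Parallel.
Variables (B : Cn -> Cn -> Cn).
Hypothesis linl : forall w, lin (fun u => B u w).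
Hypothesis linr : forall u, lin (B u).
Hypothesis symB : forall u w, B u w = B w u.

Lemma dif_quad z j : differentiable (fun u => B u u 0 j) z.
Proof.
have -> : (fun u => B u u 0 j) = (fun u => \sum_k u 0 k * B u (e_ k) 0 j).
  apply/funext => u; rewrite {1}(lin_row u (linr u)) summxE.
  by apply: eq_bigr => k _; rewrite mxE.
apply: difsum => k; apply: difM; first exact: dif_coord.
by apply: dif_lin_scal => a u w; rewrite linl !mxE.
Qed.

(** The covectors near [eta0] annihilating [u] already span the annihilator of [u], for [u] near
    [u0]. The resulting minors are polynomial in [u], so they vanish for every [u]. *)
Lemma parallel_near (eta0 : 'cV[C]_n) (u0 : Cn) k (r : R) : 0 < r -> u0 *m eta0 = 0 -> u0 0 k != 0 ->
  (forall (eta : 'cV[C]_n) u, nrm (eta - eta0) < r -> u *m eta = 0 -> B u u *m eta = 0) ->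
  forall u j, B u u 0 j * u 0 k = B u u 0 k * u 0 j.
Proof.
move=> r0 u0e uk HB.
pose s (u : Cn) : C := (u *m eta0) 0 0 / u 0 k.
have ds : differentiable s u0 by apply: difdiv => //; [exact: dif_mulc|exact: dif_coord].
have r2 : 0 < r / 2 by lra.
have [d d0 Hd] := (iffLR (cont_nrmP _ _)) (differentiable_continuous ds) (r / 2) r2.
have uk2 : 0 < nrm (u0 0 k) by rewrite nrm_gt0.
have [d' d'0 Hd'] := (iffLR (cont_nrmP _ _)) (differentiable_continuous (dif_coord u0 k)) _ uk2.
have s0 : s u0 = 0 by rewrite /s u0e mx0E mul0r.
have near (u : Cn) j : nrm (u - u0) < Num.min d d' -> B u u 0 j * u 0 k - B u u 0 k * u 0 j = 0.
  rewrite lt_min => /andP[/Hd hs /Hd' hk].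
  have uk0 : u 0 k != 0.
    by apply/eqP => u00; move: hk; rewrite u00 sub0r nrmN ltxx.
  (* [eta0] corrected in coordinate [k] so as to annihilate [u]; the correction is small because it
     vanishes at [u0]. *)
  pose eta1 : 'cV[C]_n := eta0 - s u *: delta_mx k 0.
  have e1u : u *m eta1 = 0.
    rewrite mulmxBr -scalemxAr; apply/matrixP => a b; rewrite !ord1 mxDE mxNE mxZE.
    by rewrite mulmx_deltac divfK // subrr mx0E.
  have nd : nrm (delta_mx k 0 : 'cV[C]_n) <= 1.
    by apply: nrm_mx_le => // a b; rewrite mxE; case: (_ && _); rewrite ?nrm1 ?nrm0.
  have e1n : nrm (eta1 - eta0) < r / 2.
    rewrite /eta1 addrAC subrr add0r nrmN nrmZ; move: hs; rewrite s0 subr0; apply: le_lt_trans.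
    by rewrite ler_piMr.
  (* The annihilator of [u] in coordinates [j] and [k]. Subtracting the conditions for [eta1] and
     [eta1 + c tau] isolates the minor wanted. *)
  pose tau : 'cV[C]_n := u 0 k *: delta_mx j 0 - u 0 j *: delta_mx k 0.
  have tu (w : Cn) : (w *m tau) 0 0 = w 0 j * u 0 k - w 0 k * u 0 j.
    by rewrite mulmxBr -!scalemxAr mxDE mxNE !mxZE !mulmx_deltac; ring.
  pose c : R := r / 2 / (nrm tau + 1).
  have t1 : 0 < nrm tau + 1 by rewrite ltr_wpDl.
  have c0 : 0 < c by rewrite divr_gt0.
  have e2n : nrm (eta1 + c%:C *: tau - eta0) < r.
    rewrite addrAC; apply: le_lt_trans (nrmD _ _) _.
    rewrite nrmZ nrm_real gtr0_norm //.
    have : c * nrm tau <= r / 2.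
      by rewrite /c mulrAC -mulrA ler_piMr ?ltW // ltr_pdivrMr // mul1r ltrDl.
    by move: e1n; clear; lra.
  have e2u : u *m (eta1 + c%:C *: tau) = 0.
    rewrite mulmxDr e1u add0r -scalemxAr.
    have -> : u *m tau = 0 by apply/matrixP => a b; rewrite !ord1 tu mx0E mulrC subrr.
    by rewrite scaler0.
  have e1n' : nrm (eta1 - eta0) < r by move: e1n r0; clear; lra.
  have := HB _ _ e2n e2u; rewrite mulmxDr (HB _ _ e1n' e1u) add0r -scalemxAr.
  move=> /eqP; rewrite scaler_eq0 => /orP[/eqP c00|/eqP bt].
    by move: c0; rewrite (_ : c = 0) ?ltxx //; case: c00.
  by rewrite -tu bt mx0E.
move=> u j; apply/eqP; rewrite -subr_eq0; apply/eqP.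
have dm : 0 < Num.min d d' by rewrite lt_min d0.
apply: (@identity_ball _ _ (fun u => B u u 0 j * u 0 k - B u u 0 k * u 0 j) u0 (nrm (u - u0) + 1) u0 _ _ _ dm).
- by move=> z _; apply: difB; apply: difM; (exact: dif_quad || exact: dif_coord).
- by apply: bl_center; rewrite ltr_wpDl.
- by move=> z zd; apply: near.
by rewrite /bl ltrDl.
Qed.

Definition quad_coef k (u : Cn) : C := 2 * B u (e_ k) 0 k - u 0 k * B (e_ k) (e_ k) 0 k.

Lemma quad_coef_lin k : lin (quad_coef k).
Proof.
move=> a u w; rewrite /quad_coef linl; move: (B u _) (B w _) (B (e_ k) _) => p q t.
by rewrite !mxE -[a *: (2 * _ - _)]/(a * _); ring.
Qed.

(** The [k]-th coordinate of [B u u] vanishes with [u 0 k]. Expanding at [u - u_k e_k] therefore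
    divides it by [u 0 k], and the quotient is the linear form [quad_coef k]. *)
Lemma quad_parallel k : (forall u j, B u u 0 j * u 0 k = B u u 0 k * u 0 j) ->
  forall u, B u u = quad_coef k u *: u.
Proof.
move=> F.
have Q0 (u : Cn) : u 0 k = 0 -> B u u 0 k = 0.
  move=> uk; have [->|] := eqVneq u 0; first by rewrite (lin0 (linr 0)) mx0E.
  move=> u0; apply/eqP; move: u0; apply: contraNT => bk; apply/eqP/rowP => j; rewrite mx0E; apply/eqP.
  by have := F u j; rewrite uk mulr0 => /esym/eqP; rewrite mulf_eq0 (negPf bk).
have DD u w : B (u + w) (u + w) = B u u + 2%:R *: B u w + B w w.
  rewrite (linD _ _ (linr _)) (linD u w (linl u)) (linD u w (linl w)) (symB w u).
  by rewrite scaler_nat mulr2n !addrA.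
have ZZ a u : B (a *: u) (a *: u) = a ^+ 2 *: B u u.
  by rewrite (linZ _ _ (linr _)) (linZ _ _ (linl _)) scalerA expr2.
have Qk (u : Cn) : B u u 0 k = u 0 k * quad_coef k u.
  have := Q0 (u + (- u 0 k) *: e_ k).
  rewrite mxDE mxZE delta_diag mulr1 subrr => /(_ erefl).
  rewrite DD ZZ (linZ _ _ (linr _)) /quad_coef.
  move: (B u u) (B u (e_ k)) (B (e_ k) (e_ k)) => p q t.
  rewrite !mxE => h; apply/eqP; rewrite -subr_eq0 -h; apply/eqP; ring.
have Qn (u : Cn) : u 0 k != 0 -> B u u = quad_coef k u *: u.
  move=> uk; apply/rowP => j; rewrite mxE; apply: (mulIf uk).
  by rewrite F Qk; ring.
move=> u; have [uk|/Qn //] := eqVneq (u 0 k) 0.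
(* Where [u 0 k = 0] division is impossible; the parallelogram identity with [u + e_k], [u - e_k]
   and [e_k] recovers the value at [u]. *)
have L1 := Qn (u + e_ k); have L2 := Qn (u + (-1) *: e_ k); have L3 := Qn (e_ k).
move: L1 L2 L3; rewrite !DD ZZ (linZ _ _ (linr _)).
rewrite !(linD u _ (@quad_coef_lin k)) (linZ _ _ (@quad_coef_lin k)).
rewrite !mxDE mxZE delta_diag uk !add0r mulr1 oppr_eq0 oner_neq0.
move=> /(_ isT) L1 /(_ isT) L2 /(_ isT) L3.
apply/rowP => j; move/rowP: L1 => /(_ j); move/rowP: L2 => /(_ j); move/rowP: L3 => /(_ j).
move: (e_ k) => e.
move: (B u u) (B u e) (B e e) (quad_coef k u) (quad_coef k e) => p q t s m.
rewrite !mxE -[-1 *: m]/(-1 * m) => h3 h2 h1.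
have : 2 * (p 0 j) = 2 * (s * u 0 j).
  have E : (p 0 j + 2 * (-1 * q 0 j) + (-1) ^+ 2 * t 0 j) + (p 0 j + 2 * q 0 j + t 0 j) - 2 * t 0 j = 2 * p 0 j by ring.
  by rewrite -E h2 h1 h3; ring.
by apply: mulfI; rewrite pnatr_eq0.
Qed.

End Parallel.

(** [mu] stands for the derivative of the factor [lam], and the hypothesis is the symmetry of third
    derivatives. Testing it on an index different from [a] gives [mu a a = 0] and
    [2 mu c a = mu a c], whence zero. *)
Lemma third_sym (mu : 'I_n -> 'I_n -> C) : (1 < n)%N ->
  (forall c u w j, mu c u * (e_ w) 0 j + mu c w * (e_ u) 0 j = mu w u * (e_ c) 0 j + mu w c * (e_ u) 0 j) ->
  forall a b, mu a b = 0.
Proof.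
move=> n1 Hm.
have ne (a c : 'I_n) : a != c -> (e_ a) 0 c = 0.
  by move=> ac; rewrite mxE [c == a]eq_sym (negPf ac) andbF.
have D a c : a != c -> mu a a = 0.
  move=> ac; have := Hm c a a c; rewrite ne // delta_diag !mulr0 !addr0 mulr1.
  by move=> <-.
have E a c : a != c -> 2 * mu c a = mu a c.
  move=> ac; have := Hm c a a a; rewrite delta_diag (ne c a) 1?eq_sym // mulr0 !mulr1 add0r.
  by move=> <-; ring.
move=> a b; have [<-|ab] := eqVneq a b.
  have [c ca] : exists c : 'I_n, c != a.
    case: (eqVneq a (Ordinal (ltnW n1))) => [->|h]; last by exists (Ordinal (ltnW n1)); rewrite eq_sym.
    by exists (Ordinal n1).
  by apply: (@D a c); rewrite eq_sym.
have h1 := E a b ab; have := E b a; rewrite eq_sym => /(_ ab) h2.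
have : 3 * mu a b = 0.
  have -> : 3 * mu a b = 2 * (2 * mu a b) - mu a b by ring.
  by rewrite h2 h1 subrr.
by move=> /eqP; rewrite mulf_eq0 pnatr_eq0 => /eqP.
Qed.

End Projective2.

(** * Fields preserving incidence with hyperplanes *)

Section Projective3.
Context {R : realType} {n : nat}.
Local Notation C := R[i].
Local Notation Cn := 'rV[R[i]]_n.
Local Notation e_ k := (delta_mx 0 k : 'rV[R[i]]_n).

Lemma derMr (V : normedModType C) (f : V -> C) (c : C) x v : differentiable f x ->
  'D_v (fun z => f z * c) x = 'D_v f x * c.
Proof.
move=> df; apply: (etrans (derM v df (difC c x))).
by rewrite derC mulr0 add0r mulrC.
Qed.

Lemma derMl (V : normedModType C) (f : V -> C) (c : C) x v : differentiable f x ->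
  'D_v (fun z => c * f z) x = c * 'D_v f x.
Proof.
move=> df; apply: (etrans (derM v (difC c x) df)).
by rewrite derC mulr0 addr0.
Qed.

Lemma der_line0 (V : normedModType C) (g : V -> C) x u (d : R) : 0 < d -> differentiable g x ->
  (forall t : C, nrm t < d -> g (x + t *: u) = 0) -> 'D_u g x = 0.
Proof.
move=> d0 dg g0.
have dg' : differentiable g (x + 0 *: u) by rewrite scale0r addr0.
have h1 := hasd_line (diff_hasD dg').
have := hasd_derive (1 : C) h1; rewrite scale1r scale0r addr0 => <-.
have h0 (y : C) : nrm (y - 0) < d -> (fun _ : C => 0 : C) y = g (x + y *: u).
  by rewrite subr0 => /g0 ->.
have dz : differentiable (fun _ : C => 0 : C) (0 : C) by exact: (@difC _ _ _ (0 : C)).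
by rewrite -(der_ext (1 : C) d0 h0 dz) derC.
Qed.

Lemma sum_halves (a b c d e : R) : b <= c + d -> c < (e - a) / 2 -> d < (e - a) / 2 -> a + b < e.
Proof. by lra. Qed.

(** The normal covector of the hyperplane [y] in the chart [i]; the omitted entry [y i 0] is the
    constant term of its affine equation. *)
Definition low i (y : 'cV[C]_n.+1) : 'cV[C]_n := \col_k y (lift i k) 0.

Lemma homog_low i x y : (homog i x *m y) 0 0 = y i 0 + (x *m low i y) 0 0.
Proof.
rewrite mxE (bigD1_ord i) //= homog_i mul1r [in RHS]mxE; congr (_ + _).
by apply: eq_bigr => k _; rewrite homog_lift [low _ _ _ _]mxE.
Qed.

Lemma hlin_low i x y : (hlin i x *m y) 0 0 = (x *m low i y) 0 0.
Proof.
rewrite mxE (bigD1_ord i) //= hlin_i mul0r add0r [in RHS]mxE.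
by apply: eq_bigr => k _; rewrite hlin_lift [low _ _ _ _]mxE.
Qed.

Lemma mx11P (A B : 'M[C]_1) : A 0 0 = B 0 0 -> A = B.
Proof. by move=> h; apply/matrixP => a b; rewrite !ord1. Qed.

Definition hess (v : Cn -> Cn) (x u w : Cn) : Cn :=
  \row_j 'D_w (fun z => 'D_u (fun z => v z 0 j) z) x.

Lemma hessE v x u w (a : 'I_1) j : hess v x u w a j = 'D_w (fun z => 'D_u (fun z => v z 0 j) z) x.
Proof. by rewrite mxE. Qed.

Section Local.
Variables (v : Cn -> Cn) (i : 'I_n.+1) (x0 : Cn) (r : R) (y0 : 'cV[C]_n.+1).
Hypothesis r0 : 0 < r.
Hypothesis vh : forall k, hol (fun z => v z 0 k) x0 r.
(** Infinitesimally, [v] moves the hyperplane [y] to a hyperplane, with velocity [b] independent of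
    the point [x] on it. *)
Hypothesis inc : forall y, nrm (y - y0) < r -> exists b : 'cV[C]_n.+1, forall x, bl x0 r x ->
  homog i x *m y = 0 -> hlin i (v x) *m y + homog i x *m b = 0.

Let ball_sub x : bl x0 r x -> 0 < r - nrm (x - x0) /\ forall f : Cn -> C, hol f x0 r -> hol f x (r - nrm (x - x0)).
Proof.
by move=> xr; split=> [|f fh]; [rewrite subr_gt0|apply: (hol_shift fh); rewrite addrC subrK].
Qed.

Let symB x u w : bl x0 r x -> hess v x u w = hess v x w u.
Proof.
move=> xr; have [p0 sub] := ball_sub xr.
apply/rowP => j; have h3 := derive_comm u w p0 (sub _ (vh j)).
apply: (etrans (hessE v x u w 0 j)); apply: (etrans _ (esym (hessE v x w u 0 j))).
exact: h3.
Qed.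

Let linr x u : bl x0 r x -> lin (hess v x u).
Proof.
move=> xr a w w'; apply/rowP => j; have h := deriveP_lin (hol_derive u (vh j) xr) a w w'; rewrite mxDE mxZE.
apply: (etrans (hessE v x u (a *: w + w') 0 j)); apply: (etrans h).
by congr (_ *: _ + _); apply/esym/(hessE v x u).
Qed.

Let linl x w : bl x0 r x -> lin (fun u => hess v x u w).
Proof.
by move=> xr a u u'; rewrite !(symB _ w xr); exact: linr.
Qed.

Let eta0 := low i y0.

(** Along a line of direction [u] inside the hyperplane, [v] paired with [eta] plus an affine
    function vanishes identically; the second derivative removes the affine function and the unknown
    [b] with it. *)
Lemma second_der_incidence : homog i x0 *m y0 = 0 -> exists2 r1 : R, 0 < r1 <= r & forall x (eta : 'cV[C]_n) u, bl x0 r1 x ->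
  nrm (eta - eta0) < r1 -> u *m eta = 0 -> hess v x u u *m eta = 0.
Proof.
move=> xy0.
(* [(K - 1) * r1] bounds the change of the constant term [x *m eta] when [x] and [eta] each move by
   less than [r1], with [r1] at most 1. *)
pose K : R := n%:R * (nrm eta0 + nrm x0 + 1) + 1.
have K1 : 1 <= K by rewrite lerDr mulr_ge0 // addr_ge0 // addr_ge0.
have K0 : 0 < K by apply: lt_le_trans K1.
pose r1 := Num.min 1 (r / (2 * K)).
have r10 : 0 < r1 by rewrite lt_min ltr01 divr_gt0 // mulr_gt0.
have r1K : K * r1 <= r / 2.
  have h : r1 <= r / (2 * K) by rewrite ge_min lexx orbT.
  have -> : r / 2 = K * (r / (2 * K)) by field; rewrite gt_eqF.
  by apply: ler_wpM2l => //; exact: ltW.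
have r11 : r1 <= 1 by rewrite ge_min lexx.
have r1r : r1 < r.
  apply: (@le_lt_trans _ _ (K * r1)); first by rewrite ler_peMl // ltW.
  by apply: le_lt_trans r1K _; move: r0; lra.
exists r1; first by rewrite r10 ltW.
move=> x eta u xr1 er1 ue.
have xr : bl x0 r x by apply: lt_trans xr1 r1r.
(* The hyperplane through [x] with normal [eta]. *)
pose y : 'cV[C]_n.+1 := \col_s (if unlift i s is Some k then eta k 0 else - (x *m eta) 0 0).
have yi : y i 0 = - (x *m eta) 0 0 by rewrite mxE unlift_none.
have yl : low i y = eta by apply/colP => k; rewrite !mxE liftK.
have yr : nrm (y - y0) < r.
  apply/nrm_mx_lt => // s b; rewrite [b]ord1 mxDE mxNE.
  case: (unliftP i s) => [k ->|->].
    have -> : y (lift i k) 0 - y0 (lift i k) 0 = (eta - eta0) k 0.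
      by rewrite mxDE mxNE /eta0 /low !mxE liftK.
    exact: le_lt_trans (nrm_mx_entry _ _ _) (lt_trans er1 r1r).
  have e0 : y0 i 0 = - (x0 *m eta0) 0 0.
    by have := congr1 (fun A : 'M[C]_1 => A 0 0) xy0; rewrite homog_low mx0E => /eqP; rewrite addr_eq0 => /eqP.
  rewrite yi e0 opprK addrC -mxNE -mxDE.
  have -> : x0 *m eta0 - x *m eta = - ((x - x0) *m eta0 + x *m (eta - eta0)).
    by rewrite mulmxBl mulmxBr; apply/mx11P; rewrite !(mxDE, mxNE); ring.
  apply: le_lt_trans (nrm_mx_entry _ _ _) _; rewrite nrmN.
  apply: le_lt_trans (nrmD _ _) _; apply: (@le_lt_trans _ _ (K * r1)); last by apply: le_lt_trans r1K _; move: r0; lra.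
  have h1 := nrm_mulmx (x - x0) eta0; have h2 := nrm_mulmx x (eta - eta0).
  have h3 : nrm x <= nrm x0 + 1.
    have := nrm_tri x0 x 0; rewrite !subr0 => h; apply: (le_trans h); rewrite addrC lerD2l.
    exact: ltW (lt_le_trans xr1 r11).
  have h4 : n%:R * nrm (x - x0) * nrm eta0 <= n%:R * r1 * nrm eta0.
    by apply: ler_wpM2r => //; apply: ler_wpM2l; [exact: ler0n|exact: ltW].
  have h5 : n%:R * nrm x * nrm (eta - eta0) <= n%:R * (nrm x0 + 1) * r1.
    apply: ler_pM => //; first by rewrite mulr_ge0.
      by apply: ler_wpM2l.
    exact: ltW.
  apply: le_trans (lerD h1 h2) _; apply: le_trans (lerD h4 h5) _.
  have -> : n%:R * r1 * nrm eta0 + n%:R * (nrm x0 + 1) * r1 = (K - 1) * r1 by rewrite /K; ring.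
  by apply: ler_wpM2r; [exact: ltW|rewrite gerBl].
have [b Hb] := inc yr.
pose g (z : Cn) := \sum_j v z 0 j * eta j 0 + (b i 0 + (z *m low i b) 0 0).
have dsum z : bl x0 r z -> differentiable (fun z => \sum_j v z 0 j * eta j 0) z.
  by move=> zr; apply: difsum => j; apply: difM; [exact: (vh j zr)|exact: difC].
have dlow z : differentiable (fun z : Cn => b i 0 + (z *m low i b) 0 0) z.
  by apply: difD; [exact: difC|exact: dif_mulc].
have gh z : bl x0 r z -> differentiable g z by move=> zr; apply: difD; [exact: dsum|exact: dlow].
have g0 (t : C) : bl x0 r (x + t *: u) -> g (x + t *: u) = 0.
  move=> tr; have := Hb _ tr _; rewrite /g.
  have xy : homog i (x + t *: u) *m y = 0.
    by apply: mx11P; rewrite homog_low yi yl mulmxDl -scalemxAl ue scaler0 addr0 addNr mx0E.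
  move=> /(_ xy) /(congr1 (fun A : 'M[C]_1 => A 0 0)).
  rewrite mxDE hlin_low homog_low yl mx0E => h; rewrite -[RHS]h; congr (_ + _).
  by rewrite mxE.
have Dg z : bl x0 r z -> 'D_u g z = \sum_j 'D_u (fun z => v z 0 j) z * eta j 0 + (u *m low i b) 0 0.
  move=> zr; rewrite derD; [|exact: dsum|exact: dlow].
  congr (_ + _).
    rewrite dersum; last by move=> j; apply: difM; [exact: (vh j zr)|exact: difC].
    apply: eq_bigr => j _; rewrite derM; [|exact: (vh j zr)|exact: difC].
    by rewrite derC mulr0 add0r mulrC.
  rewrite derD; [|exact: difC|exact: dif_mulc].
  rewrite derC add0r; have := hasd_derive u (hasd_mulc (low i b) 0 z).
  have -> // : (fun z0 : Cn => ((z0 - 0) *m low i b) 0 0) = (fun z0 : Cn => (z0 *m low i b) 0 0).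
  by apply/funext => z0; rewrite subr0.
have [d d0 Hd] : exists2 d : R, 0 < d & forall s t : C, nrm s < d -> nrm t < d ->
    bl x0 r (x + s *: u + t *: u).
  have n1 : 0 < nrm u + 1 by rewrite ltr_wpDl.
  have d0 : 0 < (r - nrm (x - x0)) / 2 / (nrm u + 1) by rewrite !divr_gt0 // subr_gt0.
  exists ((r - nrm (x - x0)) / 2 / (nrm u + 1)); first exact: d0.
  move=> s t sd td.
  have e1 : nrm s * (nrm u + 1) < (r - nrm (x - x0)) / 2 by rewrite -ltr_pdivlMr.
  have e2 : nrm t * (nrm u + 1) < (r - nrm (x - x0)) / 2 by rewrite -ltr_pdivlMr.
  have -> : x + s *: u + t *: u = x + (s + t) *: u by rewrite -addrA -scalerDl.
  rewrite /bl addrAC; apply: le_lt_trans (nrmD _ _) _; rewrite nrmZ.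
  have h1 : nrm (s + t) * nrm u <= (nrm s + nrm t) * (nrm u + 1).
    by apply: ler_pM => //; [exact: nrmD|rewrite lerDl].
  move: h1; rewrite mulrDl => h1; exact: (sum_halves h1 e1 e2).
have Hd1 (t : C) : nrm t < d -> bl x0 r (x + t *: u).
  by move=> td; have := Hd t 0 td; rewrite nrm0 scale0r addr0; apply.
have D1 (t : C) : nrm t < d -> 'D_u g (x + t *: u) = 0.
  move=> td; apply: (der_line0 d0 (gh _ (Hd1 t td))) => t' td'.
  have tr' := Hd t t' td td'.
  have E : x + t *: u + t' *: u = x + (t + t') *: u by rewrite -addrA -scalerDl.
  by move: tr'; rewrite E; exact: g0.
have hD j z : bl x0 r z -> differentiable (fun z => 'D_u (fun z => v z 0 j) z) z.
  by move=> zr; exact: (hol_derive u (vh j) zr).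
pose G z := \sum_j 'D_u (fun z => v z 0 j) z * eta j 0 + (u *m low i b) 0 0.
have dG z : bl x0 r z -> differentiable (fun z => \sum_j 'D_u (fun z => v z 0 j) z * eta j 0) z.
  by move=> zr; apply: difsum => j; apply: difM; [exact: hD|exact: difC].
have G0 : 'D_u G x = 0.
  apply: (der_line0 d0); first by apply: difD; [exact: dG|exact: difC].
  by move=> t td; rewrite /G -Dg; [exact: D1|exact: Hd1].
move: G0; rewrite /G derD; [|exact: dG|exact: difC].
rewrite derC addr0 dersum; last by move=> j; apply: difM; [exact: hD|exact: difC].
move=> G0; apply: mx11P; rewrite mx0E -G0 mxE; apply: eq_bigr => j _.
rewrite derM; [|exact: hD|exact: difC].
by rewrite derC mulr0 add0r mulrC; congr (_ * _); exact: (hessE v x u u).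
Qed.

Lemma perp_exists (eta : 'cV[C]_n) : (1 < n)%N -> eta != 0 -> exists k (u : Cn), u 0 k != 0 /\ u *m eta = 0.
Proof.
move=> n1 e0; have [k0 hk] : exists k, eta k 0 != 0.
  apply/existsP; move: e0; apply: contraNT; rewrite negb_exists => /forallP h.
  by apply/eqP/colP => k; rewrite mx0E; have := h k; rewrite negbK => /eqP.
have [k kk] : exists k : 'I_n, k != k0.
  case: (eqVneq k0 (Ordinal (ltnW n1))) => [->|h]; last by exists (Ordinal (ltnW n1)); rewrite eq_sym.
  by exists (Ordinal n1).
exists k, (eta k0 0 *: e_ k - eta k 0 *: e_ k0); split.
  by rewrite mxDE mxNE !mxZE delta_diag [X in _ - _ * X]mxE (negPf kk) andbF mulr0 subr0 mulr1.
have D l : e_ l *m eta = (eta l 0)%:M.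
  by apply: mx11P; rewrite -rowE mxE [RHS]mxE mulr1n.
rewrite mulmxBl -!scalemxAl !D.
by rewrite !scale_scalar_mx mulrC subrr.
Qed.

(** Second derivatives are parallel to [u] with a factor [lam x u], third derivatives commute and
    force [lam] to be constant in [x], and [quad_field] concludes. *)
Lemma projective_field : (1 < n)%N -> y0 != 0 -> homog i x0 *m y0 = 0 ->
  exists2 r1 : R, 0 < r1 & exists Bm, forall x, bl x0 r1 x -> v x = mxvf Bm i x.
Proof.
move=> n1 y00 xy0; have [r1 /andP[r10 r1r] Q] := second_der_incidence xy0.
have e0 : eta0 != 0.
  apply: contra y00 => /eqP e0; apply/eqP/colP => s; rewrite mx0E.
  have := congr1 (fun A : 'M[C]_1 => A 0 0) xy0; rewrite homog_low -/eta0 e0 mulmx0 !mx0E addr0 => yi.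
  case: (unliftP i s) => [k ->|->] //.
  by have := congr1 (fun A : 'cV[C]_n => A k 0) e0; rewrite /eta0 /low mxE mx0E.
have [k [u0 [uk ue]]] := perp_exists n1 e0.
have sub x : bl x0 r1 x -> bl x0 r x by move=> h; exact: lt_le_trans h r1r.
pose lam x u := quad_coef (hess v x) k u.
have par x u : bl x0 r1 x -> hess v x u u = lam x u *: u.
  move=> xr; have xr' := sub _ xr.
  have ll w : lin (fun u => hess v x u w) by exact: linl.
  have lr w : lin (hess v x w) by exact: linr.
  have sy a b : hess v x a b = hess v x b a by exact: symB.
  apply: (quad_parallel ll lr sy).
  apply: (parallel_near ll lr r10 ue uk) => eta w; exact: (Q x eta w xr).
have lamlin x : bl x0 r1 x -> lin (lam x).
  move=> xr; have ll w : lin (fun u => hess v x u w) by exact: linl (sub _ xr).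
  exact: (quad_coef_lin ll).
have pol x u w j : bl x0 r1 x -> 'D_w (fun z => 'D_u (fun z => v z 0 j) z) x =
    2^-1 * (lam x u * w 0 j + lam x w * u 0 j).
  move=> xr; have xr' := sub _ xr; rewrite -[LHS](hessE v x u w 0 j).
  have := par x (u + w) xr; have := par x u xr; have := par x w xr.
  rewrite (linD u w (linr (u + w) xr')) (linD u w (linl u xr')) (linD u w (linl w xr')).
  rewrite (symB w u xr') (linD u w (lamlin x xr)).
  move: (hess v x u u) (hess v x u w) (hess v x w w) (lam x u) (lam x w) => p q s a b.
  move=> -> -> /rowP /(_ j); rewrite !(mxDE, mxZE) => h.
  have : 2 * q 0 j = a * w 0 j + b * u 0 j.
    have -> : 2 * q 0 j = a * u 0 j + q 0 j + (q 0 j + b * w 0 j) - a * u 0 j - b * w 0 j by ring.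
    by rewrite h; ring.
  by move=> <-; rewrite mulKf // pnatr_eq0.
have dB u w j z : bl x0 r z -> differentiable (fun z => 'D_w (fun z => 'D_u (fun z => v z 0 j) z) z) z.
  by move=> zr; exact: (hol_derive w (hol_derive u (vh j)) zr).
(* As [quad_coef] is an explicit combination of second derivatives, [lam] depends holomorphically on
   [x] and may be differentiated. *)
have lamE u x : lam x u = 2 * 'D_(e_ k) (fun z => 'D_u (fun z => v z 0 k) z) x
    - u 0 k * 'D_(e_ k) (fun z => 'D_(e_ k) (fun z => v z 0 k) z) x.
  rewrite /lam /quad_coef; congr (_ * _ - _ * _).
    exact: (hessE v x u (e_ k) 0 k).
  exact: (hessE v x (e_ k) (e_ k) 0 k).
have dlam u z : bl x0 r z -> differentiable (fun x => lam x u) z.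
  move=> zr; rewrite (_ : (fun x => lam x u) = (fun x => 2 * 'D_(e_ k) (fun z => 'D_u (fun z => v z 0 k) z) x
    - u 0 k * 'D_(e_ k) (fun z => 'D_(e_ k) (fun z => v z 0 k) z) x)); last by apply/funext => x; exact: lamE.
  by apply: difB; apply: difM; (exact: difC || exact: dB).
have D3 x u w c j : bl x0 r1 x -> 'D_c (fun z => 'D_w (fun z => 'D_u (fun z => v z 0 j) z) z) x =
    2^-1 * ('D_c (fun z => lam z u) x * w 0 j + 'D_c (fun z => lam z w) x * u 0 j).
  move=> xr; have p0 : 0 < r1 - nrm (x - x0) by rewrite subr_gt0.
  have agree y : nrm (y - x) < r1 - nrm (x - x0) -> 'D_w (fun z => 'D_u (fun z => v z 0 j) z) y =
      2^-1 * (lam y u * w 0 j + lam y w * u 0 j).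
    move=> yr; apply: pol; rewrite /bl; apply: le_lt_trans (nrm_tri x _ _) _.
    by move: yr; rewrite ltrBrDr addrC.
  rewrite (der_ext c p0 agree); last exact: dB (sub _ xr).
  have d1 : differentiable (fun z => lam z u * w 0 j) x by apply: difM; [exact: dlam (sub _ xr)|exact: difC].
  have d2 : differentiable (fun z => lam z w * u 0 j) x by apply: difM; [exact: dlam (sub _ xr)|exact: difC].
  apply: (etrans (derMl _ _ (difD d1 d2))); congr (_ * _).
  apply: (etrans (derD _ d1 d2)); congr (_ + _); apply: derMr; exact: dlam (sub _ xr).
have mu0 x a b : bl x0 r1 x -> 'D_(e_ a) (fun z => lam z (e_ b)) x = 0.
  move=> xr; apply: (third_sym n1 (mu := fun a b => 'D_(e_ a) (fun z => lam z (e_ b)) x)) => {a b} c u w j.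
  have [p0 sb] := ball_sub (sub _ xr).
  have h := @derive_comm _ _ (fun z => 'D_(e_ u) (fun z => v z 0 j) z) x _ (e_ w) (e_ c) p0 (sb _ (hol_derive (e_ u) (vh j))).
  have h1 := D3 x (e_ u) (e_ w) (e_ c) j xr; have h2 := D3 x (e_ u) (e_ c) (e_ w) j xr.
  have {h h1 h2} := etrans (etrans (esym h1) h) h2.
  by apply: mulfI; rewrite invr_eq0 pnatr_eq0.
have const x b : bl x0 r1 x -> lam x (e_ b) = lam x0 (e_ b).
  apply: (@hol_const _ _ (fun x => lam x (e_ b)) x0 r1) => [z zr|z zr w]; first exact: dlam (sub _ zr).
  rewrite (lin_row w (deriveP_lin (dlam (e_ b) z (sub _ zr)))).
  by apply: big1 => a _; rewrite mu0 // scaler0.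
exists r1 => //; apply: (@quad_field _ _ v i x0 r1 (\col_b lam x0 (e_ b))).
  by move=> j z zr; exact: (vh j (sub _ zr)).
move=> x j u w xr; rewrite pol //.
have E u' : (u' *m \col_b lam x0 (e_ b)) 0 0 = lam x u'.
  rewrite (lin_row u' (lamlin x xr)) mxE; apply: eq_bigr => b _.
  by rewrite mxE -(const x).
by rewrite !E.
Qed.

End Local.
End Projective3.

(** * Complexified defining functions *)

Section Hypersurface.
Context {R : realType} {n : nat}.
Local Notation C := R[i].
Local Notation Cn := 'rV[R[i]]_n.
Local Notation e_ k := (delta_mx 0 k : 'rV[R[i]]_n).

Definition dg (Z : Cn) : Cn * Cn := (Z, cconj Z).
(** The antiholomorphic involution of the complexified space whose fixed points are exactly the
    diagonal points [dg Z]. *)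
Definition sw (P : Cn * Cn) : Cn * Cn := (cconj P.2, cconj P.1).

Lemma sw_anti a (u v : Cn * Cn) : sw (a *: u + v) = conjc a *: sw u + sw v.
Proof. by case: u => u1 u2; case: v => v1 v2; rewrite /sw /= !cconj_antilin. Qed.

Lemma nrm_sw u : nrm (sw u) = nrm u.
Proof. by rewrite !nrm_pair /= !nrm_cconj maxC. Qed.

Lemma sw_dg Z : sw (dg Z) = dg Z.
Proof. by rewrite /sw /= cconjK. Qed.

Lemma swB u v : sw (u - v) = sw u - sw v.
Proof. by case: u => u1 u2; case: v => v1 v2; rewrite /sw /= !cconjB. Qed.

Lemma bl_sw Z p P : bl (dg Z) p P -> bl (dg Z) p (sw P).
Proof. by rewrite /bl -{2}(sw_dg Z) -swB nrm_sw. Qed.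

Lemma nrm_dg (Z Z' : Cn) : nrm (dg Z - dg Z') = nrm (Z - Z').
Proof. by rewrite nrm_pair /= -cconjB nrm_cconj maxxx. Qed.

Lemma dgDZ Z (e : Cn) (t : C) : conjc t = t -> dg Z + t *: dg e = dg (Z + t *: e).
Proof. by move=> tr; rewrite /dg cconjD cconjZ tr. Qed.

Lemma dg_split (w : Cn) : dg w = (w, 0 : Cn) + sw (w, 0 : Cn).
Proof. by rewrite /sw /= cconj0; congr (_, _); rewrite ?addr0 ?add0r. Qed.

Lemma scale_pair (c : C) (w : Cn) : (c *: w, 0 : Cn) = c *: (w, 0 : Cn) :> Cn * Cn.
Proof. by congr (_, _); rewrite scaler0. Qed.

Lemma sub_incr (W : zmodType) (P h a b c : W) : P + h + a - (P + b) - (h + c) = a - b - c.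
Proof.
apply/eqP; rewrite subr_eq subr_eq (addrC h c) (addrA (a - b - c) c h) subrK (addrC P b) (addrA (a - b + h) b P).
by rewrite (addrAC (a - b) h b) subrK (addrC a h) (addrC _ P) addrA.
Qed.

Record hyp_germ (M : set Cn) (q : Cn) (Ph : Cn * Cn -> C) (p : R) : Prop := HypGerm {
  hg_p : 0 < p;
  hg_hol : hol Ph (dg q) p;
  hg_real : forall Z, nrm (Z - q) < p -> conjc (Ph (dg Z)) = Ph (dg Z);
  hg_M : forall Z, nrm (Z - q) < p -> (M Z <-> Ph (dg Z) = 0);
  hg_q : M q;
  hg_reg : exists v, 'D_(v, 0) Ph (dg q) != 0 }.

Lemma der_fst (Ph : Cn * Cn -> C) (Z W v : Cn) : differentiable Ph (Z, W) ->
  'D_v (fun z => Ph (z, W)) Z = 'D_(v, 0) Ph (Z, W).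
Proof.
move=> dP; have h : hasd (fun z : Cn => (z, W) : Cn * Cn) Z (fun h => (h, 0)).
  apply: (@hasd_quad _ _ _ _ _ _ 1 0 1 ltr01) => [a u w|h|h _].
  - by apply/pair_equal_spec; split=> //=; rewrite scaler0 addr0.
  - by rewrite nrm_pair /= nrm0 mul1r ge_max lexx nrm_ge0.
  have e1 : Z + h - Z - h = 0 by rewrite addrAC addrK subrr.
  have e2 : W - W - 0 = 0 by rewrite subrr subr0.
  by rewrite mul0r nrm_pair /= e1 e2 nrm0 maxxx.
have [dz _] := hasd_diff h.
apply: (etrans (der_comp v dz dP)).
by congr ('D__ _ _); exact: (hasd_derive v h).
Qed.

(** Stated for every small radius, so that the ball can be shrunk to suit other data. *)
Lemma hyp_germ_of M U Phi q : @defining_function R n M U Phi -> U q -> M q ->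
  exists2 p0 : R, 0 < p0 & forall p, 0 < p <= p0 ->
    hyp_germ M q (fun P => Phi P.1 P.2) p /\ forall Z, nrm (Z - q) < p -> U Z.
Proof.
move=> [[oU _] hP rP mP regP] Uq Mq.
have /nearP [p p0 pU] : \forall z \near q, U z by exact: open_nbhs_nbhs.
exists p => // r /andP[r0 rp].
have pU' Z : nrm (Z - q) < r -> U Z by move=> h; apply: pU; exact: lt_le_trans h rp.
have hh : hol (fun P : Cn * Cn => Phi P.1 P.2) (dg q) r.
  move=> [Z W]; rewrite /bl nrm_pair_lt /= => /andP[h1 h2]; apply: hP; split=> /=; first exact: pU'.
  by apply: pU'; rewrite -(cconjK q) -cconjB nrm_cconj.
split=> //; split=> //.
- by move=> Z /pU' /rP /CrealP.
- by move=> Z /pU' /mP.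
have [v hv] := regP q Uq Mq; exists v.
by rewrite -(der_fst v (hh (dg q) (bl_center _ r0))).
Qed.

Section Germ.
Variables (M : set Cn) (q : Cn) (Ph : Cn * Cn -> C) (p : R).
Hypothesis G : hyp_germ M q Ph p.

(** Reality on the diagonal, extended to the complexification by uniqueness there. *)
Lemma hg_conj P : bl (dg q) p P -> Ph (sw P) = conjc (Ph P).
Proof.
move=> Pp; have [p0 hP rP] := And3 (hg_p G) (hg_hol G) (hg_real G).
have dS P' : bl (dg q) p P' -> differentiable (fun P => conjc (Ph (sw P))) P'.
  by move=> h; apply: dif_conj; [exact: sw_anti|exact: nrm_sw|apply: hP; exact: bl_sw].
have : (fun P => conjc (Ph (sw P)) - Ph P) P = 0.
  apply: (@totally_real R n (fun P => conjc (Ph (sw P)) - Ph P) q p p) Pp => // [P' P'p|Z Zq]; first by apply: difB; [exact: dS|exact: hP].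
  by rewrite -[(Z, cconj Z)]/(dg Z) sw_dg rP // subrr.
by move=> /eqP; rewrite subr_eq0 => /eqP <-; rewrite conjcK.
Qed.

Lemma hg_der_sw Z h : nrm (Z - q) < p -> 'D_(sw h) Ph (dg Z) = conjc ('D_h Ph (dg Z)).
Proof.
move=> Zp; have Zb : bl (dg q) p (dg Z) by rewrite /bl nrm_dg.
have dP := hg_hol G Zb; have p0 : 0 < p - nrm (Z - q) by rewrite subr_gt0.
have dS : differentiable Ph (sw (dg Z)) by rewrite sw_dg.
have h1 := @der_conj R _ _ Ph sw (dg Z) h sw_anti nrm_sw dS.
have h2 : 'D_h Ph (dg Z) = 'D_h (fun z => conjc (Ph (sw z))) (dg Z).
  have h2 P : nrm (P - dg Z) < p - nrm (Z - q) -> Ph P = conjc (Ph (sw P)).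
    move=> Pp; have Pb : bl (dg q) p P.
      rewrite /bl; apply: le_lt_trans (nrm_tri (dg Z) _ _) _; rewrite nrm_dg.
      by move: Pp; rewrite ltrBrDr.
    exact: (etrans (esym (conjcK _)) (congr1 conjc (esym (hg_conj Pb)))).
  exact: (@der_ext _ _ _ Ph (fun z => conjc (Ph (sw z))) (dg Z) h _ p0 h2 dP).
have h3 : 'D_(sw h) Ph (sw (dg Z)) = 'D_(sw h) Ph (dg Z).
  by exact: (congr1 (fun x => 'D_(sw h) Ph x) (sw_dg Z)).
exact: (etrans (esym (conjcK _)) (congr1 conjc (esym (etrans h2 (etrans h1 (congr1 conjc h3)))))).
Qed.

Lemma hg_der_dg Z w : nrm (Z - q) < p ->
  'D_(dg w) Ph (dg Z) = 'D_(w, 0) Ph (dg Z) + conjc ('D_(w, 0) Ph (dg Z)).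
Proof.
move=> Zp; have Zb : bl (dg q) p (dg Z) by rewrite /bl nrm_dg.
have h1 := linD (w, 0 : Cn) (sw (w, 0 : Cn)) (deriveP_lin (hg_hol G Zb)).
apply: (etrans (congr1 (fun w => 'D_w Ph (dg Z)) (dg_split w))); apply: (etrans h1); congr (_ + _).
exact: hg_der_sw.
Qed.

(** If [a] is a nonzero (1,0)-derivative along [v], the derivative along [dg (c *: v)] is
    [2 Re (c a)], which is nonzero for [c = 1] or [c = 'i]. *)
Lemma transversal : exists e1 : Cn, 'D_(dg e1) Ph (dg q) != 0.
Proof.
have [v hv] := hg_reg G; have p0 := hg_p G.
have q0 := bl_center (dg q) p0; have dP := hg_hol G q0.
have [a aE] : exists a, 'D_(v, 0) Ph (dg q) = a by exists ('D_(v, 0) Ph (dg q)).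
have dge (c : C) : 'D_(dg (c *: v)) Ph (dg q) = c * a + conjc (c * a).
  have h2 := linZ c (v, 0 : Cn) (deriveP_lin dP).
  have h3 : 'D_(c *: v, 0) Ph (dg q) = c * a.
    apply: (etrans (congr1 (fun w => 'D_w Ph (dg q)) (scale_pair c v))); rewrite -aE; exact: h2.
  have h4 : nrm (q - q) < p by rewrite subrr nrm0.
  by apply: (etrans (hg_der_dg _ h4)); rewrite h3.
have [h|h] := eqVneq (a + conjc a) 0; last by exists v; rewrite -[v]scale1r dge mul1r.
exists ('i *: v); rewrite dge; move: hv; rewrite aE; apply: contraNneq.
move: h; case: (a) => x y /= [] h _; move=> [] h1 h2; apply/eqP; congr (_ +i* _); lra.
Qed.

(** [P + g P *: dg e1] retracts a ball onto the complexified hypersurface. The direction is diagonal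
    and [g] is real on the diagonal, so diagonal points are sent to points of [M]. *)
Record retr (e1 : Cn) (g : Cn * Cn -> C) (rho kap : R) : Prop := Retr {
  rt_rho : 0 < rho;
  rt_kap : 0 < kap;
  rt_0 : g (dg q) = 0;
  rt_small : forall P, bl (dg q) kap P -> nrm (g P) < rho;
  rt_zero : forall P, bl (dg q) kap P -> Ph (P + g P *: dg e1) = 0;
  rt_ball : forall P (s : C), bl (dg q) kap P -> nrm s < rho -> bl (dg q) p (P + s *: dg e1);
  rt_uniq : forall P (s : C), bl (dg q) kap P -> nrm s < rho -> Ph (P + s *: dg e1) = 0 -> s = g P;
  rt_hasd : forall P, bl (dg q) kap P -> hasd g P (fun h => - 'D_h Ph (P + g P *: dg e1) / 'D_(dg e1) Ph (P + g P *: dg e1));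
  rt_real : forall Z, nrm (Z - q) < kap -> conjc (g (dg Z)) = g (dg Z) }.

Lemma retraction : exists e1 g rho kap, retr e1 g rho kap.
Proof.
have [e1 he] := transversal; have [p0 hP] := conj (hg_p G) (hg_hol G).
have F0 : Ph (dg q) = 0 by apply/(hg_M G); [rewrite subrr nrm0|exact: hg_q G].
have [rho [kap [g [r0 k0 g0 H]]]] := implicit_function p0 hP F0 he.
exists e1, g, rho, kap; split; [exact: r0|exact: k0|exact: g0|..].
- by move=> P Pk; case: (H P Pk).
- by move=> P Pk; case: (H P Pk).
- by move=> P s Pk hs; case: (H P Pk) => _ _ h _; case: (h s hs).
- by move=> P s Pk hs; case: (H P Pk) => _ _ h _; case: (h s hs).
- by move=> P Pk; case: (H P Pk) => _ _ _ [].
move=> Z Zk; have Zb : bl (dg q) kap (dg Z) by rewrite /bl nrm_dg.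
have [h1 h2 h3 _] := H _ Zb; have [h4 _] := h3 _ h1.
have h5 : nrm (conjc (g (dg Z))) < rho by rewrite nrm_conj.
(* Uniqueness of the implicit function: by [hg_conj] the conjugate of [g (dg Z)] solves the same
   equation. *)
have [_] := h3 _ h5; apply.
have -> : dg Z + conjc (g (dg Z)) *: dg e1 = sw (dg Z + g (dg Z) *: dg e1).
  by rewrite [X in sw X]addrC sw_anti !sw_dg addrC.
by rewrite hg_conj // h2 conjc0.
Qed.

Section Retr.
Variables (e1 : Cn) (g : Cn * Cn -> C) (rho kap : R).
Hypothesis T : retr e1 g rho kap.

Definition ret P := P + g P *: dg e1.

Lemma g_zero P : bl (dg q) kap P -> Ph P = 0 -> g P = 0.
Proof.
move=> Pk P0; apply/esym/(rt_uniq T Pk); first by rewrite nrm0 (rt_rho T).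
by rewrite scale0r addr0.
Qed.

Lemma dif_g P : bl (dg q) kap P -> differentiable g P.
Proof. by move=> /(rt_hasd T) /hasd_diff []. Qed.

Lemma hasd_ret P : bl (dg q) kap P -> hasd ret P (fun h => h + 'D_h g P *: dg e1).
Proof.
move=> Pk; have /diff_hasD [ll [K lK] H] := dif_g Pk.
split.
- by move=> a u w; rewrite ll !scalerDl scalerDr scalerA !addrA; congr (_ + _); rewrite addrAC.
- exists (1 + K * nrm (dg e1)) => h; apply: le_trans (nrmD _ _) _; rewrite nrmZ mulrDl mul1r lerD2l.
  by rewrite mulrAC; apply: ler_wpM2r.
move=> e e0; have n1 : 0 < nrm (dg e1) + 1 by rewrite ltr_wpDl.
have e2 : 0 < e / (nrm (dg e1) + 1) by rewrite divr_gt0.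
have [d d0 Hd] := H _ e2; exists d => // h /Hd hh.
have -> : ret (P + h) - ret P - (h + 'D_h g P *: dg e1) = (g (P + h) - g P - 'D_h g P) *: dg e1.
  rewrite /ret !scalerBl; move: (g (P + h) *: dg e1) (g P *: dg e1) ('D_h g P *: dg e1) => a b c.
  exact: sub_incr.
rewrite nrmZ; apply: (@le_trans _ _ (e / (nrm (dg e1) + 1) * nrm h * (nrm (dg e1) + 1))).
  by apply: ler_pM => //; rewrite lerDl.
by rewrite mulrAC divfK // gt_eqF.
Qed.

Lemma dif_ret P : bl (dg q) kap P -> differentiable ret P.
Proof. by move=> /hasd_ret /hasd_diff []. Qed.

Lemma ret_fix P : bl (dg q) kap P -> Ph P = 0 -> ret P = P.
Proof. by move=> Pk P0; rewrite /ret g_zero // scale0r addr0. Qed.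

Lemma ret_center : ret (dg q) = dg q.
Proof. by rewrite /ret (rt_0 T) scale0r addr0. Qed.

Lemma ret_dg Z : nrm (Z - q) < kap -> ret (dg Z) = dg (Z + g (dg Z) *: e1) /\ M (Z + g (dg Z) *: e1).
Proof.
move=> Zk; have Zb : bl (dg q) kap (dg Z) by rewrite /bl nrm_dg.
have E := dgDZ Z e1 (rt_real T Zk); split; first exact: E.
apply/(hg_M G); last by rewrite -E (rt_zero T Zb).
by have := rt_ball T Zb (rt_small T Zb); rewrite E /bl nrm_dg.
Qed.

(** Near [q1] the function [K] composed with the retraction vanishes on the diagonal, hence on a
    complex neighbourhood, hence on the whole ball. The radius [k'] is fixed before [q1], as
    transport along paths in [M] requires. *)
Lemma propagate (K : Cn * Cn -> C) p' : 0 < p' -> hol K (dg q) p' ->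
  exists2 k' : R, 0 < k' <= kap & forall q1, nrm (q1 - q) < k' -> M q1 ->
   (exists2 d : R, 0 < d & forall Z, nrm (Z - q1) < d -> M Z -> K (dg Z) = 0) ->
   (forall P, bl (dg q) k' P -> K (ret P) = 0).
Proof.
move=> p'0 Kh; have k0 := rt_kap T; have q0 := bl_center (dg q) k0.
have /cont_nrmP /(_ p' p'0) [d1 d10 Hd1] := differentiable_continuous (dif_ret q0).
exists (Num.min kap d1); first by rewrite lt_min k0 d10 ge_min lexx.
move=> q1; rewrite lt_min => /andP[q1k q1d] Mq1 [d d0 Hd] P.
have dK P' : bl (dg q) (Num.min kap d1) P' -> differentiable (fun P => K (ret P)) P'.
  rewrite /bl lt_min => /andP[h1 h2]; apply: dif_comp; first exact: dif_ret.
  by apply: Kh; move: (Hd1 _ h2); rewrite ret_center.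
have q1b : bl (dg q) (Num.min kap d1) (dg q1) by rewrite /bl nrm_dg lt_min q1k.
have q1b' : bl (dg q) kap (dg q1) by rewrite /bl nrm_dg.
pose r := Num.min kap d1 - nrm (q1 - q).
have r0 : 0 < r by rewrite subr_gt0 lt_min q1k.
have q1p : nrm (q1 - q) < p.
  by have := rt_ball T (s := 0) q1b'; rewrite nrm0 scale0r addr0 /bl nrm_dg; apply; exact: rt_rho T.
have ph0 : Ph (dg q1) = 0 by apply/(hg_M G).
have /cont_nrmP /(_ d d0) [d2 d20 Hd2] := differentiable_continuous (dif_ret q1b').
have K1 : forall P', bl (dg q1) r P' -> K (ret P') = 0.
  have mr : 0 < Num.min r d2 by rewrite lt_min r0.
  apply: (@totally_real R n (fun P => K (ret P)) q1 r (Num.min r d2)) => // [P' P'r|Z].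
    apply: dK; rewrite /bl; apply: le_lt_trans (nrm_tri (dg q1) _ _) _; rewrite nrm_dg.
    by move: P'r; rewrite /bl /r ltrBrDr.
  rewrite lt_min -[(Z, cconj Z)]/(dg Z) => /andP[Zr Zd].
  have Zk : nrm (Z - q) < kap.
    apply: le_lt_trans (nrm_tri q1 _ _) _; move: Zr; rewrite /r ltrBrDr lt_min => /andP[] //.
  have [E MZ] := ret_dg Zk; rewrite E; apply: Hd => //.
  have Zd' : nrm (dg Z - dg q1) < d2 by rewrite nrm_dg.
  by have := Hd2 _ Zd'; rewrite E (ret_fix q1b' ph0) nrm_dg.
exact: (@identity_ball _ _ (fun P => K (ret P)) (dg q) (Num.min kap d1) (dg q1) r dK q1b r0 K1).
Qed.

End Retr.
End Germ.
End Hypersurface.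

(** * Hermitian pairings on the complexified space *)

Section Calc2.
Context {R : realType} {n : nat}.
Local Notation C := R[i].
Local Notation Cn := 'rV[R[i]]_n.
Local Notation Cn1 := 'rV[R[i]]_n.+1.
Local Notation V2 := ('rV[R[i]]_n * 'rV[R[i]]_n)%type.
Local Notation e_ k := (delta_mx 0 k : 'rV[R[i]]_n).

Lemma hformE (H : 'M[C]_n.+1) (v w : Cn1) : hform H v w = \sum_k (v *m H) 0 k * w 0 k.
Proof. by rewrite /hform mxE; apply: eq_bigr => k _; rewrite [w^T _ _]mxE. Qed.

Lemma hform_lin1 (H : 'M[C]_n.+1) a v v' w : hform H (a *: v + v') w = a * hform H v w + hform H v' w.
Proof. by rewrite /hform !mulmxDl -!scalemxAl mxDE mxZE. Qed.

Lemma hform_lin2 (H : 'M[C]_n.+1) a v w w' : hform H v (a *: w + w') = a * hform H v w + hform H v w'.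
Proof. by rewrite /hform linearP mulmxDr -scalemxAr mxDE mxZE. Qed.

Lemma hformZ (H : 'M[C]_n.+1) a b v w : hform H (a *: v) (b *: w) = a * b * hform H v w.
Proof.
have h1 u : hform H u 0 = 0 by rewrite /hform trmx0 mulmx0 mx0E.
have h2 u : hform H 0 u = 0 by rewrite /hform !mul0mx mx0E.
rewrite -[a *: v]addr0 hform_lin1 h2 addr0 -[b *: w]addr0 hform_lin2 h1 addr0; ring.
Qed.

Lemma hasd_fst (P : V2) : hasd (fun P : V2 => P.1) P (fun h => h.1).
Proof.
apply: (@hasd_quad _ _ _ _ _ _ 1 0 1 ltr01) => [a u w //|h|h _].
  by rewrite nrm_pair mul1r le_max lexx.
have -> : (P + h).1 - P.1 - h.1 = 0 by rewrite /= (addrC P.1) addrK subrr.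
by rewrite nrm0 mul0r.
Qed.

Lemma dif_comp_fst (W : normedModType C) (f : Cn -> W) (P : V2) : differentiable f P.1 ->
  differentiable (fun P : V2 => f P.1) P.
Proof. by move=> df; have [d _] := hasd_diff (hasd_fst P); exact: dif_comp d df. Qed.

Lemma der_comp_fst (W : normedModType C) (f : Cn -> W) (P h : V2) : differentiable f P.1 ->
  'D_h (fun P : V2 => f P.1) P = 'D_(h.1) f P.1.
Proof.
move=> df; have [d _] := hasd_diff (hasd_fst P).
apply: (etrans (der_comp h d df)).
exact: (congr1 (fun u => 'D_u f P.1) (hasd_derive h (hasd_fst P))).
Qed.

Lemma dif_herm (H : 'M[C]_n.+1) (A1 A2 : V2 -> Cn1) P : differentiable A1 P -> differentiable A2 (sw P) ->
  differentiable (fun P => hform H (A1 P) (cconj (A2 (sw P)))) P /\ forall h,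
  'D_h (fun P => hform H (A1 P) (cconj (A2 (sw P)))) P =
  hform H ('D_h A1 P) (cconj (A2 (sw P))) + hform H (A1 P) (cconj ('D_(sw h) A2 (sw P))).
Proof.
move=> d1 d2.
have -> : (fun P => hform H (A1 P) (cconj (A2 (sw P)))) =
    (fun P => \sum_k (A1 P *m H) 0 k * conjc (A2 (sw P) 0 k)).
  by apply/funext => P'; rewrite hformE; apply: eq_bigr => k _; congr (_ * _); rewrite mxE.
have dA : differentiable (fun P => A1 P *m H) P by exact: (@dif_mulmxr R _ _ _ _ A1 P H d1).
have dA1 k : differentiable (fun P => (A1 P *m H) 0 k) P by exact: (diff_entry 0 k dA).
have dA2 k : differentiable (fun P => A2 P 0 k) (sw P) by exact: (diff_entry 0 k d2).
have dC k : differentiable (fun P => conjc (A2 (sw P) 0 k)) P.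
  exact: (@dif_conj R _ _ (fun P => A2 P 0 k) sw P sw_anti nrm_sw (dA2 k)).
have dM k : differentiable (fun P => (A1 P *m H) 0 k * conjc (A2 (sw P) 0 k)) P by exact: (difM (dA1 k) (dC k)).
split; first exact: (difsum dM).
move=> h; apply: (etrans (dersum h dM)).
rewrite !hformE -big_split /=; apply: eq_bigr => k _.
have e1 : 'D_h (fun P => (A1 P *m H) 0 k) P = ('D_h A1 P *m H) 0 k.
  by apply: (etrans (esym (der_mxP h 0 k dA))); rewrite (der_mulmxr h H d1).
have e2 : 'D_h (fun P => conjc (A2 (sw P) 0 k)) P = (cconj ('D_(sw h) A2 (sw P))) 0 k.
  apply: (etrans (@der_conj R _ _ (fun P => A2 P 0 k) sw P h sw_anti nrm_sw (dA2 k))).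
  rewrite [in RHS]mxE; congr conjc; exact: esym (der_mxP _ 0 k d2).
apply: (etrans (derM h (dA1 k) (dC k))); rewrite e1 e2.
have -> : conjc (A2 (sw P) 0 k) = (cconj (A2 (sw P))) 0 k by rewrite mxE.
by rewrite [LHS]addrC [X in X + _]mulrC.
Qed.

(** The derivative ['D_(u, w) F P] in coordinates; the sum form shows holomorphy when the direction
    itself varies with [P]. *)
Definition dirsum (F : V2 -> C) (u w : Cn) (P : V2) : C :=
  \sum_k u 0 k * 'D_(e_ k, 0) F P + \sum_k w 0 k * 'D_(0, e_ k) F P.

Lemma dirsumE F u w P : differentiable F P -> dirsum F u w P = 'D_(u, w) F P.
Proof.
move=> /deriveP_lin ll.
have l1 : lin (fun u : Cn => 'D_(u, 0 : Cn) F P).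
  move=> a x y; apply: etrans (ll a (x, 0 : Cn) (y, 0 : Cn)).
  by apply: (congr1 (fun w => 'D_w F P)); apply/pair_equal_spec; split=> //=; rewrite scaler0 addr0.
have l2 : lin (fun u : Cn => 'D_(0 : Cn, u) F P).
  move=> a x y; apply: etrans (ll a (0 : Cn, x) (0 : Cn, y)).
  by apply: (congr1 (fun w => 'D_w F P)); apply/pair_equal_spec; split=> //=; rewrite scaler0 addr0.
have s1 := lin_row u l1; have s2 := lin_row w l2.
have h := linD (u, 0 : Cn) (0 : Cn, w) ll.
apply: (etrans (esym (congr2 (fun a b => a + b) s1 s2))); apply: (etrans (esym h)).
by apply: (congr1 (fun w => 'D_w F P)); apply/pair_equal_spec; rewrite /= addr0 add0r.
Qed.

Lemma dif_dirsum F a p (u w : V2 -> Cn) P : hol F a p -> bl a p P ->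
  (forall k, differentiable (fun P => u P 0 k) P) -> (forall k, differentiable (fun P => w P 0 k) P) ->
  differentiable (fun P => dirsum F (u P) (w P) P) P.
Proof.
move=> hF Pp du dw;
apply: difD; apply: difsum => k.
  exact: (difM (du k) (hol_derive (e_ k, 0 : Cn) hF Pp)).
exact: (difM (dw k) (hol_derive (0 : Cn, e_ k) hF Pp)).
Qed.

End Calc2.

(** * From tangency to [M] to incidence in the target *)

Section LocalThm.
Context {R : realType} {n : nat}.
Local Notation C := R[i].
Local Notation Cn := 'rV[R[i]]_n.
Local Notation Cn1 := 'rV[R[i]]_n.+1.
Local Notation V2 := ('rV[R[i]]_n * 'rV[R[i]]_n)%type.
Local Notation e_ k := (delta_mx 0 k : 'rV[R[i]]_n).

Lemma hlin_delta (i : 'I_n.+1) k : hlin i (e_ k) = delta_mx 0 (lift i k).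
Proof.
apply: (@row_split _ _ i) => [|l]; first by rewrite hlin_i mxE (negPf (neq_lift i k)) andbF.
by rewrite hlin_lift !mxE (inj_eq lift_inj).
Qed.

Lemma der_zero_ball (V : normedModType C) (K : V -> C) P (d : R) h : 0 < d ->
  (forall P', nrm (P' - P) < d -> K P' = 0) -> 'D_h K P = 0.
Proof.
move=> d0 K0; have dz : differentiable (fun _ : V => 0 : C) P by exact: (difC 0 P).
have E P' : nrm (P' - P) < d -> (fun _ : V => 0 : C) P' = K P' by move=> /K0 ->.
exact: (etrans (esym (der_ext h d0 E dz)) (derC 0 P h)).
Qed.

Variables (M : set Cn) (q : Cn) (Ph : V2 -> C) (p : R).
Hypothesis G : hyp_germ M q Ph p.
Variables (H : 'M[C]_n.+1) (i : 'I_n.+1) (F : Cn -> Cn1) (f L ginv : Cn -> Cn) (r : R).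
Hypothesis Hu : H \in unitmx.
Hypothesis fE : forall z, f z = dehomog i (F z).
Hypothesis r0 : 0 < r.
Hypothesis dF : forall Z, nrm (Z - q) < p -> differentiable F Z.
Hypothesis F0 : forall Z, nrm (Z - q) < p -> F Z 0 i != 0.
Hypothesis dL : forall Z, nrm (Z - q) < p -> differentiable L Z.
Hypothesis Lt : forall Z, nrm (Z - q) < p -> M Z -> 'D_(L Z, 0) Ph (dg Z) + conjc ('D_(L Z, 0) Ph (dg Z)) = 0.
Hypothesis FM : forall Z, nrm (Z - q) < p -> M Z -> hform H (F Z) (cconj (F Z)) = 0.
Hypothesis dgi : forall x, nrm (x - f q) < r -> [/\ differentiable ginv x, nrm (ginv x - q) < p & f (ginv x) = x].
Hypothesis gf : forall Z, nrm (Z - q) < p -> ginv (f Z) = Z.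

Definition chartA (P : V2) : Cn1 := homog i (f P.1).
(** The complexified equation of the quadric pulled back by [f]: at [(z, cconj w)] it vanishes
    exactly when [f z] lies on the polar hyperplane of [f w]. *)
Definition Psi (P : V2) : C := hform H (chartA P) (cconj (chartA (sw P))).

Lemma q_in : nrm (q - q) < p.
Proof. by rewrite subrr nrm0; exact: hg_p G. Qed.

Lemma bl_fst P : bl (dg q) p P -> nrm (P.1 - q) < p.
Proof. by rewrite /bl nrm_pair_lt => /andP[]. Qed.

Lemma dif_f Z : nrm (Z - q) < p -> differentiable f Z.
Proof.
move=> Zp; have -> : f = (fun z => dehomog i (F z)) by apply/funext.
exact: dif_dehomog (dF Zp) (F0 Zp).
Qed.

Lemma dif_chartA P : bl (dg q) p P -> differentiable chartA P /\
  forall h, 'D_h chartA P = hlin i ('D_(h.1) f P.1).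
Proof.
move=> /bl_fst P1; have df := dif_f P1.
have dh : differentiable (fun z => homog i (f z)) P.1 by exact: (dif_comp df (dif_homog i (f P.1))).
split=> [|h]; first exact: (dif_comp_fst dh).
apply: (etrans (der_comp_fst h dh)); apply: (etrans (der_comp h.1 df (dif_homog i (f P.1)))).
exact: der_homog.
Qed.

Lemma dif_Psi P : bl (dg q) p P -> differentiable Psi P /\ forall h, 'D_h Psi P =
  hform H (hlin i ('D_(h.1) f P.1)) (cconj (chartA (sw P))) +
  hform H (chartA P) (cconj (hlin i ('D_((sw h).1) f (sw P).1))).
Proof.
move=> Pp; have [d1 E1] := dif_chartA Pp; have [d2 E2] := dif_chartA (bl_sw Pp).
have [d E] := dif_herm H d1 d2; split=> // h; apply: (etrans (E h)).
by rewrite E1 E2.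
Qed.

Lemma Psi_M Z : nrm (Z - q) < p -> M Z -> Psi (dg Z) = 0.
Proof.
move=> Zp MZ; have := FM Zp MZ; have Fi := F0 Zp; rewrite {1 2}(dehomogK Fi) cconjZ hformZ.
move=> /eqP; rewrite mulf_eq0 mulf_eq0 (negPf Fi) /= conjc_eq0 (negPf Fi) /= => /eqP h.
by rewrite /Psi sw_dg /chartA /= fE.
Qed.

Lemma der_onto u : exists w, 'D_w f q = u.
Proof.
exists ('D_u ginv (f q)); have fq : nrm (f q - f q) < r by rewrite subrr nrm0.
have [dg _ _] := dgi fq; have gq := gf q_in.
have df : differentiable f (ginv (f q)) by rewrite gq; exact: (dif_f q_in).
have E : 'D_u (fun x => f (ginv x)) (f q) = u.
  have h1 : hasd (fun x : Cn => x) (f q) (fun h => h).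
    apply: (@hasd_quad _ _ _ _ _ _ 1 0 1 ltr01) => // [h|h _]; first by rewrite mul1r.
    by rewrite (addrC (f q)) addrK subrr nrm0 mul0r.
  have h2 x : nrm (x - f q) < r -> x = f (ginv x) by move=> /dgi [].
  have [d _] := hasd_diff h1.
  by rewrite -(der_ext u r0 h2 d); exact: (hasd_derive u h1).
apply: (etrans (congr1 (fun z => 'D_('D_u ginv (f q)) f z) (esym gq))).
exact: (etrans (esym (der_comp u dg df)) E).
Qed.

Section WithRetr.
Variables (e1 : Cn) (g : V2 -> C) (rho kap : R).
Hypothesis T : retr q Ph p e1 g rho kap.

Lemma der_tangent (k : R) P : (forall P, bl (dg q) k P -> Psi (ret e1 g P) = 0) -> k <= kap ->
  bl (dg q) p P -> bl (dg q) k P -> Ph P = 0 ->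
  forall h, 'D_h Psi P + 'D_h g P * 'D_(dg e1) Psi P = 0.
Proof.
move=> hk kk Pp Pk P0 h; have Pk' : bl (dg q) kap P by exact: lt_le_trans Pk kk.
have rP := ret_fix T Pk' P0; have [dP _] := dif_Psi Pp.
have dP' : differentiable Psi (ret e1 g P) by rewrite rP.
have hr := hasd_ret T Pk'; have [dr _] := hasd_diff hr.
have d0 : 0 < k - nrm (P - dg q) by rewrite subr_gt0.
have E0 : 'D_h (fun P => Psi (ret e1 g P)) P = 0.
  apply: (der_zero_ball h d0) => P' P'd; apply: hk.
  by rewrite /bl; apply: le_lt_trans (nrm_tri P _ _) _; rewrite -ltrBrDr.
have E1 := der_comp h dr dP'; have E2 := hasd_derive h hr.
have E3 : 'D_('D_h (ret e1 g) P) Psi (ret e1 g P) = 'D_(h + 'D_h g P *: dg e1) Psi P.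
  by apply: (congr2 (fun u x => 'D_u Psi x)); [exact: E2|exact: rP].
have ll := deriveP_lin dP.
have E4 := linD h ('D_h g P *: dg e1) ll; have E5 := linZ ('D_h g P) (dg e1) ll.
have E6 : 'D_h Psi P + 'D_h g P * 'D_(dg e1) Psi P = 'D_(h + 'D_h g P *: dg e1) Psi P.
  by apply: etrans (esym E4); congr (_ + _); exact: esym E5.
by rewrite E6 -E3 -E1 E0.
Qed.

(** Otherwise [der_tangent] kills the whole differential of [Psi] at [dg q]. As the differential of
    [f] is onto, [homog i (f q)] would then lie in the kernel of the nondegenerate form. *)
Lemma Psi_transversal (k : R) : 0 < k -> (forall P, bl (dg q) k P -> Psi (ret e1 g P) = 0) -> k <= kap ->
  'D_(dg e1) Psi (dg q) != 0.
Proof.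
move=> k0 hk kk; apply/eqP => D0; have Pp := bl_center (dg q) (hg_p G).
have Mq := hg_q G; have P0 : Ph (dg q) = 0 by apply/(hg_M G q_in).
have Dh h : 'D_h Psi (dg q) = 0.
  by have := der_tangent hk kk Pp (bl_center (dg q) k0) P0 h; rewrite D0 mulr0 addr0.
have [_ DE] := dif_Psi Pp; have ll := deriveP_lin (dif_f q_in).
have swq := sw_dg q.
pose v := homog i (f q).
have hv u : hform H v (cconj (hlin i u)) = 0.
  have [w wE] := der_onto u.
  have := Dh (0, cconj w : Cn); rewrite DE /=.
  have -> : 'D_(0 : Cn) f q = 0 by exact: lin0 ll.
  rewrite hlin0 !cconjK wE.
  have -> : hform H 0 (cconj (chartA (sw (dg q)))) = 0 by rewrite /hform !mul0mx mx0E.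
  by rewrite add0r.
have vk k' : (v *m H) 0 (lift i k') = 0.
  have := hv (e_ k'); rewrite hlin_delta hformE (bigD1 (lift i k')) //= big1 => [|j jk].
    by rewrite addr0 /cconj map_delta_mx [delta_mx _ _ _ _]mxE !eqxx mulr1.
  by rewrite /cconj map_delta_mx [delta_mx _ _ _ _]mxE (negPf jk) andbF mulr0.
have vv : hform H v (cconj v) = 0.
  by have := Psi_M q_in Mq; rewrite /Psi swq /chartA.
have vi : (v *m H) 0 i = 0.
  move: vv; rewrite hformE (bigD1_ord i) //= big1 => [|k' _]; last by rewrite vk mul0r.
  by rewrite addr0 [cconj _ _ _]mxE homog_i rmorph1 mulr1.
have : v *m H = 0 by apply/rowP => j; rewrite mx0E; case: (unliftP i j) => [k' ->|->].
move=> /(congr1 (fun A => A *m invmx H)); rewrite mulmxK // mul0mx => v0.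
by have := homog_neq0 i (f q); rewrite -/v v0 eqxx.
Qed.

Lemma dif_K1 P : bl (dg q) p P -> differentiable (fun P => dirsum Ph (L P.1) (cconj (L (sw P).1)) P) P.
Proof.
move=> Pp.
have d1 P' k : bl (dg q) p P' -> differentiable (fun P : V2 => L P.1 0 k) P'.
  move=> /bl_fst P1; exact: (@dif_comp_fst R n _ (fun z => L z 0 k) P' (diff_entry 0 k (dL P1))).
have d2 k : differentiable (fun P : V2 => (cconj (L (sw P).1)) 0 k) P.
  have -> : (fun P : V2 => (cconj (L (sw P).1)) 0 k) = (fun P => conjc (L (sw P).1 0 k)).
    by apply/funext => P'; rewrite mxE.
  exact: (@dif_conj R _ _ (fun P : V2 => L P.1 0 k) sw P sw_anti nrm_sw (d1 _ k (bl_sw Pp))).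
exact: (dif_dirsum (u := fun P => L P.1) (w := fun P => cconj (L (sw P).1)) (hg_hol G) Pp (fun k => d1 _ k Pp) d2).
Qed.

(** Near [dg q] the zeros of [Psi] are zeros of [Ph], both sets being graphs along [dg e1]. Tangency
    of the complexified field, known on the zeros of [Ph], thus passes to those of [Psi]. *)
Lemma segre_tangency : exists2 k : R, 0 < k <= p & forall P, bl (dg q) k P -> Psi P = 0 ->
  hform H (hlin i ('D_(L P.1) f P.1)) (cconj (chartA (sw P))) +
  hform H (chartA P) (cconj (hlin i ('D_(L (sw P).1) f (sw P).1))) = 0.
Proof.
have p0 := hg_p G; have Mq := hg_q G; have kap0 := rt_kap T.
have hPsi : hol Psi (dg q) p by move=> P /dif_Psi [].
have q0 : nrm (q - q) < kap by rewrite subrr nrm0.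
have kq (k : R) : 0 < k -> nrm (q - q) < k by rewrite subrr nrm0.
have [k1 /andP[k10 k1k] H1] := propagate G T p0 hPsi.
have {}H1 : forall P, bl (dg q) k1 P -> Psi (ret e1 g P) = 0.
  by apply: (H1 q (kq _ k10) Mq); exists p => // Z; exact: Psi_M.
have [k2 /andP[k20 k2k] H2] := propagate G T p0 dif_K1.
have {}H2 : forall P, bl (dg q) k2 P -> (fun P => dirsum Ph (L P.1) (cconj (L (sw P).1)) P) (ret e1 g P) = 0.
  apply: (H2 q (kq _ k20) Mq); exists p => // Z Zp MZ.
  have Zb : bl (dg q) p (dg Z) by rewrite /bl nrm_dg.
  have E : (sw (dg Z)).1 = Z by rewrite sw_dg.
  rewrite E dirsumE; last exact: (hg_hol G Zb).
  exact: etrans (hg_der_dg G (L Z) Zp) (Lt Zp MZ).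
have tr := Psi_transversal k10 H1 k1k.
have Psi0 : Psi (dg q) = 0 by exact: Psi_M q_in Mq.
have [r2 [q2 [g2 [r20 q20 _ H3]]]] := implicit_function p0 hPsi Psi0 tr.
have dg0 := dif_g T (bl_center (dg q) kap0).
have /cont_nrmP /(_ r2 r20) [d d0 Hd] := differentiable_continuous dg0.
pose k := Num.min (Num.min k1 k2) (Num.min (Num.min q2 d) p).
exists k; first by rewrite !lt_min k10 k20 q20 d0 p0 !ge_min lexx !orbT.
move=> P; rewrite /bl !lt_min => /andP[/andP[Pk1 Pk2] /andP[/andP[Pq2 Pd] Pp]] PP.
have Pk : bl (dg q) kap P by exact: lt_le_trans Pk1 k1k.
have [_ _ uniq _] := H3 P Pq2.
(* Both 0 and [g P] solve [Psi (P + s *: dg e1) = 0], so they coincide with [g2 P] and [P] is a zero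
   of [Ph]. *)
have g20 : 0 = g2 P.
  have z0 : nrm (0 : C) < r2 by rewrite nrm0.
  by have [_ h] := uniq 0 z0; apply: h; rewrite scale0r addr0.
have gP : g P = 0.
  have hg : nrm (g P) < r2 by have := Hd P Pd; rewrite (rt_0 T) subr0.
  by have [_ h] := uniq _ hg; rewrite g20; apply: h; exact: H1.
have Ph0 : Ph P = 0 by have := rt_zero T Pk; rewrite gP scale0r addr0.
have rP := ret_fix T Pk Ph0.
have K0 : 'D_(L P.1, cconj (L (sw P).1)) Ph P = 0.
  have h1 := dirsumE (L P.1) (cconj (L (sw P).1)) (hg_hol G Pp).
  have h2 := congr1 (fun P => dirsum Ph (L P.1) (cconj (L (sw P).1)) P) rP.
  exact: (etrans (esym h1) (etrans (esym h2) (H2 P Pk2))).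
have Dg : 'D_(L P.1, cconj (L (sw P).1)) g P = 0.
  have h := hasd_derive (L P.1, cconj (L (sw P).1)) (rt_hasd T Pk).
  apply: (etrans h); rewrite gP scale0r addr0.
  by rewrite K0 oppr0 mul0r.
have := der_tangent H1 k1k Pp Pk1 Ph0 (L P.1, cconj (L (sw P).1)).
rewrite Dg mul0r addr0; have [_ DE] := dif_Psi Pp.
move=> h; have := etrans (esym (DE _)) h.
by rewrite /= cconjK.
Qed.

End WithRetr.
End LocalThm.

(** * The matrix of the transported field and its tangency to the quadric *)

Section QuadricField.
Context {R : realType} {n : nat}.
Local Notation C := R[i].
Local Notation Cn := 'rV[R[i]]_n.
Local Notation Cn1 := 'rV[R[i]]_n.+1.

(** The polar hyperplane of [v], as a column. *)
Definition hcol (H : 'M[C]_n.+1) (v : Cn1) : 'cV[C]_n.+1 := H *m (cconj v)^T.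

Lemma hcolE H a v : (a *m hcol H v) 0 0 = hform H a (cconj v).
Proof. by rewrite /hform /hcol mulmxA. Qed.

Lemma nrm_tr m k (A : 'M[C]_(m, k)) : nrm A^T <= nrm A.
Proof. by apply: nrm_mx_le => // a b; rewrite mxE nrm_mx_entry. Qed.

Lemma cconj_tr m k (A : 'M[C]_(m, k)) : cconj A^T = (cconj A)^T.
Proof. by apply/matrixP => a b; rewrite !mxE. Qed.

Lemma cconjM m k l (A : 'M[C]_(m, k)) (B : 'M[C]_(k, l)) : cconj (A *m B) = cconj A *m cconj B.
Proof. exact: map_mxM. Qed.

(** Polarity is invertible and the chart is open, so all hyperplanes near a polar one are polars of
    nearby points, up to scale. *)
Lemma hcol_near H i x0 (r : R) : H \in unitmx -> 0 < r ->
  exists2 d : R, 0 < d & forall y, nrm (y - hcol H (homog i x0)) < d ->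
  exists w c, [/\ nrm (w - x0) < r, c != 0 & y = c *: hcol H (homog i w)].
Proof.
move=> Hu r0; set y0 := hcol H _.
have h0 : homog i x0 0 i != 0 by rewrite homog_i oner_neq0.
have did : differentiable (fun v : Cn1 => v) (homog i x0) by exact: ex_diff.
have dd := dif_dehomog did h0.
have /cont_nrmP /(_ r r0) [d1 d10 Hd1] := differentiable_continuous dd.
pose K := n.+1%:R * nrm (invmx H) + 1.
have K0 : 0 < K by rewrite ltr_wpDl // mulr_ge0.
pose m := Num.min d1 1; have m0 : 0 < m by rewrite lt_min d10 ltr01.
exists (m / K); first by rewrite divr_gt0.
move=> y yd; pose W : Cn1 := cconj ((invmx H *m y)^T).
have yW : y = hcol H W by rewrite /hcol /W cconjK trmxK mulKVmx.
have W0 : homog i x0 = cconj ((invmx H *m y0)^T) by rewrite /y0 /hcol mulKmx // trmxK cconjK.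
have WW : nrm (W - homog i x0) < m.
  rewrite W0 /W -cconjB nrm_cconj -linearB /= -mulmxBr.
  apply: le_lt_trans (nrm_tr _) _; apply: le_lt_trans (nrm_mulmx _ _) _.
  apply: (@le_lt_trans _ _ (K * nrm (y - y0))); first by apply: ler_wpM2r => //; rewrite lerDl.
  by rewrite mulrC -ltr_pdivlMr.
move: WW; rewrite lt_min => /andP[/Hd1 h1 h2].
have Wi : W 0 i != 0.
  apply: contraTneq h2 => Wi; rewrite -leNgt; apply: le_trans (nrm_mx_entry _ 0 i).
  by rewrite mxDE mxNE Wi homog_i sub0r nrmN nrm1.
exists (dehomog i W), (conjc (W 0 i)); split; first by move: h1; rewrite homogK.
  by rewrite conjc_eq0.
by rewrite yW {1}(dehomogK Wi) /hcol cconjZ linearZ /= -scalemxAr.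
Qed.

(** The columns near [y0] orthogonal to [a] span all columns orthogonal to [a]; as in
    [parallel_near], [y0] is corrected to [y1] and then perturbed by [tau]. *)
Lemma eigen_of_perp (a : Cn1) (A : 'M[C]_n.+1) i (y0 : 'cV[C]_n.+1) (d : R) : 0 < d -> a 0 i = 1 ->
  nrm ((a *m y0) 0 0) < d ->
  (forall y, nrm (y - y0) < 2 * d -> a *m y = 0 -> a *m A *m y = 0) ->
  exists c, a *m A = c *: a.
Proof.
move=> d0 ai ay0 Hy; exists ((a *m A) 0 i).
have D (b : Cn1) j : b *m (delta_mx j 0 : 'cV[C]_n.+1) = (b 0 j)%:M.
  by apply: mx11P; rewrite mulmx_deltac mxE mulr1n.
pose y1 := y0 - (a *m y0) 0 0 *: (delta_mx i 0 : 'cV[C]_n.+1).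
have nd j : nrm (delta_mx j 0 : 'cV[C]_n.+1) <= 1.
  by apply: nrm_mx_le => // k l; rewrite mxE; case: (_ && _); rewrite ?nrm1 ?nrm0.
have y1a : a *m y1 = 0.
  rewrite mulmxBr -scalemxAr D ai; apply: mx11P; rewrite mxDE mxNE mxZE mx0E [X in _ * X]mxE mulr1n mulr1.
  by rewrite subrr.
have y1d : nrm (y1 - y0) < d.
  rewrite /y1 addrAC subrr add0r nrmN nrmZ; apply: le_lt_trans ay0.
  by rewrite ler_piMr.
apply/rowP => j; rewrite mxZE.
pose tau := (delta_mx j 0 : 'cV[C]_n.+1) - a 0 j *: (delta_mx i 0 : 'cV[C]_n.+1).
have ta (b : Cn1) : b *m tau = (b 0 j - a 0 j * b 0 i)%:M.
  by rewrite mulmxBr -scalemxAr !D scale_scalar_mx -raddfB.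
have t1 : 0 < nrm tau + 1 by rewrite ltr_wpDl.
pose s : R := d / (nrm tau + 1); have s0 : 0 < s by rewrite divr_gt0.
have y2a : a *m (y1 + s%:C *: tau) = 0.
  by rewrite mulmxDr y1a add0r -scalemxAr ta ai mulr1 subrr raddf0 scaler0.
have y2d : nrm (y1 + s%:C *: tau - y0) < 2 * d.
  rewrite addrAC; apply: le_lt_trans (nrmD _ _) _.
  rewrite nrmZ nrm_real gtr0_norm //.
  have : s * nrm tau <= d by rewrite /s mulrAC -mulrA ler_piMr ?ltW // ltr_pdivrMr // mul1r ltrDl.
  by move: y1d; clear; nlra.
have y1d' : nrm (y1 - y0) < 2 * d by move: y1d d0; clear; nlra.
have := Hy _ y2d y2a; rewrite mulmxDr (Hy _ y1d' y1a) add0r -scalemxAr.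
move=> /eqP; rewrite scaler_eq0 => /orP[/eqP c00|].
  by move: s0; rewrite (_ : s = 0) ?ltxx //; case: c00.
rewrite ta => /eqP /(congr1 (fun A : 'M[C]_1 => A 0 0)); rewrite mx0E mxE mulr1n => /eqP.
by rewrite subr_eq0 => /eqP ->; rewrite mulrC.
Qed.

(** Incidence gives the matrix through [projective_field]. For the second claim, [B H + H B^*]
    vanishes on all incident pairs near [x0], so its product with [invmx H] has every nearby point
    as eigenvector and is scalar. *)
Lemma quadric_field H i (v : Cn -> Cn) x0 (r : R) : (1 < n)%N -> H \in unitmx -> 0 < r ->
  (forall k, hol (fun z => v z 0 k) x0 r) ->
  hform H (homog i x0) (cconj (homog i x0)) = 0 ->
  (forall x w, nrm (x - x0) < r -> nrm (w - x0) < r -> hform H (homog i x) (cconj (homog i w)) = 0 ->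
    hform H (hlin i (v x)) (cconj (homog i w)) + hform H (homog i x) (cconj (hlin i (v w))) = 0) ->
  exists (B : 'M[C]_n.+1) (r1 : R), [/\ 0 < r1, forall x, nrm (x - x0) < r1 -> v x = mxvf B i x &
    exists c, B *m H + H *m (cconj B)^T = c *: H].
Proof.
move=> n1 Hu r0 vh null S.
pose y0 := hcol H (homog i x0).
have [d d0 Hd] := hcol_near i x0 Hu r0.
have y00 : y0 != 0.
  apply/eqP => y00; have : (cconj (homog i x0))^T = 0 by rewrite -(mulKmx Hu (cconj (homog i x0))^T) -/(hcol H _) -/y0 y00 mulmx0.
  move=> /(congr1 trmx); rewrite trmxK trmx0 => /(congr1 (@cconj R _ _)); rewrite cconjK cconj0 => h.
  by have := homog_neq0 i x0; rewrite h eqxx.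
have x0y0 : homog i x0 *m y0 = 0 by apply: mx11P; rewrite hcolE null mx0E.
pose m := Num.min r d; have m0 : 0 < m by rewrite lt_min r0.
have vm k : hol (fun z => v z 0 k) x0 m.
  by move=> z zm; apply: vh; apply: lt_le_trans zm _; rewrite ge_min lexx.
have inc y : nrm (y - y0) < m -> exists b : 'cV[C]_n.+1, forall x, bl x0 m x ->
    homog i x *m y = 0 -> hlin i (v x) *m y + homog i x *m b = 0.
  rewrite lt_min => /andP[_ /Hd [w [c [wr c0 yE]]]].
  (* When [y] is the polar of [w], its velocity is the polar of the velocity of [w]. *)
  exists (c *: hcol H (hlin i (v w))) => x; rewrite /bl lt_min => /andP[xr _].
  rewrite yE -!scalemxAr => /eqP; rewrite scaler_eq0 (negPf c0) /= => /eqP h.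
  have {}h : hform H (homog i x) (cconj (homog i w)) = 0 by rewrite -hcolE h mx0E.
  by apply: mx11P; rewrite mxDE !mxZE !hcolE -mulrDr S // mulr0 mx0E.
have [r1 r10 [B HB]] := projective_field m0 vm inc n1 y00 x0y0.
pose m1 := Num.min r r1; have m10 : 0 < m1 by rewrite lt_min r0.
exists B, r1; split => //.
pose K := B *m H + H *m (cconj B)^T.
have SB x w : nrm (x - x0) < m1 -> nrm (w - x0) < m1 -> hform H (homog i x) (cconj (homog i w)) = 0 ->
    (homog i x *m K *m (cconj (homog i w))^T) 0 0 = 0.
  rewrite !lt_min => /andP[xr xr1] /andP[wr wr1] h; have := S x w xr wr h.
  rewrite (HB x xr1) (HB w wr1) !hlin_mxvf.
  have hl a b (c : C) z : hform H (a - c *: b) z = hform H a z - c * hform H b z.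
    by rewrite addrC -scaleNr hform_lin1 mulNr addrC.
  have hr a b (c : C) z : hform H z (cconj (a - c *: b)) = hform H z (cconj a) - conjc c * hform H z (cconj b).
    by rewrite cconjB cconjZ addrC -scaleNr hform_lin2 mulNr addrC.
  rewrite hl hr h !mulr0 !subr0 => <-.
  rewrite /K mulmxDr mulmxDl mxDE /hform; congr (_ + _); first by rewrite mulmxA.
  by rewrite cconjM trmx_mul !mulmxA.
have [d2 d20 Hd2] := hcol_near i x0 Hu m10.
have d3 : 0 < d2 / 2 by rewrite divr_gt0.
have dy : differentiable (fun x => (homog i x *m y0) 0 0) x0.
  exact: (diff_entry 0 0 (dif_mulmxr y0 (dif_homog i x0))).
have /cont_nrmP /(_ _ d3) [d4 d40 Hd4] := differentiable_continuous dy.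
have d5 : 0 < Num.min d4 m1 by rewrite lt_min d40.
have [|c cE] := @scalar_of_eigen R n (K *m invmx H) i x0 _ d5.
  move=> x; rewrite lt_min => /andP[xd4 xm1].
  apply: (eigen_of_perp (y0 := y0) d3 (homog_i i x)).
    by have := Hd4 x xd4; rewrite x0y0 mx0E subr0.
  move=> y; rewrite mulrC divfK ?pnatr_eq0 // => /Hd2 [w [c [wr c0 yE]]].
  rewrite yE -!scalemxAr => /eqP; rewrite scaler_eq0 (negPf c0) /= => /eqP h.
  have {}h : hform H (homog i x) (cconj (homog i w)) = 0 by rewrite -hcolE h mx0E.
  have -> : homog i x *m (K *m invmx H) *m hcol H (homog i w) = homog i x *m K *m (cconj (homog i w))^T.
    by rewrite /hcol !mulmxA mulmxKV.
  apply: mx11P; rewrite mxZE mx0E.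
  by rewrite SB // mulr0.
exists c; rewrite -/K -(mulmxKV Hu K) cE.
by rewrite mul_scalar_mx.
Qed.

End QuadricField.

(** * The local theorem at a point of [M] *)

Section LocalTheorem.
Context {R : realType} {n : nat}.
Local Notation C := R[i].
Local Notation Cn := 'rV[R[i]]_n.
Local Notation Cn1 := 'rV[R[i]]_n.+1.
Local Notation e_ k := (delta_mx 0 k : 'rV[R[i]]_n).

Definition intertwines (F : Cn -> Cn1) (L : Cn -> Cn) (B : 'M[C]_n.+1) z :=
  exists c : C, 'D_(L z) F z = F z *m B + c *: F z.

Lemma open_ball (V : normedModType C) (U : set V) q : open U -> U q ->
  exists2 d : R, 0 < d & forall Z, nrm (Z - q) < d -> U Z.
Proof.
by move=> oU Uq; apply/nearP; exact: open_nbhs_nbhs.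
Qed.

Lemma Re_eq0 (a : C) : 'Re a = 0 -> a + conjc a = 0.
Proof.
by rewrite ReE => /eqP; rewrite mulf_eq0 invr_eq0 pnatr_eq0 orbF => /eqP.
Qed.

Lemma local_theorem (M U : set Cn) Phi q H F L : (1 < n)%N -> H \in unitmx ->
  defining_function M U Phi -> U q -> M q -> holomorphic_on L U ->
  (forall z, U z -> M z -> re_tangent Phi z (L z)) ->
  cp_local_biholo q F -> (\forall z \near q, M z -> hform H (F z) (cconj (F z)) = 0) ->
  exists B, (\forall z \near q, intertwines F L B z) /\
    exists c, B *m H + H *m (cconj B)^T = c *: H.
Proof.
move=> n1 Hu dM Uq Mq hL tL [i [U1 [U2 [ginv [U1q hF F0 [oU1 oU2 hf hg [fg gf]]]]]]] /nearP [p2 p20 FM].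
have [p0 p00 Hp] := hyp_germ_of dM Uq Mq.
have [p1 p10 Hp1] := open_ball oU1 U1q.
pose p := Num.min (Num.min p0 p1) p2.
have pp : 0 < p by rewrite !lt_min p00 p10.
have [G pU] : hyp_germ M q (fun P => Phi P.1 P.2) p /\ forall Z, nrm (Z - q) < p -> U Z.
  by apply: Hp; rewrite pp /p !ge_min lexx.
have pU1 Z : nrm (Z - q) < p -> U1 Z by rewrite !lt_min => /andP[/andP[_ /Hp1]].
pose f z := dehomog i (F z).
have [U2f gq] := fg q U1q.
have [r3 r30 Hr3] := open_ball oU2 U2f.
have /cont_nrmP /(_ p pp) [r4 r40 Hr4] := differentiable_continuous (hg _ U2f).
pose r := Num.min r3 r4; have r0 : 0 < r by rewrite lt_min r30.
have dF Z : nrm (Z - q) < p -> differentiable F Z by move=> /pU1 /hF.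
have F0' Z : nrm (Z - q) < p -> F Z 0 i != 0 by move=> /pU1 /F0.
have dL Z : nrm (Z - q) < p -> differentiable L Z by move=> /pU /hL.
have Lt Z : nrm (Z - q) < p -> M Z -> 'D_(L Z, 0) (fun P : Cn * Cn => Phi P.1 P.2) (dg Z)
    + conjc ('D_(L Z, 0) (fun P : Cn * Cn => Phi P.1 P.2) (dg Z)) = 0.
  move=> Zp MZ; have Zb : bl (dg q) p (dg Z) by rewrite /bl nrm_dg.
  have E := der_fst (L Z) (hg_hol G Zb); rewrite -E.
  have := tL Z (pU _ Zp) MZ; rewrite /re_tangent; exact: Re_eq0.
have FM' Z : nrm (Z - q) < p -> M Z -> hform H (F Z) (cconj (F Z)) = 0.
  by rewrite !lt_min => /andP[_ /FM].
have dgi x : nrm (x - f q) < r -> [/\ differentiable ginv x, nrm (ginv x - q) < p & f (ginv x) = x].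
  rewrite lt_min => /andP[/Hr3 h1 /Hr4 h2]; split; first exact: hg.
    by move: h2; rewrite gq.
  by have [] := gf x h1.
have gf' Z : nrm (Z - q) < p -> ginv (f Z) = Z by move=> /pU1 /fg [].
have [e1 [g [rho [kap T]]]] := retraction G.
have [k /andP[k0 kp] Hk] := segre_tangency G Hu (fun z => erefl (f z)) r0 dF F0' dL Lt FM' dgi gf' T.
have /cont_nrmP /(_ k k0) [r5 r50 Hr5] := differentiable_continuous (hg _ U2f).
pose r1 := Num.min r r5; have r10 : 0 < r1 by rewrite lt_min r0.
have kk x : nrm (x - f q) < r1 -> nrm (ginv x - q) < k /\ f (ginv x) = x.
  rewrite lt_min => /andP[xr /Hr5]; rewrite [X in ginv X]/= gq => h; split=> //.
  by have [] := dgi x xr.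
have df Z : nrm (Z - q) < p -> differentiable f Z by move=> h; exact: dif_dehomog (dF _ h) (F0' _ h).
(* The field pushed forward by the chart expression of [F], as a function on the target. *)
pose v x := 'D_(L (ginv x)) f (ginv x).
have hfk l : hol (fun z => f z 0 l) q p by move=> z zp; exact: (diff_entry 0 l (df z zp)).
have vh l : hol (fun z => v z 0 l) (f q) r1.
  move=> x; rewrite /bl lt_min => /andP[xr _]; have [dg gp _] := dgi x xr.
  have d1 : differentiable (fun Z => \sum_j L Z 0 j * 'D_(e_ j) (fun z => f z 0 l) Z) (ginv x).
    apply: difsum => j; exact: (difM (diff_entry 0 j (dL _ gp)) (hol_derive (e_ j) (hfk l) gp)).
  have d2 := dif_comp dg d1.
  have x0 : 0 < r - nrm (x - f q) by rewrite subr_gt0.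
  apply: (diff_ext x0) d2 => y yx.
  have yr : nrm (y - f q) < r.
    by apply: le_lt_trans (nrm_tri x _ _) _; rewrite -ltrBrDr.
  have [_ gy _] := dgi y yr.
  have h1 := der_mxP (L (ginv y)) 0 l (df _ gy).
  have h2 := lin_row (L (ginv y)) (deriveP_lin (hfk l _ gy)).
  exact: (esym (etrans h1 h2)).
have fqq : nrm (f q - f q) < r1 by rewrite subrr nrm0.
have pq : nrm (q - q) < p by rewrite subrr nrm0.
have null : hform H (homog i (f q)) (cconj (homog i (f q))) = 0.
  have := FM' q pq Mq; have Fi := F0' q pq; rewrite {1 2}(dehomogK Fi) cconjZ hformZ.
  by move=> /eqP; rewrite mulf_eq0 mulf_eq0 (negPf Fi) /= conjc_eq0 (negPf Fi) /= => /eqP.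
have S x w : nrm (x - f q) < r1 -> nrm (w - f q) < r1 -> hform H (homog i x) (cconj (homog i w)) = 0 ->
    hform H (hlin i (v x)) (cconj (homog i w)) + hform H (homog i x) (cconj (hlin i (v w))) = 0.
  move=> /kk [xk fx] /kk [wk fw] h.
  have Pk : bl (dg q) k (ginv x, cconj (ginv w)).
    by rewrite /bl nrm_pair_lt /= xk -cconjB nrm_cconj.
  have := Hk _ Pk; rewrite /Psi /chartA /sw /= !cconjK fx fw => /(_ h).
  by [].
have [B [r2 [r20 HB KB]]] := quadric_field n1 Hu r10 vh null S.
exists B; split => //; apply/nearP.
have /cont_nrmP /(_ r2 r20) [d d0 Hd] := differentiable_continuous (df q pq).
exists (Num.min d p); first by rewrite lt_min d0.
move=> Z; rewrite lt_min => /andP[/Hd Zr Zp].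
have := HB _ Zr; rewrite /v (gf' _ Zp) => h.
have E := der_dehomog (L Z) (dF _ Zp) (F0' _ Zp).
have hE : hlin i ('D_(L Z) (fun z => dehomog i (F z)) Z) = hlin i (mxvf B i (f Z)) by rewrite -h.
have E2 := etrans (congr1 (fun u => F Z 0 i *: u) (esym hE)) E.
rewrite /intertwines; move: E2; rewrite hlin_mxvf scalerBr scalemxAl -(dehomogK (F0' _ Zp)).
move: ('D_(L Z) F Z) => DF /eqP; rewrite eq_sym subr_eq => /eqP DFE.
exists (DF 0 i / F Z 0 i - (homog i (f Z) *m B) 0 i); rewrite [LHS]DFE.
have -> : F Z 0 i *: ((homog i (f Z) *m B) 0 i *: homog i (f Z)) = (homog i (f Z) *m B) 0 i *: F Z.
  by rewrite scalerA mulrC -scalerA -(dehomogK (F0' _ Zp)).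
by rewrite scalerBl -addrA (addrC (- _)).
Qed.

End LocalTheorem.

(** * Continuation of germs along paths *)

Section Germs.
Context {R : realType} {n : nat}.
Local Notation C := R[i].
Local Notation Cn := 'rV[R[i]]_n.
Local Notation Cn1 := 'rV[R[i]]_n.+1.
Local Notation e_ k := (delta_mx 0 k : 'rV[R[i]]_n).
Implicit Types (F G : Cn -> Cn1) (z a : Cn) (c : R -> Cn) (Fam : R -> Cn -> Cn1).

Lemma biholo_near a F : cp_local_biholo a F ->
  exists2 r : R, 0 < r & forall z, nrm (z - a) < r -> cp_local_biholo z F.
Proof.
move=> [i [U [U' [g [Ua hF F0 [oU oU' hf hg gfg]]]]]].
have [r r0 Hr] := open_ball oU Ua; exists r => // z /Hr Uz.
by exists i, U, U', g; split.
Qed.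

Lemma biholo_dif a F : cp_local_biholo a F -> differentiable F a /\ F a != 0.
Proof.
move=> [i [U [U' [g [Ua hF F0 _]]]]]; split; first exact: hF.
by apply: contraNneq (F0 _ Ua) => ->; rewrite mx0E.
Qed.

Lemma row_neq0 (v : Cn1) : v != 0 -> exists k, v 0 k != 0.
Proof.
move=> v0; apply/existsP; move: v0; apply: contraNT; rewrite negb_exists => /forallP h.
by apply/eqP/rowP => k; rewrite mx0E; have := h k; rewrite negbK => /eqP.
Qed.

(** Proportionality as vanishing minors: these are holomorphic in the germs, so identities in
    projective space propagate by the identity theorem. *)
Lemma minorsP (v w : Cn1) : w != 0 -> (forall j k, v 0 j * w 0 k = v 0 k * w 0 j) <-> exists c : C, v = c *: w.
Proof.
move=> /row_neq0 [k wk]; split=> [h|[c ->] j l]; last by rewrite !mxZE; ring.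
exists (v 0 k / w 0 k); apply/rowP => j; rewrite mxZE mulrAC -h mulfK //.
Qed.

Lemma proj_eq_sym (v w : Cn1) : proj_eq v w -> proj_eq w v.
Proof. by move=> [c c0 ->]; exists c^-1; rewrite ?invr_eq0 // scalerA mulVf // scale1r. Qed.

Lemma proj_eq_trans (u v w : Cn1) : proj_eq u v -> proj_eq v w -> proj_eq u w.
Proof. by move=> [c c0 ->] [d d0 ->]; exists (c * d); rewrite ?mulf_neq0 // scalerA. Qed.

Lemma germ_sym z F G : cp_germ_eq z F G -> cp_germ_eq z G F.
Proof. by move=> /nearP [r r0 h]; apply/nearP; exists r => // x /h /proj_eq_sym. Qed.

Lemma germ_refl z F : cp_germ_eq z F F.
Proof. by apply/nearP; exists 1 => // x _; exists 1; rewrite ?oner_neq0 ?scale1r. Qed.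

Lemma germ_trans z F G K : cp_germ_eq z F G -> cp_germ_eq z G K -> cp_germ_eq z F K.
Proof.
move=> /nearP [r r0 h] /nearP [s s0 h']; apply/nearP; exists (Num.min r s); first by rewrite lt_min r0.
by move=> x; rewrite lt_min => /andP[/h h1 /h' h2]; exact: proj_eq_trans h1 h2.
Qed.

Lemma near_nearby (P : Cn -> Prop) a : (\forall z \near a, P z) ->
  exists2 r : R, 0 < r & forall z, nrm (z - a) < r -> \forall w \near z, P w.
Proof.
move=> /nearP [r r0 h]; exists r => // z zr; apply/nearP; exists (r - nrm (z - a)); first by rewrite subr_gt0.
by move=> w wz; apply: h; apply: le_lt_trans (nrm_tri z _ _) _; rewrite -ltrBrDr.
Qed.

Lemma minors_rigid (A F : Cn -> Cn1) a (r : R) z0 :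
  (forall z, nrm (z - a) < r -> differentiable A z /\ differentiable F z /\ F z != 0) ->
  nrm (z0 - a) < r -> (\forall z \near z0, exists c : C, A z = c *: F z) ->
  forall z, nrm (z - a) < r -> exists c : C, A z = c *: F z.
Proof.
move=> hol0 z0r /nearP [d d0 Hd] z zr; have [_ [_ Fz]] := hol0 z zr.
apply/(minorsP _ Fz) => j k; apply/eqP; rewrite -subr_eq0; apply/eqP.
apply: (@identity_ball _ _ (fun z => A z 0 j * F z 0 k - A z 0 k * F z 0 j) a r z0 d _ z0r d0 _ z zr).
  move=> y yr; have [dA [dF _]] := hol0 y yr.
  exact: (difB (difM (diff_entry 0 j dA) (diff_entry 0 k dF)) (difM (diff_entry 0 k dA) (diff_entry 0 j dF))).
move=> y yd; have [c ->] := Hd y yd; rewrite !mxZE; ring.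
Qed.

Lemma germ_rigid F G a (r : R) z0 z1 :
  (forall z, nrm (z - a) < r -> cp_local_biholo z F /\ cp_local_biholo z G) ->
  nrm (z0 - a) < r -> nrm (z1 - a) < r -> cp_germ_eq z0 F G -> cp_germ_eq z1 F G.
Proof.
move=> hFG z0r z1r E; apply/nearP; exists (r - nrm (z1 - a)); first by rewrite subr_gt0.
move=> z zz; have zr : nrm (z - a) < r by apply: le_lt_trans (nrm_tri z1 _ _) _; rewrite -ltrBrDr.
have [cc ccE] : exists c : C, F z = c *: G z.
  apply: (minors_rigid (r := r) (a := a) (z0 := z0)) => // [y yr|].
    by have [/biholo_dif [d1 _] /biholo_dif [d2 d3]] := hFG y yr.
  by move/nearP: E => [d d0 Hd]; apply/nearP; exists d => // y /Hd [c _ E]; exists c.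
have [/biholo_dif [_ F0] _] := hFG z zr.
by exists cc => //; apply: contraNneq F0 => cc0; rewrite ccE cc0 scale0r.
Qed.

Lemma dif_dirL F (L : Cn -> Cn) a (r : R) z : (forall z, nrm (z - a) < r -> differentiable F z) ->
  nrm (z - a) < r -> differentiable L z -> differentiable (fun z => 'D_(L z) F z) z.
Proof.
move=> dF zr dL; apply: diff_mx => b j; rewrite [b]ord1.
have hFj : hol (fun z => F z 0 j) a r by move=> y yr; exact: diff_entry 0 j (dF y yr).
have d1 : differentiable (fun z => \sum_l L z 0 l * 'D_(e_ l) (fun z => F z 0 j) z) z.
  apply: difsum => l; exact: (difM (diff_entry 0 l dL) (hol_derive (e_ l) hFj zr)).
have p0 : 0 < r - nrm (z - a) by rewrite subr_gt0.
apply: (diff_ext p0) d1 => y yz.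
have yr : nrm (y - a) < r by apply: le_lt_trans (nrm_tri z _ _) _; rewrite -ltrBrDr.
have h1 := der_mxP (L y) 0 j (dF y yr); have h2 := lin_row (L y) (deriveP_lin (hFj y yr)).
exact: (esym (etrans h1 h2)).
Qed.

(** The condition says that the holomorphic map [D_L F - F B] is proportional to [F], so
    [minors_rigid] applies. *)
Lemma intertwines_rigid F L B a (r : R) z0 :
  (forall z, nrm (z - a) < r -> cp_local_biholo z F /\ differentiable L z) ->
  nrm (z0 - a) < r -> (\forall z \near z0, intertwines F L B z) ->
  forall z, nrm (z - a) < r -> intertwines F L B z.
Proof.
move=> hF z0r E z zr.
have dF y : nrm (y - a) < r -> differentiable F y by move=> /hF [/biholo_dif []].
have h1 y : nrm (y - a) < r -> differentiable (fun z => 'D_(L z) F z - F z *m B) y /\ differentiable F y /\ F y != 0.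
  move=> yr; have [/biholo_dif [d1 F0] dL] := hF y yr; split; last exact: (conj d1 F0).
  have d2 := dif_dirL dF yr dL; have d3 := dif_mulmxr B d1.
  exact: (@difB _ _ _ (fun z => 'D_(L z) F z) (fun z => F z *m B) y d2 d3).
have h2 : \forall z \near z0, exists c : C, 'D_(L z) F z - F z *m B = c *: F z.
  move/nearP: E => [d d0 Hd]; apply/nearP; exists d; first exact: d0.
  by move=> y /Hd [c E]; exists c; rewrite [X in X - _]E addrC addKr.
have [c cE] := minors_rigid h1 z0r h2 zr.
by exists c; rewrite -cE addrC subrK.
Qed.

Lemma intertwines_germ F G L B z : differentiable F z -> F z != 0 -> differentiable G z -> cp_germ_eq z F G ->
  intertwines F L B z -> intertwines G L B z.
Proof.
move=> dF F0 dG /nearP [d d0 Hd] [c cE].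
have zz (s : R) : 0 < s -> nrm (z - z) < s by rewrite subrr nrm0.
have [k Fk] := row_neq0 F0.
have [e0 e00 ezF] := Hd z (zz _ d0).
pose u y := G y 0 k / F y 0 k.
have dFk := diff_entry 0 k dF.
have du : differentiable u z by exact: difdiv (diff_entry 0 k dG) dFk Fk.
have /cont_nrmP := differentiable_continuous dFk.
have nF : 0 < nrm (F z 0 k) by rewrite nrm_gt0.
move=> /(_ _ nF) [d1 d10 Hd1].
have GE y : nrm (y - z) < Num.min d d1 -> u y *: F y = G y.
  rewrite lt_min => /andP[/Hd [e e1 FE] /Hd1 h].
  have g0 : G y 0 k != 0.
    by apply/eqP => g0; move: h; rewrite FE mxZE g0 mulr0 sub0r nrmN ltxx.
  rewrite /u FE mxZE scalerA; move: g0 e1; move: (G y 0 k) => a a0 e1.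
  have -> : a / (e * a) * e = 1 by field; rewrite ?a0 ?e1.
  by rewrite scale1r.
have dm : 0 < Num.min d d1 by rewrite lt_min d0.
have E1 := der_ext (L z) dm GE (dif_scale du dF).
have E2 := der_scale (L z) du dF.
have uz : u z *: F z = G z by apply: GE; exact: zz.
exists (c + 'D_(L z) u z * e0).
rewrite -E1 E2 cE scalerDr scalemxAl uz -addrA; congr (_ + _).
by rewrite scalerA mulrC -scalerA uz scalerDl; congr (_ + _); rewrite -scalerA -ezF.
Qed.

Definition ctn01 c := forall t : R, 0 <= t <= 1 -> forall e : R, 0 < e ->
  exists2 d : R, 0 < d & forall s, 0 <= s <= 1 -> `|s - t| < d -> nrm (c s - c t) < e.

Record cont_fam c Fam : Prop := ContFam {
  cf_ctn : ctn01 c;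
  cf_bih : forall t : R, 0 <= t <= 1 -> cp_local_biholo (c t) (Fam t);
  cf_loc : forall t : R, 0 <= t <= 1 -> exists2 d : R, 0 < d & forall s, 0 <= s <= 1 -> `|s - t| < d ->
    cp_germ_eq (c s) (Fam s) (Fam t) }.

(** The transport principle: it suffices that near each time [P] passes between any two times. *)
Lemma loc01 (P : R -> Prop) : (forall t, 0 <= t <= 1 -> exists2 d : R, 0 < d & forall s s',
    0 <= s <= 1 -> 0 <= s' <= 1 -> `|s - t| < d -> `|s' - t| < d -> P s -> P s') ->
  P 0 -> forall t, 0 <= t <= 1 -> P t.
Proof.
move=> H; apply: clopen01 => t t01.
  move=> Pt; have [d d0 Hd] := H t t01; exists d => // s s01 sd; apply: (Hd t s) => //.
  by rewrite subrr normr0.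
have [d d0 Hd] := H t t01 => /(_ d d0) [s s01 [sd Ps]]; apply: (Hd s t) => //.
by rewrite subrr normr0.
Qed.

(** Around each time a single representative [Fam t] on one ball carries all nearby germs, so
    transport over a short time is rigidity on a ball. *)
Lemma cont_fam_window c Fam t : cont_fam c Fam -> 0 <= t <= 1 -> forall e : R, 0 < e ->
  exists r d : R, [/\ 0 < r <= e, 0 < d, forall z, nrm (z - c t) < r -> cp_local_biholo z (Fam t) &
   forall s, 0 <= s <= 1 -> `|s - t| < d -> nrm (c s - c t) < r /\ cp_germ_eq (c s) (Fam s) (Fam t)].
Proof.
move=> cf t01 e e0; have [r r0 hr] := biholo_near (cf_bih cf t01).
have m0 : 0 < Num.min r e by rewrite lt_min r0.
have [d d0 Hd] := cf_ctn cf t01 m0; have [d' d'0 Hd'] := cf_loc cf t01.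
exists (Num.min r e), (Num.min d d'); split.
- by rewrite m0 ge_min lexx orbT.
- by rewrite lt_min d0.
- by move=> z; rewrite lt_min => /andP[/hr].
by move=> s s01; rewrite lt_min => /andP[h1 h2]; split; [exact: Hd|exact: Hd'].
Qed.

Lemma cont_fam_unique c Fam Fam' : cont_fam c Fam -> cont_fam c Fam' ->
  cp_germ_eq (c 0) (Fam 0) (Fam' 0) -> forall t, 0 <= t <= 1 -> cp_germ_eq (c t) (Fam t) (Fam' t).
Proof.
move=> cf cf'; apply: loc01 => t t01.
have [r [d [/andP[r0 _] d0 h1 h2]]] := cont_fam_window cf t01 ltr01.
have [r' [d' [/andP[r'0 _] d'0 h1' h2']]] := cont_fam_window cf' t01 ltr01.
exists (Num.min d d') => [|s s' s01 s'01]; first by rewrite lt_min d0.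
rewrite !lt_min => /andP[sd sd'] /andP[s'd s'd'] E.
have [a1 a2] := h2 s s01 sd; have [a3 a4] := h2' s s01 sd'.
have [b1 b2] := h2 s' s'01 s'd; have [b3 b4] := h2' s' s'01 s'd'.
apply: (germ_trans b2); apply: (germ_trans _ (germ_sym b4)).
apply: (germ_rigid (r := Num.min r r') (a := c t) (z0 := c s)); rewrite ?lt_min ?a1 ?a3 ?b1 ?b3 //.
  by move=> z; rewrite lt_min => /andP[/h1 ? /h1' ?].
exact: (germ_trans (germ_sym a2) (germ_trans E a4)).
Qed.

Lemma intertwines_near_germ F G L B z : cp_local_biholo z F -> cp_local_biholo z G -> cp_germ_eq z F G ->
  (\forall w \near z, intertwines F L B w) -> \forall w \near z, intertwines G L B w.
Proof.
move=> /biholo_near [r r0 hF] /biholo_near [r' r'0 hG] /near_nearby [d d0 Hd] /nearP [e e0 He].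
apply/nearP; exists (Num.min (Num.min r r') (Num.min d e)); first by rewrite !lt_min r0 r'0 d0.
move=> w; rewrite !lt_min => /andP[/andP[/hF /biholo_dif [a a0] /hG /biholo_dif [b _]] /andP[/Hd c /He]].
exact: intertwines_germ.
Qed.

Lemma intertwines_transport c Fam L B (O : set Cn) : cont_fam c Fam -> open O -> holomorphic_on L O ->
  (forall t, 0 <= t <= 1 -> O (c t)) ->
  (\forall z \near c 0, intertwines (Fam 0) L B z) ->
  forall t, 0 <= t <= 1 -> \forall z \near c t, intertwines (Fam t) L B z.
Proof.
move=> cf oO hL cO; apply: loc01 => t t01.
have [e e0 He] := open_ball oO (cO t t01).
have [r [d [/andP[r0 re] d0 h1 h2]]] := cont_fam_window cf t01 e0.
exists d; first exact: d0.
move=> s s' s01 s'01 sd s'd E.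
have [a1 a2] := h2 s s01 sd; have [b1 b2] := h2 s' s'01 s'd.
have E1 := intertwines_near_germ (cf_bih cf s01) (h1 _ a1) a2 E.
apply: (intertwines_near_germ (h1 _ b1) (cf_bih cf s'01) (germ_sym b2)).
have hh z : nrm (z - c t) < r -> cp_local_biholo z (Fam t) /\ differentiable L z.
  by move=> zr; split; [exact: h1|apply: hL; apply: He; exact: lt_le_trans zr re].
apply/nearP; exists (r - nrm (c s' - c t)); first by rewrite subr_gt0.
move=> z zz; apply: (intertwines_rigid hh a1 E1).
by apply: le_lt_trans (nrm_tri (c s') _ _) _; rewrite -ltrBrDr.
Qed.

Lemma quadric_germ M H F G z : cp_germ_eq z F G ->
  (\forall w \near z, M w -> hform H (F w) (cconj (F w)) = 0) ->
  \forall w \near z, M w -> hform H (G w) (cconj (G w)) = 0.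
Proof.
move=> /germ_sym /nearP [r r0 h] /nearP [d d0 Hd]; apply/nearP; exists (Num.min r d); first by rewrite lt_min r0.
move=> w; rewrite lt_min => /andP[/h [c c0 ->] /Hd Hw] /Hw E.
by rewrite cconjZ hformZ E mulr0.
Qed.

(** [propagate] is applied to the complexified pull-back of the form; since its radius does not
    depend on the starting point, it links any two nearby times of the path in [M]. *)
Lemma quadric_transport M H c Fam : real_analytic_hypersurface M -> cont_fam c Fam ->
  (forall t, 0 <= t <= 1 -> M (c t)) ->
  (\forall z \near c 0, M z -> hform H (Fam 0 z) (cconj (Fam 0 z)) = 0) ->
  forall t, 0 <= t <= 1 -> \forall z \near c t, M z -> hform H (Fam t z) (cconj (Fam t z)) = 0.
Proof.
move=> hM cf cM; apply: loc01 => t t01.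
have [U [Phi [Uq dM]]] := hM _ (cM t t01).
have [p0 p00 Hp] := hyp_germ_of dM Uq (cM t t01).
have [r [d [/andP[r0 _] d0 h1 h2]]] := cont_fam_window cf t01 ltr01.
have [G _] : hyp_germ M (c t) (fun P => Phi P.1 P.2) p0 /\ forall Z, nrm (Z - c t) < p0 -> U Z.
  by apply: Hp; rewrite p00 lexx.
have [e1 [g [rho [kap T]]]] := retraction G.
pose K (P : Cn * Cn) := hform H (Fam t P.1) (cconj (Fam t (sw P).1)).
have hK : hol K (dg (c t)) r.
  have dP P : bl (dg (c t)) r P -> differentiable (fun P : Cn * Cn => Fam t P.1) P.
    by move=> /bl_fst /h1 /biholo_dif [dF _]; exact: dif_comp_fst dF.
  by move=> P Pr; have [] := dif_herm H (dP P Pr) (dP _ (bl_sw Pr)).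
have [k' /andP[k'0 k'k] Hk] := propagate G T r0 hK.
have [d' d'0 Hd'] := cf_ctn cf t01 k'0.
exists (Num.min d d') => [|s s' s01 s'01]; first by rewrite lt_min d0.
rewrite !lt_min => /andP[sd sd'] /andP[s'd s'd'] E.
have [a1 a2] := h2 s s01 sd; have [b1 b2] := h2 s' s'01 s'd.
apply: (quadric_germ (germ_sym b2)).
have /nearP [m m0 Hm] := quadric_germ a2 E.
have Kret : forall P, bl (dg (c t)) k' P -> K (ret e1 g P) = 0.
  apply: (Hk (c s) (Hd' s s01 sd') (cM s s01)); exists m => // Z Zm MZ.
  by rewrite /K sw_dg; exact: Hm.
apply/nearP; exists (Num.min (k' - nrm (c s' - c t)) (p0 - nrm (c s' - c t))).
  have : nrm (c s' - c t) < p0.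
    have kk : bl (dg (c t)) kap (dg (c s')) by rewrite /bl nrm_dg; exact: lt_le_trans (Hd' s' s'01 s'd') k'k.
    by have := rt_ball T (s := 0) kk; rewrite nrm0 scale0r addr0 /bl nrm_dg; apply; exact: rt_rho T.
  by move=> h; rewrite lt_min !subr_gt0 h (Hd' s' s'01 s'd').
move=> z; rewrite lt_min => /andP[z1 z2] Mz.
have zk : nrm (z - c t) < k' by apply: le_lt_trans (nrm_tri (c s') _ _) _; rewrite -ltrBrDr.
have zp : nrm (z - c t) < p0 by apply: le_lt_trans (nrm_tri (c s') _ _) _; rewrite -ltrBrDr.
have zb : bl (dg (c t)) k' (dg z) by rewrite /bl nrm_dg.
have ph0 : Phi (dg z).1 (dg z).2 = 0 by apply/(hg_M G zp).
have := Kret _ zb; rewrite (ret_fix T (lt_le_trans zb k'k) ph0) /K sw_dg.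
by [].
Qed.

End Germs.

(** * Continuation over a square *)

Section Squares.
Context {R : realType} {n : nat}.
Local Notation C := R[i].
Local Notation Cn := 'rV[R[i]]_n.
Local Notation Cn1 := 'rV[R[i]]_n.+1.
Implicit Types (F G : Cn -> Cn1) (c : R -> Cn) (Fam : R -> Cn -> Cn1) (h : R -> R -> Cn).

(** Admissible reparametrisations; the constant 2 accommodates the doubled speed in concatenated
    paths. *)
Definition lip01 (th : R -> R) := (forall t, 0 <= t <= 1 -> 0 <= th t <= 1) /\
  forall s t, `|th s - th t| <= 2 * `|s - t|.

Lemma lip01_close th s t (d : R) : lip01 th -> `|s - t| < d / 2 -> `|th s - th t| < d.
Proof. by move=> [_ /(_ s t)] h hd; apply: le_lt_trans h _; rewrite mulrC -ltr_pdivlMr. Qed.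

Lemma ctn01_comp c th : ctn01 c -> lip01 th -> ctn01 (fun t => c (th t)).
Proof.
move=> hc hth t t01 e e0; have [d d0 Hd] := hc _ (hth.1 t t01) e e0.
exists (d / 2); first by rewrite divr_gt0.
by move=> s s01 sd; apply: Hd; [exact: hth.1|exact: lip01_close].
Qed.

Lemma cont_fam_comp c Fam th : cont_fam c Fam -> lip01 th ->
  cont_fam (fun t => c (th t)) (fun t => Fam (th t)).
Proof.
move=> cf hth; split; first exact: ctn01_comp (cf_ctn cf) hth.
  by move=> t t01; exact: (cf_bih cf (hth.1 t t01)).
move=> t t01; have [d d0 Hd] := cf_loc cf (hth.1 t t01).
exists (d / 2); first by rewrite divr_gt0.
by move=> s s01 sd; apply: Hd; [exact: hth.1|exact: lip01_close].
Qed.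

Lemma cont_fam_cst c G : ctn01 c -> (forall t, 0 <= t <= 1 -> cp_local_biholo (c t) G) ->
  cont_fam c (fun _ => G).
Proof.
by move=> hc hG; split=> // t t01; exists 1 => // s _ _; exact: germ_refl.
Qed.

Lemma mul01 (s t : R) : 0 <= s <= 1 -> 0 <= t <= 1 -> 0 <= s * t <= 1.
Proof.
move=> /andP[s0 s1] /andP[t0 t1]; rewrite mulr_ge0 //=.
by apply: le_trans s1; rewrite ler_piMr.
Qed.

Lemma lip01_seg (a b : R) : 0 <= a <= 1 -> 0 <= b <= 1 -> lip01 (fun u => a + u * (b - a)).
Proof.
move=> a01 b01; split=> [t|s t].
  move: a01 b01 => /andP[a0 a1] /andP[b0 b1] /andP[t0 t1].
  have -> : a + t * (b - a) = (1 - t) * a + t * b by ring.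
  have t1' : 0 <= 1 - t by rewrite subr_ge0.
  rewrite addr_ge0 ?mulr_ge0 //=.
  have h1 : (1 - t) * a <= 1 - t by rewrite ler_piMr.
  have h2 : t * b <= t by rewrite ler_piMr.
  by apply: le_trans (lerD h1 h2) _; rewrite subrK.
have -> : a + s * (b - a) - (a + t * (b - a)) = (s - t) * (b - a) by ring.
rewrite normrM mulrC ler_wpM2r //; move: a01 b01 => /andP[a0 a1] /andP[b0 b1].
by rewrite ler_norml; apply/andP; split; lra.
Qed.

Lemma cont_fam_const c Fam G (a b : R) : cont_fam c Fam -> 0 <= a <= 1 -> 0 <= b <= 1 ->
  (forall u, 0 <= u <= 1 -> cp_local_biholo (c (a + u * (b - a))) G) ->
  cp_germ_eq (c a) (Fam a) G -> cp_germ_eq (c b) (Fam b) G.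
Proof.
move=> cf a01 b01 hG E; have hl := lip01_seg a01 b01.
have cf1 := cont_fam_comp cf hl; have cf2 := cont_fam_cst (cf_ctn cf1) hG.
have u1 : 0 <= (1 : R) <= 1 by rewrite lexx ler01.
have := cont_fam_unique cf1 cf2 _ u1; rewrite mul0r addr0 mul1r addrC subrK; exact.
Qed.

Definition ctn_sq h := forall s t : R, 0 <= s <= 1 -> 0 <= t <= 1 -> forall e : R, 0 < e ->
  exists2 d : R, 0 < d & forall s' t', 0 <= s' <= 1 -> 0 <= t' <= 1 -> `|s' - s| < d -> `|t' - t| < d ->
    nrm (h s' t' - h s t) < e.

Record sq_fam h (Gm : R -> R -> Cn -> Cn1) : Prop := SqFam {
  sq_ctn : ctn_sq h;
  sq_bih : forall s t, 0 <= s <= 1 -> 0 <= t <= 1 -> cp_local_biholo (h s t) (Gm s t);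
  sq_loc : forall s t : R, 0 <= s <= 1 -> 0 <= t <= 1 -> exists2 d : R, 0 < d & forall s' t',
    0 <= s' <= 1 -> 0 <= t' <= 1 -> `|s' - s| < d -> `|t' - t| < d ->
    cp_germ_eq (h s' t') (Gm s' t') (Gm s t) }.

Lemma sq_fam_curve h Gm th th' : sq_fam h Gm -> lip01 th -> lip01 th' ->
  cont_fam (fun t => h (th t) (th' t)) (fun t => Gm (th t) (th' t)).
Proof.
move=> sq l l'; split=> [t t01 e e0|t t01|t t01]; last 1 first.
- have [d d0 Hd] := sq_loc sq (l.1 t t01) (l'.1 t t01).
  exists (d / 2); first by rewrite divr_gt0.
  by move=> s s01 sd; apply: Hd; [exact: l.1|exact: l'.1|exact: lip01_close|exact: lip01_close].
- have [d d0 Hd] := sq_ctn sq (l.1 t t01) (l'.1 t t01) e0.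
  exists (d / 2); first by rewrite divr_gt0.
  by move=> s s01 sd; apply: Hd; [exact: l.1|exact: l'.1|exact: lip01_close|exact: lip01_close].
- exact: (sq_bih sq (l.1 t t01) (l'.1 t t01)).
Qed.

Lemma scale_close (a s s0 d : R) : 0 <= a <= 1 -> `|s - s0| < d -> `|a * s - a * s0| < d.
Proof.
move=> /andP[a0 a1]; rewrite -mulrBr normrM ger0_norm //; apply: le_lt_trans.
by rewrite ler_piMl.
Qed.

Lemma prod_close (a b s s0 d : R) : 0 <= a <= 1 -> 0 <= s0 <= 1 -> `|a - b| < d / 2 -> `|s - s0| < d / 2 ->
  `|a * s - b * s0| < d.
Proof.
move=> a01 /andP[s00 s01] h1 h2; have := scale_close a01 h2 => h3.
have -> : a * s - b * s0 = (a * s - a * s0) + (a - b) * s0 by ring.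
apply: le_lt_trans (ler_normD _ _) _.
have : `|(a - b) * s0| <= `|a - b| by rewrite normrM (ger0_norm s00) ler_piMr.
by move: h1 h3; clear; lra.
Qed.

(** [Gm s t] is the end germ of the continuation along the segment from the corner to [(s, t)].
    Coherence at [(s0, t0)] is shown by moving along the segments together, with [loc01] in their
    parameter. *)
Lemma square_family h F : ctn_sq h ->
  (forall s t, 0 <= s <= 1 -> 0 <= t <= 1 -> exists Fam,
    cont_fam (fun u => h (u * s) (u * t)) Fam /\ cp_germ_eq (h 0 0) (Fam 0) F) ->
  exists Gm, sq_fam h Gm /\ cp_germ_eq (h 0 0) (Gm 0 0) F.
Proof.
move=> hc ext; have z01 : 0 <= (0 : R) <= 1 by rewrite lexx ler01.
have o01 : 0 <= (1 : R) <= 1 by rewrite lexx ler01.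
have [Fm HFm] : exists Fm : R * R -> R -> Cn -> Cn1, forall st : R * R, 0 <= st.1 <= 1 -> 0 <= st.2 <= 1 ->
    cont_fam (fun u => h (u * st.1) (u * st.2)) (Fm st) /\ cp_germ_eq (h 0 0) (Fm st 0) F.
  have [|Fm HFm] := @choice (R * R)%type (R -> Cn -> Cn1) (fun st Fam => 0 <= st.1 <= 1 -> 0 <= st.2 <= 1 ->
    cont_fam (fun u => h (u * st.1) (u * st.2)) Fam /\ cp_germ_eq (h 0 0) (Fam 0) F); last by exists Fm.
  move=> [s t] /=.
  case: (boolP (0 <= s <= 1)) => s01; last by exists (fun _ => F).
  case: (boolP (0 <= t <= 1)) => t01; last by exists (fun _ => F).
  by have [Fam HF] := ext s t s01 t01; exists Fam.
exists (fun s t => Fm (s, t) 1); split; last first.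
  have [cf E] := HFm (0, 0) z01 z01.
  apply: germ_trans E; have cst : cont_fam (fun u : R => h (u * 0) (u * 0)) (fun _ => Fm (0, 0) 0).
    apply: cont_fam_cst (cf_ctn cf) _ => t t01; have := cf_bih cf z01.
    by rewrite !mulr0.
  by have := cont_fam_unique cf cst (germ_refl _ _) o01; rewrite !mulr0.
split=> [//|s t s01 t01|s0 t0 s01 t01].
  by have [cf _] := HFm (s, t) s01 t01; have := cf_bih cf o01; rewrite !mul1r.
have [cf0 E0] := HFm (s0, t0) s01 t01.
(* At parameter [u], the continuations to all end points near [(s0, t0)] have the germ of the
   central one; [d] may shrink as [u] moves. *)
pose P (u : R) := exists2 d : R, 0 < d & forall s t, 0 <= s <= 1 -> 0 <= t <= 1 ->
  `|s - s0| < d -> `|t - t0| < d -> cp_germ_eq (h (u * s) (u * t)) (Fm (s, t) u) (Fm (s0, t0) u).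
suff : P 1.
  move=> [d d0 Hd]; exists d; first exact: d0.
  by move=> s t a b a' b'; have := Hd s t a b a' b'; rewrite !mul1r.
have us u : 0 <= u <= 1 -> 0 <= u * s0 <= 1 by move=> u01; exact: mul01.
have ut u : 0 <= u <= 1 -> 0 <= u * t0 <= 1 by move=> u01; exact: mul01.
apply: (loc01 (P := P)) o01; last first.
  exists 1; first exact: ltr01.
  move=> s t a b _ _; rewrite !mul0r; have [_ E] := HFm (s, t) a b.
  exact: germ_trans E (germ_sym E0).
move=> u u01; have [r [d [/andP[r0 _] d0 h1 h2]]] := cont_fam_window cf0 u01 ltr01.
have [d1 d10 Hd1] := hc _ _ (us u u01) (ut u u01) r r0.
have near_germ w : 0 <= w <= 1 -> `|w - u| < d -> exists2 m : R, 0 < m & forall s t, 0 <= s <= 1 -> 0 <= t <= 1 ->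
    `|s - s0| < m -> `|t - t0| < m -> cp_germ_eq (h (w * s) (w * t)) (Fm (s0, t0) w) (Fm (s0, t0) u).
  move=> w01 wd; have [_ /near_nearby [e e0 He]] := h2 w w01 wd.
  have [m m0 Hm] := hc _ _ (us w w01) (ut w w01) e e0; exists m; first exact: m0.
  move=> s t a b a' b'; apply: He; apply: Hm; [exact: mul01|exact: mul01|exact: scale_close|exact: scale_close].
exists (Num.min d (d1 / 2)) => [|w w' w01 w'01]; first by rewrite lt_min d0 divr_gt0.
rewrite !lt_min => /andP[wd wd1] /andP[w'd w'd1] [m m0 Hm].
have [m1 m10 Hm1] := near_germ w w01 wd; have [m2 m20 Hm2] := near_germ w' w'01 w'd.
exists (Num.min (Num.min m (d1 / 2)) (Num.min m1 m2)); first by rewrite !lt_min m0 m10 m20 divr_gt0.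
move=> s t a b; rewrite !lt_min => /andP[/andP[sm sd] /andP[sm1 sm2]] /andP[/andP[tm td] /andP[tm1 tm2]].
have [cf _] := HFm (s, t) a b.
have Ew := germ_trans (Hm s t a b sm tm) (Hm1 s t a b sm1 tm1).
apply: germ_trans (germ_sym (Hm2 s t a b sm2 tm2)).
have [a01 b01] := conj w01 w'01.
apply: (cont_fam_const cf w01 w'01) Ew => v v01; apply: h1.
pose x := w + v * (w' - w).
have x01 : 0 <= x <= 1 by exact: (lip01_seg w01 w'01).1.
have xd : `|x - u| < d1 / 2.
  have -> : x - u = (1 - v) * (w - u) + v * (w' - u) by rewrite /x; ring.
  move: v01 => /andP[v0 v1]; apply: le_lt_trans (ler_normD _ _) _.
  rewrite !normrM (ger0_norm v0) ger0_norm ?subr_ge0 //.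
  apply: (@le_lt_trans _ _ ((1 - v) * Num.max `|w - u| `|w' - u| + v * Num.max `|w - u| `|w' - u|)).
    by apply: lerD; apply: ler_wpM2l; rewrite ?subr_ge0 // le_max lexx ?orbT.
  by rewrite -mulrDl subrK mul1r gt_max wd1.
apply: Hd1; [exact: mul01|exact: mul01| |].
  exact: (prod_close x01 s01 xd sd).
exact: (prod_close x01 t01 xd td).
Qed.

Lemma path_in_ctn (A : set Cn) p c : path_in A p c -> ctn01 c.
Proof.
move=> [/subspace_continuousP cc _ _] t t01 e e0.
have t01' : `[0, 1]%classic t by rewrite /= in_itv.
have /nrm_cvgP /(_ e e0) := cc t t01'.
rewrite near_withinE => /nbhs_ballP [d d0 Hd]; exists d => // s s01 sd.
have sb : ball t d s by rewrite /ball /= distrC.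
have s01' : `[0, 1]%classic s by rewrite /= in_itv.
exact: (Hd s sb s01').
Qed.

Lemma ctn_path_in (A : set Cn) p c : ctn01 c -> c 0 = p -> (forall t, 0 <= t <= 1 -> A (c t)) -> path_in A p c.
Proof.
move=> hc c0 cA; split=> //; apply/subspace_continuousP => t; rewrite /= in_itv /= => t01.
apply/nrm_cvgP => e e0; have [d d0 Hd] := hc t t01 e e0.
rewrite near_withinE; apply/nbhs_ballP; exists d => // s sd; rewrite /= in_itv /= => s01.
by apply: Hd => //; rewrite distrC.
Qed.

Lemma continuation_cont_fam c F Fam : ctn01 c -> continuation_along c F Fam ->
  cont_fam c Fam /\ cp_germ_eq (c 0) (Fam 0) F.
Proof.
move=> hc [E b l]; split=> //; split=> // t t01.
have /nbhs_ballP [d d0 Hd] := l t t01; exists d => // s s01 sd; apply: Hd => //.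
by rewrite /ball /= distrC.
Qed.

End Squares.

(** * Paths inside the hypersurface *)

Section Reach.
Context {R : realType} {n : nat}.
Local Notation C := R[i].
Local Notation Cn := 'rV[R[i]]_n.
Implicit Types (A M O : set Cn) (a b z : Cn) (c : R -> Cn).

Definition reach A a b := exists c, [/\ ctn01 c, c 0 = a, c 1 = b & forall t, 0 <= t <= 1 -> A (c t)].

Lemma reach_refl A a : A a -> reach A a a.
Proof.
by move=> Aa; exists (fun _ => a); split=> // t _ e e0; exists 1 => // s _ _; rewrite subrr nrm0.
Qed.

Lemma lip01_rev : lip01 (fun t : R => 1 - t).
Proof.
split=> [t /andP[t0 t1]|s t]; first by rewrite subr_ge0 t1 gerBl.
have -> : 1 - s - (1 - t) = - (s - t) by ring.
by rewrite normrN ler_peMl // ler1n.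
Qed.

Lemma lip01_first : lip01 (fun t : R => Num.min (2 * t) 1).
Proof.
split=> [t /andP[t0 t1]|s t]; first by rewrite le_min ler01 mulr_ge0 // ge_min lexx orbT.
have h1 := ler_norm (s - t); have := ler_norm (t - s); rewrite distrC => h2.
rewrite ler_norml; apply/andP; split; case: (leP (2 * s) 1) => hs; case: (leP (2 * t) 1) => ht; lra.
Qed.

Lemma lip01_second : lip01 (fun t : R => Num.max (2 * t - 1) 0).
Proof.
split=> [t /andP[t0 t1]|s t]; first by rewrite le_max lexx orbT ge_max ler01; lra.
have h1 := ler_norm (s - t); have := ler_norm (t - s); rewrite distrC => h2.
rewrite ler_norml; apply/andP; split; case: (leP (2 * s - 1) 0) => hs; case: (leP (2 * t - 1) 0) => ht; lra.
Qed.

Lemma reach_sym A a b : reach A a b -> reach A b a.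
Proof.
move=> [c [hc c0 c1 cA]]; exists (fun t => c (1 - t)); split.
- exact: ctn01_comp hc lip01_rev.
- by rewrite subr0.
- by rewrite subrr.
by move=> t t01; apply: cA; exact: lip01_rev.1.
Qed.

Lemma reach_trans A a b z : reach A a b -> reach A b z -> reach A a z.
Proof.
move=> [c [hc c0 c1 cA]] [d [hd d0 d1 dA]].
(* On each half one summand rests at [b]; writing the concatenation as a sum avoids a case split in
   the continuity proof. *)
exists (fun t => c (Num.min (2 * t) 1) + d (Num.max (2 * t - 1) 0) - b); split.
- move=> t t01 e e0; have e2 : 0 < e / 2 by rewrite divr_gt0.
  have [m m0 Hm] := ctn01_comp hc lip01_first t01 e2.
  have [m' m'0 Hm'] := ctn01_comp hd lip01_second t01 e2.
  exists (Num.min m m'); first by rewrite lt_min m0.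
  move=> s s01; rewrite lt_min => /andP[/(Hm s s01) h1 /(Hm' s s01) h2].
  move: h1 h2; move: (c _) (c _) (d _) (d _) => x y u v h1 h2.
  have -> : y + v - b - (x + u - b) = (y - x) + (v - u).
    by rewrite opprB addrA subrK opprD addrACA.
  by apply: le_lt_trans (nrmD _ _) _; move: h1 h2; clear; nlra.
- by rewrite mulr0 sub0r min_l ?ler01 // max_r ?lerN10 // c0 d0 addrK.
- have -> : (2 * 1 - 1 : R) = 1 by ring.
  by rewrite mulr1 min_r ?ler1n // max_l ?ler01 // c1 d1 addrC addKr.
move=> t /andP[t0 t1]; case: (leP (2 * t) 1) => ht.
  rewrite max_r ?d0 ?addrK; last by lra.
  by apply: cA; rewrite ht andbT mulr_ge0.
rewrite max_l; last by lra.
by rewrite c1 addrC addKr; apply: dA; apply/andP; split; lra.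
Qed.

(** The straight segment to [z'] is pushed into [M] by the retraction, which fixes its end points
    and, near [z], does not leave [O]. *)
Lemma reach_local M O z : real_analytic_hypersurface M -> open O -> (M `&` O) z ->
  exists2 d : R, 0 < d & forall z', (M `&` O) z' -> nrm (z' - z) < d -> reach (M `&` O) z z'.
Proof.
move=> hM oO [Mz Oz]; have [U [Phi [Uz dM]]] := hM z Mz.
have [p0 p00 Hp] := hyp_germ_of dM Uz Mz.
have [G _] : hyp_germ M z (fun P => Phi P.1 P.2) p0 /\ forall Z, nrm (Z - z) < p0 -> U Z.
  by apply: Hp; rewrite p00 lexx.
have [e1 [g [rho [kap T]]]] := retraction G.
have [dO dO0 HO] := open_ball oO Oz.
pose mu Z := Z + g (dg Z) *: e1.
have muE Z : nrm (Z - z) < kap -> ret e1 g (dg Z) = dg (mu Z) /\ M (mu Z) := ret_dg G T (Z := Z).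
have mu_cont Z : nrm (Z - z) < kap -> forall e : R, 0 < e -> exists2 d : R, 0 < d & forall Z', nrm (Z' - z) < kap ->
    nrm (Z' - Z) < d -> nrm (mu Z' - mu Z) < e.
  move=> Zk e e0; have Zb : bl (dg z) kap (dg Z) by rewrite /bl nrm_dg.
  have /cont_nrmP /(_ e e0) [d d0 Hd] := differentiable_continuous (dif_ret T Zb).
  exists d => // Z' Z'k Z'd; rewrite -nrm_dg -(muE Z' Z'k).1 -(muE Z Zk).1.
  by apply: Hd; rewrite nrm_dg.
have mu_fix Z : nrm (Z - z) < kap -> M Z -> mu Z = Z.
  move=> Zk MZ; have Zb : bl (dg z) kap (dg Z) by rewrite /bl nrm_dg.
  have Zp : nrm (Z - z) < p0.
    by have := rt_ball T (s := 0) Zb; rewrite nrm0 scale0r addr0 /bl nrm_dg; apply; exact: rt_rho T.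
  have ph0 : Phi (dg Z).1 (dg Z).2 = 0 by apply/(hg_M G Zp).
  by rewrite /mu (g_zero T Zb ph0) scale0r addr0.
have zk : nrm (z - z) < kap by rewrite subrr nrm0 (rt_kap T).
have [d1 d10 Hd1] := mu_cont z zk dO dO0.
exists (Num.min kap d1); first by rewrite lt_min (rt_kap T).
move=> z' [Mz' Oz']; rewrite lt_min => /andP[z'k z'd].
pose Zt (t : R) := z + t%:C *: (z' - z).
have ZtB t : 0 <= t <= 1 -> nrm (Zt t - z) <= nrm (z' - z).
  by move=> /andP[t0 t1]; rewrite /Zt addrC addKr nrmZ nrm_real ger0_norm // ler_piMl.
exists (fun t => mu (Zt t)); split.
- move=> t t01 e e0; have Zk : nrm (Zt t - z) < kap by exact: le_lt_trans (ZtB t t01) z'k.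
  have [d d0 Hd] := mu_cont _ Zk e e0.
  have n1 : 0 < nrm (z' - z) + 1 by rewrite ltr_wpDl.
  exists (d / (nrm (z' - z) + 1)); first by rewrite divr_gt0.
  move=> s s01 sd; apply: Hd; first exact: le_lt_trans (ZtB s s01) z'k.
  have -> : Zt s - Zt t = (s - t)%:C *: (z' - z).
    by rewrite /Zt opprD addrACA subrr add0r -scalerBl rmorphB.
  rewrite nrmZ nrm_real; apply: (@le_lt_trans _ _ (`|s - t| * (nrm (z' - z) + 1))).
    by apply: ler_wpM2l => //; rewrite lerDl.
  by rewrite -ltr_pdivlMr.
- by rewrite /Zt scale0r addr0 mu_fix.
- by rewrite /Zt scale1r addrC subrK mu_fix.
move=> t t01; have Zk : nrm (Zt t - z) < kap by exact: le_lt_trans (ZtB t t01) z'k.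
split; first exact: (muE _ Zk).2.
have := Hd1 _ Zk (le_lt_trans (ZtB t t01) z'd).
by rewrite (mu_fix z zk Mz) => /HO.
Qed.

Lemma reach_component A a b :
  (forall z, A z -> exists2 d : R, 0 < d & forall z', A z' -> nrm (z' - z) < d -> reach A z z') ->
  A a -> connected_component A a b -> reach A a b.
Proof.
move=> loc Aa [D [Da DA cD] Db].
(* A union of balls on which points of [A] are reachable from the centre; with [Q] reachability it
   gives relative openness, with the negation relative closedness. *)
have op (Q : set Cn) : open [set x | exists2 w, (D w /\ Q w) & exists d : R, [/\ 0 < d,
     forall z', A z' -> nrm (z' - w) < d -> reach A w z' & nrm (x - w) < d]].
  rewrite openE => x [w [Dw Qw] [d [d0 Hd xd]]]; apply: (iffRL (nearP (x : Cn) _)).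
  exists (d - nrm (x - w)); first by rewrite subr_gt0.
  move=> y yx; exists w => //; exists d; split => //.
  by apply: le_lt_trans (nrm_tri x _ _) _; rewrite -ltrBrDr.
have E : D `&` [set x | reach A a x] = D.
  apply: cD.
  - by exists a; split=> //; exact: reach_refl.
  - exists [set x | exists2 w, (D w /\ reach A a w) & exists d : R, [/\ 0 < d,
     forall z', A z' -> nrm (z' - w) < d -> reach A w z' & nrm (x - w) < d]]; first exact: op.
    apply/seteqP; split=> [x [Dx rx]|x [Dx [w [Dw rw] [d [d0 Hd xd]]]]]; split=> //.
      have [d d0 Hd] := loc x (DA _ Dx); exists x => //; exists d; split => //.
      by rewrite subrr nrm0.
    by apply: reach_trans rw _; apply: Hd => //; exact: DA.
  exists (~` [set x | exists2 w, (D w /\ ~ reach A a w) & exists d : R, [/\ 0 < d,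
     forall z', A z' -> nrm (z' - w) < d -> reach A w z' & nrm (x - w) < d]]).
    by apply: open_closedC; exact: (op (fun w => ~ reach A a w)).
  apply/seteqP; split=> [x [Dx rx]|x [Dx nx]]; split=> //.
    move=> [w [Dw nw] [d [d0 Hd xd]]]; apply: nw; apply: reach_trans rx _.
    by apply: reach_sym; apply: Hd => //; exact: DA.
  apply: contrapT => nr; apply: nx; have [d d0 Hd] := loc x (DA _ Dx).
  by exists x => //; exists d; split => //; rewrite subrr nrm0.
by have [] : (D `&` [set x | reach A a x]) b by rewrite E.
Qed.

End Reach.

(** * The matrix exponential *)

Section MatrixExp.
Context {R : realType} {n : nat}.
Local Notation C := R[i].
Local Notation Mn := 'M[R[i]]_n.+1.
Implicit Types (A B : Mn).

Definition eterm A k : Mn := (k`!%:R : C)^-1 *: A ^+ k.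
Definition esum A (N : nat) : Mn := \sum_(0 <= k < N) eterm A k.

Lemma nrm_one_mx : nrm (1 : Mn) <= 1.
Proof. by apply: nrm_mx_le => // i j; rewrite mxE; case: (i == j); rewrite ?nrm1 ?nrm0. Qed.

Lemma nrm_pow A k : nrm (A ^+ k) <= (n.+1%:R * nrm A) ^+ k.
Proof.
elim: k => [|k IH]; first by rewrite !expr0 nrm_one_mx.
rewrite !exprS; apply: le_trans (nrm_mulmx _ _) _.
by apply: ler_wpM2l => //; rewrite mulr_ge0.
Qed.

Lemma nrm_fact k : nrm ((k`!%:R : C)^-1) = (k`!%:R)^-1.
Proof.
by rewrite nrmV; have := nrm_real (k`!%:R : R); rewrite rmorph_nat ger0_norm // => ->.
Qed.

(** [a^k / k! = 2^-k (2 a)^k / k!], and each term of the series of [expR (2 * a)] is at most its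
    sum. *)
Lemma exp_bound (a : R) : 0 <= a -> exists2 c : R, 0 <= c & forall k, a ^+ k / k`!%:R <= c / 2 ^+ k.
Proof.
move=> a0; have a2 : 0 <= 2 * a by rewrite mulr_ge0.
exists (expR (2 * a)); first exact: expR_ge0.
move=> k; rewrite ler_pdivlMr ?exprn_gt0 // mulrAC -exprMn (mulrC a).
have -> : (2 * a) ^+ k / k`!%:R = exp_coeff (2 * a) k by [].
case: k => [|k]; last first.
  by apply: le_trans (expR_ge1Dxn k a2); rewrite lerDr.
by rewrite /exp_coeff /= expr0 fact0 divr1; apply: le_trans (expR_ge1Dx _); rewrite lerDl.
Qed.

Lemma nrm_eterm A k : nrm (eterm A k) <= (n.+1%:R * nrm A) ^+ k / k`!%:R.
Proof. by rewrite nrmZ nrm_fact mulrC ler_wpM2r ?invr_ge0 // nrm_pow. Qed.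

Lemma mexp_cvg A : exists c : R, forall N, nrm (esum A N - mexp A) <= c / 2 ^+ N.
Proof.
have a0 : 0 <= n.+1%:R * nrm A by rewrite mulr_ge0.
have [c c0 Hc] := exp_bound a0.
have stp i j k : nrm (esum A k.+1 i j - esum A k i j) <= c / 2 ^+ k.
  rewrite /esum big_nat_recr //= mxDE addrC addKr.
  exact: le_trans (nrm_mx_entry _ _ _) (le_trans (nrm_eterm A k) (Hc k)).
have ex i j : exists l : C, forall k, nrm (esum A k i j - l) <= 4 * c / 2 ^+ k.
  exact: geom_cvg (stp i j).
have [l Hl] := @choice ('I_n.+1 * 'I_n.+1)%type C (fun ij l => forall k, nrm (esum A k ij.1 ij.2 - l) <= 4 * c / 2 ^+ k)
  (fun ij => ex ij.1 ij.2).
pose Lm : Mn := \matrix_(i, j) l (i, j).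
have HL k : nrm (esum A k - Lm) <= 4 * c / 2 ^+ k.
  apply: nrm_mx_le => [|i j]; first by rewrite divr_ge0 ?exprn_ge0 // mulr_ge0.
  by rewrite mxDE mxNE [Lm _ _]mxE; exact: (Hl (i, j)).
suff -> : mexp A = Lm by exists (4 * c).
have cv : series (fun k => (k`!%:R : C)^-1 *: A ^+ k) @ \oo --> Lm.
  apply/nrm_cvgP => e e0; have [N hN] := geom_small (4 * c) e0.
  exists N => // k /= Nk; have -> : series (fun k => (k`!%:R : C)^-1 *: A ^+ k) k = esum A k by [].
  apply: le_lt_trans (HL k) _; apply: le_lt_trans hN.
  apply: ler_wpM2l; first by rewrite mulr_ge0.
  by rewrite lef_pV2 ?posrE ?exprn_gt0 // ler_weXn2l // ler1n.
exact: (cvg_lim (@norm_hausdorff _ _) cv).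
Qed.

Lemma geom_lim_le (V : normedModType C) (X : nat -> V) Y (c K : R) :
  (forall N, nrm (X N - Y) <= c / 2 ^+ N) -> (forall N, nrm (X N) <= K) -> nrm Y <= K.
Proof.
move=> h1 h2; rewrite leNgt; apply/negP => lt.
have e0 : 0 < nrm Y - K by rewrite subr_gt0.
have [N hN] := geom_small c e0.
have := nrmB (X N) (X N - Y); rewrite subKr; have := h1 N; have := h2 N.
by clear -hN; nlra.
Qed.

Lemma geom_lim_eq (V : normedModType C) (Y : V) (c : R) : (forall N, nrm Y <= c / 2 ^+ N) -> Y = 0.
Proof.
move=> h; apply/eqP; rewrite -nrm_eq0 eq_le nrm_ge0 andbT leNgt; apply/negP => lt.
by have [N hN] := geom_small c lt; have := lt_le_trans hN (h N); rewrite ltxx.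
Qed.

Lemma mexp_comm A S : A *m S = S *m A -> mexp A *m S = S *m mexp A.
Proof.
move=> cAS; have [c Hc] := mexp_cvg A.
have cp k : A ^+ k *m S = S *m A ^+ k.
  elim: k => [|k IH]; first by rewrite expr0 mul1mx mulmx1.
  by rewrite exprSr -[A ^+ k * A]/(A ^+ k *m A) -mulmxA cAS mulmxA IH mulmxA.
have cs N : esum A N *m S = S *m esum A N.
  elim: N => [|N IH]; first by rewrite /esum big_nil mul0mx mulmx0.
  by rewrite /esum big_nat_recr //= mulmxDl mulmxDr -/(esum A N) IH /eterm -scalemxAl -scalemxAr cp.
apply/eqP; rewrite -subr_eq0; apply/eqP.
apply: (@geom_lim_eq _ _ (2 * (n.+1%:R * nrm S) * c)) => N.
have -> : mexp A *m S - S *m mexp A = S *m (esum A N - mexp A) - (esum A N - mexp A) *m S.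
  rewrite mulmxBr mulmxBl cs; move: (S *m esum A N) (S *m mexp A) (mexp A *m S) => x y z.
  by rewrite opprB [RHS]addrC addrA subrK.
have k0 : 0 <= n.+1%:R * nrm S by rewrite mulr_ge0.
have h := ler_wpM2l k0 (Hc N).
have E2 (K d y : R) : 2 * K * d * y = K * (d * y) + K * (d * y) by ring.
rewrite E2; apply: (le_trans (nrmB _ _)); apply: lerD; first exact: le_trans (nrm_mulmx _ _) h.
by apply: (le_trans (nrm_mulmx _ _)); rewrite mulrAC.
Qed.

(** The second-order Taylor remainder of the [k]-th power; at [k = 0] the truncated predecessor is
    harmless, its coefficient being 0. *)
Definition taylor2 (t s : C) k := (t + s) ^+ k - t ^+ k - k%:R * s * t ^+ k.-1.

Lemma taylor2_bound (t s : C) (T : R) k : 1 <= T -> nrm t <= T -> nrm (t + s) <= T ->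
  nrm (taylor2 t s k) <= nrm s ^+ 2 * (2 * T) ^+ k.
Proof.
move=> T1 tT tsT; have T0 : 0 <= T by apply: le_trans T1.
elim: k => [|k IH]; first by rewrite /taylor2 !expr0 subrr !mul0r subr0 nrm0 mulr1 exprn_ge0.
have -> : taylor2 t s k.+1 = (t + s) * taylor2 t s k + k%:R * s ^+ 2 * t ^+ k.-1.
  rewrite /taylor2; case: k {IH} => [|k] /=; first by rewrite !expr0 !expr1; ring.
  by rewrite !exprS -[k.+2%:R]natr1 -[k.+1%:R]natr1; ring.
have nk : nrm (k%:R : C) = k%:R.
  by have := nrm_real (k%:R : R); rewrite rmorph_nat ger0_norm.
have s0 : 0 <= nrm s ^+ 2 by rewrite exprn_ge0.
have a1 : nrm (t + s) * nrm (taylor2 t s k) <= T * (nrm s ^+ 2 * (2 * T) ^+ k) by exact: ler_pM.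
have a2 : k%:R * nrm t ^+ k.-1 <= T * (2 * T) ^+ k.
  have kT : (k%:R : R) <= 2 ^+ k by rewrite -natrX ler_nat ltnW // ltn_expl.
  have tT' : nrm t ^+ k.-1 <= T ^+ k.
    apply: (@le_trans _ _ (T ^+ k.-1)); first by apply: lerXn2r; rewrite ?nnegrE.
    by apply: ler_weXn2l => //; exact: leq_pred.
  apply: (@le_trans _ _ ((2 * T) ^+ k)); last by rewrite ler_peMl // exprn_ge0 // mulr_ge0.
  by rewrite exprMn; apply: ler_pM => //; exact: exprn_ge0.
apply: (le_trans (nrmD _ _)); rewrite !nrmM nk !nrmX [(2 * T) ^+ k.+1]exprS.
have a3 := ler_wpM2l s0 a2.
have E3 (x y z : R) : x * (2 * y * z) = y * (x * z) + x * (y * z) by ring.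
rewrite E3; apply: lerD => //.
by rewrite [k%:R * _]mulrC -mulrA.
Qed.

Lemma esumS A N : esum A N.+1 = esum A N + eterm A N.
Proof. by rewrite /esum big_nat_recr. Qed.

Lemma esum0 A : esum A 0 = 0.
Proof. by rewrite /esum big_nil. Qed.

Lemma etermZ (c : C) A k : eterm (c *: A) k = c ^+ k *: eterm A k.
Proof. by rewrite /eterm exprZn !scalerA mulrC. Qed.

Lemma mul_eterm A k : A *m eterm A k = k.+1%:R *: eterm A k.+1.
Proof.
rewrite /eterm -scalemxAr -[A *m A ^+ k]/(A * A ^+ k) -exprS scalerA; congr (_ *: _).
by rewrite factS natrM invfM mulrA divff ?mul1r // pnatr_eq0.
Qed.

(** The truncations differ by one because the first-order term carries an additional factor [A]. *)
Lemma esum_taylor A (t s : C) N : esum ((t + s) *: A) N.+1 - esum (t *: A) N.+1 - (s *: A) *m esum (t *: A) N =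
  \sum_(0 <= k < N.+1) taylor2 t s k *: eterm A k.
Proof.
elim: N => [|N IH].
  rewrite !esumS !esum0 mulmx0 subr0 !add0r big_nat1 !etermZ !expr0 subrr.
  by rewrite /taylor2 !expr0 subrr !mul0r subr0 scale0r.
rewrite (big_nat_recr N.+1) //= -IH (esumS _ N.+1) (esumS (t *: A) N.+1).
have h : (s *: A) *m esum (t *: A) N.+1 = (s *: A) *m esum (t *: A) N + (N.+1%:R * s * t ^+ N) *: eterm A N.+1.
  rewrite esumS mulmxDr; congr (_ + _).
  by rewrite etermZ -scalemxAr -scalemxAl mul_eterm !scalerA; congr (_ *: _); ring.
rewrite h !etermZ /taylor2 /= !scalerBl.
move: (esum ((t + s) *: A) N.+1) (esum (t *: A) N.+1) ((s *: A) *m esum (t *: A) N) => x y z.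
move: (_ *: eterm A N.+1) (_ *: eterm A N.+1) (_ *: eterm A N.+1) => u v w.
by apply/matrixP => i j; rewrite !mxE; ring.
Qed.

Lemma sub6 (V : zmodType) (a b c x y z : V) : a - b - c - (x - y - z) = (a - x) - (b - y) - (c - z).
Proof. by rewrite !opprD !opprK !addrA [LHS](ACl (1*4*2*5*3*6)). Qed.

Lemma mexp_taylor A (T : R) : 1 <= T -> exists2 K : R, 0 <= K & forall t s : C, nrm t <= T -> nrm (t + s) <= T ->
  nrm (mexp ((t + s) *: A) - mexp (t *: A) - (s *: A) *m mexp (t *: A)) <= K * nrm s ^+ 2.
Proof.
move=> T1; have T0 : 0 <= T by apply: le_trans T1.
have a0 : 0 <= 2 * T * (n.+1%:R * nrm A) by rewrite !mulr_ge0.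
have [c c0 Hc] := exp_bound a0.
exists (2 * c); first by rewrite mulr_ge0.
move=> t s tT tsT.
have [c1 H1] := mexp_cvg ((t + s) *: A); have [c2 H2] := mexp_cvg (t *: A).
pose k0 := n.+1%:R * nrm (s *: A); have k00 : 0 <= k0 by rewrite mulr_ge0.
apply: (@geom_lim_le _ (fun N => esum ((t + s) *: A) N.+1 - esum (t *: A) N.+1 - (s *: A) *m esum (t *: A) N)
   _ (c1 / 2 + c2 / 2 + k0 * c2)) => N; last first.
  rewrite esum_taylor.
  have bnd k : nrm (taylor2 t s k *: eterm A k) <= nrm s ^+ 2 * (c / 2 ^+ k).
    rewrite nrmZ; apply: (@le_trans _ _ ((nrm s ^+ 2 * (2 * T) ^+ k) * ((n.+1%:R * nrm A) ^+ k / k`!%:R))).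
      by apply: ler_pM => //; [exact: taylor2_bound|exact: nrm_eterm].
    have -> : nrm s ^+ 2 * (2 * T) ^+ k * ((n.+1%:R * nrm A) ^+ k / k`!%:R) =
        nrm s ^+ 2 * ((2 * T * (n.+1%:R * nrm A)) ^+ k / k`!%:R) by rewrite [in RHS]exprMn; ring.
    by apply: ler_wpM2l; [rewrite exprn_ge0|exact: Hc].
  have sum_bnd m : nrm (\sum_(0 <= k < m) taylor2 t s k *: eterm A k) <= nrm s ^+ 2 * (2 * c - 2 * c / 2 ^+ m).
    elim: m => [|m IH]; first by rewrite big_nil nrm0 expr0 divr1 subrr mulr0.
    rewrite big_nat_recr //=; apply: le_trans (nrmD _ _) _; apply: le_trans (lerD IH (bnd m)) _.
    rewrite -mulrDr; apply: ler_wpM2l; first by rewrite exprn_ge0.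
    have -> : 2 * c / 2 ^+ m.+1 = c / 2 ^+ m by rewrite exprS; field; rewrite expf_neq0 // pnatr_eq0.
    have -> : 2 * c / 2 ^+ m = c / 2 ^+ m + c / 2 ^+ m by ring.
    by move: (c / 2 ^+ m) => x; clear; lra.
  apply: le_trans (sum_bnd _) _; rewrite mulrC; apply: ler_wpM2r; first by rewrite exprn_ge0.
  by rewrite gerBl divr_ge0 ?exprn_ge0 // mulr_ge0.
have e1 := H1 N.+1; have e2 := H2 N.+1; have e3 := H2 N.
have -> : esum ((t + s) *: A) N.+1 - esum (t *: A) N.+1 - (s *: A) *m esum (t *: A) N -
    (mexp ((t + s) *: A) - mexp (t *: A) - (s *: A) *m mexp (t *: A)) =
    (esum ((t + s) *: A) N.+1 - mexp ((t + s) *: A)) - (esum (t *: A) N.+1 - mexp (t *: A))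
     - (s *: A) *m (esum (t *: A) N - mexp (t *: A)).
  rewrite mulmxBr; exact: sub6.
apply: le_trans (nrmB _ _) _; have h1 := nrmB (esum ((t + s) *: A) N.+1 - mexp ((t + s) *: A)) (esum (t *: A) N.+1 - mexp (t *: A)).
have h2 := nrm_mulmx (s *: A) (esum (t *: A) N - mexp (t *: A)).
have h3 : k0 * nrm (esum (t *: A) N - mexp (t *: A)) <= k0 * (c2 / 2 ^+ N) by apply: ler_wpM2l.
have -> : (c1 / 2 + c2 / 2 + k0 * c2) / 2 ^+ N = (c1 / 2 ^+ N.+1 + c2 / 2 ^+ N.+1) + k0 * (c2 / 2 ^+ N).
  by rewrite exprS; field; rewrite expf_neq0 // pnatr_eq0.
by apply: lerD; [apply: le_trans h1 (lerD e1 e2)|exact: le_trans h2 h3].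
Qed.

Lemma hasd_mexp A (t : C) : hasd (fun t : C => mexp (t *: A)) t (fun s => s *: (A *m mexp (t *: A))).
Proof.
have T1 : 1 <= nrm t + 1 by rewrite lerDr.
have [K K0 HK] := mexp_taylor A T1.
apply: (@hasd_quad _ _ _ _ _ _ (nrm (A *m mexp (t *: A))) K 1 ltr01).
- by move=> a u w; rewrite scalerDl scalerA.
- by move=> h; rewrite nrmZ mulrC.
move=> h h1; rewrite scalemxAl; apply: HK; first by rewrite lerDl.
by apply: le_trans (nrmD _ _) _; rewrite lerD2l ltW.
Qed.

Lemma mexp0 : mexp (0 : Mn) = 1.
Proof.
have [c Hc] := mexp_cvg 0; apply/eqP; rewrite -subr_eq0 -oppr_eq0 opprB; apply/eqP.
apply: (@geom_lim_eq _ _ (c / 2)) => N.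
have E : forall m, esum (0 : Mn) m.+1 = 1.
  elim=> [|m IH]; rewrite esumS.
    by rewrite esum0 add0r /eterm expr0 fact0 invr1 scale1r.
  by rewrite IH /eterm expr0n scaler0 addr0.
have h := Hc N.+1; rewrite E in h; apply: (le_trans h).
by rewrite exprS le_eqVlt; apply/orP; left; apply/eqP; field; rewrite expf_neq0 // pnatr_eq0.
Qed.

(** The product of [exp (t A)] and [exp (- t A)] has zero derivative in the complex variable [t], so
    it keeps its value 1 at [t = 0]. *)
Lemma mexp_unit A : mexp A \in unitmx.
Proof.
pose E (t : C) := mexp (t *: A); pose E' (t : C) := mexp (t *: - A).
have dE t := hasd_diff (hasd_mexp A t); have dE' t := hasd_diff (hasd_mexp (- A) t).
have P i j : (E 1 *m E' 1) i j = (E 0 *m E' 0) i j.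
  pose f (t : C) := \sum_k E t i k * E' t k j.
  have d1 t k : differentiable (fun t => E t i k) t by exact: diff_entry i k (dE t).1.
  have d2 t k : differentiable (fun t => E' t k j) t by exact: diff_entry k j (dE' t).1.
  have e1 t k : 'D_(1 : C) (fun t => E t i k) t = (A *m E t) i k.
    by have := hasd_derive (1 : C) (hasd_entry i k (hasd_mexp A t)); rewrite scale1r.
  have e2 t k : 'D_(1 : C) (fun t => E' t k j) t = - (A *m E' t) k j.
    by have := hasd_derive (1 : C) (hasd_entry k j (hasd_mexp (- A) t)); rewrite scale1r mulNmx mxNE.
  have df t : differentiable f t by apply: difsum => k; exact: difM (d1 t k) (d2 t k).
  have D1 t : 'D_(1 : C) f t = 0.
    apply: (etrans (dersum _ (fun k => difM (d1 t k) (d2 t k)))).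
    have Ek k : 'D_(1 : C) (fun t => E t i k * E' t k j) t = (A *m E t) i k * E' t k j - E t i k * (A *m E' t) k j.
      by apply: (etrans (derM _ (d1 t k) (d2 t k))); rewrite e1 e2; ring.
    rewrite (eq_bigr _ (fun k _ => Ek k)) sumrB.
    have -> : \sum_k (A *m E t) i k * E' t k j = (A *m E t *m E' t) i j by rewrite [RHS]mxE.
    have -> : \sum_k E t i k * (A *m E' t) k j = (E t *m (A *m E' t)) i j by rewrite [RHS]mxE.
    have cA : E t *m A = A *m E t by apply: mexp_comm; rewrite -scalemxAl -scalemxAr.
    by rewrite mulmxA cA subrr.
  have D0 t u : 'D_u f t = 0.
    by have := linZ u (1 : C) (deriveP_lin (df t)); rewrite D1 scaler0 -[u *: 1]/(u * 1) mulr1.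
  have b1 : bl (0 : C) 2 1 by rewrite /bl subr0 nrm1 ltr1n.
  have fE t : (E t *m E' t) i j = f t by rewrite mxE.
  have h := @hol_const _ _ f 0 2 (fun z _ => df z) (fun z _ => D0 z) 1 b1.
  exact: (etrans (fE 1) (etrans h (esym (fE 0)))).
have E1 : E 1 *m E' 1 = 1.
  have E0 : E 0 = 1 by rewrite /E scale0r mexp0.
  have E'0 : E' 0 = 1 by rewrite /E' scale0r mexp0.
  by apply/matrixP => i j; apply: (etrans (P i j)); rewrite E0 E'0 mulmx1.
have [u _] := mulmx1_unit E1.
have E11 : E 1 = mexp A by rewrite /E scale1r.
exact: (eq_ind _ (fun X : Mn => X \in unitmx) u _ E11).
Qed.

End MatrixExp.

(** * Fields induced by matrices: centralizer, quadric, uniqueness, brackets *)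

Section Algebra.
Context {R : realType} {n : nat}.
Local Notation C := R[i].
Local Notation Cn := 'rV[R[i]]_n.
Local Notation Cn1 := 'rV[R[i]]_n.+1.
Local Notation e_ k := (delta_mx 0 k : 'rV[R[i]]_n).
Implicit Types (B S H : 'M[R[i]]_n.+1) (F G : Cn -> Cn1) (L : Cn -> Cn).

Lemma hasd_mulmxl (V : normedModType C) m k p (X : V -> 'M[C]_(k, p)) x l (A : 'M[C]_(m, k)) :
  hasd X x l -> hasd (fun z => A *m X z) x (fun h => A *m l h).
Proof.
case=> ll [K lK] Hx; have k0 : 0 <= k%:R * nrm A by rewrite mulr_ge0.
split.
- by move=> a u v; rewrite ll mulmxDr scalemxAr.
- exists (k%:R * nrm A * K) => h; apply: le_trans (nrm_mulmx _ _) _.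
  by rewrite -[leRHS]mulrA ler_wpM2l.
move=> e e0; have K1 : 0 < k%:R * nrm A + 1 by rewrite ltr_wpDl.
have [d d0 Hd] := Hx _ (divr_gt0 e0 K1); exists d => // h /Hd hh.
rewrite -!mulmxBr; apply: le_trans (nrm_mulmx _ _) _.
apply: (@le_trans _ _ ((k%:R * nrm A + 1) * nrm (X (x + h) - X x - l h))).
  by apply: ler_wpM2r => //; rewrite lerDl.
rewrite mulrC -ler_pdivlMr //; apply: le_trans hh _.
by rewrite mulrAC.
Qed.

Lemma generates_mxvf B : generates_vfield B (mxvf B).
Proof.
move=> i z; pose G (t : C) := homog i z *m mexp (t *: B).
have hG : hasd G 0 (fun s => homog i z *m (s *: (B *m mexp (0 *: B)))).
  exact: hasd_mulmxl (hasd_mexp B 0).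
have G0 : G 0 = homog i z by rewrite /G scale0r mexp0 mulmx1.
have [dG _] := hasd_diff hG.
have g0 : G 0 0 i != 0 by rewrite G0 homog_i oner_neq0.
have dd := dif_dehomog dG g0.
have DG : 'D_1 G 0 = homog i z *m B.
  by have := hasd_derive (1 : C) hG; rewrite !scale1r scale0r mexp0 mulmx1.
apply: DeriveDef; first exact: diff_derivable.
have E := der_dehomog (1 : C) dG g0.
apply: (@hlin_inj _ _ i); rewrite hlin_mxvf.
have G01 : G 0 0 i = 1 by rewrite G0 homog_i.
move: E; rewrite DG G01 scale1r divr1 => E; apply: (etrans E).
by congr (_ - _ *: _); exact: G0.
Qed.

Lemma centralizer_mxvf B S : B *m S = S *m B -> centralizer_algebra S (mxvf B).
Proof.
move=> cBS; split; first exact: hol_CP_mxvf.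
exists B; split; first exact: generates_mxvf.
move=> t; split; first exact: mexp_unit.
exists 1; first exact: oner_neq0.
by rewrite scale1r; apply: mexp_comm; rewrite -scalemxAl -scalemxAr cBS.
Qed.

(** The real part to be killed is half the value of [B H + H B^*], that is of [c H], at a null
    vector; the radial correction in [mxvf] disappears for the same reason. *)
Lemma hol_quadric_mxvf H B c : H \is hermsymmx -> B *m H + H *m (cconj B)^T = c *: H ->
  hol_quadric H (mxvf B).
Proof.
move=> /is_hermitianmxP hH KB; split; first exact: hol_CP_mxvf.
move=> i z [_ null].
have hH' : (cconj H)^T = H.
  by rewrite [in RHS]hH expr0 scale1r /cconj map_trmx.
rewrite /re_tangent.
have hz : homog i (cconj z) = cconj (homog i z).
  apply: (@row_split _ _ i) => [|k].
    by rewrite homog_i [RHS]mxE homog_i rmorph1.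
  by rewrite homog_lift [LHS]mxE [RHS]mxE homog_lift.
pose W := H *m (cconj (homog i z))^T.
have D : 'D_(mxvf B i z) (fun x => hform H (homog i x) (homog i (cconj z))) z = (hlin i (mxvf B i z) *m W) 0 0.
  have -> : (fun x => hform H (homog i x) (homog i (cconj z))) = (fun x => (homog i x *m W) 0 0).
    by apply/funext => x; rewrite hz /hform /W mulmxA.
  have dh := dif_mulmxr W (dif_homog i z).
  apply: (etrans (esym (der_mxP _ 0 0 dh))).
  by rewrite (der_mulmxr _ W (dif_homog i z)) der_homog.
rewrite D hlin_mxvf mulmxBl -scalemxAl mxDE mxNE mxZE.
have nW : (homog i z *m W) 0 0 = 0 by rewrite -null /hform /W mulmxA.
rewrite nW mulr0 subr0 ReE.
set X := (homog i z *m B *m W).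
have cX : (X 0 0)^*%R = (homog i z *m (H *m (cconj B)^T) *m (cconj (homog i z))^T) 0 0.
  have -> : (X 0 0)^*%R = ((cconj X)^T) 0 0 by rewrite !mxE.
  by rewrite /X /W !cconjM cconj_tr cconjK !trmx_mul trmxK hH' !mulmxA.
have X0 : X 0 0 = (homog i z *m (B *m H) *m (cconj (homog i z))^T) 0 0 by rewrite /X /W !mulmxA.
rewrite cX X0 -mxDE -mulmxDl -mulmxDr KB.
by rewrite -scalemxAr -scalemxAl mxZE -/(hform H _ _) null mulr0 mul0r.
Qed.

(** The image of a local biholomorphism fills an open part of a chart, so [scalar_of_eigen] applies
    there. *)
Lemma germ_scalar z G (A : 'M[C]_n.+1) : cp_local_biholo z G ->
  (\forall w \near z, exists c : C, G w *m A = c *: G w) -> exists c, A = c%:M.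
Proof.
move=> [i [U [U' [g [Uz hG G0 [oU oU' hf hg [fg gf]]]]]]] /nearP [d d0 Hd].
have [U'f gz] := fg z Uz.
have [r r0 Hr] := open_ball oU' U'f.
have /cont_nrmP /(_ d d0) [r1 r10 Hr1] := differentiable_continuous (hg _ U'f).
have m0 : 0 < Num.min r r1 by rewrite lt_min r0.
apply: (scalar_of_eigen (i := i) (x0 := (dehomog i \o G) z) m0) => x.
rewrite lt_min => /andP[/Hr U'x /Hr1 hx].
have [Ug fx] := gf x U'x; have [|c cE] := Hd (g x); first by move: hx; rewrite gz.
have gi := G0 _ Ug; have GE := dehomogK gi.
have fx' : dehomog i (G (g x)) = x by [].
rewrite fx' in GE; exists c; move: cE; rewrite GE -scalemxAl scalerA mulrC -scalerA.
by move=> /(scalerI gi).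
Qed.

Lemma intertwines_unique z G L B B' : cp_local_biholo z G ->
  (\forall w \near z, intertwines G L B w) -> (\forall w \near z, intertwines G L B' w) ->
  exists c, B - B' = c%:M.
Proof.
move=> bG /nearP [d d0 Hd] /nearP [d' d'0 Hd']; apply: (germ_scalar bG); apply/nearP.
exists (Num.min d d'); first by rewrite lt_min d0.
move=> w; rewrite lt_min => /andP[/Hd [c cE] /Hd' [c' c'E]]; exists (c' - c).
move: cE; rewrite c'E mulmxBr scalerBl => E.
by apply/eqP; rewrite subr_eq addrAC eq_sym subr_eq (addrC (c' *: _)) E addrC.
Qed.

Lemma intertwines_commute z G L B S : S \in unitmx -> cp_local_biholo z G ->
  (\forall w \near z, intertwines G L B w) -> (\forall w \near z, intertwines (fun w => G w *m S) L B w) ->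
  B *m S = S *m B.
Proof.
move=> uS bG /nearP [d d0 Hd] /nearP [d' d'0 Hd'].
have [r r0 hr] := biholo_near bG.
have [|c cE] := germ_scalar (A := (B *m S - S *m B) *m invmx S) bG.
  apply/nearP; exists (Num.min r (Num.min d d')); first by rewrite !lt_min r0 d0.
  move=> w; rewrite !lt_min => /andP[/hr /biholo_dif [dG _] /andP[/Hd [c cE] /Hd' [c' c'E]]].
  exists (c' - c); have E : G w *m B *m S + c *: (G w *m S) = G w *m S *m B + c' *: (G w *m S).
    by apply: etrans c'E; rewrite (der_mulmxr (L w) S dG) cE mulmxDl scalemxAl.
  have E2 : G w *m (B *m S - S *m B) = (c' - c) *: (G w *m S).
    rewrite mulmxBr !mulmxA scalerBl.
    apply/eqP; rewrite subr_eq addrAC eq_sym subr_eq (addrC (c' *: _)); apply/eqP.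
    by rewrite -E.
  by rewrite mulmxA E2 -scalemxAl mulmxK.
have : \tr ((B *m S - S *m B) *m invmx S) = 0.
  rewrite mulmxBl linearB /= mulmxK // -mulmxA mxtrace_mulC -mulmxA mulVmx // mulmx1.
  by rewrite subrr.
rewrite cE mxtrace_scalar => /eqP; rewrite mulrn_eq0 /= => /eqP c0.
move: cE; rewrite c0 raddf0 => /(congr1 (fun X => X *m S)).
by rewrite mulmxKV // mul0mx => /eqP; rewrite subr_eq0 => /eqP.
Qed.

Lemma intertwines_chart i F L B z : differentiable F z -> F z 0 i != 0 ->
  intertwines F L B z <-> 'D_(L z) (fun z => dehomog i (F z)) z = mxvf B i (dehomog i (F z)).
Proof.
move=> dF Fi; have E := der_dehomog (L z) dF Fi.
have K : F z 0 i *: hlin i (mxvf B i (dehomog i (F z))) =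
    F z *m B - (homog i (dehomog i (F z)) *m B) 0 i *: F z.
  rewrite hlin_mxvf scalerBr scalemxAl -(dehomogK Fi); congr (_ - _).
  by rewrite scalerA mulrC -scalerA -(dehomogK Fi).
have Bi : (F z *m B) 0 i = F z 0 i * (homog i (dehomog i (F z)) *m B) 0 i.
  by rewrite {1}(dehomogK Fi) -scalemxAl mxZE.
move: E K Bi; move: ('D_(L z) (fun z => dehomog i (F z)) z) ((homog i (dehomog i (F z)) *m B) 0 i).
rewrite /intertwines; move: ('D_(L z) F z) (F z *m B) => DF FB v b E K Bi.
split=> [[c cE]|h].
  apply: (@hlin_inj _ _ i); apply: (scalerI Fi); rewrite E K cE.
  have -> : (FB + c *: F z) 0 i / F z 0 i = b + c by rewrite mxDE mxZE Bi; field.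
  by apply/rowP => j; rewrite !(mxDE, mxNE, mxZE); ring.
exists (DF 0 i / F z 0 i - b); move: E; rewrite h K => /rowP E.
apply/rowP => j; have := E j; rewrite !(mxDE, mxNE, mxZE).
move: (DF 0 i / F z 0 i) => d Ej.
have -> : DF 0 j = (FB 0 j - b * F z 0 j) + d * F z 0 j by rewrite Ej subrK.
by ring.
Qed.

Lemma der_dir (f : Cn -> C) (L : Cn -> Cn) a (r : R) (w : Cn) : 0 < r -> hol f a r -> differentiable L a ->
  differentiable (fun y => 'D_(L y) f y) a /\ 'D_w (fun y => 'D_(L y) f y) a = 'D_('D_w L a) f a + 'D_(L a) (fun y => 'D_w f y) a.
Proof.
move=> r0 hf dL; have aa := bl_center a r0; have hD u := hol_derive u hf.
pose P y := \sum_l L y 0 l * 'D_(e_ l) f y.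
have agree y : nrm (y - a) < r -> P y = 'D_(L y) f y.
  by move=> yr; exact: (esym (lin_row (L y) (deriveP_lin (hf y yr)))).
have dl l : differentiable (fun y => L y 0 l) a by exact: diff_entry 0 l dL.
have dt l : differentiable (fun y => L y 0 l * 'D_(e_ l) f y) a by exact: difM (dl l) (hD (e_ l) a aa).
have dP : differentiable P a by exact: difsum dt.
split; first exact: (diff_ext r0 agree dP).
apply: (etrans (esym (der_ext w r0 agree dP))).
apply: (etrans (dersum w dt)).
have E l : 'D_w (fun y => L y 0 l * 'D_(e_ l) f y) a =
    ('D_w L a) 0 l * 'D_(e_ l) f a + L a 0 l * 'D_(e_ l) (fun y => 'D_w f y) a.
  apply: (etrans (derM w (dl l) (hD (e_ l) a aa))).
  have h1 := derive_comm (e_ l) w r0 hf; have h2 := der_mxP w 0 l dL.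
  have aux (x y u v : C) : x * y + u * v = v * u + x * y by ring.
  have h3 := aux (L a 0 l) ('D_w (fun y => 'D_(e_ l) f y) a) ('D_(e_ l) f a) ('D_w (fun y => L y 0 l) a).
  exact: (etrans h3 (congr2 (fun p q => p * 'D_(e_ l) f a + L a 0 l * q) (esym h2) h1)).
apply: (etrans (eq_bigr _ (fun l _ => E l))); apply: (etrans (big_split _ _ _ _ _)).
congr (_ + _); first exact: (esym (lin_row ('D_w L a) (deriveP_lin (hf a aa)))).
exact: (esym (lin_row (L a) (deriveP_lin (hD w a aa)))).
Qed.

(** By the product rule [der_dir] each iterated derivative has a second-order part, and these parts
    cancel by symmetry. *)
Lemma der_bracket (f L L' : Cn -> Cn) a (r : R) : 0 < r -> (forall y, nrm (y - a) < r -> differentiable f y) ->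
  differentiable L a -> differentiable L' a ->
  'D_(lie_bracket L L' a) f a = 'D_(L a) (fun y => 'D_(L' y) f y) a - 'D_(L' a) (fun y => 'D_(L y) f y) a.
Proof.
move=> r0 df dL dL'; have aa : nrm (a - a) < r by rewrite subrr nrm0.
have hk k : hol (fun y => f y 0 k) a r by move=> y yr; exact: diff_entry 0 k (df y yr).
have vec (Q : Cn -> Cn) w : differentiable Q a -> differentiable (fun y => 'D_(Q y) f y) a /\ forall k,
    ('D_w (fun y => 'D_(Q y) f y) a) 0 k = 'D_w (fun y => 'D_(Q y) (fun y => f y 0 k) y) a.
  move=> dQ.
  have agree k y : nrm (y - a) < r -> 'D_(Q y) (fun y => f y 0 k) y = ('D_(Q y) f y) 0 k.
    by move=> yr; exact: (esym (der_mxP (Q y) 0 k (df y yr))).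
  have dk k : differentiable (fun y => ('D_(Q y) f y) 0 k) a.
    by have [d _] := der_dir w r0 (hk k) dQ; exact: (diff_ext r0 (agree k) d).
  have dv : differentiable (fun y => 'D_(Q y) f y) a by apply: diff_mx => b k; rewrite [b]ord1; exact: dk.
  split=> [//|k]; apply: (etrans (der_mxP w 0 k dv)).
  have [d _] := der_dir w r0 (hk k) dQ; exact: (esym (der_ext w r0 (agree k) d)).
apply/rowP => k; rewrite mxDE mxNE.
have [_ E1] := vec L' (L a) dL'; have [_ E2] := vec L (L' a) dL.
have [_ F1] := der_dir (L a) r0 (hk k) dL'; have [_ F2] := der_dir (L' a) r0 (hk k) dL.
have E12 := congr2 (fun p q => p - q) (etrans (E1 k) F1) (etrans (E2 k) F2).
have ll := deriveP_lin (hk k a aa).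
have h0 := der_mxP (lie_bracket L L' a) 0 k (df a aa); apply: (etrans h0).
have h1 : 'D_(lie_bracket L L' a) (fun y => f y 0 k) a =
    'D_('D_(L a) L' a) (fun y => f y 0 k) a - 'D_('D_(L' a) L a) (fun y => f y 0 k) a.
  rewrite /lie_bracket -scaleN1r addrC; apply: (etrans (ll (-1) _ _)).
  by rewrite addrC -[-1 *: _]/(-1 * _) mulN1r.
have h2 := derive_comm (L a) (L' a) r0 (hk k).
have aux (u v x y : C) : y = x -> u - v = (u + y) - (v + x) by move=> ->; ring.
exact: (etrans h1 (etrans (aux _ _ _ _ h2) (esym E12))).
Qed.

End Algebra.

(** * Operations on intertwining germs *)

Section Intertwining.
Context {R : realType} {n : nat}.
Local Notation C := R[i].
Local Notation Cn := 'rV[R[i]]_n.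
Local Notation Cn1 := 'rV[R[i]]_n.+1.
Implicit Types (B S H : 'M[R[i]]_n.+1) (F G : Cn -> Cn1) (L : Cn -> Cn).

Lemma hasd_id (w : Cn) : hasd (fun x : Cn => x) w (fun h => h).
Proof.
apply: (@hasd_quad _ _ _ _ _ _ 1 0 1 ltr01); first by [].
  by move=> y; rewrite mul1r.
by move=> y _; rewrite (addrC w) addrK subrr nrm0 mul0r.
Qed.

Lemma intertwines_ext G L L' B z : L z = L' z -> intertwines G L B z -> intertwines G L' B z.
Proof. by rewrite /intertwines => ->. Qed.

Lemma intertwines_lin G L L' B B' z (a : C) : differentiable G z -> intertwines G L B z -> intertwines G L' B' z ->
  intertwines G (fun z => a *: L z + L' z) (a *: B + B') z.
Proof.
move=> dG [c cE] [c' c'E]; exists (a * c + c').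
apply: (etrans (deriveP_lin dG a (L z) (L' z))); rewrite cE c'E mulmxDr -scalemxAr.
move: (G z *m B) (G z *m B') (G z) => x y u.
by apply/rowP => j; rewrite !(mxDE, mxZE); ring.
Qed.

Lemma intertwines_inj z G L L' B : cp_local_biholo z G ->
  (\forall w \near z, intertwines G L B w) -> (\forall w \near z, intertwines G L' B w) ->
  \forall w \near z, L w = L' w.
Proof.
move=> [i [U [U' [g [Uz hG G0 [oU oU' hf hg [fg gf]]]]]]] /nearP [d d0 Hd] /nearP [d' d'0 Hd'].
have [r r0 Hr] := open_ball oU Uz.
apply/nearP; exists (Num.min r (Num.min d d')); first by rewrite !lt_min r0 d0.
move=> w; rewrite !lt_min => /andP[wr /andP[/Hd h1 /Hd' h2]]; have Uw := Hr _ wr.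
have dG := hG w Uw; have g0 := G0 w Uw.
have E := etrans ((intertwines_chart L B dG g0).1 h1) (esym ((intertwines_chart L' B dG g0).1 h2)).
have [U'f gw] := fg w Uw.
have df : differentiable (fun z => dehomog i (G z)) w by exact: hf.
have dg : differentiable g (dehomog i (G w)) by exact: hg.
have K u : 'D_('D_u (fun z => dehomog i (G z)) w) g (dehomog i (G w)) = u.
  have h := der_comp u df dg; apply: (etrans (esym h)).
  have r1 : 0 < r - nrm (w - z) by rewrite subr_gt0.
  have hid := hasd_id w.
  have agree y : nrm (y - w) < r - nrm (w - z) -> y = g (dehomog i (G y)).
    move=> yw; have yr : nrm (y - z) < r by apply: le_lt_trans (nrm_tri w _ _) _; rewrite -ltrBrDr.
    by have [_ gy] := fg y (Hr _ yr).
  have [did _] := hasd_diff hid.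
  exact: (etrans (esym (der_ext u r1 agree did)) (hasd_derive u hid)).
exact: (etrans (esym (K (L w))) (etrans (congr1 (fun v => 'D_v g (dehomog i (G w))) E) (K (L' w)))).
Qed.

Lemma intertwines_bracket z G L L' B B' : cp_local_biholo z G ->
  (\forall w \near z, differentiable L w) -> (\forall w \near z, differentiable L' w) ->
  (\forall w \near z, intertwines G L B w) -> (\forall w \near z, intertwines G L' B' w) ->
  \forall w \near z, intertwines G (lie_bracket L L') (B *m B' - B' *m B) w.
Proof.
move=> [i [U [U' [g [Uz hG G0 [oU oU' hf hg [fg gf]]]]]]] /nearP [e e0 dL] /nearP [e' e'0 dL'] /nearP [d d0 Hd] /nearP [d' d'0 Hd'].
have [r r0 Hr] := open_ball oU Uz.
apply/nearP; pose m := Num.min (Num.min r (Num.min e e')) (Num.min d d').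
exists m; first by rewrite !lt_min r0 d0 e0 e'0.
pose f z := dehomog i (G z).
have all y : nrm (y - z) < m -> [/\ differentiable f y, differentiable L y, differentiable L' y,
    'D_(L y) f y = mxvf B i (f y) & 'D_(L' y) f y = mxvf B' i (f y)].
  rewrite !lt_min => /andP[/andP[yr /andP[ye ye']] /andP[/Hd h1 /Hd' h2]]; have Uy := Hr _ yr.
  have c1 := (intertwines_chart L B (hG y Uy) (G0 y Uy)).1 h1.
  have c2 := (intertwines_chart L' B' (hG y Uy) (G0 y Uy)).1 h2.
  by split; [exact: hf|exact: dL|exact: dL'|exact: c1|exact: c2].
move=> w wm; have wr : nrm (w - z) < r by move: wm; rewrite !lt_min => /andP[/andP[]].
have Uw := Hr _ wr; apply/(intertwines_chart _ _ (hG w Uw) (G0 w Uw)).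
have m0 : 0 < m - nrm (w - z) by rewrite subr_gt0.
have sub y : nrm (y - w) < m - nrm (w - z) -> nrm (y - z) < m.
  by move=> yw; apply: le_lt_trans (nrm_tri w _ _) _; rewrite -ltrBrDr.
have [df dLw dLw' cL cL'] := all w wm.
have dfy y : nrm (y - w) < m - nrm (w - z) -> differentiable f y by move=> /sub /all [].
have E := der_bracket m0 dfy dLw dLw'.
have T (Q : Cn -> Cn) A v : (forall y, nrm (y - z) < m -> 'D_(Q y) f y = mxvf A i (f y)) ->
    'D_v (fun y => 'D_(Q y) f y) w = 'D_('D_v f w) (mxvf A i) (f w).
  move=> hQ; have dA := dif_mxvf A i (f w); have dd := dif_comp df dA.
  have agree y : nrm (y - w) < m - nrm (w - z) -> mxvf A i (f y) = 'D_(Q y) f y by move=> /sub /hQ.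
  exact: (etrans (esym (der_ext v m0 agree dd)) (der_comp v df dA)).
have T1 := T L' B' (L w) (fun y ym => let: And5 _ _ _ _ h := all y ym in h).
have T2 := T L B (L' w) (fun y ym => let: And5 _ _ _ h _ := all y ym in h).
have T1' := etrans T1 (congr1 (fun v => 'D_v (mxvf B' i) (f w)) cL).
have T2' := etrans T2 (congr1 (fun v => 'D_v (mxvf B i) (f w)) cL').
apply: (etrans E); apply: (etrans (congr2 (fun a b => a - b) T1' T2')).
exact: (congr1 (fun V : vfield R n => V i (f w)) (mxvf_bracket B B')).
Qed.

(** The chart condition in [cp_local_biholo] may change under [S], so [germ_rigid] is redone with
    only differentiability and the nonvanishing of [F] and [G]. *)
Lemma germ_rigid_mul F G S a (r : R) z0 z1 : S \in unitmx ->
  (forall z, nrm (z - a) < r -> cp_local_biholo z F /\ cp_local_biholo z G) ->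
  nrm (z0 - a) < r -> nrm (z1 - a) < r -> cp_germ_eq z0 F (fun z => G z *m S) ->
  cp_germ_eq z1 F (fun z => G z *m S).
Proof.
move=> uS hFG z0r z1r /germ_sym E; apply: germ_sym; apply/nearP; exists (r - nrm (z1 - a)); first by rewrite subr_gt0.
move=> z zz; have zr : nrm (z - a) < r by apply: le_lt_trans (nrm_tri z1 _ _) _; rewrite -ltrBrDr.
have h1 y : nrm (y - a) < r -> differentiable (fun z => G z *m S) y /\ differentiable F y /\ F y != 0.
  by move=> /hFG [/biholo_dif [d1 f0] /biholo_dif [d2 _]]; split; [exact: dif_mulmxr|].
have h2 : \forall z \near z0, exists c : C, G z *m S = c *: F z.
  by move/nearP: E => [d d0 Hd]; apply/nearP; exists d => // y /Hd [c _ E]; exists c.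
have [cc ccE] := minors_rigid h1 z0r h2 zr.
have [_ /biholo_dif [_ G0]] := hFG z zr.
exists cc => //; apply: contraNneq G0 => cc0.
by rewrite -(mulmxK uS (G z)) ccE cc0 scale0r mul0mx.
Qed.

Lemma germ_mul z F G S : cp_germ_eq z F G -> cp_germ_eq z (fun z => F z *m S) (fun z => G z *m S).
Proof.
move=> /nearP [r r0 h]; apply/nearP; exists r => // w /h [c c0 ->].
by exists c; rewrite // scalemxAl.
Qed.

Lemma cont_fam_unique_mul c Fam Fam' S : S \in unitmx -> cont_fam c Fam -> cont_fam c Fam' ->
  cp_germ_eq (c 0) (Fam 0) (fun z => Fam' 0 z *m S) ->
  forall t, 0 <= t <= 1 -> cp_germ_eq (c t) (Fam t) (fun z => Fam' t z *m S).
Proof.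
move=> uS cf cf'; apply: loc01 => t t01.
have [r [d [/andP[r0 _] d0 h1 h2]]] := cont_fam_window cf t01 ltr01.
have [r' [d' [/andP[r'0 _] d'0 h1' h2']]] := cont_fam_window cf' t01 ltr01.
exists (Num.min d d') => [|s s' s01 s'01]; first by rewrite lt_min d0.
rewrite !lt_min => /andP[sd sd'] /andP[s'd s'd'] E.
have [a1 a2] := h2 s s01 sd; have [a3 a4] := h2' s s01 sd'.
have [b1 b2] := h2 s' s'01 s'd; have [b3 b4] := h2' s' s'01 s'd'.
apply: (germ_trans b2); apply: (germ_trans _ (germ_sym (germ_mul S b4))).
have hh z : nrm (z - c t) < Num.min r r' -> cp_local_biholo z (Fam t) /\ cp_local_biholo z (Fam' t).
  by rewrite lt_min => /andP[/h1 ? /h1' ?].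
have as_ : nrm (c s - c t) < Num.min r r' by rewrite lt_min a1.
have bs_ : nrm (c s' - c t) < Num.min r r' by rewrite lt_min b1.
exact: (germ_rigid_mul uS hh as_ bs_ (germ_trans (germ_sym a2) (germ_trans E (germ_mul S a4)))).
Qed.

Lemma cont_fam_ext (c c' : R -> Cn) Fam : (forall t, 0 <= t <= 1 -> c t = c' t) -> cont_fam c Fam -> cont_fam c' Fam.
Proof.
move=> E [h1 h2 h3]; split=> [t t01 e e0|t t01|t t01].
- have [d d0 Hd] := h1 t t01 e e0; exists d; first exact: d0.
  by move=> s s01 sd; rewrite -!E //; exact: Hd.
- by rewrite -E //; exact: h2.
have [d d0 Hd] := h3 t t01; exists d; first exact: d0.
by move=> s s01 sd; rewrite -E //; exact: Hd.
Qed.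

End Intertwining.

(** * The matrix of an infinitesimal automorphism *)

Section Final.
Context {R : realType} {n : nat}.
Local Notation C := R[i].
Local Notation Cn := 'rV[R[i]]_n.
Local Notation Cn1 := 'rV[R[i]]_n.+1.
Implicit Types (B : 'M[R[i]]_n.+1) (L : Cn -> Cn) (c : R -> Cn).

Lemma polydiscP (z : Cn) : polydisc z <-> nrm z < 1.
Proof.
have E k : (`|z 0 k| < 1) = (nrm (z 0 k) < 1) by rewrite nrmE -[1]/(1%:C) ltcR.
split=> [h|/(nrm_mx_lt _ ltr01) h k]; last by rewrite E.
by apply/(nrm_mx_lt _ ltr01) => a k; rewrite [a]ord1 -E.
Qed.

Lemma lip01_id : lip01 (fun t : R => t).
Proof. by split=> // s t; rewrite ler_peMl // ler1n. Qed.

Lemma lip01_cst (a : R) : 0 <= a <= 1 -> lip01 (fun _ : R => a).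
Proof. by move=> a01; split=> // s t; rewrite subrr normr0 mulr_ge0. Qed.

Lemma lip01_mulr (a : R) : 0 <= a <= 1 -> lip01 (fun u : R => u * a).
Proof.
move=> a01; split=> [t t01|s t]; first exact: mul01.
move: a01 => /andP[a0 a1]; rewrite -mulrBl normrM (ger0_norm a0) mulrC.
by apply: ler_wpM2r => //; apply: le_trans a1 _; rewrite ler1n.
Qed.

Lemma open_nrm_ball (d : R) : open [set z : Cn | nrm z < d].
Proof.
rewrite openE => x xd; apply: (iffRL (nearP (x : Cn) _)); exists (d - nrm x); first by rewrite subr_gt0.
by move=> y yx; have := nrm_tri x y 0; rewrite !subr0 => h; apply: le_lt_trans h _; rewrite -ltrBrDr.
Qed.

Variables (M X U : set Cn) (psi psi' : Cn -> Cn) (k : 'I_n).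
Hypothesis bih : biholomorphism (@polydisc R n) U psi psi'.
Hypothesis psi00 : psi 0 = 0.
Hypothesis XE : forall z, polydisc z -> (X (psi z) <-> z 0 k = 0).

Let O := U `\` X.

Lemma O_coord w : O w <-> U w /\ psi' w 0 k != 0.
Proof.
have [_ _ _ _ [h1 h2]] := bih; split=> [[Uw nX]|[Uw h]]; have [pw pE] := h2 w Uw; split=> //.
  by apply/eqP => e; apply: nX; rewrite -pE; apply/(XE pw).
by rewrite -pE => /(XE pw) e; move: h; rewrite e eqxx.
Qed.

Lemma O_open : open O.
Proof.
have [_ oU _ hpsi' _] := bih; rewrite openE => w Ow.
have [Uw h] := (O_coord w).1 Ow; apply: (iffRL (nearP (w : Cn) _)).
have [r r0 Hr] := open_ball oU Uw.
have hk : 0 < nrm (psi' w 0 k) by rewrite nrm_gt0.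
have /cont_nrmP /(_ _ hk) [d d0 Hd] := differentiable_continuous (hpsi' w Uw).
exists (Num.min r d); first by rewrite lt_min r0.
move=> z; rewrite lt_min => /andP[/Hr Uz /Hd zd]; apply/O_coord; split=> //.
apply/eqP => z0; have := le_lt_trans (nrm_mx_entry _ 0 k) zd.
by rewrite mxDE mxNE z0 sub0r nrmN ltxx.
Qed.

Lemma psi'0 : psi' 0 = 0.
Proof.
have [_ _ _ _ [h1 _]] := bih; have p0 : polydisc (0 : Cn) by apply/polydiscP; rewrite nrm0.
by have [_] := h1 0 p0; rewrite psi00.
Qed.

Definition rho (e s : R) : R := 1 - s * (1 - e).

Lemma rho_bnd (e s : R) : 0 < e <= 1 -> 0 <= s <= 1 -> 0 < rho e s <= 1.
Proof.
move=> /andP[e0 e1] /andP[s0 s1]; have e1' : 0 <= 1 - e by rewrite subr_ge0.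
have h : s * (1 - e) <= 1 - e by rewrite ler_piMl.
have h' : 0 <= s * (1 - e) by rewrite mulr_ge0.
rewrite /rho; apply/andP; split; lra.
Qed.

(** Positive scaling in the polydisc keeps the coordinate defining [X] away from 0, so the
    contraction never meets [X]; it stops at the factor [e] instead of reaching 0. *)
Definition hsq (e : R) c (s t : R) : Cn := psi ((rho e s)%:C *: psi' (c t)).

Lemma hsq_in e c s t : 0 < e <= 1 -> 0 <= s <= 1 -> O (c t) ->
  [/\ polydisc ((rho e s)%:C *: psi' (c t)), O (hsq e c s t) &
      nrm (psi' (hsq e c s t)) = rho e s * nrm (psi' (c t))].
Proof.
move=> e01 s01 /O_coord [Uc ck]; have /andP[r0 r1] := rho_bnd e01 s01.
have [_ _ _ _ [h1 h2]] := bih; have [/polydiscP pc _] := h2 _ Uc.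
have nE : nrm ((rho e s)%:C *: psi' (c t)) = rho e s * nrm (psi' (c t)).
  by rewrite nrmZ nrm_real gtr0_norm.
have pd : polydisc ((rho e s)%:C *: psi' (c t)).
  by apply/polydiscP; rewrite nE; apply: le_lt_trans pc; rewrite ler_piMl.
have [Up pE] := h1 _ pd; split=> //; last by rewrite /hsq pE.
apply/O_coord; split=> //; rewrite /hsq pE mxZE mulf_neq0 //.
by rewrite -nrm_gt0 nrm_real gtr0_norm.
Qed.

Lemma hsq_ctn e c : 0 < e <= 1 -> ctn01 c -> (forall t, 0 <= t <= 1 -> O (c t)) -> ctn_sq (hsq e c).
Proof.
move=> e01 hc cO s t s01 t01 d d0.
have [_ _ hpsi hpsi' [_ h2]] := bih.
have [pd _ _] := hsq_in e01 s01 (cO t t01).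
have [Uc _] := (O_coord _).1 (cO t t01).
have /cont_nrmP /(_ d d0) [d1 d10 H1] := differentiable_continuous (hpsi _ pd).
have d12 : 0 < d1 / 2 by rewrite divr_gt0.
have /cont_nrmP /(_ _ d12) [d2 d20 H2] := differentiable_continuous (hpsi' _ Uc).
have [d3 d30 H3] := hc t t01 d2 d20.
exists (Num.min d3 (d1 / 2)); first by rewrite lt_min d30.
move=> s' t' s'01 t'01; rewrite !lt_min => /andP[_ sd] /andP[td _]; apply: H1.
have h := H2 _ (H3 t' t'01 td).
have [/polydiscP pt _] := h2 _ Uc.
have -> : (rho e s')%:C *: psi' (c t') - (rho e s)%:C *: psi' (c t) =
    (rho e s')%:C *: (psi' (c t') - psi' (c t)) + (rho e s' - rho e s)%:C *: psi' (c t).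
  have rB : (rho e s' - rho e s)%:C = (rho e s')%:C - (rho e s)%:C by exact: rmorphB.
  by rewrite rB scalerBr scalerBl addrA subrK.
apply: le_lt_trans (nrmD _ _) _; rewrite !nrmZ !nrm_real.
have /andP[r0 r1] := rho_bnd e01 s'01; rewrite (gtr0_norm r0).
have a1 : rho e s' * nrm (psi' (c t') - psi' (c t)) <= nrm (psi' (c t') - psi' (c t)) by rewrite ler_piMl.
have rE : rho e s' - rho e s = (s - s') * (1 - e) by rewrite /rho; ring.
have a2 : `|rho e s' - rho e s| <= `|s' - s|.
  rewrite rE normrM distrC ler_piMr //; move: e01 => /andP[e0 e1].
  by rewrite ger0_norm ?subr_ge0 // gerBl ltW.
have a3 : `|rho e s' - rho e s| * nrm (psi' (c t)) <= `|rho e s' - rho e s| by rewrite ler_piMr // ltW.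
by move: h sd a1 a2 a3; clear; move: `|s' - s| => u; nlra.
Qed.

Variables (p : Cn) (F : Cn -> Cn1).
Hypothesis Op : O p.
Hypothesis ext : forall delta, path_in O p delta -> exists Fam, continuation_along delta F Fam.

Lemma hsq0 e c t : O (c t) -> hsq e c 0 t = c t.
Proof.
move=> /O_coord [Uc _]; rewrite /hsq /rho mul0r subr0 scale1r.
by have [_ _ _ _ [_ h2]] := bih; have [] := h2 _ Uc.
Qed.

Lemma square e c : 0 < e <= 1 -> ctn01 c -> (forall t, 0 <= t <= 1 -> O (c t)) -> c 0 = p ->
  exists Gm, sq_fam (hsq e c) Gm /\ cp_germ_eq p (Gm 0 0) F.
Proof.
move=> e01 hc cO c0; have hsq_c := hsq_ctn e01 hc cO.
have z01 : 0 <= (0 : R) <= 1 by rewrite lexx ler01.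
have h00 : hsq e c 0 0 = p by rewrite hsq0 ?c0.
have [|Gm [sq E]] := @square_family R n (hsq e c) F hsq_c; last by exists Gm; rewrite -h00.
move=> s t s01 t01.
have ct : ctn01 (fun u => hsq e c (u * s) (u * t)).
  move=> u u01 d d0; have [m m0 Hm] := hsq_c _ _ ((lip01_mulr s01).1 u u01) ((lip01_mulr t01).1 u u01) d d0.
  exists (m / 2); first by rewrite divr_gt0.
  move=> v v01 vu; apply: Hm; [exact: (lip01_mulr s01).1|exact: (lip01_mulr t01).1| |].
    exact: (lip01_close (lip01_mulr s01)).
  exact: (lip01_close (lip01_mulr t01)).
have [|Fam hF] := ext (delta := fun u => hsq e c (u * s) (u * t)).
  apply: ctn_path_in => //; first by rewrite !mul0r h00.
  move=> u u01; have [_ hO _] := hsq_in e01 (mul01 u01 s01) (cO _ (mul01 u01 t01)).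
  exact: hO.
have [cf E] := continuation_cont_fam ct hF; exists Fam; split; first exact: cf.
by move: E; rewrite !mul0r.
Qed.

Definition ray e (s : R) : Cn := hsq e (fun _ => p) s 0.

(** The radial paths contract [p] to 0 in the adapted chart. *)
Definition assoc L B := exists2 e0 : R, 0 < e0 & forall e, 0 < e <= 1 -> e < e0 ->
  forall Fm, cont_fam (ray e) Fm -> cp_germ_eq p (Fm 0) F ->
  \forall z \near ray e 1, intertwines (Fm 1) L B z.

Lemma ray_ext e : 0 < e <= 1 -> exists Fm, cont_fam (ray e) Fm /\ cp_germ_eq p (Fm 0) F.
Proof.
move=> e01; have z01 : 0 <= (0 : R) <= 1 by rewrite lexx ler01.
have hc : ctn01 (fun _ : R => p) by move=> t _ d d0; exists 1 => // s _ _; rewrite subrr nrm0.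
have [Gm [sq E]] := square e01 hc (fun t _ => Op) erefl.
exists (fun s => Gm s 0); split; last exact: E.
exact: (sq_fam_curve sq lip01_id (lip01_cst z01)).
Qed.

Lemma psi_near (W : set Cn) : open W -> W 0 -> exists2 e : R, 0 < e <= 1 & forall z, nrm z < e -> W (psi z).
Proof.
move=> oW W0; have [_ _ hpsi _ _] := bih; have [r r0 Hr] := open_ball oW W0.
have p0 : polydisc (0 : Cn) by apply/polydiscP; rewrite nrm0.
have /cont_nrmP /(_ r r0) [d d0 Hd] := differentiable_continuous (hpsi _ p0).
exists (Num.min d 1); first by rewrite lt_min d0 ltr01 ge_min lexx orbT.
move=> z; rewrite lt_min => /andP[zd _]; apply: Hr; move: (Hd z); rewrite psi00; apply.
by rewrite subr0.
Qed.

Lemma ray1 e : 0 < e <= 1 -> ray e 1 = psi (e%:C *: psi' p) /\ nrm (e%:C *: psi' p) < e.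
Proof.
move=> /andP[e0 e1]; split; first by rewrite /ray /hsq /rho mul1r opprB addrC subrK.
rewrite nrmZ nrm_real gtr0_norm //; have [Up _] := (O_coord p).1 Op.
have [_ _ _ _ [_ h2]] := bih; have [/polydiscP pp _] := h2 _ Up.
by rewrite gtr_pMr.
Qed.

Lemma ray_near (W : set Cn) : open W -> W 0 -> exists2 e : R, 0 < e & forall e', 0 < e' <= 1 -> e' < e ->
  W (ray e' 1).
Proof.
move=> oW W0; have [e /andP[e0 e1] He] := psi_near oW W0; exists e => // e' e'1 e'e.
by have [-> h] := ray1 e'1; apply: He; exact: lt_trans h e'e.
Qed.

Lemma small (a b c : R) : 0 < a -> 0 < b -> 0 < c -> exists e : R, [/\ 0 < e <= 1, e < a, e < b & e < c].
Proof.
move=> a0 b0 c0; exists (Num.min (Num.min a b) (Num.min c 1) / 2).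
set m := Num.min _ _; have m0 : 0 < m by rewrite !lt_min a0 b0 c0 ltr01.
have [ma mb mc m1] : [/\ m <= a, m <= b, m <= c & m <= 1] by split; rewrite /m !ge_min lexx ?orbT.
by clearbody m; split; [apply/andP; split|..]; lra.
Qed.

Lemma assoc_unique L B B' : assoc L B -> assoc L B' -> mxvf B = mxvf B'.
Proof.
move=> [a a0 Ha] [b b0 Hb]; have [e [e01 ea eb _]] := small a0 b0 ltr01.
have [Fm [cf E]] := ray_ext e01; have o01 : 0 <= (1 : R) <= 1 by rewrite lexx ler01.
apply/mxvfP; apply: (intertwines_unique (cf_bih cf o01)); [exact: Ha|exact: Hb].
Qed.

Lemma assoc_ext L L' B : germ0_eq L L' -> assoc L B -> assoc L' B.
Proof.
move=> /near_nearby [d d0 Hd] [a a0 Ha].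
have oD := @open_nrm_ball d.
have D0 : nrm (0 : Cn) < d by rewrite nrm0.
have [b b0 Hb] := ray_near oD D0.
exists (Num.min a b); first by rewrite lt_min a0 b0.
move=> e e01; rewrite lt_min => /andP[ea eb] Fm cf E.
have /nearP [m m0 Hm] := Ha e e01 ea Fm cf E.
have := Hd (ray e 1); rewrite subr0 => /(_ (Hb e e01 eb)) /nearP [m' m'0 Hm'].
apply/nearP; exists (Num.min m m'); first by rewrite lt_min m0.
by move=> z; rewrite lt_min => /andP[/Hm h /Hm' h']; exact: intertwines_ext h' h.
Qed.

(** The fields agree near the end of a short ray, which lies in a ball about 0 where both are
    holomorphic; the identity theorem carries the equality to 0. *)
Lemma assoc_inj L L' B (W : set Cn) : open W -> W 0 -> holomorphic_on L W -> holomorphic_on L' W ->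
  assoc L B -> assoc L' B -> germ0_eq L L'.
Proof.
move=> oW W0 hL hL' [a a0 Ha] [b b0 Hb].
have [r r0 Hr] := open_ball oW W0.
have oD := @open_nrm_ball r.
have D0 : nrm (0 : Cn) < r by rewrite nrm0.
have [d d0 Hd] := ray_near oD D0.
have [e [e01 ea eb ed]] := small a0 b0 d0.
have [Fm [cf E]] := ray_ext e01; have o01 : 0 <= (1 : R) <= 1 by rewrite lexx ler01.
have /nearP [m m0 Hm] := intertwines_inj (cf_bih cf o01) (Ha e e01 ea Fm cf E) (Hb e e01 eb Fm cf E).
apply/nearP; exists r => // z zr; apply/rowP => j; apply/eqP; rewrite -subr_eq0; apply/eqP.
have hj : hol (fun z => L z 0 j - L' z 0 j) (0 : Cn) r.
  move=> y yr; have Wy := Hr y yr.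
  exact: (difB (diff_entry 0 j (hL y Wy)) (diff_entry 0 j (hL' y Wy))).
have br : bl (0 : Cn) r (ray e 1) by rewrite /bl subr0; exact: Hd.
by apply: (identity_ball hj br m0 _ zr) => y ym; rewrite (Hm y ym) subrr.
Qed.

Lemma assoc_lin L L' B B' (a : C) : assoc L B -> assoc L' B' ->
  assoc (fun z => a *: L z + L' z) (a *: B + B').
Proof.
move=> [d d0 Hd] [d' d'0 Hd']; exists (Num.min d d'); first by rewrite lt_min d0.
move=> e e01; rewrite lt_min => /andP[ed ed'] Fm cf E; have o01 : 0 <= (1 : R) <= 1 by rewrite lexx ler01.
have [r r0 hr] := biholo_near (cf_bih cf o01).
have /nearP [m m0 Hm] := Hd e e01 ed Fm cf E; have /nearP [m' m'0 Hm'] := Hd' e e01 ed' Fm cf E.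
apply/nearP; exists (Num.min r (Num.min m m')); first by rewrite !lt_min r0 m0.
move=> z; rewrite !lt_min => /andP[/hr /biholo_dif [dG _] /andP[/Hm h /Hm' h']].
exact: intertwines_lin dG h h'.
Qed.

Lemma assoc_bracket L L' B B' (W : set Cn) : open W -> W 0 -> holomorphic_on L W -> holomorphic_on L' W ->
  assoc L B -> assoc L' B' -> assoc (lie_bracket L L') (B *m B' - B' *m B).
Proof.
move=> oW W0 hL hL' [a a0 Ha] [b b0 Hb]; have [d d0 Hd] := ray_near oW W0.
exists (Num.min (Num.min a b) d); first by rewrite !lt_min a0 b0.
move=> e e01; rewrite !lt_min => /andP[/andP[ea eb] ed] Fm cf E.
have o01 : 0 <= (1 : R) <= 1 by rewrite lexx ler01.
have [m m0 Hm] := open_ball oW (Hd e e01 ed).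
apply: (intertwines_bracket (cf_bih cf o01)); [| |exact: Ha|exact: Hb]; apply/nearP; exists m => // z /Hm.
  exact: hL.
exact: hL'.
Qed.

(** Transport across the square [hsq e c], whose far edge [s = 1] is close to 0. *)
Lemma far_edge e c Gm L B (W : set Cn) (e0 : R) : 0 < e <= 1 -> e < e0 -> open W ->
  (forall z, nrm z < e0 -> W (psi z)) -> holomorphic_on L W -> sq_fam (hsq e c) Gm ->
  (forall t, 0 <= t <= 1 -> O (c t)) -> forall a b : R, 0 <= a <= 1 -> 0 <= b <= 1 ->
  (\forall z \near hsq e c 1 a, intertwines (Gm 1 a) L B z) -> \forall z \near hsq e c 1 b, intertwines (Gm 1 b) L B z.
Proof.
move=> e01 ee0 oW hW hL sq cO a b a01 b01 E; have o01 : 0 <= (1 : R) <= 1 by rewrite lexx ler01.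
have ll := lip01_seg a01 b01.
have cf := sq_fam_curve sq (lip01_cst o01) ll.
have inW t : 0 <= t <= 1 -> W (hsq e c 1 (a + t * (b - a))).
  move=> t01; apply: hW; have [Uc _] := (O_coord _).1 (cO _ (ll.1 t t01)).
  have [_ _ _ _ [_ h2]] := bih; have [/polydiscP pp _] := h2 _ Uc.
  rewrite /rho mul1r opprB addrC subrK; move: e01 => /andP[ep _].
  rewrite nrmZ nrm_real gtr0_norm //; apply: lt_trans ee0.
  by rewrite gtr_pMr.
have := intertwines_transport cf oW hL inW _ o01.
by rewrite mul0r addr0 mul1r (addrC a) subrK; apply.
Qed.

Lemma assoc0 : assoc (fun _ => 0) 0.
Proof.
exists 1; first exact: ltr01.
move=> e e01 _ Fm cf _; have o01 : 0 <= (1 : R) <= 1 by rewrite lexx ler01.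
have [r r0 hr] := biholo_near (cf_bih cf o01); apply/nearP; exists r; first exact: r0.
move=> z /hr /biholo_dif [dG _]; exists 0; rewrite mulmx0 scale0r addr0.
exact: (lin0 (deriveP_lin dG)).
Qed.

Lemma assoc_add L L' B B' : assoc L B -> assoc L' B' -> assoc (fun z => L z + L' z) (B + B').
Proof.
move=> h h'; have E : (fun z => 1 *: L z + L' z) = (fun z => L z + L' z).
  by apply/funext => z; rewrite scale1r.
by rewrite -E -[B]scale1r; exact: assoc_lin.
Qed.

Lemma assoc_scale L B (a : C) : assoc L B -> assoc (fun z => a *: L z) (a *: B).
Proof.
move=> h; have E : (fun z => a *: L z + 0) = (fun z => a *: L z).
  by apply/funext => z; rewrite addr0.
by rewrite -E -[a *: B]addr0; exact: (assoc_lin a h assoc0).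
Qed.

Lemma assoc_shift L B B' : mxvf B = mxvf B' -> assoc L B -> assoc L B'.
Proof.
move=> /mxvfP [d dE] [a a0 Ha]; exists a; first exact: a0.
move=> e e01 ea Fm cf E; have /nearP [m m0 Hm] := Ha e e01 ea Fm cf E.
apply/nearP; exists m; first exact: m0.
move=> z /Hm [c cE]; exists (c + d); rewrite cE.
have -> : B = B' + d%:M by rewrite -dE addrC subrK.
by rewrite mulmxDr mul_mx_scalar scalerDl -addrA (addrC (d *: _)).
Qed.

Lemma ray_of e c (b : R) s : c b = p -> hsq e c s b = ray e s.
Proof. by rewrite /ray /hsq => ->. Qed.

Lemma near_edge e c Gm : sq_fam (hsq e c) Gm -> (forall t, 0 <= t <= 1 -> O (c t)) ->
  cont_fam c (fun t => Gm 0 t).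
Proof.
move=> sq cO; have z01 : 0 <= (0 : R) <= 1 by rewrite lexx ler01.
apply: cont_fam_ext (sq_fam_curve sq (lip01_cst z01) lip01_id) => t t01.
by apply: hsq0; exact: cO.
Qed.

Lemma side_edge e c Gm (b : R) : sq_fam (hsq e c) Gm -> 0 <= b <= 1 -> c b = p ->
  cont_fam (ray e) (fun s => Gm s b).
Proof.
move=> sq b01 cb.
apply: cont_fam_ext (sq_fam_curve sq lip01_id (lip01_cst b01)) => s _.
exact: ray_of.
Qed.

(** The component of [p] accumulates at 0, and its points are joined to [p] by paths because [M] off
    [X] is locally path connected. *)
Lemma path_to_0 (e0 : R) : real_analytic_hypersurface M -> in_component_at0 M X U p -> 0 < e0 ->
  exists al, [/\ ctn01 al, al 0 = p, nrm (psi' (al 1)) < e0, forall t, 0 <= t <= 1 -> M (al t) &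
    forall t, 0 <= t <= 1 -> O (al t)].
Proof.
move=> hM [Ap cl] e00; have [_ oU _ hpsi' [h1 _]] := bih.
have p0 : polydisc (0 : Cn) by apply/polydiscP; rewrite nrm0.
have U0 : U 0 by have [+ _] := h1 0 p0; rewrite psi00.
have /cont_nrmP /(_ e0 e00) [d d0 Hd] := differentiable_continuous (hpsi' _ U0).
have nb : nbhs (0 : Cn) [set z | nrm z < d].
  apply: (iffRL (nearP (0 : Cn) (fun z => nrm z < d))).
  by exists d => // z; rewrite subr0.
have [q [cq qd]] := cl _ nb.
have loc z : ((M `&` U) `\` X) z -> exists2 d : R, 0 < d & forall z', ((M `&` U) `\` X) z' -> nrm (z' - z) < d ->
    reach ((M `&` U) `\` X) z z'.
  by rewrite -setIDA => Az; exact: reach_local hM O_open Az.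
have [al [h2 h3 h4 h5]] := reach_component loc Ap cq.
exists al; split=> //.
- by have := Hd q; rewrite psi'0 !subr0 h4; apply.
- by move=> t /h5 [[]].
by move=> t /h5 [[_ ?] ?]; split.
Qed.

Lemma assoc_exists L H S gamma Fam : (1 < n)%N -> real_analytic_hypersurface M -> H \in unitmx -> S \in unitmx ->
  in_component_at0 M X U p -> local_biholo_into_quadric M H p F ->
  loop_in O p gamma -> continuation_along gamma F Fam -> cp_germ_eq p (Fam 1) (fun z => F z *m S) ->
  hol_germ M L ->
  exists B, [/\ assoc L B, B *m S = S *m B & exists c : C, B *m H + H *m (cconj B)^T = c *: H].
Proof.
move=> n1 hM Hu uS comp [bF qF] [gpath g1] hFam mono [UL [Phi [UL0 dM hL tL]]].
have oUL : open UL by case: dM => [[]].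
have z01 : 0 <= (0 : R) <= 1 by rewrite lexx ler01.
have o01 : 0 <= (1 : R) <= 1 by rewrite lexx ler01.
have [e0 /andP[e00 _] He0] := psi_near oUL UL0.
have [al [hal al0 al1 alM alO]] := path_to_0 hM comp e00.
have [Fa hFa] := ext (ctn_path_in hal al0 alO).
have [cfa Ea] := continuation_cont_fam hal hFa; rewrite al0 in Ea.
have quad : \forall z \near al 0, M z -> hform H (Fa 0 z) (cconj (Fa 0 z)) = 0.
  rewrite al0; apply: (quadric_germ (germ_sym Ea)).
  by move/nearP: qF => [d d0 Hd]; apply/nearP; exists d => // z /Hd h /h [].
have quad1 := quadric_transport hM cfa alM quad o01.
have [Ual1 _] := (O_coord _).1 (alO 1 o01).
have ULq : UL (al 1).
  have [_ _ _ _ [_ h2]] := bih; have [_ <-] := h2 _ Ual1; exact: He0.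
have [B [EB KB]] := local_theorem n1 Hu dM ULq (alM 1 o01) hL tL (cf_bih cfa o01) quad1.
have aB : assoc L B.
  exists e0; first exact: e00.
  move=> e e01 ee0 Fm cf E.
  (* The matrix is known at the corner [(0, 1)], the end of [al]. It is carried radially to
     [(1, 1)], then back along the far edge to [(1, 0)], the end of the ray; both legs stay where
     [L] is defined. *)
  have [Gm [sq EG]] := square e01 hal alO al0.
  have c0 := near_edge sq alO.
  have g00 : cp_germ_eq (al 0) (Gm 0 0) (Fa 0) by rewrite al0; exact: germ_trans EG (germ_sym Ea).
  have g01 := cont_fam_unique c0 cfa g00 o01.
  have E01 := intertwines_near_germ (cf_bih cfa o01) (cf_bih c0 o01) (germ_sym g01) EB.
  have c1 := sq_fam_curve sq lip01_id (lip01_cst o01).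
  have inUL s : 0 <= s <= 1 -> UL (hsq e al s 1).
    move=> s01; have [_ _ nE] := hsq_in e01 s01 (alO 1 o01).
    have /andP[r0 r1] := rho_bnd e01 s01; apply: He0.
    rewrite nrmZ nrm_real gtr0_norm //; apply: le_lt_trans al1.
    by rewrite ler_piMl.
  have E01' : \forall z \near hsq e al 0 1, intertwines (Gm 0 1) L B z by rewrite hsq0 //; exact: alO.
  have E11 := intertwines_transport c1 oUL hL inUL E01' o01.
  have E10 := far_edge e01 ee0 oUL He0 hL sq alO o01 z01 E11.
  have cs := side_edge sq z01 al0.
  have r00 : ray e 0 = p by rewrite /ray hsq0.
  have gs : cp_germ_eq (ray e 0) (Gm 0 0) (Fm 0) by rewrite r00; exact: germ_trans EG (germ_sym E).
  have g1' := cont_fam_unique cs cf gs o01.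
  rewrite (ray_of _ _ al0) in E10.
  exact: intertwines_near_germ (cf_bih cs o01) (cf_bih cf o01) g1' E10.
exists B; split=> //; have [ea ea0 Ha] := aB.
have [e [e01 eea ee0 _]] := small ea0 e00 ltr01.
have [_ g0 gO] := gpath; have hg := path_in_ctn gpath.
have [Gm [sq EG]] := square e01 hg gO g0.
have [cfF EF] := continuation_cont_fam hg hFam.
have c0 := near_edge sq gO.
have g00 : cp_germ_eq (gamma 0) (Gm 0 0) (Fam 0) by move: EF; rewrite g0 => EF; exact: germ_trans EG (germ_sym EF).
have g01 := cont_fam_unique c0 cfF g00 o01; rewrite g1 in g01.
have cs0 := side_edge sq z01 g0; have cs1 := side_edge sq o01 g1.
have r00 : ray e 0 = p by rewrite /ray hsq0.
(* Since [gamma] is a loop, both vertical edges lie over the ray of [p]. Their germs differ by [S]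
   at its start, hence at its end. *)
have init : cp_germ_eq (ray e 0) (Gm 0 1) (fun z => Gm 0 0 z *m S).
  rewrite r00; apply: germ_trans g01 _; apply: germ_trans mono _; exact: germ_mul (germ_sym EG).
have gS := cont_fam_unique_mul uS cs1 cs0 init o01.
have E10 := Ha e e01 eea _ cs0 EG.
have E10' : \forall z \near hsq e gamma 1 0, intertwines (Gm 1 0) L B z by rewrite (ray_of _ _ g0).
have E11 := far_edge e01 ee0 oUL He0 hL sq gO z01 o01 E10'.
rewrite (ray_of _ _ g1) in E11.
apply: (intertwines_commute uS (cf_bih cs0 o01) E10).
have [r r0 hr] := biholo_near (cf_bih cs0 o01); have [r' r'0 hr'] := biholo_near (cf_bih cs1 o01).
have [m m0 Hm] := near_nearby gS; move/nearP: E11 => [m' m'0 Hm'].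
apply/nearP; exists (Num.min (Num.min r r') (Num.min m m')); first by rewrite !lt_min r0 r'0 m0.
move=> w; rewrite !lt_min => /andP[/andP[/hr /biholo_dif [d1 _] /hr' /biholo_dif [d2 f2]] /andP[/Hm gw /Hm' iw]].
exact: (intertwines_germ d2 f2 (dif_mulmxr S d1) gw iw).
Qed.

End Final.

Local Close Scope complex_scope.

Theorem theorem3p7 (R : realType) (n : nat) (hn : (2 <= n)%N)
  (M X : set 'rV[R[i]]_n)
  (hM : real_analytic_hypersurface M) (hX : nonminimal_along M X)
  (hps : pseudospherical M X)
  (H S : 'M[R[i]]_n.+1) (hH : nondegenerate_indefinite H)
  (hS : monodromy_operator M X H S) :
  exists iota : ('rV[R[i]]_n -> 'rV[R[i]]_n) -> vfield R n,
    hol_embedding M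
      (fun V => centralizer_algebra S V /\ hol_quadric H V) iota.
Proof.
have [U [p [F [gamma [Fam [[[psi [psi' [k [bih psi0 XE]]]] comp FQ] ext [lp _] hFam [uS mono]]]]]]] := hS.
have [herm uH _ _] := hH.
have Op : (U `\` X) p by case: comp => [[[_ ?] ?] _].
pose rel L B := assoc psi psi' p F L B.
have ex L : hol_germ M L -> exists B, [/\ rel L B, B *m S = S *m B &
    exists c : R[i], B *m H + H *m (cconj B)^T = c *: H].
  exact: (assoc_exists bih psi0 XE Op ext hn hM uH uS comp FQ lp hFam mono).
(* A chosen matrix, unique up to scalars, with 0 as the value where none exists; [mxvf] removes the
   ambiguity, and [BP] lets any associated matrix replace the chosen one. *)
pose B L := xget 0 [set B | rel L B].
have BP L B' : rel L B' -> mxvf (B L) = mxvf B'.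
  move=> h; have hB : rel L (B L) := xgetPex (0 : 'M[R[i]]_n.+1) (ex_intro (rel L) B' h).
  exact: (assoc_unique bih XE Op ext hB h).
have rB L : hol_germ M L -> rel L (B L).
  by move=> /ex [B' [h _ _]]; exact: (xgetPex (0 : 'M[R[i]]_n.+1) (ex_intro (rel L) B' h)).
exists (fun L => mxvf (B L)); split.
- move=> L /ex [B' [h cB [c KB]]]; rewrite (BP _ _ h).
  by split; [exact: centralizer_mxvf|exact: hol_quadric_mxvf KB].
- move=> L L' hL hL'; split=> [E|E]; last first.
    by apply: BP; exact: (assoc_ext bih psi0 XE Op (filterS (fun z => @esym _ _ _) E) (rB _ hL')).
  have [W [Phi [W0 [[oW _] _ _ _ _] hW _]]] := hL; have [W' [Phi' [W'0 [[oW' _] _ _ _ _] hW' _]]] := hL'.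
  (* Equal fields mean matrices equal up to a scalar, so [L] and [L'] are associated with one and
     the same matrix. *)
  have h1 := assoc_shift E (rB _ hL).
  have oWW : open (W `&` W') by exact: openI.
  have WW0 : (W `&` W') 0 by split.
  have hLW : holomorphic_on L (W `&` W') by move=> z [/hW].
  have hLW' : holomorphic_on L' (W `&` W') by move=> z [_ /hW'].
  exact: (assoc_inj bih psi0 XE Op ext oWW WW0 hLW hLW' h1 (rB _ hL')).
- by move=> L L' hL hL'; rewrite -mxvfD; apply: BP; exact: (assoc_add (rB _ hL) (rB _ hL')).
- by move=> a L hL; rewrite -mxvfZ; apply: BP; exact: (assoc_scale _ (rB _ hL)).
move=> L L' hL hL'; rewrite mxvf_bracket; apply: BP.
have [W [Phi [W0 [[oW _] _ _ _ _] hW _]]] := hL; have [W' [Phi' [W'0 [[oW' _] _ _ _ _] hW' _]]] := hL'.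
have oWW : open (W `&` W') by exact: openI.
have WW0 : (W `&` W') 0 by split.
have hLW : holomorphic_on L (W `&` W') by move=> z [/hW].
have hLW' : holomorphic_on L' (W `&` W') by move=> z [_ /hW'].
exact: (assoc_bracket bih psi0 XE Op oWW WW0 hLW hLW' (rB _ hL) (rB _ hL')).
Qed.
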